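(* Let $n\ge1$, $j_1,\dots,j_n,j'_1\in\{1,\dots,d\}$, $h_1\in\mathcal{K}_{n,j_1,\dots,j_n}$ and $h_2\in\mathcal{K}_{1,j'_1}$. The Wiener--Itô integrals $I_n(h_1|j_1,\dots,j_n)=\int h_1(x_1,\dots,x_n)Z_{G,j_1}(dx_1)\dots Z_{G,j_n}(dx_n)$ and $I_1(h_2|j'_1)=\int h_2(x_1)Z_{G,j'_1}(dx_1)$ satisfy the identity \begin{align*} I_n(h_1|j_1,\dots,j_n)I_1(h_2|j'_1)&=\int h_{\gamma_0}(x_1,\dots,x_{n+1})Z_{G,j_1}(dx_1)\cdots Z_{G,j_n}(dx_n)Z_{G,j'_1}(dx_{n+1})\\ &\quad+\sum_{p=1}^n\int h_{\gamma_p}(x_1,\dots,x_{n-1})\prod_{s=1}^{p-1}Z_{G,j_s}(dx_s)\prod_{s=p}^{n-1}Z_{G,j_{s+1}}(dx_s)\\ &=I_{n+1}(h_{\gamma_0}|j_1,\dots,j_n,j'_1)+\sum_{p=1}^nI_{n-1}(h_{\gamma_p}|j_1,\dots,j_{p-1},j_{p+1},\dots,j_n), \end{align*} where $h_{\gamma_0}(x_1,\dots,x_{n+1})=h_1(x_1,\dots,x_n)h_2(x_{n+1})$, and for $1\le p\le n$ $$h_{\gamma_p}(x_1,\dots,x_{n-1})=\int h_{1,\gamma_p}(x_1,\dots,x_n)\overline{h_2(x_n)}\,G_{j_p,j'_1}(dx_n)$$ with $h_{1,\gamma_p}(x_1,\dots,x_n)=h_1(x_{\pi_p(1)},\dots,x_{\pi_p(n)})$,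 where $\pi_p(k)=k$ if $1\le k\le p-1$, $\pi_p(p)=n$, and $\pi_p(k)=k-1$ if $p+1\le k\le n$. (Empty products of the $Z$'s, for $p=1$ and $p=n$, are understood as $1$.)
   Context: Setting. $E$ denotes either $\mathbb{R}^\nu$ or the torus $[-\pi,\pi)^\nu$ (coordinates modulo $2\pi$). $G=(G_{j,j'})_{1\le j,j'\le d}$ is a matrix valued spectral measure on $E$: the $G_{j,j'}$ are complex measures, of finite total variation if $E$ is the torus, and of locally finite total variation (i.e. defined on bounded Borel sets, with finite total variation on each cube $[-T,T]^\nu$) if $E=\mathbb{R}^\nu$; there is a $\sigma$-finite positive measure $\mu$ on $E$ dominating all $G_{j,j'}$ such that the matrix $(g_{j,j'}(x))$, $g_{j,j'}=\frac{dG_{j,j'}}{d\mu}$, is Hermitian positive semidefinite for $\mu$-almost all $x$; $G_{j,j'}(-A)=\overline{G_{j,j'}(A)}$ for all bounded measurable $A$; and if $E=\mathbb{R}^\nu$, $\int(1+|x|)^{-r}G_{j,j}(dx)<\infty$ for all $j$ with some $r>0$. It is assumed that $G$ is non-atomic: $\mu(\{x\})=0$ for all $x\in E$. Integrals with respect to $G_{j,j'}(dx)$ mean integrals with respect to $g_{j,j'}(x)\mu(dx)$; a function defined by such an integral is set equal to $0$ where the integral does not converge absolutely. $Z_G=(Z_{G,1},\dots,Z_{G,d})$ is a vector valued random spectral measure corresponding to $G$: complex valued random variables $Z_{G,j}(A)$, $1\le j\le d$, $A\subset E$ bounded Borel, such that (i) the real and imaginary parts of any finitely many of them are jointly Gaussian;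 (ii) $EZ_{G,j}(A)=0$; (iii) $EZ_{G,j}(A)\overline{Z_{G,j'}(B)}=G_{j,j'}(A\cap B)$; (iv) $\sum_{s=1}^nZ_{G,j}(A_s)=Z_{G,j}(\bigcup_{s=1}^nA_s)$ for disjoint $A_1,\dots,A_n$; (v) $Z_{G,j}(A)=\overline{Z_{G,j}(-A)}$. $\mathcal{K}_{n,j_1,\dots,j_n}$ is the real Hilbert space of complex valued functions $f$ on $E^n$ with (a) $f(-x_1,\dots,-x_n)=\overline{f(x_1,\dots,x_n)}$ and (b) $\|f\|^2=\int|f(x_1,\dots,x_n)|^2G_{j_1,j_1}(dx_1)\dots G_{j_n,j_n}(dx_n)<\infty$ (functions equal almost everywhere are identified). For $n=0$, $\mathcal{K}_0=\mathbb{R}$ and $I_0(c)=c$. Multiple Wiener--Itô integral. A regular system is a finite collection $\mathcal{D}=\{\Delta_k: k=\pm1,\dots,\pm N\}$ of bounded measurable sets in $E$ with $\Delta_k=-\Delta_{-k}$ and $\Delta_k\cap\Delta_l=\emptyset$ for $k\ne l$. A function $f\in\mathcal{K}_{n,j_1,\dots,j_n}$ is simple if for some regular system it is constant on each set $\Delta_{k_1}\times\dots\times\Delta_{k_n}$, vanishes outside these sets, and vanishes on those of them with $k_l=\pm k_{l'}$ for some $l\ne l'$. For such $f$, $$I_n(f|j_1,\dots,j_n)=\sum_{k_1,\dots,k_n\in\{\pm1,\dots,\pm N\}}f(u_{k_1},\dots,u_{k_n})Z_{G,j_1}(\Delta_{k_1})\cdots Z_{G,j_n}(\Delta_{k_n}),\quad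 u_k\in\Delta_k .$$ Simple functions are dense in $\mathcal{K}_{n,j_1,\dots,j_n}$ and $E|I_n(f|j_1,\dots,j_n)|^2\le n!\|f\|^2$ for them; $I_n(f|j_1,\dots,j_n)=\int f(x_1,\dots,x_n)Z_{G,j_1}(dx_1)\dots Z_{G,j_n}(dx_n)$ is defined for all $f\in\mathcal{K}_{n,j_1,\dots,j_n}$ by continuous ($L_2$) extension. *)

(* Defs.v *)
From HB Require Import structures.
From mathcomp Require Import all_boot all_order all_algebra.
From mathcomp Require Import complex.
From mathcomp Require Import all_classical all_reals all_analysis.

Set Implicit Arguments.
Unset Strict Implicit.
Unset Printing Implicit Defensive.

Import Order.TTheory GRing.Theory Num.Theory.
Import numFieldNormedType.Exports.

Local Open Scope classical_set_scope.
Local Open Scope ring_scope.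
Local Open Scope complex_scope.

(* Num.Theory also has a Re and an Im, valued in R[i]. *)
Local Notation Re := complex.Re.
Local Notation Im := complex.Im.
Local Notation normc := Normc.normc.

Variant space_kind := Euclidean | Torus.

Section points.
Context (R : realType) (k : space_kind).

Definition axis_range (x : R) : bool :=
  match k with Euclidean => true | Torus => (- pi <= x) && (x < pi) end.

Definition axis := {x : R | axis_range x}.

HB.instance Definition _ := [isSub for (fun x : axis => sval x)].
HB.instance Definition _ := [Choice of axis by <:].

Lemma axis_range0 : axis_range 0.
Proof.
by rewrite /axis_range; case: k => //; rewrite oppr_le0 pi_ge0 pi_gt0.
Qed.

HB.instance Definition _ :=
  isPointed.Build axis (exist axis_range 0 axis_range0).

(* The Borel sets of a coordinate are the traces of the Borel sets of R. *)
Definition axis_measurable : set (set axis) :=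
  preimage_set_system setT (val : axis -> R) measurable.

Lemma axis_measurable0 : axis_measurable set0.
Proof. by exists set0; rewrite ?preimage_set0 ?setI0. Qed.

Lemma axis_measurableC A : axis_measurable A -> axis_measurable (~` A).
Proof.
move=> [B mB <-]; exists (~` B); first exact: measurableC.
by rewrite !setTI preimage_setC.
Qed.

Lemma axis_measurable_bigcup (F : (set axis)^nat) :
  (forall i, axis_measurable (F i)) -> axis_measurable (\bigcup_i F i).
Proof.
move=> mF; pose B i := s2val (cid2 (mF i)).
exists (\bigcup_i B i).
  by apply: bigcup_measurable => i _; exact: s2valP (cid2 (mF i)).
rewrite setTI preimage_bigcup; apply: eq_bigcup => // i _.
by rewrite -[RHS](s2valP' (cid2 (mF i))) setTI.
Qed.

HB.instance Definition _ := isMeasurable.Build default_measure_display axis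
  axis_measurable0 axis_measurableC axis_measurable_bigcup.

(* On the torus, - x is outside of [-pi, pi[ only for x = - pi, which is its own
   opposite modulo 2 pi: this is the default value of insubd. *)
Definition axis_opp (x : axis) : axis := insubd x (- val x).

End points.

(* The space E: R^nu or the torus [-pi, pi[^nu, with the product of the Borel
   sigma-algebras. *)
Notation espace R k nu := (nu.-tuple (axis R k)).

Section complex_integration.
Context (R : realType) (d : measure_display) (T : measurableType d).

Definition cmeasurable (f : T -> R[i]) :=
  measurable_fun setT (fun x => Re (f x)) /\
  measurable_fun setT (fun x => Im (f x)).

Definition cintegrable (mu : {measure set T -> \bar R}) (D : set T)
    (f : T -> R[i]) :=
  mu.-integrable D (fun x => (Re (f x))%:E) /\
  mu.-integrable D (fun x => (Im (f x))%:E).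

Definition cintegral (mu : {measure set T -> \bar R}) (D : set T)
    (f : T -> R[i]) : R[i] :=
  if `[< cintegrable mu D f >]
  then (\int[mu]_(x in D) Re (f x)) +i* (\int[mu]_(x in D) Im (f x))
  else 0.

Definition cvg_L2 (P : probability T R) (S : nat -> T -> R[i]) (X : T -> R[i]) :=
  (fun m => \int[P]_w (normc (S m w - X w) ^+ 2)%:E)%E @ \oo --> 0%E.

(* normal_prob has a junk value for a null standard deviation, hence the
   separate treatment of degenerate Gaussian variables. *)
Definition gaussian (P : probability T R) (X : T -> R) :=
  (exists m : R, {ae P, forall w, X w = m}) \/
  (exists m s : R, s != 0 /\
     forall A : set R, measurable A -> P (X @^-1` A) = normal_prob m s A).

End complex_integration.

Section spectral_measures.
Context (R : realType) (k : space_kind) (nu : nat).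
Local Notation E := (espace R k nu).

Definition pt_opp (x : E) : E := map_tuple (@axis_opp R k) x.

Definition set_opp (A : set E) : set E := [set x | A (pt_opp x)].

Definition pt_norm (x : E) : R := Num.sqrt (\sum_(i < nu) val (tnth x i) ^+ 2).

Definition cube (T : R) : set E :=
  [set x | forall i : 'I_nu, `|val (tnth x i)| <= T].

Definition bounded_pts (A : set E) := exists T : R, A `<=` cube T.

Definition bborel (A : set E) := measurable A /\ bounded_pts A.

(* Complex measures of locally finite total variation. On the torus every set is
   bounded and cube pi is the whole space, so that these are the complex measures
   of finite total variation. *)
Record locfin_complex_measure (H : set E -> R[i]) : Prop := {
  lcm_sigma_additive : forall F : nat -> set E,
    (forall i, measurable (F i)) -> trivIset setT F ->
    bounded_pts (\bigcup_i F i) ->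
    (fun n => \sum_(i < n) Re (H (F i))) @ \oo --> Re (H (\bigcup_i F i)) /\
    (fun n => \sum_(i < n) Im (H (F i))) @ \oo --> Im (H (\bigcup_i F i)) ;
  lcm_variation : forall T : R, exists M : R,
    forall (n : nat) (F : 'I_n -> set E),
    (forall i, measurable (F i)) -> trivIset setT F ->
    (forall i, F i `<=` cube T) ->
    \sum_(i < n) normc (H (F i)) <= M
}.

Definition hermitian_psd (d : nat) (A : 'M[R[i]]_d) :=
  map_mx conjc (A^T) = A /\
  forall v : 'cV[R[i]]_d, 0 <= (map_mx conjc (v^T) *m A *m v) 0 0.

(* G is a matrix valued spectral measure, dominated by mu with densities g. *)
Record matrix_spectral_measure (d : nat) (G : 'I_d -> 'I_d -> set E -> R[i])
    (mu : {sigma_finite_measure set E -> \bar R})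
    (g : 'I_d -> 'I_d -> E -> R[i]) : Prop := {
  msm_measure : forall j j', locfin_complex_measure (G j j') ;
  msm_dominated : forall j j' A, bborel A -> mu A = 0%E -> G j j' A = 0 ;
  msm_density_measurable : forall j j', cmeasurable (g j j') ;
  msm_density : forall j j' A, bborel A ->
    cintegrable mu A (g j j') /\ G j j' A = cintegral mu A (g j j') ;
  msm_psd : {ae mu, forall x, hermitian_psd (\matrix_(j, j') g j j' x)} ;
  msm_even : forall j j' A, bborel A -> G j j' (set_opp A) = (G j j' A)^*%C ;
  msm_growth : k = Euclidean -> exists2 r : R, 0 < r & forall j,
    (\int[mu]_x (((1 + pt_norm x) `^ (- r)) * Re (g j j x))%:E < +oo)%E
}.

Definition nonatomic (mu : {sigma_finite_measure set E -> \bar R}) :=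
  forall x : E, mu [set x] = 0%E.

Section random_spectral_measure.
Context (dO : measure_display) (O : measurableType dO) (P : probability O R).

Record random_spectral_measure (d : nat) (G : 'I_d -> 'I_d -> set E -> R[i])
    (Z : 'I_d -> set E -> O -> R[i]) : Prop := {
  rsm_measurable : forall j A, bborel A -> cmeasurable (Z j A) ;
  (* Joint Gaussianity: all real linear combinations are Gaussian. *)
  rsm_gaussian : forall (m : nat) (j : 'I_m -> 'I_d) (A : 'I_m -> set E)
      (a b : 'I_m -> R),
    (forall i, bborel (A i)) ->
    gaussian P (fun w => \sum_(i < m)
      (a i * Re (Z (j i) (A i) w) + b i * Im (Z (j i) (A i) w))) ;
  rsm_centered : forall j A, bborel A -> cintegral P setT (Z j A) = 0 ;
  rsm_covariance : forall j j' A B, bborel A -> bborel B ->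
    cintegral P setT (fun w => Z j A w * (Z j' B w)^*%C) = G j j' (A `&` B) ;
  rsm_additive : forall j (n : nat) (A : 'I_n -> set E),
    (forall s, bborel (A s)) -> trivIset setT A ->
    {ae P, forall w, \sum_(s < n) Z j (A s) w = Z j (\bigcup_s A s) w} ;
  rsm_even : forall j A, bborel A ->
    {ae P, forall w, Z j A w = (Z j (set_opp A) w)^*%C}
}.

End random_spectral_measure.

Section kernels.
Context (d : nat) (mu : {sigma_finite_measure set E -> \bar R}).
Context (g : 'I_d -> 'I_d -> E -> R[i]).

(* The integral of f with respect to G_{j,j'}(dx). *)
Definition Gintegral (j j' : 'I_d) (f : E -> R[i]) : R[i] :=
  cintegral mu setT (fun x => f x * g j j' x).

(* The integral of f(x_1,..,x_n) with respect to
   G_{j_1,j_1}(dx_1) ... G_{j_n,j_n}(dx_n), as an iterated integral; it is only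
   used with nonnegative f. *)
Fixpoint diag_integral (n : nat) :
    n.-tuple 'I_d -> (n.-tuple E -> \bar R) -> \bar R :=
  match n return n.-tuple 'I_d -> (n.-tuple E -> \bar R) -> \bar R with
  | 0 => fun _ f => f [tuple]
  | n'.+1 => fun js f =>
      (\int[mu]_x ((Re (g (thead js) (thead js) x))%:E *
        @diag_integral n' [tuple of behead js]
          (fun y => f [tuple of x :: y])))%E
  end.

Definition Knorm2 (n : nat) (js : n.-tuple 'I_d) (f : n.-tuple E -> R[i]) :
    \bar R :=
  diag_integral js (fun x => (normc (f x) ^+ 2)%:E).

Definition in_K (n : nat) (js : n.-tuple 'I_d) (f : n.-tuple E -> R[i]) :=
  [/\ cmeasurable f,
      forall x, f (map_tuple pt_opp x) = (f x)^*%C &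
      (Knorm2 js f < +oo)%E].

(* The index +l (resp. -l) of a regular system, 1 <= l <= N, is (true, l - 1)
   (resp. (false, l - 1)). *)
Definition signed_index (N : nat) := (bool * 'I_N)%type.

Definition regular_system (N : nat) (D : signed_index N -> set E) :=
  [/\ forall i, bborel (D i),
      forall i, D i = set_opp (D (~~ i.1, i.2)) &
      forall i i', i <> i' -> D i `&` D i' = set0].

Definition box (N n : nat) (D : signed_index N -> set E)
    (ks : n.-tuple (signed_index N)) : set (n.-tuple E) :=
  [set x | forall l, D (tnth ks l) (tnth x l)].

Definition simple_for (N n : nat) (D : signed_index N -> set E)
    (f : n.-tuple E -> R[i]) :=
  [/\ regular_system D,
      forall ks x y, box D ks x -> box D ks y -> f x = f y,
      forall x, (forall ks, ~ box D ks x) -> f x = 0 &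
      forall (ks : n.-tuple (signed_index N)) (l l' : 'I_n), l <> l' ->
        (tnth ks l).2 = (tnth ks l').2 -> forall x, box D ks x -> f x = 0].

Section integral.
Context (dO : measure_display) (O : measurableType dO) (P : probability O R).
Context (Z : 'I_d -> set E -> O -> R[i]).

(* get (D i) is a point of D i if D i is nonempty; if D i is empty then Z_j(D i)
   vanishes almost surely. *)
Definition simple_integral (N n : nat) (js : n.-tuple 'I_d)
    (D : signed_index N -> set E) (f : n.-tuple E -> R[i]) (w : O) : R[i] :=
  \sum_(ks : n.-tuple (signed_index N))
    f [tuple get (D (tnth ks l)) | l < n] *
    \prod_(l < n) Z (tnth js l) (D (tnth ks l)) w.

(* X is a value of the L2-extension of the integral at f: the L2-limit of the
   integrals of some simple functions converging to f in K. *)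
Definition is_wiener_ito (n : nat) (js : n.-tuple 'I_d)
    (f : n.-tuple E -> R[i]) (X : O -> R[i]) :=
  cmeasurable X /\
  exists (N : nat -> nat) (D : forall m, signed_index (N m) -> set E)
      (s : nat -> n.-tuple E -> R[i]),
    [/\ forall m, in_K js (s m) /\ simple_for (@D m) (s m),
        (fun m => Knorm2 js (fun x => s m x - f x)) @ \oo --> 0%E &
        cvg_L2 P (fun m => simple_integral js (@D m) (s m)) X].

(* I_n(f | j_1,..,j_n), a random variable determined up to almost sure equality.
   On K simple functions are dense and the integral of simple functions is
   bounded, so that the default value 0 is not used there. *)
Definition wiener_ito (n : nat) :
    n.-tuple 'I_d -> (n.-tuple E -> R[i]) -> O -> R[i] :=
  match n return n.-tuple 'I_d -> (n.-tuple E -> R[i]) -> O -> R[i] with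
  | 0 => fun _ f _ => f [tuple]
  | _ => fun js f => xget (fun _ => 0) (is_wiener_ito js f)
  end.

End integral.

Definition h_gamma0 (n : nat) (h1 : n.-tuple E -> R[i])
    (h2 : 1.-tuple E -> R[i]) (x : n.+1.-tuple E) : R[i] :=
  h1 [tuple tnth x (widen_ord (leqnSn n) i) | i < n] * h2 [tuple tnth x ord_max].

(* In 0-based numbering: i |-> i for i < p, p |-> n, i |-> i - 1 for i > p. *)
Definition pi_gamma (n : nat) (p i : 'I_n.+1) : 'I_n.+1 :=
  if (i < p)%N then i else if i == p then ord_max else inord i.-1.

Definition h1_gamma (n : nat) (h1 : n.+1.-tuple E -> R[i]) (p : 'I_n.+1)
    (x : n.+1.-tuple E) : R[i] :=
  h1 [tuple tnth x (pi_gamma p i) | i < n.+1].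

Definition h_gamma (n : nat) (js : n.+1.-tuple 'I_d) (j' : 'I_d)
    (h1 : n.+1.-tuple E -> R[i]) (h2 : 1.-tuple E -> R[i]) (p : 'I_n.+1)
    (x : n.-tuple E) : R[i] :=
  Gintegral (tnth js p) j'
    (fun y => h1_gamma h1 p [tuple of rcons x y] * (h2 [tuple y])^*%C).

End kernels.

End spectral_measures.

(* The tuple without its p-th element: s |-> j_s for s < p, s |-> j_{s+1} for
   s >= p. *)
Definition tuple_del (T : Type) (n : nat) (p : 'I_n.+1) (t : n.+1.-tuple T) :
  n.-tuple T := [tuple tnth t (lift p s) | s < n].

(* Main.v *)
(* The proof works with finite sums of indicators of rectangles A_1 x .. x A_n
   whose sides are pairwise disjoint and disjoint from the opposites of all sides.
   The integral of such a sum is the corresponding sum of products of Z's; by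
   Wick's theorem and a common refinement into a regular system it is bounded in
   L2 by the norm of the sum. As mu has no atoms these sums are dense, so that the
   integral extends to all square integrable f, symmetric or not, and is bilinear
   with the kernel; symmetrization identifies it with the integral of the
   statement.

   The product formula then has only to be proved for the indicator of a good
   rectangle and a set B that is equal or opposite to one of the sides, or
   disjoint from all of them and their opposites. If A_p = B or A_p = - B, cut B
   into small cells B_s: in Z(A_p) Z(B) the products of Z's of cells which are
   neither equal nor opposite form an integral of a good sum, and the other ones
   add up to G(A_p cap - B) up to an error whose variance is bounded by the sum of
   the squares of the masses of the cells, which tends to 0. The general case
   follows in L1, both sides being continuous in (h1, h2). *)

Require Import Defs.
From HB Require Import structures.
From mathcomp Require Import finmap all_boot all_order all_algebra.
From mathcomp Require Import complex ring lra.
From mathcomp Require Import all_classical all_reals all_analysis measurable_realfun.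

Set Implicit Arguments.
Unset Strict Implicit.
Unset Printing Implicit Defensive.

Import Order.TTheory GRing.Theory Num.Theory.
Import numFieldNormedType.Exports.
Import HBNNSimple.

Local Open Scope classical_set_scope.
Local Open Scope ring_scope.

(** * Polarization *)

(** Joint Gaussianity is given only through real linear combinations, so Wick's theorem has to come
    from the moments of a single variable: perturb it linearly, compare coefficients, then polarize.
    The reality condition f(-x) = conj f(x) fails for a single rectangle, and this shapes the rest.
    The integral is therefore extended to kernels without this condition, and in the contraction the
    conjugate of h2(y) is replaced by h2(-y). On K the two agree, but the second is linear in h2 and
    makes sense for each rectangle, where it produces G(A_p cap - B), the expectation of Z(A_p)
    Z(B). A regular system chooses one point out of each pair x, -x, hence the half space; the
    points with -x = x that it leaves out are finitely many and null for a non-atomic mu. The L2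
    bound is proved with a crude constant, and all estimates use squared norms in [\bar R], where a
    factor 2 or 4 stands for the triangle inequality. A product of two L2 limits converges only in
    L1, which is why the limit identities are settled by an L1 argument. *)

Lemma polarization (m : nat) : exists2 c : nat, (0 < c)%N &
  forall (A : comNzRingType) (x : 'I_m -> A),
    c%:R * \prod_i x i =
    \sum_(S : {set 'I_m}) (-1) ^+ #|~: S| * (\sum_(i in S) x i) ^+ m.
Proof.
pose surj (f : {ffun 'I_m -> 'I_m}) := [forall j, j \in codom f].
(* The constant is m!, counted as the number of maps of ['I_m] onto itself. It is fixed before the
   ring, because the identity is used again in a polynomial ring. *)
exists #|surj|.
  apply/card_gt0P; exists [ffun i => i]; apply/forallP => j.
  by apply/codomP; exists j; rewrite ffunE.
move=> A x.
(* [e f S] is the sign of S if S contains the image of f, and 0 otherwise. Being a product over j,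
   it has a sum over S that factors, and each j outside the image contributes 1 - 1 = 0. Only the
   surjective f, that is the permutations, remain. *)
pose e (f : {ffun 'I_m -> 'I_m}) (S : {set 'I_m}) : A :=
  \prod_j (if j \in S then 1 else - (j \notin codom f)%:R).
have powE S : (\sum_(i in S) x i) ^+ m =
    \sum_(f : {ffun 'I_m -> 'I_m} | [forall i, f i \in S]) \prod_i x (f i).
  transitivity (\prod_(j < m) \sum_(i in S) x i).
    by rewrite prodr_const card_ord.
  rewrite bigA_distr_big.
  by apply: eq_bigl => f; apply/ffun_onP/forallP.
transitivity (\sum_(f : {ffun 'I_m -> 'I_m})
    (\sum_(S : {set 'I_m}) e f S) * \prod_i x (f i)).
  transitivity (\sum_(f : {ffun 'I_m -> 'I_m} | surj f) \prod_i x i).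
    by rewrite sumr_const mulr_natl.
  rewrite big_mkcond; apply: eq_bigr => f _.
  have -> : \sum_(S : {set 'I_m}) e f S = \prod_j (1 - (j \notin codom f)%:R).
    by rewrite [RHS]bigA_distr; apply: eq_bigr.
  have [/forallP sf|nsf] := boolP (surj f).
    rewrite [X in X * _]big1 => [|j _]; last by rewrite sf subr0.
    rewrite mul1r.
    apply: reindex; apply: onW_bij; apply: injF_bij.
    apply/injectiveP; rewrite /injectiveb /dinjectiveb.
    apply/card_uniqP; rewrite size_map -cardE card_ord -[RHS]card_ord.
    by apply: eq_card => j; rewrite (sf j).
  have /existsP[j jf] : [exists j, j \notin codom f].
    by rewrite -negb_forall.
  by rewrite (bigD1 j)//= jf subrr !mul0r.
under eq_bigr do rewrite mulr_suml.
rewrite exchange_big /=; apply: eq_bigr => S _.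
rewrite powE mulr_sumr [RHS]big_mkcond; apply: eq_bigr => f _.
have [/forallP fS|] := boolP [forall i, f i \in S].
  congr (_ * _); rewrite /e -prodr_const [RHS]big_mkcond; apply: eq_bigr => j _.
  rewrite inE; case: ifPn => //= jS.
  case: (boolP (j \in codom f)) => //= /codomP[i ji].
  by move: jS; rewrite ji fS.
rewrite negb_forall => /existsP[i fiS].
by rewrite /e (bigD1 (f i))//= (negbTE fiS) codom_f oppr0 !mul0r.
Qed.

(* The value at x of the derivation of prod_i X_i with X_k' = a_k; Wick's formula
   takes a_k = E[V X_k]. *)
Definition wick_sum (A : comNzRingType) (I : finType) (a x : I -> A) : A :=
  \sum_k a k * \prod_(i | i != k) x i.

Lemma horner_deriv_prod (A : comNzRingType) (I : eqType) (r : seq I)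
    (p : I -> {poly A}) t : uniq r ->
  ((\prod_(i <- r) p i)^`()).[t] =
  \sum_(k <- r) (p k)^`().[t] * \prod_(i <- r | i != k) (p i).[t].
Proof.
elim: r => [|j r IH] /=; first by rewrite !big_nil -[1]/1%:P derivC horner0.
case/andP=> jr ur; rewrite !big_cons derivM hornerD !hornerM IH//.
rewrite eqxx /= horner_prod; congr (_ * _ + _).
  rewrite big_seq [RHS]big_seq_cond; apply: eq_bigl => i.
  by case: (boolP (i \in r)) => //= ir; apply/esym; apply: contraNneq jr => <-.
rewrite mulr_sumr [LHS]big_seq [RHS]big_seq; apply: eq_bigr => k kr.
rewrite big_cons ifT; last by apply: contraNneq jr => ->.
by rewrite [LHS]mulrCA.
Qed.

(** The derivation becomes a derivative at 0 in a polynomial ring, so that any identity between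
    products, valid in all commutative rings, can be differentiated into one for [wick_sum]. *)
Lemma wick_sumE (A : comNzRingType) (I : finType) (a x : I -> A) :
  wick_sum a x = ((\prod_i ((x i)%:P + a i *: 'X))^`()).[0].
Proof.
rewrite horner_deriv_prod ?index_enum_uniq//; apply: eq_bigr => k _.
rewrite derivD derivC derivZ derivX add0r hornerZ hornerC mulr1; congr (_ * _).
by apply: eq_bigr => i _; rewrite hornerD hornerC hornerZ hornerX mulr0 addr0.
Qed.

(** The second identity is the derivative at 0 of the first one, taken at the polynomials x_i + a_i
    X. The constant and the signs are therefore the same in both, which lets the proof of Wick's
    formula compare them term by term. *)
Lemma wick_sum_polarization (m : nat) : exists2 c : nat, (0 < c)%N &
  forall (A : comNzRingType) (a x : 'I_m -> A),
    c%:R * \prod_i x i =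
    \sum_(S : {set 'I_m}) (-1) ^+ #|~: S| * (\sum_(i in S) x i) ^+ m /\
    c%:R * wick_sum a x =
    \sum_(S : {set 'I_m}) (-1) ^+ #|~: S| *
      (m%:R * (\sum_(i in S) a i) * (\sum_(i in S) x i) ^+ m.-1).
Proof.
have [c c0 pc] := polarization m; exists c => // A a x.
have sg k (p : {poly A}) : (((-1) ^+ k * p)^`()).[0] = (-1) ^+ k * (p^`()).[0].
  rewrite -signr_odd -[in RHS]signr_odd; case: odd.
    by rewrite !expr1 !mulN1r derivN hornerN.
  by rewrite !expr0 !mul1r.
split; first exact: pc.
have /(congr1 (fun p => p^`().[0])) := pc _ (fun i => (x i)%:P + a i *: 'X).
rewrite -[c%:R]polyC_natr derivM derivC mul0r add0r hornerM hornerC.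
rewrite -wick_sumE => ->; rewrite (raddf_sum (@deriv A)) horner_sum; apply: eq_bigr => S _ /=.
rewrite sg; congr (_ * _); rewrite big_split/= -scaler_suml deriv_exp hornerMn hornerM.
rewrite horner_exp hornerD hornerZ hornerX mulr0 addr0.
rewrite derivD derivZ derivX hornerD hornerZ hornerC mulr1.
rewrite -[RHS]mulrA mulr_natl; congr (_ * _ ^+ _ *+ _).
  rewrite (_ : _^`() = 0) ?horner0 ?add0r//.
  by rewrite (raddf_sum (@deriv A)) big1// => i _ /=; rewrite derivC.
by rewrite horner_sum; apply: eq_bigr => i _; rewrite hornerC.
Qed.

(** Multilinearity, with a and x expanded along the same coefficients. It serves to split complex
    variables into their real and imaginary parts. *)
Lemma wick_sum_distr (A : comNzRingType) (I J : finType) (c : J -> A)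
    (a x : I -> J -> A) :
  wick_sum (fun i => \sum_j c j * a i j) (fun i => \sum_j c j * x i j) =
  \sum_(f : {ffun I -> J}) (\prod_i c (f i)) *
     wick_sum (fun i => a i (f i)) (fun i => x i (f i)).
Proof.
rewrite wick_sumE.
under eq_bigr => i _.
  rewrite (_ : _ + _ = \sum_j c j *: ((x i j)%:P + a i j *: 'X)); last first.
    rewrite rmorph_sum scaler_suml -big_split; apply: eq_bigr => j _ /=.
    by rewrite scalerDr scalerA polyCM mul_polyC.
  over.
rewrite bigA_distr_bigA (raddf_sum (@deriv A)) horner_sum; apply: eq_bigr => f _.
rewrite /= scaler_prod derivZ hornerZ wick_sumE.
by [].
Qed.

(** * Moments of Gaussian variables *)

Section density_measure.
Context (d : measure_display) (T : measurableType d) (R : realType).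
Variables (mu : {measure set T -> \bar R}) (rho : T -> R).
Hypotheses (mrho : measurable_fun setT rho) (rho0 : forall x, 0 <= rho x).
Local Open Scope ereal_scope.

Definition dens (A : set T) : \bar R := \int[mu]_(x in A) (rho x)%:E.

Let dens0 : dens set0 = 0.
Proof. by rewrite /dens integral_set0. Qed.

Let dens_ge0 A : 0 <= dens A.
Proof. by apply: integral_ge0 => x _; rewrite lee_fin. Qed.

Let dens_sigma_additive : semi_sigma_additive dens.
Proof.
move=> /= F mF tF mUF; rewrite /dens ge0_integral_bigcup//=; last 2 first.
- by apply/measurable_EFinP/measurable_funTS.
- by move=> x _; rewrite lee_fin.
by apply: is_cvg_ereal_nneg_natsum_cond => n _ _; exact: dens_ge0.
Qed.

Definition dens_measure : {measure set T -> \bar R} :=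
  HB.pack dens (isMeasure.Build _ _ _ dens dens0 dens_ge0 dens_sigma_additive).

Lemma integral_dens (f : T -> \bar R) :
  measurable_fun setT f -> (forall x, 0 <= f x) ->
  \int[dens_measure]_x f x = \int[mu]_x (f x * (rho x)%:E).
Proof.
move=> mf f0; pose h := nnsfun_approx measurableT mf.
have hf x : EFin \o h^~ x @ \oo --> f x by exact: cvg_nnsfun_approx.
have -> : \int[dens_measure]_x f x =
    limn (fun n => \int[dens_measure]_x (h n x)%:E).
  rewrite -monotone_convergence//.
  - by apply: eq_integral => x _; apply/esym/cvg_lim => //; exact: hf.
  - by move=> n; exact/measurable_EFinP.
  - by move=> n x _; rewrite lee_fin.
  - by move=> x _ a b ab; rewrite lee_fin; exact/lefP/nd_nnsfun_approx.
have -> : \int[mu]_x (f x * (rho x)%:E) =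
    limn (fun n => \int[mu]_x ((h n x)%:E * (rho x)%:E)).
  rewrite -monotone_convergence//.
  - apply: eq_integral => x _; apply/esym/cvg_lim => //.
    by apply: cvgeZr => //; exact: hf.
  - by move=> n; apply: emeasurable_funM; exact/measurable_EFinP.
  - by move=> n x _; rewrite mule_ge0// lee_fin.
  - move=> x _ a b ab; rewrite lee_wpmul2r ?lee_fin//.
    exact/lefP/nd_nnsfun_approx.
congr (limn _); apply/funext => n.
transitivity (\int[dens_measure]_x
   (\sum_(y \in range (h n)) (y * \1_(h n @^-1` [set y]) x)%:E)).
  by apply: eq_integral => t tE; rewrite /= fimfunE -fsumEFin.
have indich m r : measurable_fun setT
    (fun x => (r * \1_(h m @^-1` [set r]) x)%:E).
  by apply/measurable_EFinP; exact: measurable_funM.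
rewrite ge0_integral_fsum//; last by move=> m y Ey; exact: nnfun_muleindic_ge0.
transitivity (\int[mu]_x (\sum_(y \in range (h n))
    (y * \1_(h n @^-1` [set y]) x)%:E * (rho x)%:E)); last first.
  apply: eq_integral => x _.
  rewrite -ge0_mule_fsuml => [|y]; last exact: nnfun_muleindic_ge0.
  by rewrite fsumEFin// -(fimfunE _ x).
rewrite ge0_integral_fsum//; last 2 first.
- by move=> y; apply: emeasurable_funM => //; exact/measurable_EFinP.
- by move=> m y _; apply: mule_ge0; [exact: nnfun_muleindic_ge0|rewrite lee_fin].
apply: eq_fsbigr => r rhn.
rewrite integralZl_indic_nnsfun// integral_indic// setIT.
under [RHS]eq_integral do rewrite EFinM -muleA.
rewrite ge0_integralZl//.
- congr (_ * _); rewrite /= /dens integral_mkcond; apply: eq_integral => x _.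
  by rewrite epatch_indic muleC.
- by apply: emeasurable_funM; apply/measurable_EFinP.
- by move=> t Et; rewrite mule_ge0 ?lee_fin.
- by move: rhn; rewrite inE => -[t _ <-]; rewrite lee_fin.
Qed.

End density_measure.

Definition push_measure (d d' : measure_display) (T1 : measurableType d)
    (T2 : measurableType d') (R : realType) (m : {measure set T1 -> \bar R})
    (f : T1 -> T2) (mf : measurable_fun setT f) : {measure set T2 -> \bar R} :=
  measure_function_pushforward__canonical__measure_function_Measure m mf.

Section moments_finite.
Context (d : measure_display) (O : measurableType d) (R : realType).
Variable P : probability O R.

(** These variables form an algebra that contains the Gaussian ones, so polynomials in Gaussian
    variables can be integrated without following the exponents. *)
Definition allmom (X : O -> R) := measurable_fun setT X /\
  forall p : nat, (\int[P]_w (`|X w| ^+ p)%:E < +oo)%E.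

Lemma allmom_integrable X : allmom X -> P.-integrable setT (EFin \o X).
Proof.
move=> [mX /(_ 1%N)]; under eq_integral do rewrite expr1.
by move=> X1; apply/integrableP; split => //; exact/measurable_EFinP.
Qed.

Lemma measurable_pnorm (X : O -> R) p : measurable_fun setT X ->
  measurable_fun setT (fun w => (`|X w| ^+ p)%:E).
Proof.
move=> mX; apply/measurable_EFinP; apply: measurable_funX.
exact: measurableT_comp.
Qed.

(** The exponent q may depend on p: q = p serves for sums and q = 2 p for products. *)
Lemma allmom_le (X Y Z : O -> R) :
  (forall p, exists a b : R, exists2 q, 0 <= a /\ 0 <= b & forall w,
    `|Z w| ^+ p <= a * `|X w| ^+ q + b * `|Y w| ^+ q) ->
  measurable_fun setT Z -> allmom X -> allmom Y -> allmom Z.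
Proof.
move=> le mZ [mX X1] [mY Y1]; split => // p.
have [a' [b' [q [a0 b0] le']]] := le p; have {}le := le'.
apply: (@le_lt_trans _ _ (\int[P]_w
    (a'%:E * (`|X w| ^+ q)%:E + b'%:E * (`|Y w| ^+ q)%:E))%E).
  apply: ge0_le_integral => //.
  - exact: measurable_pnorm.
  - by apply: emeasurable_funD; apply: emeasurable_funM => //;
      exact: measurable_pnorm.
  - by move=> w _; rewrite -!EFinM -EFinD lee_fin.
rewrite ge0_integralD//.
- rewrite !ge0_integralZl//.
  + by rewrite lte_add_pinfty// lte_mul_pinfty.
  all: try by [exact: measurable_pnorm|
     move=> w _; rewrite lee_fin exprn_ge0].
- by move=> w _; rewrite mule_ge0// lee_fin exprn_ge0.
- by apply: emeasurable_funM => //; exact: measurable_pnorm.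
- by move=> w _; rewrite mule_ge0// lee_fin exprn_ge0.
- by apply: emeasurable_funM => //; exact: measurable_pnorm.
Qed.

Lemma allmomD X Y : allmom X -> allmom Y -> allmom (fun w => X w + Y w).
Proof.
move=> mX mY; apply: (allmom_le _ _ mX mY); last first.
  by apply: measurable_funD; [case: mX|case: mY].
move=> p; exists (2 ^+ p), (2 ^+ p); exists p; first by rewrite !exprn_ge0.
move=> w; rewrite -mulrDr.
have [xy|/ltW yx] := leP `|X w| `|Y w|.
  apply: (@le_trans _ _ ((2 * `|Y w|) ^+ p)).
    by rewrite lerXn2r ?nnegrE ?mulr_ge0// (le_trans (ler_normD _ _))// mulr2n
      mulrDl mul1r lerD.
  by rewrite exprMn ler_wpM2l ?exprn_ge0// lerDr exprn_ge0.
apply: (@le_trans _ _ ((2 * `|X w|) ^+ p)).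
  by rewrite lerXn2r ?nnegrE ?mulr_ge0// (le_trans (ler_normD _ _))// mulr2n
    mulrDl mul1r lerD.
by rewrite exprMn ler_wpM2l ?exprn_ge0// lerDl exprn_ge0.
Qed.

Lemma allmomM X Y : allmom X -> allmom Y -> allmom (fun w => X w * Y w).
Proof.
move=> mX mY; apply: (allmom_le _ _ mX mY); last first.
  by apply: measurable_funM; [case: mX|case: mY].
move=> p; exists 1, 1; exists (p * 2)%N; first by split.
move=> w; rewrite !mul1r normrM exprMn !exprM.
set x := _ ^+ p; set y := _ ^+ p.
have := sqr_ge0 (x - y); have := sqr_ge0 x; have := sqr_ge0 y; nra.
Qed.

Lemma allmom_cst c : allmom (fun=> c).
Proof.
split => [|p]; first exact: measurable_cst.
rewrite (eq_integral (cst (`|c| ^+ p)%:E))// integral_cst//.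
rewrite lte_mul_pinfty ?lee_fin ?exprn_ge0//.
by apply: (le_lt_trans (probability_le1 P measurableT)); rewrite ltry.
Qed.

Lemma allmomZ c X : allmom X -> allmom (fun w => c * X w).
Proof. exact: allmomM (allmom_cst c). Qed.

Lemma allmomX X n : allmom X -> allmom (fun w => X w ^+ n).
Proof.
move=> mX; elim: n => [|n IH]; first exact: allmom_cst.
by under eq_fun do rewrite exprS; exact: allmomM.
Qed.

Lemma allmom_sum (I : Type) (r : seq I) (Q : pred I) (X : I -> O -> R) :
  (forall i, Q i -> allmom (X i)) -> allmom (fun w => \sum_(i <- r | Q i) X i w).
Proof.
move=> mX; elim: r => [|i r IH].
  by under eq_fun do rewrite big_nil; exact: allmom_cst.
under eq_fun do rewrite big_cons; case: (boolP (Q i)) => Qi //.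
by apply: allmomD => //; exact: mX.
Qed.

Lemma allmom_prod (I : Type) (r : seq I) (Q : pred I) (X : I -> O -> R) :
  (forall i, Q i -> allmom (X i)) -> allmom (fun w => \prod_(i <- r | Q i) X i w).
Proof.
move=> mX; elim: r => [|i r IH].
  by under eq_fun do rewrite big_nil; exact: allmom_cst.
under eq_fun do rewrite big_cons; case: (boolP (Q i)) => Qi //.
by apply: allmomM => //; exact: mX.
Qed.

Lemma Ex_sum (I : Type) (r : seq I) (Q : pred I) (X : I -> O -> R) :
  (forall i, Q i -> allmom (X i)) ->
  \int[P]_w (\sum_(i <- r | Q i) X i w) = \sum_(i <- r | Q i) \int[P]_w X i w.
Proof.
move=> mX; elim: r => [|i r IH].
  under eq_Rintegral do rewrite big_nil.
  by rewrite big_nil Rintegral_cst// mul0r.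
rewrite big_cons; under eq_Rintegral do rewrite big_cons.
case: (boolP (Q i)) => Qi //; rewrite RintegralD ?IH//.
- exact/allmom_integrable/mX.
- exact/allmom_integrable/allmom_sum.
Qed.

Lemma Ex_cst (c : R) : \int[P]_w c = c.
Proof.
rewrite Rintegral_cst//; have E : P setT = 1%E := probability_setT P.
by transitivity (c * fine (P setT)) => //; rewrite E mulr1.
Qed.

Lemma ae_eq_Ex (X Y : O -> R) : measurable_fun setT X -> measurable_fun setT Y ->
  {ae P, forall w, X w = Y w} -> \int[P]_w X w = \int[P]_w Y w.
Proof.
move=> mX mY XY; rewrite /Rintegral; congr fine; apply: ae_eq_integral => //.
- exact/measurable_EFinP.
- exact/measurable_EFinP.
- by apply: filterS XY => w -> _.
Qed.

Lemma ExZ c X : allmom X -> \int[P]_w (c * X w) = c * \int[P]_w X w.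
Proof. by move=> mX; rewrite RintegralZl//; exact: allmom_integrable. Qed.

Lemma ExD X Y : allmom X -> allmom Y ->
  \int[P]_w (X w + Y w) = \int[P]_w X w + \int[P]_w Y w.
Proof. by move=> mX mY; rewrite RintegralD//; exact: allmom_integrable. Qed.

End moments_finite.

Section normal_moments.
Context (R : realType) (m s : R).
Hypothesis s0 : s != 0.
Local Notation mu := (@lebesgue_measure R).
Local Notation pdf := (normal_pdf m s).

Let s2gt0 : 0 < s ^+ 2. Proof. by rewrite exprn_even_gt0. Qed.

Lemma normal_pdf_expE x :
  pdf x = normal_peak s * expR (- (x - m) ^+ 2 / (s ^+ 2 *+ 2)).
Proof. by rewrite normal_pdfE. Qed.

(* expR (- y^2 / (2 s^2)) = expR (- y^2 / (4 s^2))^2 and one of the factors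
   absorbs the power of y *)
Lemma normal_pdf_decay (j : nat) : exists2 C : R, 0 <= C &
  forall x, `|x - m| ^+ j * pdf x <= C * normal_pdf m (Num.sqrt 2 * s) x.
Proof.
pose s' := Num.sqrt 2 * s.
have s'2 : s' ^+ 2 = 2 * s ^+ 2 by rewrite exprMn sqr_sqrtr.
have s'0 : s' != 0 by rewrite mulf_neq0// gt_eqF// sqrtr_gt0.
(* With u = y^2 / (4 s^2), the power |y|^j is at most 1 + (y^2)^(j+1) = 1 + (4 s^2)^(j+1) u^(j+1),
   and u^(j+1) is at most (j+1)! exp u by the exponential series. This is K exp u. *)
pose K := 1 + (s ^+ 2 *+ 4) ^+ j.+1 * (j.+1)`!%:R.
have fact0 : 0 < (j.+1)`!%:R :> R by rewrite ltr0n fact_gt0.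
have K0 : 0 <= K.
  by rewrite addr_ge0// mulr_ge0 ?exprn_ge0 ?mulrn_wge0 ?sqr_ge0.
have ps : 0 < normal_peak s by exact: normal_peak_gt0.
have ps' : 0 < normal_peak s' by exact: normal_peak_gt0.
exists (K * normal_peak s / normal_peak s').
  by apply: divr_ge0; [apply: mulr_ge0 => //|]; exact: ltW.
move=> x; rewrite normal_pdf_expE (normal_pdfE _ s'0) /normal_fun s'2.
set y := x - m; pose u := y ^+ 2 / (s ^+ 2 *+ 4).
have s4 : 0 < s ^+ 2 *+ 4 by rewrite pmulrn_rgt0.
have u0 : 0 <= u by rewrite divr_ge0 ?sqr_ge0 ?ltW.
have -> : - y ^+ 2 / (s ^+ 2 *+ 2) = - u + - u.
  by rewrite /u; field.
have -> : - y ^+ 2 / ((2 * s ^+ 2) *+ 2) = - u.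
  by rewrite /u; field; rewrite s0.
rewrite expRD.
have -> : K * normal_peak s / normal_peak s' * (normal_peak s' * expR (- u)) =
    K * normal_peak s * expR (- u).
  by field; rewrite gt_eqF.
suff yK : `|y| ^+ j * expR (- u) <= K.
  have -> : `|y| ^+ j * (normal_peak s * (expR (- u) * expR (- u))) =
    (`|y| ^+ j * expR (- u)) * (normal_peak s * expR (- u)) by ring.
  by rewrite -[leRHS]mulrA ler_wpM2r// mulr_ge0 ?expR_ge0 ?ltW.
rewrite expRN ler_pdivrMr ?expR_gt0//.
apply: (@le_trans _ _ (1 + y ^+ 2 ^+ j.+1)).
  have [y1|/ltW y1] := leP `|y| 1.
    rewrite (@le_trans _ _ 1) ?exprn_ile1// lerDl exprn_ge0 ?sqr_ge0//.
  rewrite -(real_normK (num_real y)) -exprM (@le_trans _ _ (`|y| ^+ (2 * j.+1)))//.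
    by rewrite ler_weXn2l// (leq_trans (leqnSn _))// leq_pmull.
  by rewrite lerDr.
have -> : y ^+ 2 = u * (s ^+ 2 *+ 4) by rewrite /u divfK// gt_eqF.
have e1 := expR_ge1Dxn j u0.
have e2 : u ^+ j.+1 <= (j.+1)`!%:R * expR u.
  rewrite -ler_pdivrMl// mulrC (le_trans _ e1)// lerDr//.
have e3 : 1 <= expR u.
  by rewrite (le_trans _ e1)// lerDl; apply: divr_ge0; [exact: exprn_ge0|exact: ltW].
rewrite exprMn /K mulrDl mul1r lerD//.
by rewrite mulrC -mulrA ler_wpM2l// exprn_ge0// ltW.
Qed.

Lemma measurable_moment j : measurable_fun [set: R] (fun x : R => (x - m) ^+ j * pdf x).
Proof.
apply: measurable_funM; last exact: measurable_normal_pdf.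
by apply: measurable_funX; exact: measurable_funB.
Qed.

Lemma integrable_moment j :
  mu.-integrable [set: R] (fun x : R => ((x - m) ^+ j * pdf x)%:E).
Proof.
have [C C0 Cj] := normal_pdf_decay j.
apply: (@le_integrable _ _ _ mu setT measurableT _
  (fun x => (C%:E * (normal_pdf m (Num.sqrt 2 * s) x)%:E)%E)).
- by apply/measurable_EFinP; exact: measurable_moment.
- move=> x _ /=; rewrite lee_fin normrM normrX.
  rewrite (ger0_norm (normal_pdf_ge0 _ _ _)) (le_trans (Cj x))// normrM.
  by rewrite (ger0_norm C0) (ger0_norm (normal_pdf_ge0 _ _ _)).
- by apply: integrableZl => //; exact: integrable_normal_pdf.
Qed.

Lemma derive_moment k (x : R) : is_derive x 1 (fun x : R => (x - m) ^+ k * pdf x)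
  (k%:R * ((x - m) ^+ k.-1 * pdf x) - (s ^+ 2)^-1 * ((x - m) ^+ k.+1 * pdf x)).
Proof.
rewrite (normal_pdfE _ s0).
have d1 : is_derive x 1 (fun x : R => x - m) 1.
  by apply: is_derive_eq; rewrite subr0.
have d2 n : is_derive x 1 (fun x : R => (x - m) ^+ n) (n%:R * (x - m) ^+ n.-1).
  rewrite (_ : (fun x : R => _) = (fun x : R => x - m) ^+ n).
    by apply: (is_derive_eq (is_deriveX n d1)); rewrite /GRing.scale/= mulr1.
  by rewrite exprfctE.
have d4 : is_derive x 1 (fun x : R => - (x - m) ^+ 2 / (s ^+ 2 *+ 2))
    (- (2 * (x - m)) / (s ^+ 2 *+ 2)).
  rewrite (_ : (fun x : R => _) =
      (- (s ^+ 2 *+ 2)^-1) *: (fun x : R => (x - m) ^+ 2)).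
    apply: (is_derive_eq (is_deriveZ _ (d2 2%N))).
    by rewrite /GRing.scale/= expr1; ring.
  by apply/funext => y; rewrite [RHS]/GRing.scale/= /GRing.scale/=; ring.
have d3 : is_derive x 1 (normal_fun m s)
    (normal_fun m s x * (- (2 * (x - m)) / (s ^+ 2 *+ 2))).
  exact: (@is_derive1_comp R expR _ x _ _ (is_derive_expR _) d4).
have d3' : is_derive x 1 (fun x : R => normal_peak s * normal_fun m s x)
    (normal_peak s * (normal_fun m s x * (- (2 * (x - m)) / (s ^+ 2 *+ 2)))).
  exact: is_deriveZ.
rewrite (_ : (fun x : R => _) =
    (fun x : R => (x - m) ^+ k) * (fun x : R => normal_peak s * normal_fun m s x)); last first.
  by apply/funext.
apply: (is_derive_eq (is_deriveM (d2 k) d3')).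
rewrite /GRing.scale/=.
case: k => [|k] /=.
  by field; rewrite s0.
by rewrite !exprS; field; rewrite s0.
Qed.

Lemma moment_continuous k : continuous (fun x : R => (x - m) ^+ k * pdf x).
Proof.
move=> x; apply/differentiable_continuous/derivable1_diffP.
by have [] := derive_moment k x.
Qed.

(** Integration by parts: [derive_moment] writes a combination of the two integrands as the
    derivative of F = (x - m)^k pdf, and F vanishes at infinity. For k = 0 the exponent [k.-1] is
    truncated, but its coefficient is 0. *)
Lemma normal_moment_rec k :
  \int[mu]_x ((x - m) ^+ k.+1 * pdf x) =
  k%:R * s ^+ 2 * \int[mu]_x ((x - m) ^+ k.-1 * pdf x).
Proof.
pose F (x : R) := (x - m) ^+ k * pdf x.
pose f (x : R) := k%:R * ((x - m) ^+ k.-1 * pdf x) -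
  (s ^+ 2)^-1 * ((x - m) ^+ k.+1 * pdf x).
have iZ (c : R) i : mu.-integrable [set: R]
    (EFin \o (fun x : R => c * ((x - m) ^+ i * pdf x))).
  rewrite (_ : _ \o _ = (fun x : R => (c%:E * ((x - m) ^+ i * pdf x)%:E)%E)).
    by apply: integrableZl => //; exact: integrable_moment.
  by apply/funext => x.
have intf : mu.-integrable [set: R] (EFin \o f).
  exact: (@integrableB _ _ _ mu setT measurableT _ _ (iZ k%:R k.-1) (iZ (s ^+ 2)^-1 k.+1)).
have Ef : \int[mu]_x f x = k%:R * \int[mu]_x ((x - m) ^+ k.-1 * pdf x) -
    (s ^+ 2)^-1 * \int[mu]_x ((x - m) ^+ k.+1 * pdf x).
  rewrite -!RintegralZl//; [|exact: integrable_moment..].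
  by rewrite RintegralB//; exact: iZ.
suff : \int[mu]_x f x = 0.
  rewrite Ef => /eqP; rewrite subr_eq0 => /eqP e.
  by rewrite mulrAC e; field; rewrite s0.
pose I n := `[m - n.+1%:R, m + n.+1%:R].
have FTC n : (\int[mu]_(x in [set` I n]) (f x)%:E = (F (m + n.+1%:R) - F (m - n.+1%:R))%:E)%E.
  rewrite EFinB; apply: continuous_FTC2.
  - by rewrite ltrD2l (@lt_trans _ _ 0)// oppr_lt0.
  - apply: continuous_subspaceT => x; apply: cvgB; apply: cvgM => //;
      try exact: cvg_cst; exact: moment_continuous.
  - split.
    + by move=> x _; have [] := derive_moment k x.
    + by apply: cvg_at_right_filter; exact: moment_continuous.
    + by apply: cvg_at_left_filter; exact: moment_continuous.
  - by move=> x _; rewrite derive1E; have [_ ->] := derive_moment k x.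
have lim1 : (\int[mu]_(x in [set` I n]) (f x)%:E)%E @[n --> \oo] -->
    (\int[mu]_x (f x)%:E)%E.
  under eq_fun do rewrite integral_mkcond.
  apply: (@dominated_cvg _ _ _ mu setT measurableT _ _ (fun x => `|(f x)%:E|%E)) => //.
  - move=> n; apply/(measurable_restrictT _ _).1 => //.
    by apply: measurable_funTS; exact: measurable_int intf.
  - move=> x _; apply: cvg_near_cst; near=> n.
    have xn : `|x - m| <= n%:R by near: n; exact: nbhs_infty_ger.
    have nn : n%:R <= n.+1%:R :> R by rewrite ler_nat.
    move: xn; rewrite ler_norml => /andP[xn1 xn2].
    by rewrite patchE mem_set//= in_itv/=; apply/andP; split; lra.
  - exact: integrable_abse.
  - move=> n x _; rewrite patchE; case: ifPn => // _; rewrite abse0//.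
have lim2 : (\int[mu]_(x in [set` I n]) (f x)%:E)%E @[n --> \oo] --> 0%E.
  under eq_fun do rewrite FTC.
  (* One power more than in F: at distance n + 1 from m this bounds |F| by K / (n + 1), a multiple
     of [harmonic n]. *)
  have [C C0 FC] := normal_pdf_decay k.+1.
  pose K := C * normal_peak (Num.sqrt 2 * s).
  have s'0 : Num.sqrt 2 * s != 0 by rewrite mulf_neq0// gt_eqF// sqrtr_gt0.
  have FK (x : R) n : `|x - m| = n.+1%:R -> `|F x| <= K * harmonic n.
    move=> xm; rewrite /harmonic ler_pdivlMr// /F normrM normrX.
    rewrite (ger0_norm (normal_pdf_ge0 _ _ _)) mulrAC -xm -exprSr.
    by rewrite (le_trans (FC x))// ler_wpM2l// normal_pdf_ub.
  have FK2 n : `|F (m + n.+1%:R) - F (m - n.+1%:R)| <= 2 * K * harmonic n.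
    rewrite (le_trans (ler_normB _ _))// -mulrA mulr2n mulrDl mul1r lerD//; apply: FK.
      by rewrite addrAC subrr add0r ger0_norm.
    by rewrite addrAC subrr add0r normrN ger0_norm.
  apply: cvg_EFin; first exact: nearW.
  have h0 : 2 * K * harmonic n @[n --> \oo] --> 0.
    by rewrite -[X in _ --> X](mulr0 (2 * K)); apply: cvgMr; exact: cvg_harmonic.
  apply/norm_cvg0P; apply: (squeeze_cvgr _ (cvg_cst 0) h0).
  by apply: nearW => n; rewrite normr_ge0 FK2.
by rewrite /Rintegral (cvg_unique _ lim1 lim2).
Unshelve. all: end_near.
Qed.

End normal_moments.

Section gaussian_moments.
Context (d : measure_display) (O : measurableType d) (R : realType).
Variables (P : probability O R) (X : O -> R).
Hypotheses (mX : measurable_fun setT X) (gX : gaussian P X).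
Local Notation mu := (@lebesgue_measure R).

Section nondegenerate.
Variables (m s : R).
Hypothesis (Xms : forall A : set R, measurable A -> P (X @^-1` A) = normal_prob m s A).

Lemma ge0_integral_gaussian (f : R -> \bar R) :
  measurable_fun setT f -> (forall x, (0 <= f x)%E) ->
  (\int[P]_w f (X w) = \int[mu]_x (f x * (normal_pdf m s x)%:E))%E.
Proof.
move=> mf f0.
have mpdf : measurable_fun [set: measurableTypeR R] (normal_pdf m s).
  exact: measurable_normal_pdf.
have pdf0 x : 0 <= normal_pdf m s x by exact: normal_pdf_ge0.
rewrite -(integral_dens mu mpdf pdf0 mf f0).
have mX' : measurable_fun [set: O] (X : O -> measurableTypeR R) by exact: mX.
have := @ge0_integral_pushforward _ _ _ _ _ _ mX' P setT f measurableT mf.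
rewrite preimage_setT /= => <-; last by move=> x _; exact: f0.
have E (A : set (measurableTypeR R)) : measurable A -> A `<=` setT ->
    push_measure P mX' A = dens_measure mu mpdf pdf0 A.
  by move=> mA _; exact: Xms.
exact: (@eq_measure_integral _ _ _ setT (dens_measure mu mpdf pdf0) (push_measure P mX') f E).
Qed.

Lemma integral_gaussian (f : R -> R) : measurable_fun setT f ->
  \int[P]_w f (X w) = \int[mu]_x (f x * normal_pdf m s x).
Proof.
move=> mf; rewrite /Rintegral; congr fine.
have mf' : measurable_fun setT (EFin \o f) by exact/measurable_EFinP.
have pdf0 x : (0 <= (normal_pdf m s x)%:E)%E by rewrite lee_fin normal_pdf_ge0.
transitivity (\int[P]_w (((EFin \o f)^\+)%E (X w)) -
    \int[P]_w (((EFin \o f)^\-)%E (X w)))%E.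
  by rewrite integralE; congr (_ - _)%E; apply: eq_integral => w _;
    rewrite (funeposE, funenegE) (funeposE, funenegE).
rewrite [RHS]integralE.
rewrite !ge0_integral_gaussian//;
  [|exact: measurable_funeneg|exact: measurable_funepos].
congr (_ - _)%E; apply: eq_integral => x _.
  by rewrite !funeposE maxe_pMl// mul0e.
by rewrite !funenegE maxe_pMl// mul0e mulNe.
Qed.

End nondegenerate.

Lemma gaussian_allmom : allmom P X.
Proof.
split => // p; have [[c Xc]|[m [s [s0 Xms]]]] := gX.
  rewrite (@ae_eq_integral _ _ _ P _ (cst (`|c| ^+ p)%:E))//.
  - have [_ /(_ p)] := allmom_cst P c; exact.
  - exact: measurable_pnorm.
  - by apply: filterS Xc => w -> _.
have [K K0 Kp] := normal_pdf_decay m s0 p.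
pose q : R -> R := fun x => `|x| ^+ p.
have mq : measurable_fun setT q by apply: measurable_funX; exact: normr_measurable.
rewrite (ge0_integral_gaussian Xms (f := EFin \o q))//; last 2 first.
- exact/measurable_EFinP.
- by move=> x; rewrite lee_fin exprn_ge0.
(* |x|^p <= 2^p (|x - m|^p + |m|^p) *)
have [C C0 Cp] := normal_pdf_decay m s0 p.
have mpdf s' : measurable_fun [set: measurableTypeR R] (EFin \o normal_pdf m s').
  by apply/measurable_EFinP; exact: measurable_normal_pdf.
have pdf0 s' x : 0 <= normal_pdf m s' x by exact: normal_pdf_ge0.
apply: (@le_lt_trans _ _ (\int[mu]_x (
   (2 ^+ p * C)%:E * (normal_pdf m (Num.sqrt 2 * s) x)%:E +
   (2 ^+ p * `|m| ^+ p)%:E * (normal_pdf m s x)%:E))%E).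
  apply: ge0_le_integral => //.
  - by move=> x _; rewrite lee_fin mulr_ge0// exprn_ge0.
  - apply: emeasurable_funM; [exact/measurable_EFinP|exact: mpdf].
  - by apply: emeasurable_funD; apply: emeasurable_funM => //; exact: mpdf.
  move=> x _; rewrite -!EFinM -EFinD lee_fin.
  rewrite -!mulrA -mulrDr.
  apply: (@le_trans _ _ (2 ^+ p * ((`|x - m| ^+ p + `|m| ^+ p) * normal_pdf m s x))).
    rewrite mulrA ler_wpM2r//.
    have xm : `|x| <= `|x - m| + `|m| by rewrite -{1}(subrK m x) ler_normD.
    have [le|/ltW le] := leP `|x - m| `|m|.
      rewrite (@le_trans _ _ ((2 * `|m|) ^+ p))//.
        rewrite lerXn2r ?nnegrE ?mulr_ge0//; lra.
      by rewrite exprMn ler_wpM2l ?exprn_ge0// lerDr exprn_ge0.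
    rewrite (@le_trans _ _ ((2 * `|x - m|) ^+ p))//.
      rewrite lerXn2r ?nnegrE ?mulr_ge0//; lra.
    by rewrite exprMn ler_wpM2l ?exprn_ge0// lerDl exprn_ge0.
  by rewrite ler_wpM2l ?exprn_ge0// mulrDl lerD2r.
rewrite ge0_integralD//.
  rewrite !ge0_integralZl//; try exact: mpdf; try by rewrite lee_fin mulr_ge0 ?exprn_ge0.
  + by rewrite !integral_normal_pdf !mule1 -EFinD ltry.
  all: try by move=> x _; exact: pdf0.
all: try by apply: emeasurable_funM => //; exact: mpdf.
all: by move=> x _; apply: mule_ge0; rewrite lee_fin; [apply: mulr_ge0; rewrite ?exprn_ge0|exact: pdf0].
Qed.

(** A degenerate variable of mean 0 vanishes almost surely, and then so do both sides. Otherwise the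
    first central moment shows that the parameter m is the mean, hence 0, and the recursion of the
    density applies twice, once to identify the variance. *)
Lemma gaussian_moment_rec : \int[P]_w X w = 0 ->
  forall k, \int[P]_w (X w ^+ k.+1) =
    k%:R * \int[P]_w (X w ^+ 2) * \int[P]_w (X w ^+ k.-1).
Proof.
have aX := gaussian_allmom.
move=> EX k; have [[c Xc]|[m [s [s0 Xms]]]] := gX.
  have c0 : c = 0.
    by rewrite -EX -[LHS](Ex_cst P c); apply: ae_eq_Ex => //; apply: filterS Xc.
  have E0 i : \int[P]_w (X w ^+ i.+1) = 0.
    rewrite -[RHS](Ex_cst P 0); apply: ae_eq_Ex => //; first exact: measurable_funX.
    by apply: filterS Xc => w ->; rewrite c0 expr0n.
  by rewrite !E0 mulr0 mul0r.
have Em i : \int[P]_w ((X w - m) ^+ i) = \int[mu]_x ((x - m) ^+ i * normal_pdf m s x).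
  apply: (integral_gaussian Xms (f := fun x => (x - m) ^+ i)).
  by apply: measurable_funX; exact: measurable_funB.
have m0 : m = 0.
  have := Em 1%N; rewrite normal_moment_rec// mul0r mul0r.
  under eq_Rintegral do rewrite expr1.
  rewrite RintegralB//; last 2 first.
  - exact: allmom_integrable aX.
  - exact: allmom_integrable (allmom_cst P m).
  rewrite EX Ex_cst sub0r.
  by move=> /eqP; rewrite oppr_eq0 => /eqP.
have EX' i : \int[P]_w (X w ^+ i) = \int[mu]_x ((x - m) ^+ i * normal_pdf m s x).
  by rewrite -Em; apply: eq_Rintegral => w _; rewrite m0 subr0.
rewrite !EX' (normal_moment_rec m s0 k) (normal_moment_rec m s0 1) mul1r /=.
suff -> : \int[mu]_x ((x - m) ^+ 0 * normal_pdf m s x) = 1 by rewrite mulr1.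
under eq_Rintegral do rewrite expr0 mul1r.
by rewrite /Rintegral integral_normal_pdf.
Qed.

End gaussian_moments.

(** * Wick's theorem *)

Lemma poly_eq_fun (F : numFieldType) (p q : {poly F}) :
  (forall t, p.[t] = q.[t]) -> p = q.
Proof.
move=> pq; apply/eqP; rewrite -subr_eq0; apply/eqP.
apply: (@roots_geq_poly_eq0 _ _ [seq i%:R | i <- iota 0 (size (p - q))]).
- by apply/allP => x _; rewrite /root hornerD hornerN pq subrr.
- rewrite map_inj_uniq ?iota_uniq// => i j /eqP.
  by rewrite eqr_nat => /eqP.
- by rewrite size_map size_iota.
Qed.

Section real_wick.
Context (d : measure_display) (O : measurableType d) (R : realType).
Variables (P : probability O R) (Gs : set (O -> R)).
Hypotheses (Gs_meas : forall X, Gs X -> measurable_fun setT X)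
  (Gs_gauss : forall X, Gs X -> gaussian P X)
  (Gs_centered : forall X, Gs X -> \int[P]_w X w = 0)
  (Gs0 : Gs (fun=> 0))
  (Gs_lin : forall c X Y, Gs X -> Gs Y -> Gs (fun w => X w + c * Y w)).
Local Notation Ex f := (\int[P]_w (f w)).

Lemma Gs_allmom X : Gs X -> allmom P X.
Proof. by move=> gX; apply: gaussian_allmom; [exact: Gs_meas|exact: Gs_gauss]. Qed.

Lemma Gs_sum (I : Type) (r : seq I) (Q : pred I) (X : I -> O -> R) :
  (forall i, Gs (X i)) -> Gs (fun w => \sum_(i <- r | Q i) X i w).
Proof.
move=> gX; elim: r => [|i r IH]; first by under eq_fun do rewrite big_nil.
under eq_fun do rewrite big_cons; case: (Q i) => //.
by under eq_fun do rewrite addrC -[X in _ + X]mul1r; exact: Gs_lin.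
Qed.

(* The variance of U + t V is a polynomial in t, hence so are both sides of the
   moment recursion of U + t V: compare the coefficients of t. *)
Lemma wick_diag U V m : Gs U -> Gs V ->
  \int[P]_w (V w * U w ^+ m) =
  m%:R * \int[P]_w (V w * U w) * \int[P]_w (U w ^+ m.-1).
Proof.
move=> gU gV.
have aU := Gs_allmom gU; have aV := Gs_allmom gV.
have aUV k i : allmom P (fun w => U w ^+ k * V w ^+ i).
  by apply: allmomM; exact: allmomX.
pose mom k : {poly R} :=
  \poly_(i < k.+1) ('C(k, i)%:R * \int[P]_w (U w ^+ (k - i) * V w ^+ i)).
have momE k t : (mom k).[t] = \int[P]_w ((U w + t * V w) ^+ k).
  rewrite horner_poly; under [RHS]eq_Rintegral do rewrite exprDn.
  rewrite Ex_sum; last first.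
    move=> i _; under eq_fun do rewrite exprMn -mulr_natl.
    apply: allmomZ; apply: allmomM; first exact: allmomX.
    by apply: allmomM; [exact: allmom_cst|exact: allmomX].
  apply: eq_bigr => i _; under [RHS]eq_Rintegral do
    rewrite exprMn mulrCA -mulr_natl mulrA.
  by rewrite ExZ// mulrAC.
have mom_rec k : mom k.+1 = k%:R *: (mom 2%N * mom k.-1).
  apply: poly_eq_fun => t; rewrite hornerZ hornerM !momE mulrA.
  have gUV : Gs (fun w => U w + t * V w) by exact: Gs_lin.
  by apply: gaussian_moment_rec; [exact: Gs_meas|exact: Gs_gauss|exact: Gs_centered].
have mom0 k : (mom k)`_0 = \int[P]_w (U w ^+ k).
  rewrite coef_poly/= bin0 mul1r subn0.
  by apply: eq_Rintegral => w _; rewrite mulr1.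
have mom1 k : (mom k)`_1 = k%:R * \int[P]_w (V w * U w ^+ k.-1).
  rewrite coef_poly; case: k => [|k] /=; first by rewrite mul0r.
  rewrite bin1 subn1/=; congr (_ * _).
  by apply: eq_Rintegral => w _; rewrite expr1 mulrC.
have Urec k : \int[P]_w (U w ^+ k.+1) =
    k%:R * \int[P]_w (U w ^+ 2) * \int[P]_w (U w ^+ k.-1).
  by apply: gaussian_moment_rec; [exact: Gs_meas|exact: Gs_gauss|exact: Gs_centered].
(* The coefficient of t in the recursion for U + t V contains, besides E[V U] E[U^(m+1)], the term
   E[U^2] E[V U^m]. The latter is known by induction two steps below, and [Urec] then merges the
   two. *)
elim/ltn_ind: m => -[|[|m]] IH.
- rewrite !mul0r; under eq_Rintegral do rewrite expr0 mulr1.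
  exact: Gs_centered.
- rewrite mul1r /=; under [X in _ = _ * X]eq_Rintegral do rewrite expr0.
  by rewrite Ex_cst mulr1; apply: eq_Rintegral => w _; rewrite expr1.
have := congr1 (fun p : {poly R} => p`_1) (mom_rec m.+2).
rewrite coefZ coefM big_ord_recl big_ord1 /= !mom0 !mom1 /=.
rewrite (IH m)//.
have -> : \int[P]_w (V w * U w ^+ 1) = \int[P]_w (V w * U w).
  by apply: eq_Rintegral => w _; rewrite expr1.
case: m IH => [|m] IH.
  rewrite !mul0r !mulr0 add0r => e; apply: (@mulfI _ 3%:R); first by rewrite pnatr_eq0.
  have U1 : \int[P]_w (U w ^+ 1) = 0.
    by rewrite -(Gs_centered gU); apply: eq_Rintegral => w _; rewrite expr1.
  by rewrite e U1 !mulr0.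
rewrite (Urec m.+1) /= => e; apply: (@mulfI _ m.+4%:R); first by rewrite pnatr_eq0.
by rewrite e -!natr1; ring.
Qed.

(* By polarization it is enough to treat equal factors. *)
Lemma wick_real (m : nat) (V : O -> R) (X : 'I_m -> O -> R) :
  Gs V -> (forall i, Gs (X i)) ->
  \int[P]_w (V w * \prod_i X i w) =
  \int[P]_w (wick_sum (fun k => \int[P]_w (V w * X k w)) (X^~ w)).
Proof.
move=> gV gX; have [c c0 pol] := wick_sum_polarization m.
have aV := Gs_allmom gV; have aX i := Gs_allmom (gX i).
have aS (S : {set 'I_m}) : allmom P (fun w => \sum_(i in S) X i w).
  by apply: allmom_sum => i _.
have gS (S : {set 'I_m}) : Gs (fun w => \sum_(i in S) X i w) by exact: Gs_sum.
apply: (@mulfI _ (c%:R : R)); first by rewrite pnatr_eq0 -lt0n.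
rewrite -!ExZ; last 2 first.
- apply: allmom_sum => k _; apply: allmomZ; exact: allmom_prod.
- by apply: allmomM => //; exact: allmom_prod.
pose a k := \int[P]_w (V w * X k w).
under [RHS]eq_Rintegral => w _ do rewrite (pol _ a (X^~ w)).2.
under [LHS]eq_Rintegral => w _ do
  rewrite mulrCA (pol _ a (X^~ w)).1 mulr_sumr.
rewrite !Ex_sum; last 2 first.
- move=> S _; do 2 (apply: allmomM; first exact: allmom_cst).
  exact: allmomX.
- move=> S _; apply: allmomM => //; apply: allmomM; first exact: allmom_cst.
  exact: allmomX.
apply: eq_bigr => S _.
under [LHS]eq_Rintegral do rewrite mulrCA.
rewrite ExZ; last by apply: allmomM => //; exact: allmomX.
rewrite [RHS]ExZ; last first.
  by apply: allmomM; [exact: allmom_cst|exact: allmomX].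
rewrite [X in _ = _ * X]ExZ; last exact: allmomX.
congr (_ * _); rewrite (wick_diag _ (gS S) gV); congr (_ * _ * _).
under eq_Rintegral do rewrite mulr_sumr.
by rewrite Ex_sum// => i _; exact: allmomM.
Qed.

End real_wick.

Local Open Scope complex_scope.
Local Notation Re := complex.Re.
Local Notation Im := complex.Im.
Local Notation normc := Normc.normc.

(** * Complex valued functions, their expectations and Wick's theorem for them *)

Section complex_parts.
Context (R : realType).
Implicit Types x y : R[i].

Lemma cRe0 : Re (0 : R[i]) = 0. Proof. by []. Qed.
Lemma cIm0 : Im (0 : R[i]) = 0. Proof. by []. Qed.
Lemma cReD x y : Re (x + y) = Re x + Re y. Proof. by case: x; case: y. Qed.
Lemma cImD x y : Im (x + y) = Im x + Im y. Proof. by case: x; case: y. Qed.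
Lemma cReN x : Re (- x) = - Re x. Proof. by case: x. Qed.
Lemma cImN x : Im (- x) = - Im x. Proof. by case: x. Qed.
Lemma cReM x y : Re (x * y) = Re x * Re y - Im x * Im y.
Proof. by case: x; case: y. Qed.
Lemma cImM x y : Im (x * y) = Re x * Im y + Im x * Re y.
Proof. by case: x; case: y. Qed.
Lemma cReJ x : Re (x^*) = Re x. Proof. by case: x. Qed.
Lemma cImJ x : Im (x^*) = - Im x. Proof. by case: x. Qed.
Definition cRI := (cReD, cImD, cReN, cImN, cReM, cImM, cReJ, cImJ).

Lemma cRe_sum (I : Type) (r : seq I) (Q : pred I) (f : I -> R[i]) :
  Re (\sum_(i <- r | Q i) f i) = \sum_(i <- r | Q i) Re (f i).
Proof. exact: (big_morph _ cReD cRe0). Qed.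

Lemma cIm_sum (I : Type) (r : seq I) (Q : pred I) (f : I -> R[i]) :
  Im (\sum_(i <- r | Q i) f i) = \sum_(i <- r | Q i) Im (f i).
Proof. exact: (big_morph _ cImD cIm0). Qed.

Lemma cRe_scale (a : R) x : Re (a%:C * x) = a * Re x.
Proof. by case: x => b c /=; rewrite mul0r subr0. Qed.

Lemma complex_ext x y : Re x = Re y -> Im x = Im y -> x = y.
Proof. by case: x => ? ?; case: y => ? ? /= -> ->. Qed.

Lemma sqr_normcE x : normc x ^+ 2 = Re x ^+ 2 + Im x ^+ 2.
Proof. by case: x => a b /=; rewrite sqr_sqrtr// addr_ge0 ?sqr_ge0. Qed.

Lemma normc_ge0 x : 0 <= normc x.
Proof. by case: x => a b /=; exact: sqrtr_ge0. Qed.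

Lemma normcJ x : normc (x^*) = normc x.
Proof. by case: x => a b /=; rewrite sqrrN. Qed.

Lemma mul_conjc x : x * x^* = (normc x ^+ 2)%:C.
Proof.
by apply: complex_ext; rewrite !cRI sqr_normcE/=; ring.
Qed.

End complex_parts.

Section cmeasurable.
Context (d : measure_display) (T : measurableType d) (R : realType).
Implicit Types f g : T -> R[i].

Lemma cmeasurable_cst c : cmeasurable (fun _ : T => c : R[i]).
Proof. by split; exact: measurable_cst. Qed.

Lemma cmeasurableD f g : cmeasurable f -> cmeasurable g ->
  cmeasurable (fun x => f x + g x).
Proof.
move=> [mf1 mf2] [mg1 mg2]; split.
- by under eq_fun do rewrite cReD; exact: measurable_funD.
- by under eq_fun do rewrite cImD; exact: measurable_funD.
Qed.

Lemma cmeasurableM f g : cmeasurable f -> cmeasurable g ->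
  cmeasurable (fun x => f x * g x).
Proof.
move=> [mf1 mf2] [mg1 mg2]; split.
- by under eq_fun do rewrite cReM; apply: measurable_funB; exact: measurable_funM.
- by under eq_fun do rewrite cImM; apply: measurable_funD; exact: measurable_funM.
Qed.

Lemma cmeasurableZ c f : cmeasurable f -> cmeasurable (fun x => c * f x).
Proof. exact: cmeasurableM (cmeasurable_cst c). Qed.

Lemma cmeasurableN f : cmeasurable f -> cmeasurable (fun x => - f x).
Proof.
by move=> mf; under eq_fun do rewrite -mulN1r; exact: cmeasurableZ.
Qed.

Lemma cmeasurableB f g : cmeasurable f -> cmeasurable g ->
  cmeasurable (fun x => f x - g x).
Proof. by move=> mf mg; apply: cmeasurableD => //; exact: cmeasurableN. Qed.

Lemma cmeasurableJ f : cmeasurable f -> cmeasurable (fun x => (f x)^*).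
Proof.
move=> [mf1 mf2]; split; first by under eq_fun do rewrite cReJ.
by under eq_fun do rewrite cImJ; exact: measurableT_comp.
Qed.

Lemma cmeasurable_sum (I : Type) (r : seq I) (Q : pred I) (f : I -> T -> R[i]) :
  (forall i, Q i -> cmeasurable (f i)) ->
  cmeasurable (fun x => \sum_(i <- r | Q i) f i x).
Proof.
move=> mf; elim: r => [|i r IH].
  by under eq_fun do rewrite big_nil; exact: cmeasurable_cst.
under eq_fun do rewrite big_cons; case: (boolP (Q i)) => Qi //.
by apply: cmeasurableD => //; exact: mf.
Qed.

Lemma cmeasurable_prod (I : Type) (r : seq I) (Q : pred I) (f : I -> T -> R[i]) :
  (forall i, Q i -> cmeasurable (f i)) ->
  cmeasurable (fun x => \prod_(i <- r | Q i) f i x).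
Proof.
move=> mf; elim: r => [|i r IH].
  by under eq_fun do rewrite big_nil; exact: cmeasurable_cst.
under eq_fun do rewrite big_cons; case: (boolP (Q i)) => Qi //.
by apply: cmeasurableM => //; exact: mf.
Qed.

Lemma cmeasurable_real (f : T -> R) : measurable_fun setT f ->
  cmeasurable (fun x => (f x)%:C).
Proof. by move=> mf; split => //; exact: measurable_cst. Qed.

Lemma measurable_sqr_normc f : cmeasurable f ->
  measurable_fun setT (fun x => normc (f x) ^+ 2).
Proof.
move=> [mf1 mf2]; under eq_fun do rewrite sqr_normcE.
by apply: measurable_funD; exact: measurable_funX.
Qed.

Lemma measurable_normc f : cmeasurable f ->
  measurable_fun setT (fun x => normc (f x)).
Proof.
move=> /measurable_sqr_normc mf.
rewrite (_ : (fun x => _) = Num.sqrt \o (fun x => normc (f x) ^+ 2)).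
  by apply: measurableT_comp => //; apply: continuous_measurable_fun; exact: sqrt_continuous.
by apply/funext => x /=; rewrite sqrtr_sqr ger0_norm// normc_ge0.
Qed.

End cmeasurable.

Lemma cmeasurable_comp (d d' : measure_display) (T : measurableType d)
    (T' : measurableType d') (R : realType) (f : T' -> R[i]) (h : T -> T') :
  cmeasurable f -> measurable_fun setT h -> cmeasurable (f \o h).
Proof.
move=> [mf1 mf2] mh.
by split; [exact: (measurableT_comp mf1 mh)|exact: (measurableT_comp mf2 mh)].
Qed.

Section complex_expectation.
Context (d : measure_display) (O : measurableType d) (R : realType).
Variable P : probability O R.
Implicit Types f g : O -> R[i].

Definition callmom f :=
  allmom P (fun w => Re (f w)) /\ allmom P (fun w => Im (f w)).

Definition EC f : R[i] :=
  (\int[P]_w Re (f w)) +i* (\int[P]_w Im (f w)).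

Lemma callmom_meas f : callmom f -> cmeasurable f.
Proof. by move=> [[? _] [? _]]. Qed.

Lemma cintegral_EC f : callmom f -> cintegral P setT f = EC f.
Proof.
move=> [f1 f2]; rewrite /cintegral asboolT//; split.
- exact: allmom_integrable f1.
- exact: allmom_integrable f2.
Qed.

Lemma callmom_cst c : callmom (fun _ => c).
Proof. by split; exact: allmom_cst. Qed.

Lemma callmomD f g : callmom f -> callmom g -> callmom (fun w => f w + g w).
Proof.
move=> [f1 f2] [g1 g2]; split.
- by under eq_fun do rewrite cReD; exact: allmomD.
- by under eq_fun do rewrite cImD; exact: allmomD.
Qed.

Lemma callmomM f g : callmom f -> callmom g -> callmom (fun w => f w * g w).
Proof.
move=> [f1 f2] [g1 g2]; split.
- under eq_fun do rewrite cReM -mulN1r; apply: allmomD; first exact: allmomM.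
  by apply: allmomZ; exact: allmomM.
- by under eq_fun do rewrite cImM; apply: allmomD; exact: allmomM.
Qed.

Lemma callmomZ c f : callmom f -> callmom (fun w => c * f w).
Proof. exact: callmomM (callmom_cst c). Qed.

Lemma callmomB f g : callmom f -> callmom g -> callmom (fun w => f w - g w).
Proof.
move=> cf cg; under eq_fun do rewrite -mulN1r.
by apply: callmomD => //; exact: callmomZ.
Qed.

Lemma callmomJ f : callmom f -> callmom (fun w => (f w)^*).
Proof.
move=> [f1 f2]; split; first by under eq_fun do rewrite cReJ.
by under eq_fun do rewrite cImJ -mulN1r; exact: allmomZ.
Qed.

Lemma callmom_sum (I : Type) (r : seq I) (Q : pred I) (f : I -> O -> R[i]) :
  (forall i, Q i -> callmom (f i)) ->
  callmom (fun x => \sum_(i <- r | Q i) f i x).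
Proof.
move=> mf; elim: r => [|i r IH].
  by under eq_fun do rewrite big_nil; exact: callmom_cst.
under eq_fun do rewrite big_cons; case: (boolP (Q i)) => Qi //.
by apply: callmomD => //; exact: mf.
Qed.

Lemma callmom_prod (I : Type) (r : seq I) (Q : pred I) (f : I -> O -> R[i]) :
  (forall i, Q i -> callmom (f i)) ->
  callmom (fun x => \prod_(i <- r | Q i) f i x).
Proof.
move=> mf; elim: r => [|i r IH].
  by under eq_fun do rewrite big_nil; exact: callmom_cst.
under eq_fun do rewrite big_cons; case: (boolP (Q i)) => Qi //.
by apply: callmomM => //; exact: mf.
Qed.

Lemma callmom_real (X : O -> R) : allmom P X -> callmom (fun w => (X w)%:C).
Proof. by move=> aX; split => //=; exact: allmom_cst. Qed.

Lemma EC_real (X : O -> R) : EC (fun w => (X w)%:C) = (\int[P]_w X w)%:C.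
Proof. by apply: complex_ext => //=; rewrite Ex_cst. Qed.

Lemma EC_cst c : EC (fun _ => c) = c.
Proof. by case: c => a b; rewrite /EC /= !Ex_cst. Qed.

Lemma ECD f g : callmom f -> callmom g -> EC (fun w => f w + g w) = EC f + EC g.
Proof.
move=> [f1 f2] [g1 g2]; apply: complex_ext; rewrite !cRI/= -ExD//;
  by apply: eq_Rintegral => w _; rewrite !cRI.
Qed.

Lemma ECZ c f : callmom f -> EC (fun w => c * f w) = c * EC f.
Proof.
move=> [f1 f2]; apply: complex_ext; rewrite !cRI/=.
  under eq_Rintegral do rewrite cReM -mulNr.
  by rewrite ExD ?ExZ ?mulNr//; exact: allmomZ.
under eq_Rintegral do rewrite cImM.
by rewrite ExD ?ExZ//; exact: allmomZ.
Qed.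

Lemma EC_sum (I : Type) (r : seq I) (Q : pred I) (f : I -> O -> R[i]) :
  (forall i, Q i -> callmom (f i)) ->
  EC (fun w => \sum_(i <- r | Q i) f i w) = \sum_(i <- r | Q i) EC (f i).
Proof.
move=> cf; apply: complex_ext; rewrite ?cRe_sum ?cIm_sum/=.
  under eq_Rintegral do rewrite cRe_sum.
  by rewrite Ex_sum// => i /cf[].
under eq_Rintegral do rewrite cIm_sum.
by rewrite Ex_sum// => i /cf[].
Qed.

Lemma eq_EC f g : (forall w, f w = g w) -> EC f = EC g.
Proof. by move=> /funext ->. Qed.

Lemma ae_eq_EC f g : cmeasurable f -> cmeasurable g ->
  {ae P, forall w, f w = g w} -> EC f = EC g.
Proof.
move=> [f1 f2] [g1 g2] fg; apply: complex_ext; apply: ae_eq_Ex => //;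
  by apply: filterS fg => w ->.
Qed.

End complex_expectation.

Section complex_wick.
Context (d : measure_display) (O : measurableType d) (R : realType).
Variables (P : probability O R) (Gs : set (O -> R)).
Hypotheses (Gs_meas : forall X, Gs X -> measurable_fun setT X)
  (Gs_gauss : forall X, Gs X -> gaussian P X)
  (Gs_centered : forall X, Gs X -> \int[P]_w X w = 0)
  (Gs0 : Gs (fun=> 0))
  (Gs_lin : forall c X Y, Gs X -> Gs Y -> Gs (fun w => X w + c * Y w)).
Local Notation EC := (EC P).
Local Notation callmom := (callmom P).

Definition CGs (f : O -> R[i]) := Gs (fun w => Re (f w)) /\ Gs (fun w => Im (f w)).

Lemma CGs_callmom f : CGs f -> callmom f.
Proof. by move=> [? ?]; split; apply: (Gs_allmom Gs_meas Gs_gauss). Qed.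

Lemma wick_sum_real (I : finType) (a x : I -> R) :
  (wick_sum a x)%:C = wick_sum (fun i => (a i)%:C) (fun i => (x i)%:C).
Proof.
rewrite /wick_sum rmorph_sum; apply: eq_bigr => i _.
by rewrite rmorphM rmorph_prod.
Qed.

Lemma callmom_wick (I : finType) (a : I -> R[i]) (f : I -> O -> R[i]) :
  (forall i, callmom (f i)) -> callmom (fun w => wick_sum a (f^~ w)).
Proof.
by move=> cf; apply: callmom_sum => k _; apply: callmomZ; exact: callmom_prod.
Qed.

Let cc (b : bool) : R[i] := if b then 1 else 'i.
Let part (b : bool) (f : O -> R[i]) (w : O) : R := if b then Re (f w) else Im (f w).

Let partE f w : f w = \sum_(b : bool) cc b * (part b f w)%:C.
Proof.
rewrite big_bool/= mul1r; apply: complex_ext; rewrite !cRI/=; ring.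
Qed.

Let part_Gs b f : CGs f -> Gs (part b f).
Proof. by case: b => -[]. Qed.

(** Only V is kept real here. Both sides are expanded over the choices of the real or the imaginary
    part of each factor, and [wick_real] applies to each choice. *)
Lemma wick_real_complex (m : nat) (V : O -> R) (Z : 'I_m -> O -> R[i]) :
  Gs V -> (forall i, CGs (Z i)) ->
  EC (fun w => (V w)%:C * \prod_i Z i w) =
  EC (fun w => wick_sum (fun k => EC (fun w => (V w)%:C * Z k w)) (Z^~ w)).
Proof.
move=> gV gZ; have aV := Gs_allmom Gs_meas Gs_gauss gV.
have aZ i b := Gs_allmom Gs_meas Gs_gauss (part_Gs b (gZ i)).
pose a i b := \int[P]_w (V w * part b (Z i) w).
have aE k : EC (fun w => (V w)%:C * Z k w) = \sum_b cc b * (a k b)%:C.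
  under eq_EC => w do rewrite partE mulr_sumr.
  rewrite EC_sum; last first.
    move=> b _; apply: callmomM; first exact: callmom_real.
    by apply: callmomZ; exact: callmom_real.
  apply: eq_bigr => b _; under eq_EC do rewrite mulrCA -rmorphM.
  by rewrite ECZ ?EC_real//; apply: callmom_real; exact: allmomM.
have -> : (fun k => EC (fun w => (V w)%:C * Z k w)) =
   (fun k => \sum_b cc b * (a k b)%:C) by apply/funext.
under [RHS]eq_EC => w.
  rewrite (_ : Z^~ w = fun i => \sum_b cc b * (part b (Z i) w)%:C); last first.
    by apply/funext => i; exact: partE.
  rewrite wick_sum_distr.
  under eq_bigr do rewrite -wick_sum_real.
  over.
under [LHS]eq_EC => w.
  under eq_bigr do rewrite partE.
  rewrite bigA_distr_bigA mulr_sumr.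
  under eq_bigr do rewrite big_split mulrCA/= -rmorph_prod -rmorphM.
  over.
rewrite !EC_sum; last 2 first.
- move=> f _; apply: callmomZ; apply: callmom_real.
  apply: allmom_sum => k _; apply: allmomZ.
  by apply: allmom_prod => i _.
- move=> f _; apply: callmomZ; apply: callmom_real.
  by apply: allmomM => //; apply: allmom_prod => i _.
apply: eq_bigr => f _; rewrite !ECZ; last 2 first.
- apply: callmom_real; apply: allmom_sum => k _; apply: allmomZ.
  by apply: allmom_prod => i _.
- apply: callmom_real.
  by apply: allmomM => //; apply: allmom_prod => i _.
congr (_ * _); rewrite !EC_real; congr (_%:C).
apply: (wick_real Gs_meas Gs_gauss Gs_centered Gs0 Gs_lin) => //.
by move=> i; exact: part_Gs.
Qed.

Lemma wick_ord (m : nat) (V : O -> R[i]) (Z : 'I_m -> O -> R[i]) :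
  CGs V -> (forall i, CGs (Z i)) ->
  EC (fun w => V w * \prod_i Z i w) =
  EC (fun w => wick_sum (fun k => EC (fun w => V w * Z k w)) (Z^~ w)).
Proof.
move=> gV gZ; have aV b := Gs_allmom Gs_meas Gs_gauss (part_Gs b gV).
have aZ i := CGs_callmom (gZ i).
have E (f : O -> R[i]) : callmom f ->
    EC (fun w => V w * f w) = \sum_b cc b * EC (fun w => (part b V w)%:C * f w).
  move=> cf; under eq_EC => w do rewrite partE mulr_suml.
  rewrite EC_sum => [|b _]; last first.
    by apply: callmomM => //; apply: callmomZ; exact: callmom_real.
  apply: eq_bigr => b _; under eq_EC do rewrite -mulrA.
  by rewrite ECZ//; apply: callmomM => //; exact: callmom_real.
rewrite E; last exact: callmom_prod.
have -> : (fun k => EC (fun w => V w * Z k w)) =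
    (fun k => \sum_b cc b * EC (fun w => (part b V w)%:C * Z k w)).
  by apply/funext => k; rewrite E.
under [RHS]eq_EC => w.
  rewrite (_ : wick_sum _ _ = \sum_b cc b *
     wick_sum (fun k => EC (fun w => (part b V w)%:C * Z k w)) (Z^~ w)); last first.
    rewrite /wick_sum; under eq_bigr do rewrite mulr_suml.
    rewrite exchange_big/=; apply: eq_bigr => b _; rewrite mulr_sumr.
    by apply: eq_bigr => k _; rewrite mulrA.
  over.
rewrite EC_sum => [|b _]; last by apply: callmomZ; exact: callmom_wick.
apply: eq_bigr => b _; rewrite ECZ; last exact: callmom_wick.
by rewrite wick_real_complex//; exact: part_Gs.
Qed.

(** One factor is singled out and paired with each of the others. With products over an arbitrary
    predicate Q the same form can be applied again to the remaining factors. *)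
Theorem wick (I : finType) (Q : pred I) (V : O -> R[i]) (Z : I -> O -> R[i]) :
  CGs V -> (forall i, CGs (Z i)) ->
  EC (fun w => V w * \prod_(i | Q i) Z i w) =
  \sum_(k | Q k) EC (fun w => V w * Z k w) *
     EC (fun w => \prod_(i | Q i && (i != k)) Z i w).
Proof.
move=> gV gZ; have aZ i := CGs_callmom (gZ i).
under eq_EC => w do rewrite big_enum_val.
rewrite wick_ord//= EC_sum => [|k _]; last first.
  by apply: callmomZ; exact: callmom_prod.
rewrite [RHS]big_enum_val/=; apply: eq_bigr => k _.
rewrite ECZ; last exact: callmom_prod.
congr (_ * _); apply: eq_EC => w; rewrite [RHS]big_enum_val_cond/=.
by apply: eq_bigl => i; rewrite (inj_eq enum_val_inj).
Qed.

End complex_wick.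

(** * Spectral measures *)

Section opposite.
Context (R : realType) (k : space_kind) (nu : nat).
Local Notation axis := (axis R k).
Local Notation E := (espace R k nu).

Lemma measurable_axis_val : measurable_fun setT (val : axis -> R).
Proof. by move=> _ B mB; exists B. Qed.

Lemma measurable_axisP (d : measure_display) (T : measurableType d)
    (f : T -> axis) :
  measurable_fun setT (fun x => val (f x)) -> measurable_fun setT f.
Proof.
move=> mf _ A [B mB <-]; have := mf measurableT B mB.
by rewrite !setTI.
Qed.

Lemma axis_opp_val (x : axis) : val (axis_opp x) =
  if axis_range k (- val x) then - val x else val x.
Proof. by rewrite /axis_opp val_insubd. Qed.

(** On the torus the default value of [insubd] makes -pi its own opposite, which is exactly what an
    involution modulo 2 pi requires. *)
Lemma axis_oppK : involutive (@axis_opp R k).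
Proof.
move=> x; apply: val_inj; rewrite [LHS]axis_opp_val.
have rx : axis_range k (val x) by exact: (valP x).
have := axis_opp_val x; case: ifPn => h ->; first by rewrite opprK rx.
by rewrite (negbTE h).
Qed.

Lemma axis_opp_norm (x : axis) : `|val (axis_opp x)| = `|val x|.
Proof. by rewrite axis_opp_val; case: ifP => // _; rewrite normrN. Qed.

Lemma measurable_axis_range : measurable [set x : R | axis_range k x].
Proof.
rewrite /axis_range; case: k; first by rewrite (_ : [set _ | _] = setT)//;
  apply/seteqP; split.
have -> : [set x : R | - pi <= x < pi] = [set` `[- pi, pi[ ].
  by apply/seteqP; split=> x /=; rewrite in_itv.
exact: measurable_itv.
Qed.

Lemma measurable_axis_opp : measurable_fun setT (@axis_opp R k).
Proof.
apply: measurable_axisP; under eq_fun do rewrite axis_opp_val.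
have mv := measurable_axis_val.
have mN : measurable_fun setT (fun x : axis => - val x) by exact: measurableT_comp.
apply: measurable_fun_ifT => //.
apply: (measurable_fun_bool true).
rewrite setTI (_ : _ @^-1` _ = (fun x : axis => - val x) @^-1` [set x | axis_range k x])//.
by rewrite -[X in measurable X]setTI; apply: mN => //; exact: measurable_axis_range.
Qed.

Lemma tnth_pt_opp (x : E) i : tnth (pt_opp x) i = axis_opp (tnth x i).
Proof. by rewrite tnth_map. Qed.

Lemma pt_oppK : involutive (@pt_opp R k nu).
Proof. by move=> x; apply: eq_from_tnth => i; rewrite !tnth_pt_opp axis_oppK. Qed.

Lemma measurable_pt_opp : measurable_fun setT (@pt_opp R k nu).
Proof.
apply/measurable_fun_tnthP => i.
rewrite (_ : _ \o _ = (@axis_opp R k) \o (fun x : E => tnth x i)).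
  by apply: measurableT_comp; [exact: measurable_axis_opp|exact: measurable_tnth].
by apply/funext => x /=; rewrite tnth_pt_opp.
Qed.

Lemma set_oppK : involutive (@set_opp R k nu).
Proof. by move=> A; apply/seteqP; split=> x; rewrite /set_opp /= pt_oppK. Qed.

Lemma set_oppE (A : set E) : set_opp A = @pt_opp R k nu @^-1` A.
Proof. by []. Qed.

Lemma measurable_set_opp (A : set E) : measurable A -> measurable (set_opp A).
Proof.
by move=> mA; rewrite set_oppE -[X in measurable X]setTI; exact: measurable_pt_opp.
Qed.

Lemma cube_opp T (x : E) : cube T (pt_opp x) <-> cube T x.
Proof. by split=> h i; have := h i; rewrite tnth_pt_opp axis_opp_norm. Qed.

Lemma bborel_opp (A : set E) : bborel A -> bborel (set_opp A).
Proof.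
move=> [mA [T AT]]; split; first exact: measurable_set_opp.
by exists T => x /AT /cube_opp.
Qed.

Lemma measurable_cube T : measurable (cube T : set E).
Proof.
rewrite (_ : cube T = \bigcap_(i in [set: 'I_nu]) [set x : E | `|val (tnth x i)| <= T]).
  apply: fin_bigcap_measurable => // i _.
  have mf : measurable_fun setT (fun x : E => `|val (tnth x i)|).
    apply: measurableT_comp => //; apply: measurableT_comp; first exact: measurable_axis_val.
    exact: measurable_tnth.
  rewrite (_ : [set x | _] = setT `&` (fun x : E => `|val (tnth x i)|) @^-1` [set` `]-oo, T]]).
    by apply: mf => //; exact: measurable_itv.
  by rewrite setTI; apply/seteqP; split=> x /=; rewrite in_itv.
by apply/seteqP; split=> x h i; [move=> _; exact: h|exact: (h i I)].
Qed.

Lemma bborel_cube T : bborel (cube T : set E).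
Proof. by split; [exact: measurable_cube|exists T]. Qed.

Lemma bborelI (A B : set E) : bborel A -> measurable B -> bborel (A `&` B).
Proof.
move=> [mA [T AT]] mB; split; first exact: measurableI.
by exists T; apply: subset_trans AT; exact: subIsetl.
Qed.

Lemma bborelD (A B : set E) : bborel A -> measurable B -> bborel (A `\` B).
Proof. by move=> bA mB; rewrite setDE; apply: bborelI => //; exact: measurableC. Qed.

Lemma bborel0 : bborel (set0 : set E).
Proof. by split=> //; exists 0. Qed.

Lemma cube_le (S T : R) : S <= T -> cube S `<=` (cube T : set E).
Proof. by move=> ST x h i; exact: le_trans (h i) ST. Qed.

Lemma bborelU (A B : set E) : bborel A -> bborel B -> bborel (A `|` B).
Proof.
move=> [mA [S AS]] [mB [T BT]]; split; first exact: measurableU.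
exists (Num.max S T) => x [/AS|/BT]; apply: cube_le; rewrite le_max lexx ?orbT//.
Qed.

Lemma bigcup_cube : \bigcup_(n : nat) cube n%:R = [set: E].
Proof.
apply/seteqP; split=> // x _.
pose M := \sum_(i < nu) `|val (tnth x i)|.
have M0 : 0 <= M by exact: sumr_ge0.
exists (Num.truncn M).+1 => // i.
rewrite (@le_trans _ _ M)//; last by rewrite ltW// truncnS_gt.
by rewrite /M (bigD1 i)//= lerDl sumr_ge0.
Qed.

Lemma nondecreasing_cube : nondecreasing_seq (fun n : nat => cube n%:R : set E).
Proof. by move=> m n mn; apply/subsetPset; apply: cube_le; rewrite ler_nat. Qed.

(** The values of G are only given on bounded sets; cubes exhaust E, and continuity from below
    carries an equality over to all measurable sets. *)
Lemma eq_measure_bborel (m1 m2 : {measure set E -> \bar R}) :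
  (forall A, bborel A -> m1 A = m2 A) -> forall A, measurable A -> m1 A = m2 A.
Proof.
move=> m12 A mA; pose F n := A `&` cube n%:R.
have mF n : measurable (F n) by apply: measurableI => //; exact: measurable_cube.
have FA : \bigcup_n F n = A by rewrite -setI_bigcupr bigcup_cube setIT.
have ndF : nondecreasing_seq F.
  by move=> a b ab; apply/subsetPset; apply: setIS; apply/subsetPset/nondecreasing_cube.
have c (m : {measure set E -> \bar R}) : m (F n) @[n --> \oo] --> m A.
  rewrite -[in X in _ --> X]FA; apply: nondecreasing_cvg_mu => //.
  by rewrite FA.
rewrite -(cvg_lim (@ereal_hausdorff R) (c m1)) -(cvg_lim (@ereal_hausdorff R) (c m2)).
congr (limn _); apply/funext => n; apply: m12.
by rewrite /F setIC; apply: bborelI => //; exact: bborel_cube.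
Qed.

End opposite.

Section complex_norm.
Context (R : realType).
Implicit Types x y : R[i].

Lemma normc_Re x : `|Re x| <= normc x.
Proof.
rewrite -[leRHS]ger0_norm ?normc_ge0// -ler_sqr ?nnegrE// !real_normK ?num_real//.
by rewrite sqr_normcE lerDl sqr_ge0.
Qed.

Lemma normc_Im x : `|Im x| <= normc x.
Proof.
rewrite -[leRHS]ger0_norm ?normc_ge0// -ler_sqr ?nnegrE// !real_normK ?num_real//.
by rewrite sqr_normcE lerDr sqr_ge0.
Qed.

Lemma normc_le x : normc x <= `|Re x| + `|Im x|.
Proof.
rewrite -ler_sqr ?nnegrE ?normc_ge0 ?addr_ge0// sqr_normcE sqrrD !real_normK ?num_real//.
by rewrite -addrA lerD2l lerDr mulrn_wge0// mulr_ge0.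
Qed.
End complex_norm.

Section cintegrable.
Context (d : measure_display) (T : measurableType d) (R : realType).
Variable mu : {measure set T -> \bar R}.
Implicit Types f : T -> R[i].

Lemma cintegrableP D f : measurable D -> cmeasurable f ->
  cintegrable mu D f <-> (\int[mu]_(x in D) (normc (f x))%:E < +oo)%E.
Proof.
move=> mD mf; have [mf1 mf2] := mf; split => [[i1 i2]|fin].
  have mD' (g : T -> R) : measurable_fun setT g -> measurable_fun D (fun x => `|(g x)%:E|%E).
    move=> mg; apply: measurable_funTS; apply: measurableT_comp => //.
    exact/measurable_EFinP.
  apply: (@le_lt_trans _ _ (\int[mu]_(x in D)
      (`|(Re (f x))%:E| + `|(Im (f x))%:E|))%E).
    apply: ge0_le_integral => //.
    - by move=> x _; rewrite lee_fin normc_ge0.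
    - by apply: measurable_funTS; apply/measurable_EFinP; exact: measurable_normc.
    - by apply: emeasurable_funD; exact: mD'.
    - by move=> x _; rewrite -EFinD lee_fin normc_le.
  rewrite ge0_integralD//; [|exact: mD'..].
  by move/integrableP : i1 => [_ ?]; move/integrableP : i2 => [_ ?]; rewrite lte_add_pinfty.
split; apply/integrableP; (split; first by apply: measurable_funTS; exact/measurable_EFinP);
  apply: le_lt_trans fin; apply: ge0_le_integral => //;
  try by [apply: measurable_funTS; apply/measurable_EFinP; exact: measurable_normc|
    apply: measurable_funTS; apply: measurableT_comp => //; exact/measurable_EFinP|
    move=> x _; rewrite lee_fin ?normc_Re ?normc_Im].
Qed.

End cintegrable.

Section psd.
Context (R : realType) (d : nat) (M : 'M[R[i]]_d).
Hypothesis psd : hermitian_psd M.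

Lemma psd_herm i j : M j i = (M i j)^*.
Proof. by case: psd => h _; rewrite -[in LHS]h !mxE. Qed.

Let form (u v : 'cV[R[i]]_d) := (map_mx conjc (u^T) *m M *m v) 0 0.

Let formD u u' v v' : form (u + u') (v + v') =
  form u v + form u v' + (form u' v + form u' v').
Proof.
rewrite /form; have -> : map_mx conjc ((u + u')^T) = map_mx conjc u^T + map_mx conjc u'^T.
  by apply/matrixP => a b; rewrite !mxE rmorphD.
have addE (A B : 'M[R[i]]_1) : (A + B) 0 0 = A 0 0 + B 0 0 by rewrite mxE.
by rewrite 2!mulmxDl 2!mulmxDr 3!addE.
Qed.

Let form_delta a b i j : form (a *: delta_mx i 0) (b *: delta_mx j 0) = a^* * b * M i j.
Proof.
rewrite /form.
have -> : map_mx conjc ((a *: delta_mx i 0)^T) = a^* *: (delta_mx 0 i : 'rV[R[i]]_d).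
  by apply/matrixP => x y; rewrite !mxE rmorphM/= conjc_nat andbC.
rewrite -!scalemxAl -scalemxAr -rowE -colE.
have scE c (A : 'M[R[i]]_1) : (c *: A) 0 0 = c * A 0 0 by rewrite mxE.
by rewrite !scE mxE mxE mulrA.
Qed.

Lemma psd_diag i : 0 <= M i i.
Proof.
have := psd.2 (1 *: delta_mx i 0); have := form_delta 1 1 i i.
by rewrite /form => ->; rewrite rmorph1 !mul1r.
Qed.

Lemma psd_diagRe i : 0 <= Re (M i i).
Proof. by have := psd_diag i; rewrite lecE/= => /andP[]. Qed.

Lemma psd_diagIm i : Im (M i i) = 0.
Proof. exact: ger0_Im (psd_diag i). Qed.

(* nonnegativity at v = - s M_ij e_i + e_j, for s = 1 / M_ii or s large *)
Lemma psd_minor i j : normc (M i j) ^+ 2 <= Re (M i i) * Re (M j j).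
Proof.
set p := Re (M i i); set q := Re (M j j); set z := M i j.
have quad (s : R) : 0 <= s ^+ 2 * normc z ^+ 2 * p - 2 * s * normc z ^+ 2 + q.
  have := psd.2 ((- (s%:C * z)) *: delta_mx i 0 + 1 *: delta_mx j 0).
  rewrite -[X in 0 <= X]/(form _ _) formD !form_delta (psd_herm i j) -/z.
  rewrite lecE => /andP[_].
  rewrite !cRI/= -/p -/q (psd_diagIm i) (psd_diagIm j) sqr_normcE.
  by congr (_ <= _); ring.
have p0 : 0 <= p by exact: psd_diagRe.
have z0 : 0 <= normc z ^+ 2 by exact: sqr_ge0.
have q0 : 0 <= q by exact: psd_diagRe.
have [p00|pp] := eqVneq p 0.
  rewrite p00 mul0r; rewrite leNgt; apply/negP => zp.
  have := quad ((q + 1) / normc z ^+ 2); rewrite p00 mulr0 add0r.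
  rewrite -mulrA divfK ?gt_eqF//; lra.
have {}pp : 0 < p by rewrite lt0r pp.
have := quad p^-1; set Z := normc z ^+ 2 => h.
have : 0 <= q - Z / p.
  by move: h; congr (_ <= _); field; rewrite gt_eqF.
by rewrite subr_ge0 ler_pdivrMr// mulrC.
Qed.

End psd.

Section reflection.
Context (R : realType) (k : space_kind) (nu : nat).
Local Notation E := (espace R k nu).
Variable mu : {measure set E -> \bar R}.

Definition pospart (h : E -> R) (x : E) : R := Num.max (h x) 0.

Lemma pospart_ge0 h x : 0 <= pospart h x.
Proof. by rewrite /pospart le_max lexx orbT. Qed.

Lemma measurable_pospart h : measurable_fun setT h -> measurable_fun setT (pospart h).
Proof. by move=> mh; apply: measurable_maxr. Qed.

(* h' is the image of h under x |-> - x, in the sense of densities. *)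
Definition reflects (h h' : E -> R) := [/\ measurable_fun setT h,
  measurable_fun setT h', forall A, bborel A -> mu.-integrable A (EFin \o h),
  forall A, bborel A -> mu.-integrable A (EFin \o h') &
  forall A, bborel A -> (\int[mu]_(x in set_opp A) (h x)%:E =
    \int[mu]_(x in A) (h' x)%:E)%E].

Lemma reflects_sym h h' : reflects h h' -> reflects h' h.
Proof.
move=> [mh mh' ih ih' hh']; split => // A bA.
rewrite -hh'; last exact: bborel_opp.
by rewrite set_oppK.
Qed.

Lemma reflectsN h h' : reflects h h' -> reflects (fun x => - h x) (fun x => - h' x).
Proof.
move=> [mh mh' ih ih' hh']; split.
- exact: measurableT_comp.
- exact: measurableT_comp.
- by move=> A bA; rewrite (_ : _ \o _ = (fun x => - (EFin \o h) x)%E)//; exact: integrableN (ih _ bA).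
- by move=> A bA; rewrite (_ : _ \o _ = (fun x => - (EFin \o h') x)%E)//; exact: integrableN (ih' _ bA).
- move=> A bA; under eq_integral do rewrite EFinN.
  under [RHS]eq_integral do rewrite EFinN.
  have bA' := bborel_opp bA.
  rewrite integralN; last by apply: integrable_add_def (ih _ bA'); case: bA'.
  rewrite integralN; last by apply: integrable_add_def (ih' _ bA); case: bA.
  by rewrite hh'.
Qed.

(** On the part of A where h is nonnegative the positive part is h itself; its integral is reflected
    there and then bounded by that of the positive part of h'. Exchanging h and h' gives the
    equality of [reflects_dens]. *)
Lemma reflects_pospart_le h h' A : reflects h h' -> bborel A ->
  (dens mu (pospart h) A <= dens mu (pospart h') (set_opp A))%E.
Proof.
move=> [mh mh' ih ih' hh'] bA; have [mA _] := bA.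
pose B := A `&` [set x | 0 <= h x].
have m0 : measurable [set x | 0 <= h x].
  rewrite (_ : [set x | _] = setT `&` h @^-1` [set` `[0, +oo[ ]).
    by apply: mh => //; exact: measurable_itv.
  by rewrite setTI; apply/seteqP; split => x /=; rewrite in_itv/= andbT.
have bB : bborel B by exact: bborelI.
have [mB _] := bB.
have mpe f : measurable_fun setT f -> measurable_fun setT (fun x => (pospart f x)%:E).
  by move=> mf; apply/measurable_EFinP; exact: measurable_pospart.
have -> : dens mu (pospart h) A = (\int[mu]_(x in B) (h x)%:E)%E.
  rewrite /dens /B integral_mkcondr; apply: eq_integral => x _.
  rewrite patchE /pospart; case: ifPn; rewrite ?inE ?notin_setE/= => h0.
    by rewrite max_l.
  by rewrite max_r// leNgt; apply/negP => /ltW.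
rewrite -[B]set_oppK hh'; last exact: bborel_opp.
apply: (@le_trans _ _ (\int[mu]_(x in set_opp B) (pospart h' x)%:E)%E).
  apply: le_integral => //.
  - exact: measurable_set_opp.
  - by apply: ih'; exact: bborel_opp.
  - rewrite (_ : (fun x => _) = (EFin \o h')^\+%E).
      by apply: integrable_funepos; [exact: measurable_set_opp|exact: ih' (bborel_opp bB)].
    by apply/funext => x; rewrite funeposE /pospart EFin_max.
  - by move=> x _; rewrite lee_fin le_max lexx.
apply: ge0_subset_integral => //.
- exact: measurable_set_opp.
- exact: measurable_set_opp.
- exact: measurable_funTS (mpe _ mh').
- by move=> x _; rewrite lee_fin pospart_ge0.
- by move=> x [].
Qed.

End reflection.

Section reflection_integral.
Context (R : realType) (k : space_kind) (nu : nat).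
Local Notation E := (espace R k nu).
Variable mu : {measure set E -> \bar R}.
Local Notation opp := (@pt_opp R k nu).

Lemma reflects_dens h h' A : reflects mu h h' -> measurable A ->
  dens mu (pospart h) (set_opp A) = dens mu (pospart h') A.
Proof.
move=> hh'; have [mh mh' _ _ _] := hh'.
pose m1 := push_measure
  (dens_measure mu (measurable_pospart mh) (pospart_ge0 h)) (@measurable_pt_opp R k nu).
pose m2 := dens_measure mu (measurable_pospart mh') (pospart_ge0 h').
apply: (@eq_measure_bborel _ _ _ m1 m2) => B bB.
apply/eqP; rewrite eq_le; apply/andP; split.
  have := reflects_pospart_le hh' (bborel_opp bB).
  by rewrite set_oppK.
exact: reflects_pospart_le (reflects_sym hh') bB.
Qed.

Lemma reflects_ge0_integral h h' (phi : E -> \bar R) : reflects mu h h' ->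
  measurable_fun setT phi -> (forall x, 0 <= phi x)%E ->
  (\int[mu]_x (phi (opp x) * (pospart h x)%:E) =
   \int[mu]_x (phi x * (pospart h' x)%:E))%E.
Proof.
move=> hh' mphi phi0; have [mh mh' _ _ _] := hh'.
pose m1 := dens_measure mu (measurable_pospart mh) (pospart_ge0 h).
pose m2 := dens_measure mu (measurable_pospart mh') (pospart_ge0 h').
have mo := @measurable_pt_opp R k nu.
transitivity (\int[m1]_x phi (opp x))%E.
  by rewrite integral_dens//; exact: measurableT_comp.
transitivity (\int[m2]_x phi x)%E; last by rewrite integral_dens.
have := @ge0_integral_pushforward _ _ _ _ _ _ mo m1 setT phi measurableT mphi.
rewrite preimage_setT /= => <-; last by move=> x _; exact: phi0.
have EE (A : set E) : measurable A -> A `<=` setT -> push_measure m1 mo A = m2 A.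
  by move=> mA _; exact: reflects_dens.
exact: (@eq_measure_integral _ _ _ setT m2 (push_measure m1 mo) phi EE).
Qed.

Lemma max0M (a b : R) : Num.max (a * b) 0 =
  Num.max a 0 * Num.max b 0 + Num.max (- a) 0 * Num.max (- b) 0.
Proof.
have [a0|a0] := leP 0 a; have [b0|b0] := leP 0 b.
- have na : - a <= 0 by lra.
  by rewrite ?(max_r na) mul0r addr0 ?(max_l a0) ?(max_l b0) max_l ?mulr_ge0.
- have na : - a <= 0 by lra.
  rewrite ?(max_r na) mul0r addr0 ?(max_r (ltW b0)) mulr0 max_r//.
  by rewrite mulr_ge0_le0// ltW.
- have nb : - b <= 0 by lra.
  rewrite ?(max_r nb) mulr0 addr0 ?(max_r (ltW a0)) mul0r max_r//.
  by rewrite mulr_le0_ge0// ltW.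
- have na : 0 <= - a by lra.
  have nb : 0 <= - b by lra.
  rewrite ?(max_r (ltW a0)) mul0r add0r ?(max_l na) ?(max_l nb) mulrNN max_l//.
  by rewrite nmulr_rge0// ltW.
Qed.

(** The positive part of a product is the sum of the product of the positive parts and the product
    of the negative parts ([max0M]). This reduces the claim to nonnegative functions, for h and for
    - h. *)
Lemma reflects_funepos h h' (phi : E -> R) : reflects mu h h' ->
  measurable_fun setT phi ->
  (\int[mu]_x ((fun x => (phi (opp x) * h x)%:E)^\+ x) =
   \int[mu]_x ((fun x => (phi x * h' x)%:E)^\+ x))%E.
Proof.
move=> hh' mphi; have [mh mh' _ _ _] := hh'.
have mo := @measurable_pt_opp R k nu.
have mN (f : E -> R) : measurable_fun setT f -> measurable_fun setT (fun x => - f x).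
  by move=> mf; exact: measurableT_comp.
have mP (f : E -> R) : measurable_fun setT f -> measurable_fun setT (fun x => (pospart f x)%:E).
  by move=> mf; apply/measurable_EFinP; exact: measurable_pospart.
have mphio := measurableT_comp mphi mo.
have key (f g : E -> R) : measurable_fun setT f -> measurable_fun setT g ->
  (\int[mu]_x ((fun x => (f x * g x)%:E)^\+ x) =
   \int[mu]_x ((pospart f x)%:E * (pospart g x)%:E) +
   \int[mu]_x ((pospart (fun x => - f x) x)%:E * (pospart (fun x => - g x) x)%:E))%E.
  move=> mf mg; rewrite -ge0_integralD//.
  - apply: eq_integral => x _; rewrite funeposE -EFin_max max0M.
    by rewrite -!EFinM -EFinD.
  - by move=> x _; rewrite -EFinM lee_fin mulr_ge0// pospart_ge0.
  - by apply: emeasurable_funM; exact: mP.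
  - by move=> x _; rewrite -EFinM lee_fin mulr_ge0// pospart_ge0.
  - by apply: emeasurable_funM; apply: mP; exact: mN.
rewrite (key _ _ mphio mh) (key _ _ mphi mh'); congr (_ + _)%E.
  apply: (reflects_ge0_integral (phi := fun x => (pospart phi x)%:E) hh').
    exact: mP.
  by move=> x; rewrite lee_fin pospart_ge0.
apply: (reflects_ge0_integral (phi := fun x => (pospart (fun x => - phi x) x)%:E) (reflectsN hh')).
  by apply: mP; exact: mN.
by move=> x; rewrite lee_fin pospart_ge0.
Qed.

Lemma reflects_funeneg h h' (phi : E -> R) : reflects mu h h' ->
  measurable_fun setT phi ->
  (\int[mu]_x ((fun x => (phi (opp x) * h x)%:E)^\- x) =
   \int[mu]_x ((fun x => (phi x * h' x)%:E)^\- x))%E.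
Proof.
move=> hh' mphi; have := reflects_funepos (reflectsN hh') mphi.
have E2 (f g : E -> R) : (fun x => (f x * - g x)%:E)^\+%E = (fun x => (f x * g x)%:E)^\-%E.
  by apply/funext => x; rewrite funeposE funenegE mulrN EFinN.
by rewrite !E2.
Qed.

Lemma reflects_integral h h' (phi : E -> R) : reflects mu h h' ->
  measurable_fun setT phi ->
  (\int[mu]_x (phi (opp x) * h x)%:E = \int[mu]_x (phi x * h' x)%:E)%E.
Proof.
move=> hh' mphi; rewrite integralE [RHS]integralE.
by rewrite (reflects_funepos hh')// (reflects_funeneg hh').
Qed.

Lemma reflects_integrable h h' (phi : E -> R) : reflects mu h h' ->
  measurable_fun setT phi ->
  mu.-integrable setT (fun x => (phi (opp x) * h x)%:E) <->
  mu.-integrable setT (fun x => (phi x * h' x)%:E).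
Proof.
move=> hh' mphi; have [mh mh' _ _ _] := hh'.
have mo := @measurable_pt_opp R k nu.
have mphio := measurableT_comp mphi mo.
have m1 : measurable_fun setT (fun x => (phi (opp x) * h x)%:E).
  by apply/measurable_EFinP; exact: measurable_funM.
have m2 : measurable_fun setT (fun x => (phi x * h' x)%:E).
  by apply/measurable_EFinP; exact: measurable_funM.
have key (f : E -> \bar R) : measurable_fun setT f ->
    (\int[mu]_x `|f x| = \int[mu]_x (f^\+ x) + \int[mu]_x (f^\- x))%E.
  move=> mf; rewrite -ge0_integralD//.
  - by apply: eq_integral => x _; rewrite -/((abse \o f) x) fune_abse.
  - exact: measurable_funepos.
  - exact: measurable_funeneg.
have e : (\int[mu]_x `|(phi (opp x) * h x)%:E| = \int[mu]_x `|(phi x * h' x)%:E|)%E.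
  by rewrite !key// (reflects_funepos hh')// (reflects_funeneg hh').
by split => /integrableP[_ fin]; apply/integrableP; split => //; move: fin; rewrite e.
Qed.

(** Each of the four real products is bounded by |f g| = |f| |g|, so none of them can fail to be
    integrable through cancellation. *)
Lemma cintegrable_parts (f g : E -> R[i]) : cmeasurable f -> cmeasurable g ->
  cintegrable mu setT (fun x => f x * g x) <->
  [/\ mu.-integrable setT (fun x => (Re (f x) * Re (g x))%:E),
      mu.-integrable setT (fun x => (Im (f x) * Im (g x))%:E),
      mu.-integrable setT (fun x => (Re (f x) * Im (g x))%:E) &
      mu.-integrable setT (fun x => (Im (f x) * Re (g x))%:E)].
Proof.
move=> mf mg; have [mf1 mf2] := mf; have [mg1 mg2] := mg; split.
  move=> /(cintegrableP mu measurableT (cmeasurableM mf mg)) fin.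
  have i : mu.-integrable setT (fun x => (normc (f x * g x))%:E).
    apply/integrableP; split.
      by apply/measurable_EFinP; apply: measurable_normc; exact: cmeasurableM.
    by under eq_integral do rewrite gee0_abs ?lee_fin ?normc_ge0//.
  have le (a b : E -> R) : measurable_fun setT a -> measurable_fun setT b ->
      (forall x, `|a x| <= normc (f x)) -> (forall x, `|b x| <= normc (g x)) ->
      mu.-integrable setT (fun x => (a x * b x)%:E).
    move=> ma mb af bg; apply: le_integrable i => //.
      by apply/measurable_EFinP; exact: measurable_funM.
    move=> x _ /=; rewrite lee_fin normrM (ger0_norm (normc_ge0 _)) Normc.normcM.
    by rewrite ler_pM.
  by split; apply: le => // x; rewrite ?normc_Re ?normc_Im.
move=> [i1 i2 i3 i4]; split.
  rewrite (_ : (fun x => _) = (fun x => (Re (f x) * Re (g x))%:E - (Im (f x) * Im (g x))%:E)%E).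
    exact: integrableB.
  by apply/funext => x; rewrite cReM EFinB.
rewrite (_ : (fun x => _) = (fun x => (Re (f x) * Im (g x))%:E + (Im (f x) * Re (g x))%:E)%E).
  exact: integrableD.
by apply/funext => x; rewrite cImM EFinD.
Qed.

Lemma cintegral_parts (f g : E -> R[i]) : cmeasurable f -> cmeasurable g ->
  cintegrable mu setT (fun x => f x * g x) ->
  cintegral mu setT (fun x => f x * g x) =
  (\int[mu]_x (Re (f x) * Re (g x)) - \int[mu]_x (Im (f x) * Im (g x))) +i*
  (\int[mu]_x (Re (f x) * Im (g x)) + \int[mu]_x (Im (f x) * Re (g x))).
Proof.
move=> mf mg ifg; have [i1 i2 i3 i4] := (cintegrable_parts mf mg).1 ifg.
rewrite /cintegral asboolT//; apply: complex_ext => /=.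
  by rewrite -RintegralB//; apply: eq_Rintegral => x _; rewrite cReM.
by rewrite -RintegralD//; apply: eq_Rintegral => x _; rewrite cImM.
Qed.

(** The evenness G(-A) = conj G(A), at the level of the density. Integrability of the two sides is
    equivalent, so they also take the default value 0 together. *)
Lemma cintegral_reflect (phi g : E -> R[i]) : cmeasurable phi ->
  reflects mu (fun x => Re (g x)) (fun x => Re (g x)) ->
  reflects mu (fun x => Im (g x)) (fun x => - Im (g x)) ->
  cintegral mu setT (fun x => phi (opp x) * g x) =
  cintegral mu setT (fun x => phi x * (g x)^*).
Proof.
move=> mphi r1 r2; have [mp1 mp2] := mphi.
have [mg1 _ _ _ _] := r1; have [mg2 _ _ _ _] := r2.
have mg : cmeasurable g by split.
have mgJ := cmeasurableJ mg.
have mo := @measurable_pt_opp R k nu.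
have mphio := cmeasurable_comp mphi mo.
have iff : cintegrable mu setT (fun x => phi (opp x) * g x) <->
    cintegrable mu setT (fun x => phi x * (g x)^*).
  rewrite (cintegrable_parts mphio mg) (cintegrable_parts mphi mgJ).
  have e1 (f : E -> R) : (fun x => (f x * Re ((g x)^*))%:E) =
    (fun x => (f x * Re (g x))%:E) by apply/funext => x; rewrite cReJ.
  have e2 (f : E -> R) : (fun x => (f x * Im ((g x)^*))%:E) =
    (fun x => (f x * - Im (g x))%:E) by apply/funext => x; rewrite cImJ.
  rewrite (e1 (fun x => Re (phi x))) (e1 (fun x => Im (phi x))).
  rewrite (e2 (fun x => Re (phi x))) (e2 (fun x => Im (phi x))).
  have I1 := reflects_integrable r1 mp1; have I2 := reflects_integrable r2 mp2.
  have I3 := reflects_integrable r2 mp1; have I4 := reflects_integrable r1 mp2.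
  by split => -[/I1 a /I2 b /I3 c /I4 d].
have [i|ni] := pselect (cintegrable mu setT (fun x => phi (opp x) * g x)); last first.
  rewrite /cintegral asboolF// asboolF//.
  by move=> /iff.
rewrite (cintegral_parts mphio mg i) (cintegral_parts mphi mgJ (iff.1 i)).
rewrite /Rintegral /=; congr Complex; [congr (_ - _)|congr (_ + _)].
- by rewrite (reflects_integral r1 mp1); congr fine; apply: eq_integral => x _; rewrite cReJ.
- by rewrite (reflects_integral r2 mp2); congr fine; apply: eq_integral => x _; rewrite cImJ.
- by rewrite (reflects_integral r2 mp1); congr fine; apply: eq_integral => x _; rewrite cImJ.
- by rewrite (reflects_integral r1 mp2); congr fine; apply: eq_integral => x _; rewrite cReJ.
Qed.

End reflection_integral.

Section spectral.
Context (R : realType) (k : space_kind) (nu d : nat).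
Local Notation E := (espace R k nu).
Variables (mu : {sigma_finite_measure set E -> \bar R})
  (G : 'I_d -> 'I_d -> set E -> R[i]) (g : 'I_d -> 'I_d -> E -> R[i]).
Hypothesis hG : matrix_spectral_measure G mu g.

(** Almost everywhere this is g_jj itself; taking the positive part makes it nonnegative everywhere,
    so that it defines a measure without exceptional points. *)
Definition rho (j : 'I_d) : E -> R := pospart (fun x => Re (g j j x)).

Lemma rho_ge0 j x : 0 <= rho j x. Proof. exact: pospart_ge0. Qed.

Lemma measurable_rho j : measurable_fun setT (rho j).
Proof. by apply: measurable_pospart; have [] := msm_density_measurable hG j j. Qed.

(* The measure G_jj, as a positive measure on all of E. *)
Definition nuj j : {measure set E -> \bar R} :=
  dens_measure mu (measurable_rho j) (rho_ge0 j).

(** The consequences of the matrix positivity that the proof uses: nonnegative diagonal densities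
    and nonnegative minors of order 2. *)
Lemma g_ae : {ae mu, forall x, forall j j',
  [/\ Re (g j j x) = rho j x, Im (g j j x) = 0 &
      normc (g j j' x) ^+ 2 <= rho j x * rho j' x]}.
Proof.
apply: filterS (msm_psd hG) => x psd j j'.
have e i i' : (\matrix_(j, j') g j j' x) i i' = g i i' x by rewrite mxE.
have r i : Re (g i i x) = rho i x.
  by rewrite /rho /pospart max_l// -e; exact: psd_diagRe.
split => //; first by rewrite -e; exact: psd_diagIm.
by rewrite -!r -!e; exact: psd_minor.
Qed.

Lemma G_Re j j' A : bborel A ->
  (\int[mu]_(x in A) (Re (g j j' x))%:E)%E = (Re (G j j' A))%:E.
Proof.
move=> bA; have [i ->] := msm_density hG j j' bA.
rewrite /cintegral asboolT//= fineK//.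
by have [mA _] := bA; apply: integrable_fin_num => //; case: i.
Qed.

Lemma G_Im j j' A : bborel A ->
  (\int[mu]_(x in A) (Im (g j j' x))%:E)%E = (Im (G j j' A))%:E.
Proof.
move=> bA; have [i ->] := msm_density hG j j' bA.
rewrite /cintegral asboolT//= fineK//.
by have [mA _] := bA; apply: integrable_fin_num => //; case: i.
Qed.

Lemma reflects_Re j j' :
  reflects mu (fun x => Re (g j j' x)) (fun x => Re (g j j' x)).
Proof.
have [m1 _] := msm_density_measurable hG j j'.
have i A : bborel A -> mu.-integrable A (EFin \o (fun x => Re (g j j' x))).
  by move=> bA; have [[]] := msm_density hG j j' bA.
split => // A bA; rewrite !G_Re//; last exact: bborel_opp.
by rewrite (msm_even hG)// cReJ.
Qed.

Lemma reflects_Im j j' :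
  reflects mu (fun x => Im (g j j' x)) (fun x => - Im (g j j' x)).
Proof.
have [_ m1] := msm_density_measurable hG j j'.
have i A : bborel A -> mu.-integrable A (EFin \o (fun x => Im (g j j' x))).
  by move=> bA; have [[]] := msm_density hG j j' bA.
split => //.
- exact: measurableT_comp.
- move=> A bA; rewrite (_ : _ \o _ = (fun x => - (EFin \o (fun x => Im (g j j' x))) x)%E)//.
  exact: integrableN (i _ bA).
- move=> A bA; under [RHS]eq_integral do rewrite EFinN.
  rewrite integralN; last by apply: integrable_add_def (i _ bA); case: bA.
  rewrite !G_Im//; last exact: bborel_opp.
  by rewrite (msm_even hG)// cImJ EFinN.
Qed.

Lemma nujE j A : bborel A -> nuj j A = (Re (G j j A))%:E.
Proof.
move=> bA; rewrite -G_Re// /nuj /= /dens; have [mA _] := bA.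
apply: ae_eq_integral => //.
- by apply: measurable_funTS; apply/measurable_EFinP; exact: measurable_rho.
- apply: measurable_funTS; apply/measurable_EFinP.
  by have [] := msm_density_measurable hG j j.
- by apply: filterS g_ae => x /(_ j j)[-> _ _] _.
Qed.

Lemma G_diag j A : bborel A -> G j j A = (fine (nuj j A))%:C.
Proof.
move=> bA; rewrite nujE//=; apply: complex_ext => //=.
apply: EFin_inj; rewrite -G_Im//; have [mA _] := bA.
rewrite (@ae_eq_integral _ _ _ mu _ (cst 0%E)) ?integral0//.
- apply: measurable_funTS; apply/measurable_EFinP.
  by have [] := msm_density_measurable hG j j.
- by apply: filterS g_ae => x /(_ j j)[_ -> _] _.
Qed.

Lemma nuj_fin j A : bborel A -> (nuj j A < +oo)%E.
Proof. by move=> bA; rewrite nujE// ltry. Qed.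

Lemma nuj_opp j A : measurable A -> nuj j (set_opp A) = nuj j A.
Proof. by move=> mA; exact: reflects_dens (reflects_Re j j) mA. Qed.

Lemma nuj_set1 j (x : E) : nonatomic mu -> measurable [set x] -> nuj j [set x] = 0%E.
Proof.
move=> na mx; rewrite /nuj /= /dens; apply: null_set_integral => //.
  by apply: measurable_funTS; apply/measurable_EFinP; exact: measurable_rho.
exact: na.
Qed.

Let snuj_sigma_finite j : sigma_finite setT (nuj j).
Proof.
exists (fun n => cube n%:R); first by rewrite bigcup_cube.
move=> n; split; first exact: measurable_cube.
exact: nuj_fin (bborel_cube _ _ _).
Qed.

Definition snu j : {sigma_finite_measure set E -> \bar R} :=
  HB.pack (Measure.sort (nuj j)) (Measure.class (nuj j))
    (Measure_isSigmaFinite.Build _ _ _ (nuj j) (snuj_sigma_finite j)).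

(** The minors give 2 |g_jj'| <= rho_j + rho_j' almost everywhere. The factor 2 pays for the bound
    of |G| by |Re G| + |Im G|. *)
Lemma normc_G_le j j' A : bborel A ->
  normc (G j j' A) <= fine (nuj j A) + fine (nuj j' A).
Proof.
move=> bA; have [mA _] := bA.
have [ig Gg] := msm_density hG j j' bA.
have [i1 i2] := ig.
have mg := msm_density_measurable hG j j'.
have fin : (\int[mu]_(x in A) (normc (g j j' x))%:E < +oo)%E.
  by apply/cintegrableP.
have mn : measurable_fun A (fun x => (normc (g j j' x))%:E).
  by apply: measurable_funTS; apply/measurable_EFinP; exact: measurable_normc.
have mr i : measurable_fun A (fun x => (rho i x)%:E).
  by apply: measurable_funTS; apply/measurable_EFinP; exact: measurable_rho.
have part (h : E -> R) : measurable_fun setT h -> mu.-integrable A (EFin \o h) ->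
    (forall x, `|h x| <= normc (g j j' x)) ->
    (`| \int[mu]_(x in A) (h x)%:E | <= \int[mu]_(x in A) (normc (g j j' x))%:E)%E.
  move=> mh ih hn; apply: (le_trans (le_abse_integral _ _ _)) => //.
    by apply: measurable_funTS; exact/measurable_EFinP.
  apply: ge0_le_integral => //.
  - by apply: measurableT_comp => //; apply: measurable_funTS; exact/measurable_EFinP.
  - by move=> x _; rewrite lee_fin.
have p1 := part _ mg.1 i1 (fun x => normc_Re _).
have p2 := part _ mg.2 i2 (fun x => normc_Im _).
have h : (2%:E * \int[mu]_(x in A) (normc (g j j' x))%:E <= nuj j A + nuj j' A)%E.
  rewrite -ge0_integralZl//; last by move=> x _; rewrite lee_fin normc_ge0.
  rewrite /nuj /= /dens -ge0_integralD//; last 2 first.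
  - by move=> x _; rewrite lee_fin rho_ge0.
  - by move=> x _; rewrite lee_fin rho_ge0.
  apply: ae_ge0_le_integral => //.
  - by move=> x _; rewrite mule_ge0// lee_fin normc_ge0.
  - exact: emeasurable_funM.
  - by move=> x _; rewrite -EFinD lee_fin addr_ge0// rho_ge0.
  - exact: emeasurable_funD.
  - apply: filterS g_ae => x /(_ j j')[_ _ le] _; rewrite -EFinM -EFinD lee_fin.
    have r1 := rho_ge0 j x; have r2 := rho_ge0 j' x; have n0 := normc_ge0 (g j j' x).
    rewrite -ler_sqr ?nnegrE ?mulr_ge0 ?addr_ge0// exprMn.
    have := sqr_ge0 (rho j x - rho j' x); move: le; nra.
rewrite (le_trans (normc_le _))// -lee_fin EFinD.
rewrite (G_Re j j' bA) /= in p1; rewrite (G_Im j j' bA) /= in p2.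
apply: (le_trans (leeD p1 p2)).
rewrite EFinD !fineK ?ge0_fin_numE ?nuj_fin//.
by move: h; rewrite mule_natl mule2n.
Qed.

End spectral.

(** * Product measures on tuples and L2 norms *)

Section tuple_measure.
Context (d : measure_display) (T : measurableType d) (R : realType) (I : Type).
Variable m : I -> {sigma_finite_measure set T -> \bar R}.

Definition tcons (n : nat) (p : T * n.-tuple T) : n.+1.-tuple T :=
  [tuple of p.1 :: p.2].

Definition tuncons (n : nat) (x : n.+1.-tuple T) : T * n.-tuple T :=
  (thead x, [tuple of behead x]).

Lemma tconsK n : cancel (@tcons n) (@tuncons n).
Proof.
move=> [x y]; rewrite /tuncons /tcons /= theadE; congr pair.
exact/val_inj.
Qed.

Lemma measurable_tcons n : measurable_fun setT (@tcons n).
Proof. exact: measurable_cons. Qed.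

Lemma measurable_tuncons n : measurable_fun setT (@tuncons n).
Proof.
apply: measurable_fun_pair => /=; first exact: (measurable_tnth ord0).
exact: measurable_behead.
Qed.

Section cons_measure.
Variables (n : nat) (m1 : {sigma_finite_measure set T -> \bar R})
  (m2 : {sigma_finite_measure set (n.-tuple T) -> \bar R}).

Let mcons := push_measure (m1 \x m2)%E (@measurable_tcons n).

Let mcons_sigma_finite : sigma_finite setT mcons.
Proof.
have /sigma_finiteP[F [TF ndF Foo]] := sigma_finiteT m1.
have /sigma_finiteP[F' [TF' ndF' Foo']] := sigma_finiteT m2.
exists (fun i => @tuncons n @^-1` (F i `*` F' i)).
  rewrite -preimage_bigcup (_ : \bigcup_i _ = setT) ?preimage_setT//.
  apply/seteqP; split => // -[x y] _.
  have [a _ Fa] : (\bigcup_i F i) x by rewrite -TF.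
  have [b _ Fb] : (\bigcup_i F' i) y by rewrite -TF'.
  exists (maxn a b) => //; split => /=.
    by move: x Fa; exact/subsetPset/ndF/leq_maxl.
  by move: y Fb; exact/subsetPset/ndF'/leq_maxr.
move=> i; have [? ?] := Foo i; have [? ?] := Foo' i.
have mX : measurable (F i `*` F' i) by exact: measurableX.
split.
  by rewrite -[X in measurable X]setTI; exact: measurable_tuncons.
rewrite /mcons /= /pushforward -comp_preimage.
rewrite (_ : _ \o _ = id); last by apply/funext => x; exact: tconsK.
by rewrite preimage_id product_measure1E// lte_mul_pinfty// ge0_fin_numE.
Qed.

Definition cons_measure : {sigma_finite_measure set (n.+1.-tuple T) -> \bar R} :=
  HB.pack (Measure.sort mcons) (Measure.class mcons)
    (Measure_isSigmaFinite.Build _ _ _ mcons mcons_sigma_finite).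

Local Open Scope ereal_scope.

Lemma integral_cons_measure (f : n.+1.-tuple T -> \bar R) :
  measurable_fun setT f -> (forall x, 0 <= f x) ->
  \int[cons_measure]_x f x = \int[(m1 \x m2)%E]_x f (tcons x).
Proof.
move=> mf f0.
have := @ge0_integral_pushforward _ _ _ _ _ _ (@measurable_tcons n) (m1 \x m2)%E
  setT f measurableT mf.
by rewrite preimage_setT /= => <-// x _; exact: f0.
Qed.

End cons_measure.

(** The recursion on the head is the one of [diag_integral], so that the two compare by induction.
    Sigma-finiteness is carried along because each step uses Tonelli's theorem. *)
Fixpoint tmeas (n : nat) : n.-tuple I -> {sigma_finite_measure set (n.-tuple T) -> \bar R} :=
  match n return n.-tuple I -> {sigma_finite_measure set (n.-tuple T) -> \bar R} with
  | 0 => fun _ => dirac ([tuple] : 0.-tuple T)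
  | n'.+1 => fun js => cons_measure (m (thead js)) (@tmeas n' [tuple of behead js])
  end.

Local Open Scope ereal_scope.

Lemma integral_tmeas0 (js : 0.-tuple I) (f : 0.-tuple T -> \bar R) :
  (forall x, 0 <= f x) -> \int[tmeas js]_x f x = f [tuple].
Proof.
move=> f0; rewrite /= integral_dirac//.
  by rewrite diracE mem_set// mul1e.
rewrite (_ : f = cst (f [tuple])); first exact: measurable_cst.
by apply/funext => x; rewrite tuple0.
Qed.

Lemma integral_tmeasS n (js : n.+1.-tuple I) (f : n.+1.-tuple T -> \bar R) :
  measurable_fun setT f -> (forall x, 0 <= f x) ->
  \int[tmeas js]_x f x = \int[m (thead js)]_x
    \int[tmeas [tuple of behead js]]_y f [tuple of x :: y].
Proof.
move=> mf f0; rewrite integral_cons_measure//.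
rewrite fubini_tonelli1//.
by apply: measurableT_comp => //; exact: measurable_tcons.
Qed.

Lemma integral_tmeasS_swap n (js : n.+1.-tuple I) (f : n.+1.-tuple T -> \bar R) :
  measurable_fun setT f -> (forall x, 0 <= f x) ->
  \int[tmeas js]_x f x = \int[tmeas [tuple of behead js]]_y
    \int[m (thead js)]_x f [tuple of x :: y].
Proof.
move=> mf f0; rewrite integral_cons_measure//.
rewrite fubini_tonelli2//.
by apply: measurableT_comp => //; exact: measurable_tcons.
Qed.

Definition ins (n : nat) (p : 'I_n.+1) (x : n.-tuple T) (y : T) : n.+1.-tuple T :=
  [tuple if unlift p i is Some s then tnth x s else y | i < n.+1].

Lemma tnth_ins_lift n p (x : n.-tuple T) y s : tnth (ins p x y) (lift p s) = tnth x s.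
Proof. by rewrite tnth_mktuple liftK. Qed.

Lemma tnth_ins n p (x : n.-tuple T) y : tnth (ins p x y) p = y.
Proof. by rewrite tnth_mktuple unlift_none. Qed.

Lemma measurable_ins n (p : 'I_n.+1) :
  measurable_fun setT (fun z : n.-tuple T * T => ins p z.1 z.2).
Proof.
apply/measurable_fun_tnthP => i.
case: (unliftP p i) => [s ->|->].
  rewrite (_ : _ \o _ = (fun x => tnth x s) \o fst).
    by apply: measurableT_comp => //; exact: measurable_tnth.
  by apply/funext => z /=; rewrite tnth_ins_lift.
rewrite (_ : _ \o _ = snd)//.
by apply/funext => z /=; rewrite tnth_ins.
Qed.

Lemma ins0 n (x : n.-tuple T) y : ins ord0 x y = [tuple of y :: x].
Proof.
apply: eq_from_tnth => i; case: (unliftP ord0 i) => [s ->|->].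
  by rewrite tnth_ins_lift tnthS.
by rewrite tnth_ins tnth0.
Qed.

Lemma insS n (p : 'I_n.+1) (x : n.+1.-tuple T) y :
  ins (lift ord0 p) x y = [tuple of thead x :: ins p [tuple of behead x] y].
Proof.
apply: eq_from_tnth => i; case: (unliftP (lift ord0 p) i) => [s ->|->].
  rewrite tnth_ins_lift; case: (unliftP ord0 s) => [s' ->|->].
    have -> : lift (lift ord0 p) (lift ord0 s') = lift ord0 (lift p s').
      by apply: val_inj; rewrite /= /bump /= !add1n ltnS; case: leqP => _; rewrite ?add1n ?add0n.
    by rewrite tnthS tnth_ins_lift {1}(tuple_eta x) tnthS.
  have -> : lift (lift ord0 p) ord0 = ord0 by apply: val_inj.
  by rewrite tnth0.
by rewrite tnth_ins tnthS tnth_ins.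
Qed.

Lemma tuple_del0 n (js : n.+1.-tuple I) : tuple_del ord0 js = [tuple of behead js].
Proof.
apply: eq_from_tnth => i; rewrite tnth_mktuple.
by rewrite {1}(tuple_eta js) tnthS.
Qed.

Lemma tuple_delS n (p : 'I_n.+1) (js : n.+2.-tuple I) : tuple_del (lift ord0 p) js =
  [tuple of thead js :: tuple_del p [tuple of behead js]].
Proof.
apply: eq_from_tnth => i; rewrite tnth_mktuple.
case: (unliftP ord0 i) => [s' ->|->].
  have -> : lift (lift ord0 p) (lift ord0 s') = lift ord0 (lift p s').
    by apply: val_inj; rewrite /= /bump /= !add1n ltnS; case: leqP => _; rewrite ?add1n ?add0n.
  by rewrite tnthS tnth_mktuple {1}(tuple_eta js) tnthS.
have -> : lift (lift ord0 p) ord0 = ord0 by apply: val_inj.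
by rewrite tnth0.
Qed.

Lemma measurable_integral_ins n (p : 'I_n.+1) j (f : n.+1.-tuple T -> \bar R) :
  measurable_fun setT f -> (forall x, 0 <= f x) ->
  measurable_fun setT (fun x => \int[m j]_y f (ins p x y)).
Proof.
move=> mf f0.
apply: (@measurable_fun_fubini_tonelli_F _ _ _ _ R (m j)
  (fun z : n.-tuple T * T => f (ins p z.1 z.2))) => //.
by apply: measurableT_comp => //; exact: measurable_ins.
Qed.

(** The p-th variable becomes the innermost one, as a contraction requires. For p = 0 this is the
    other order in Tonelli's theorem; otherwise the head stays outermost and the induction treats
    the tail. *)
Lemma integral_tmeas_ins n (p : 'I_n.+1) (js : n.+1.-tuple I)
    (f : n.+1.-tuple T -> \bar R) :
  measurable_fun setT f -> (forall x, 0 <= f x) ->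
  \int[tmeas js]_x f x =
  \int[tmeas (tuple_del p js)]_x \int[m (tnth js p)]_y f (ins p x y).
Proof.
elim: n p js f => [|n IH] p js f mf f0.
  rewrite (ord1 p) tuple_del0 integral_tmeasS_swap//.
  apply: eq_integral => x _; apply: eq_integral => y _.
  by rewrite ins0.
case: (unliftP ord0 p) => [p' ->|->]; last first.
  rewrite tuple_del0 integral_tmeasS_swap//.
  apply: eq_integral => x _; apply: eq_integral => y _.
  by rewrite ins0.
rewrite integral_tmeasS// tuple_delS integral_tmeasS//; last 2 first.
- exact: measurable_integral_ins.
- by move=> x; exact: integral_ge0.
apply: eq_integral => x _.
rewrite (IH p'); last 2 first.
- apply: (measurableT_comp mf).
  exact: (measurable_cons (f := fun=> x) (g := id)).
- by [].
have -> : [tuple of behead [tuple of thead js :: tuple_del p' [tuple of behead js]]] =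
   tuple_del p' [tuple of behead js] by exact/val_inj.
apply: eq_integral => y _.
have -> : tnth js (lift ord0 p') = tnth [tuple of behead js] p'.
  by rewrite {1}(tuple_eta js) tnthS.
apply: eq_integral => z _; rewrite insS theadE; congr (f _); congr [tuple of _ :: ins _ _ _].
exact/val_inj.
Qed.

Lemma tmeas_box n (js : n.-tuple I) (A : 'I_n -> set T) :
  (forall i, measurable (A i)) ->
  tmeas js [set x | forall i, A i (tnth x i)] = \prod_(i < n) m (tnth js i) (A i).
Proof.
elim: n js A => [|n IH] js A mA.
  rewrite big_ord0 /= diracE mem_set//=.
  by case.
pose B := [set x | forall i, A (lift ord0 i) (tnth x i)] : set (n.-tuple T).
have mB : measurable B.
  rewrite (_ : B = \bigcap_(i in [set: 'I_n])
    [set x : n.-tuple T | A (lift ord0 i) (tnth x i)]).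
    apply: fin_bigcap_measurable => // i _.
    by rewrite -[X in measurable X]setTI; exact: measurable_tnth.
  by apply/seteqP; split=> x h i; [move=> _; exact: h|exact: (h i Logic.I)].
transitivity (m (thead js) (A ord0) * tmeas [tuple of behead js] B).
  rewrite -product_measure1E//; congr (product_measure1 _ _ _).
  apply/seteqP; split=> [[x y] h|[x y] [/= hx hy] i]; rewrite /tcons /=.
    split => /=; first by have := h ord0; rewrite tnth0.
    by move=> i; have := h (lift ord0 i); rewrite tnthS.
  by case: (unliftP ord0 i) => [s ->|->]; rewrite ?tnthS ?tnth0.
rewrite big_ord_recl; congr (_ * _).
rewrite [LHS](IH [tuple of behead js] (fun i => A (lift ord0 i)) (fun i => mA (lift ord0 i))).
apply: eq_bigr => i _.
have -> : tnth js (lift ord0 i) = tnth [tuple of behead js] i => //.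
by rewrite {1}(tuple_eta js) tnthS.
Qed.

Lemma integral_tmeas_map n (js : n.-tuple I) (h : T -> T) (f : n.-tuple T -> \bar R) :
  measurable_fun setT h ->
  (forall j (f : T -> \bar R), measurable_fun setT f -> (forall x, 0 <= f x) ->
     \int[m j]_x f (h x) = \int[m j]_x f x) ->
  measurable_fun setT f -> (forall x, 0 <= f x) ->
  \int[tmeas js]_x f (map_tuple h x) = \int[tmeas js]_x f x.
Proof.
move=> mh hm; elim: n js f => [|n IH] js f mf f0.
  by rewrite !integral_tmeas0//; congr (f _); exact/val_inj.
have mmap l : measurable_fun setT (map_tuple h : l.-tuple T -> l.-tuple T).
  apply/measurable_fun_tnthP => i.
  rewrite (_ : _ \o _ = h \o (fun x => tnth x i)).
    by apply: measurableT_comp => //; exact: measurable_tnth.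
  by apply/funext => x /=; rewrite tnth_map.
rewrite !integral_tmeasS//; last exact: (measurableT_comp mf (mmap _)).
rewrite -[RHS]hm.
- apply: eq_integral => x _; rewrite -[RHS]IH//.
    by apply: eq_integral => y _; congr (f _); exact/val_inj.
  apply: (measurableT_comp mf).
  exact: (measurable_cons (f := fun=> h x) (g := id)).
- apply: (@measurable_fun_fubini_tonelli_F _ _ _ _ R (tmeas [tuple of behead js])
    (fun z : T * n.-tuple T => f (tcons z))) => //.
  by apply: measurableT_comp => //; exact: measurable_tcons.
- by move=> x; exact: integral_ge0.
Qed.

End tuple_measure.

Section L2.
Context (d : measure_display) (T : measurableType d) (R : realType).
Variable m : {measure set T -> \bar R}.
Implicit Types f g : T -> R[i].

(** The squared L2 norm, possibly infinite. Working with squares avoids roots of extended reals. *)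
Definition N2 f : \bar R := (\int[m]_x (normc (f x) ^+ 2)%:E)%E.

Lemma N2_ge0 f : (0 <= N2 f)%E.
Proof. by apply: integral_ge0 => x _; rewrite lee_fin sqr_ge0. Qed.

Lemma measurable_N2 f : cmeasurable f -> measurable_fun setT (fun x => (normc (f x) ^+ 2)%:E).
Proof. by move=> mf; apply/measurable_EFinP; exact: measurable_sqr_normc. Qed.

Lemma le_N2 f g : cmeasurable f -> cmeasurable g ->
  (forall x, normc (f x) <= normc (g x)) -> (N2 f <= N2 g)%E.
Proof.
move=> mf mg fg; apply: ge0_le_integral => //.
- by move=> x _; rewrite lee_fin sqr_ge0.
- exact: measurable_N2.
- exact: measurable_N2.
- by move=> x _; rewrite lee_fin lerXn2r ?nnegrE ?normc_ge0.
Qed.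

Lemma ae_eq_N2 f g : cmeasurable f -> cmeasurable g ->
  {ae m, forall x, f x = g x} -> N2 f = N2 g.
Proof.
move=> mf mg fg; apply: ae_eq_integral => //.
- exact: measurable_N2.
- exact: measurable_N2.
- by apply: filterS fg => x ->.
Qed.

Lemma N2Z c f : cmeasurable f -> N2 (fun x => c * f x) = ((normc c ^+ 2)%:E * N2 f)%E.
Proof.
move=> mf; rewrite /N2 -ge0_integralZl//.
- by apply: eq_integral => x _; rewrite Normc.normcM exprMn.
- exact: measurable_N2.
- by move=> x _; rewrite lee_fin sqr_ge0.
- by rewrite lee_fin sqr_ge0.
Qed.

Lemma N2N f : N2 (fun x => - f x) = N2 f.
Proof. by apply: eq_integral => x _; rewrite !sqr_normcE !cRI !sqrrN. Qed.

Lemma N2J f : N2 (fun x => (f x)^*) = N2 f.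
Proof. by apply: eq_integral => x _; rewrite normcJ. Qed.

Lemma N2D f g : cmeasurable f -> cmeasurable g ->
  (N2 (fun x => f x + g x)%R <= 2%:E * (N2 f + N2 g))%E.
Proof.
move=> mf mg; rewrite /N2 -ge0_integralD//; last 4 first.
- by move=> x _; rewrite lee_fin sqr_ge0.
- exact: measurable_N2.
- by move=> x _; rewrite lee_fin sqr_ge0.
- exact: measurable_N2.
rewrite -ge0_integralZl//; last 2 first.
- by apply: emeasurable_funD; exact: measurable_N2.
- by move=> x _; rewrite -EFinD lee_fin addr_ge0 ?sqr_ge0.
apply: ge0_le_integral => //.
- by move=> x _; rewrite lee_fin sqr_ge0.
- by apply: measurable_N2; exact: cmeasurableD.
- by apply: emeasurable_funM => //; apply: emeasurable_funD; exact: measurable_N2.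
move=> x _; rewrite -EFinD -EFinM lee_fin !sqr_normcE !cRI.
have := sqr_ge0 (Re (f x) - Re (g x)); have := sqr_ge0 (Im (f x) - Im (g x)); nra.
Qed.

Lemma N2B f g : cmeasurable f -> cmeasurable g ->
  (N2 (fun x => f x - g x)%R <= 2%:E * (N2 f + N2 g))%E.
Proof.
by move=> mf mg; rewrite -(N2N g); apply: N2D => //; exact: cmeasurableN.
Qed.

Lemma N2_sym f g : N2 (fun x => f x - g x) = N2 (fun x => g x - f x).
Proof. by rewrite -N2N; congr N2; apply/funext => x; rewrite opprB. Qed.

Lemma N2_tri f g h : cmeasurable f -> cmeasurable g -> cmeasurable h ->
  (N2 (fun x => f x - h x)%R <=
   2%:E * (N2 (fun x => f x - g x)%R + N2 (fun x => g x - h x)%R))%E.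
Proof.
move=> mf mg mh.
rewrite (_ : (fun x => f x - h x) = (fun x => (f x - g x) + (g x - h x))); last first.
  by apply/funext => x; rewrite addrA subrK.
by apply: N2D; exact: cmeasurableB.
Qed.

Lemma N20 : N2 (fun _ => 0) = 0%E.
Proof.
by rewrite /N2 integral0_eq// => x _; rewrite Normc.normc0 expr0n.
Qed.

Lemma N2_eq0 f : cmeasurable f -> N2 f = 0%E -> {ae m, forall x, f x = 0}.
Proof.
move=> mf h; have : ae_eq m setT (fun x => (normc (f x) ^+ 2)%:E) (cst 0%E).
  apply/ae_eq_integral_abs => //; first exact: measurable_N2.
  by rewrite -h; apply: eq_integral => x _; rewrite gee0_abs// lee_fin sqr_ge0.
apply: filterS => x /(_ Logic.I) /= [] /eqP; rewrite sqrf_eq0 => /eqP.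
exact: Normc.eq0_normc.
Qed.

Lemma N2B_fin f g : cmeasurable f -> cmeasurable g -> (N2 f < +oo)%E ->
  (N2 g < +oo)%E -> (N2 (fun x => f x - g x)%R < +oo)%E.
Proof.
move=> mf mg ff gf; apply: le_lt_trans (N2B mf mg) _.
by rewrite lte_mul_pinfty// lte_add_pinfty.
Qed.

(** The inequality 2 f g <= t f^2 + g^2 / t is integrated for all t > 0, which also proves that the
    left side is finite, and then t is optimized. *)
Lemma cauchy_schwarz (f g : T -> R) :
  measurable_fun setT f -> measurable_fun setT g ->
  (forall x, 0 <= f x) -> (forall x, 0 <= g x) ->
  (\int[m]_x (f x ^+ 2)%:E < +oo)%E -> (\int[m]_x (g x ^+ 2)%:E < +oo)%E ->
  ((\int[m]_x (f x * g x)%:E) < +oo)%E /\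
  (fine (\int[m]_x (f x * g x)%:E)) ^+ 2 <=
    fine (\int[m]_x (f x ^+ 2)%:E) * fine (\int[m]_x (g x ^+ 2)%:E).
Proof.
move=> mf mg f0 g0 Af Bg.
set A := (\int[m]_x (f x ^+ 2)%:E)%E; set B := (\int[m]_x (g x ^+ 2)%:E)%E.
set I := (\int[m]_x (f x * g x)%:E)%E.
have A0 : (0 <= A)%E by apply: integral_ge0 => x _; rewrite lee_fin sqr_ge0.
have B0 : (0 <= B)%E by apply: integral_ge0 => x _; rewrite lee_fin sqr_ge0.
have I0 : (0 <= I)%E by apply: integral_ge0 => x _; rewrite lee_fin mulr_ge0.
have m2 (h : T -> R) : measurable_fun setT h -> measurable_fun setT (fun x : T => (h x ^+ 2)%:E : \bar R).
  by move=> mh; apply/measurable_EFinP; exact: measurable_funX.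
have young (t : R) : 0 < t -> (2%:E * I <= t%:E * A + t^-1%:E * B)%E.
  have mfg : measurable_fun setT (fun x => (f x * g x)%:E).
    by apply/measurable_EFinP; exact: measurable_funM.
  have s0 (h : T -> R) x : setT x -> (0 <= (h x ^+ 2)%:E)%E by rewrite lee_fin sqr_ge0.
  have fg0 x : setT x -> (0 <= (f x * g x)%:E)%E by rewrite lee_fin mulr_ge0.
  move=> t0; rewrite /I /A /B.
  have t1 : (0 <= t%:E)%E by rewrite lee_fin ltW.
  have t2 : (0 <= t^-1%:E)%E by rewrite lee_fin invr_ge0 ltW.
  rewrite -(ge0_integralZl m measurableT (m2 _ mf) (s0 f) t1).
  rewrite -(ge0_integralZl m measurableT (m2 _ mg) (s0 g) t2).
  rewrite -(ge0_integralZl m measurableT mfg fg0)//.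
  rewrite -ge0_integralD//; last 4 first.
  - by move=> x _; rewrite mule_ge0// lee_fin ?sqr_ge0// ltW.
  - by apply: emeasurable_funM => //; exact: m2.
  - by move=> x _; rewrite mule_ge0// lee_fin ?sqr_ge0// invr_ge0 ltW.
  - by apply: emeasurable_funM => //; exact: m2.
  apply: ge0_le_integral => //.
  - by move=> x _; rewrite mule_ge0// lee_fin mulr_ge0.
  - by apply: emeasurable_funM => //; apply/measurable_EFinP; exact: measurable_funM.
  - by apply: emeasurable_funD; apply: emeasurable_funM => //; exact: m2.
  move=> x _; rewrite -!EFinM -EFinD lee_fin.
  rewrite -subr_ge0 (_ : _ - _ = t^-1 * (t * f x - g x) ^+ 2).
    by rewrite mulr_ge0 ?sqr_ge0// invr_ge0 ltW.
  by field; rewrite gt_eqF.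
have Ifin : (I < +oo)%E.
  apply: (@le_lt_trans _ _ (2%:E * I)%E).
    by rewrite mule_natl mule2n leeDl.
  apply: le_lt_trans (young 1 ltr01) _.
  by rewrite invr1 !mul1e lte_add_pinfty.
split => //.
have fA : A \is a fin_num by rewrite ge0_fin_numE.
have fB : B \is a fin_num by rewrite ge0_fin_numE.
have fI : I \is a fin_num by rewrite ge0_fin_numE.
have a0 : 0 <= fine A by exact: fine_ge0.
have b0 : 0 <= fine B by exact: fine_ge0.
have i0 : 0 <= fine I by exact: fine_ge0.
have {}young (t : R) : 0 < t -> 2 * fine I <= t * fine A + t^-1 * fine B.
  by move=> t0; rewrite -lee_fin EFinD !EFinM !fineK//; exact: young.
move: a0 b0 i0 young; set a := fine A; set b := fine B; set i := fine I.
move=> a0 b0 i0 young.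
have [->|ip] := eqVneq i 0; first by rewrite expr0n mulr_ge0.
have {}ip : 0 < i by rewrite lt0r ip.
(* The optimal t is i / a. For a = 0 it is replaced by (b + 1) / i, which gives 2 i <= i b / (b +
   1), impossible for i > 0. *)
have [a00|ap] := eqVneq a 0.
  have t0 : 0 < (b + 1) / i by rewrite divr_gt0// ltr_wpDl.
  have := young _ t0; rewrite a00 mulr0 add0r invf_div => h.
  have : 2 * (b + 1) <= b.
    have e : i / (b + 1) * b * ((b + 1) / i) = b.
      by field; rewrite gt_eqF//= gt_eqF// ltr_wpDl.
    rewrite -[leRHS]e (_ : 2 * (b + 1) = 2 * i * ((b + 1) / i)).
      by rewrite ler_wpM2r// ltW.
    by field; rewrite gt_eqF.
  lra.
have {}ap : 0 < a by rewrite lt0r ap.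
have := young (i / a) (divr_gt0 ip ap); rewrite divfK ?gt_eqF// invf_div => h.
have : i <= a / i * b by lra.
by rewrite mulrAC ler_pdivlMr// expr2.
Qed.

End L2.

Section diag_integral.
Context (R : realType) (k : space_kind) (nu d : nat).
Local Notation E := (espace R k nu).
Variables (mu : {sigma_finite_measure set E -> \bar R})
  (G : 'I_d -> 'I_d -> set E -> R[i]) (g : 'I_d -> 'I_d -> E -> R[i]).
Hypothesis hG : matrix_spectral_measure G mu g.

Definition Mj n (js : n.-tuple 'I_d) := tmeas (snu hG) js.

Lemma integral_snu j (f : E -> \bar R) :
  measurable_fun setT f -> (forall x, (0 <= f x)%E) ->
  (\int[snu hG j]_x f x = \int[mu]_x ((Re (g j j x))%:E * f x))%E.
Proof.
move=> mf f0; transitivity (\int[nuj hG j]_x f x)%E; first by [].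
rewrite /nuj integral_dens//.
apply: ae_eq_integral => //.
- apply: emeasurable_funM => //; apply/measurable_EFinP; exact: measurable_rho hG j.
- apply: emeasurable_funM => //; apply/measurable_EFinP.
  by have [] := msm_density_measurable hG j j.
- by apply: filterS (g_ae hG) => x /(_ j j)[-> _ _] _; rewrite muleC.
Qed.

Lemma diag_integralE n (js : n.-tuple 'I_d) (f : n.-tuple E -> \bar R) :
  measurable_fun setT f -> (forall x, (0 <= f x)%E) ->
  diag_integral mu g js f = (\int[Mj js]_x f x)%E.
Proof.
elim: n js f => [|n IH] js f mf f0; first by rewrite integral_tmeas0.
rewrite /Mj integral_tmeasS// integral_snu; last 2 first.
- apply: (@measurable_fun_fubini_tonelli_F _ _ _ _ R (tmeas (snu hG) [tuple of behead js])
    (fun z : E * n.-tuple E => f (tcons z))) => //.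
  by apply: measurableT_comp => //; exact: measurable_tcons.
- by move=> x; exact: integral_ge0.
apply: eq_integral => x _; congr (_ * _)%E.
apply: IH => //; apply: (measurableT_comp mf).
exact: (measurable_cons (f := fun=> x) (g := id)).
Qed.

Lemma Knorm2E n (js : n.-tuple 'I_d) f : cmeasurable f ->
  Knorm2 mu g js f = N2 (Mj js) f.
Proof.
move=> mf; rewrite /Knorm2 diag_integralE//; first exact: measurable_N2.
by move=> x; rewrite lee_fin sqr_ge0.
Qed.

Lemma measurable_map_opp n : measurable_fun setT
  (map_tuple (@pt_opp R k nu) : n.-tuple E -> n.-tuple E).
Proof.
apply/measurable_fun_tnthP => i.
rewrite (_ : _ \o _ = @pt_opp R k nu \o (fun x => tnth x i)).
  by apply: measurableT_comp; [exact: measurable_pt_opp|exact: measurable_tnth].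
by apply/funext => x /=; rewrite tnth_map.
Qed.

Lemma integral_Mj_opp n (js : n.-tuple 'I_d) (f : n.-tuple E -> \bar R) :
  measurable_fun setT f -> (forall x, (0 <= f x)%E) ->
  (\int[Mj js]_x f (map_tuple (@pt_opp R k nu) x) = \int[Mj js]_x f x)%E.
Proof.
apply: integral_tmeas_map; first exact: measurable_pt_opp.
move=> j {}f mf f0.
have mfo := measurableT_comp mf (@measurable_pt_opp R k nu).
rewrite (_ : (\int[snu hG j]_x f (pt_opp x) = \int[nuj hG j]_x (f \o @pt_opp R k nu) x)%E)//.
rewrite (_ : (\int[snu hG j]_x f x = \int[nuj hG j]_x f x)%E)//.
rewrite /nuj !integral_dens//.
  exact: (reflects_ge0_integral (reflects_Re hG j j)).
by move=> x /=; exact: f0.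
Qed.

Lemma N2_opp n (js : n.-tuple 'I_d) f : cmeasurable f ->
  N2 (Mj js) (fun x => f (map_tuple (@pt_opp R k nu) x)) = N2 (Mj js) f.
Proof.
move=> mf; rewrite /N2.
apply: (integral_Mj_opp _ (f := fun x => (normc (f x) ^+ 2)%:E)).
  exact: measurable_N2.
by move=> x; rewrite lee_fin sqr_ge0.
Qed.

Lemma Mj_box n (js : n.-tuple 'I_d) (A : 'I_n -> set E) :
  (forall i, measurable (A i)) ->
  Mj js [set x | forall i, A i (tnth x i)] = (\prod_(i < n) nuj hG (tnth js i) (A i))%E.
Proof. exact: tmeas_box. Qed.

End diag_integral.

Lemma ae_forall_fin (d : measure_display) (T : measurableType d) (R : realType)
    (m : {measure set T -> \bar R}) (I : finType) (Q : I -> T -> Prop) :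
  (forall i, {ae m, forall x, Q i x}) -> {ae m, forall x, forall i, Q i x}.
Proof.
move=> h; suff : forall s : seq I, {ae m, forall x, forall i, i \in s -> Q i x}.
  by move=> /(_ (enum I)); apply: filterS => x hx i; apply: hx; rewrite mem_enum.
elim=> [|i s IH]; first by apply: filterE => x i; rewrite in_nil.
apply: filterS2 (h i) IH => x Qi hx i'; rewrite in_cons => /orP[/eqP ->//|].
exact: hx.
Qed.

(** * Products of values of the random measure *)

Section random_measure.
Context (R : realType) (k : space_kind) (nu d : nat).
Local Notation E := (espace R k nu).
Variables (mu : {sigma_finite_measure set E -> \bar R})
  (G : 'I_d -> 'I_d -> set E -> R[i]) (g : 'I_d -> 'I_d -> E -> R[i]).
Hypothesis hG : matrix_spectral_measure G mu g.
Context (dO : measure_display) (O : measurableType dO) (P : probability O R).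
Variable Z : 'I_d -> set E -> O -> R[i].
Hypothesis hZ : random_spectral_measure P G Z.
Local Notation EC := (EC P).
Local Notation callmom := (callmom P).

(** The linear class of centered Gaussian variables to which Wick's theorem is applied;
    [rsm_gaussian] speaks exactly of its elements. *)
Definition Zspace (X : O -> R) := exists (m : nat) (j : 'I_m -> 'I_d)
  (A : 'I_m -> set E) (a b : 'I_m -> R), (forall i, bborel (A i)) /\
  X = (fun w => \sum_(i < m) (a i * Re (Z (j i) (A i) w) + b i * Im (Z (j i) (A i) w))).

Lemma Zspace0 : Zspace (fun=> 0).
Proof.
exists 0%N, (ffun0 (card_ord 0)), (fun=> set0), (fun=> 0), (fun=> 0).
split; first by case.
by apply/funext => w; rewrite big_ord0.
Qed.

Lemma Zspace_lin c X Y : Zspace X -> Zspace Y -> Zspace (fun w => X w + c * Y w).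
Proof.
move=> [m [j [A [a [b [bA ->]]]]]] [m' [j' [A' [a' [b' [bA' ->]]]]]].
pose pk T (f : 'I_m -> T) (f' : 'I_m' -> T) (i : 'I_(m + m')) :=
  match fintype.split i with inl x => f x | inr y => f' y end.
exists (m + m')%N, (pk _ j j'), (pk _ A A'), (pk _ a (fun i => c * a' i)),
  (pk _ b (fun i => c * b' i)); split.
  by move=> i; rewrite /pk; case: (fintype.split i).
apply/funext => w; rewrite big_split_ord/= mulr_sumr; congr (_ + _).
  by apply: eq_bigr => i _; rewrite /pk; rewrite (unsplitK (inl _ i)).
apply: eq_bigr => i _; rewrite /pk; rewrite (unsplitK (inr _ i)).
by rewrite mulrDr !mulrA.
Qed.

Lemma Zspace_Re j A : bborel A -> Zspace (fun w => Re (Z j A w)).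
Proof.
move=> bA; exists 1%N, (fun=> j), (fun=> A), (fun=> 1), (fun=> 0); split => //.
by apply/funext => w; rewrite big_ord1 mul1r mul0r addr0.
Qed.

Lemma Zspace_Im j A : bborel A -> Zspace (fun w => Im (Z j A w)).
Proof.
move=> bA; exists 1%N, (fun=> j), (fun=> A), (fun=> 0), (fun=> 1); split => //.
by apply/funext => w; rewrite big_ord1 mul1r mul0r add0r.
Qed.

Lemma Zspace_meas X : Zspace X -> measurable_fun setT X.
Proof.
move=> [m [j [A [a [b [bA ->]]]]]]; apply: measurable_sum => i.
have [m1 m2] := rsm_measurable hZ (j i) (bA i).
by apply: measurable_funD; apply: measurable_funM.
Qed.

Lemma Zspace_gauss X : Zspace X -> gaussian P X.
Proof.
by move=> [m [j [A [a [b [bA ->]]]]]]; exact: (rsm_gaussian hZ j a b bA).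
Qed.

Lemma CGs_Z j A : bborel A -> CGs Zspace (Z j A).
Proof. by move=> bA; split; [exact: Zspace_Re|exact: Zspace_Im]. Qed.

Lemma callmom_Z j A : bborel A -> callmom (Z j A).
Proof. by move=> bA; exact: (CGs_callmom Zspace_meas Zspace_gauss (CGs_Z j bA)). Qed.

Lemma Zspace_centered X : Zspace X -> \int[P]_w X w = 0.
Proof.
move=> [m [j [A [a [b [bA ->]]]]]].
have aR i := (callmom_Z (j i) (bA i)).1.
have aI i := (callmom_Z (j i) (bA i)).2.
rewrite Ex_sum; last by move=> i _; apply: allmomD; exact: allmomZ.
apply: big1 => i _; rewrite ExD; [|exact: allmomZ..].
have := rsm_centered hZ (j i) (bA i); rewrite cintegral_EC; last exact: callmom_Z.
by rewrite !ExZ// => -[-> ->]; rewrite !mulr0 addr0.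
Qed.

Lemma Z_opp j A : bborel A -> {ae P, forall w, (Z j A w)^* = Z j (set_opp A) w}.
Proof.
by move=> bA; apply: filterS (rsm_even hZ j bA) => w ->; rewrite conjcK.
Qed.

(** Z(B) is the conjugate of Z(-B), so a product without conjugation is a covariance with the
    opposite set. *)
Lemma EC_ZZ j j' A B : bborel A -> bborel B ->
  EC (fun w => Z j A w * Z j' B w) = G j j' (A `&` set_opp B).
Proof.
move=> bA bB; have bB' := bborel_opp bB.
rewrite -(rsm_covariance hZ)// cintegral_EC; last first.
  by apply: callmomM; [exact: callmom_Z|apply: callmomJ; exact: callmom_Z].
apply: ae_eq_EC.
- by apply: callmom_meas; apply: callmomM; exact: callmom_Z.
- by apply: callmom_meas; apply: callmomM; [|apply: callmomJ]; exact: callmom_Z.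
- by apply: filterS (rsm_even hZ j' bB) => w ->.
Qed.

Lemma G0 j j' : G j j' set0 = 0.
Proof. by rewrite (msm_dominated hG)//; exact: bborel0. Qed.

Lemma Z_fin_add (I : finType) j (A : I -> set E) : (forall i, bborel (A i)) ->
  (forall i i', i != i' -> A i `&` A i' = set0) ->
  {ae P, forall w, Z j (\bigcup_(i in setT) A i) w = \sum_i Z j (A i) w}.
Proof.
move=> bA tA.
have t : trivIset setT (fun s : 'I_#|I| => A (enum_val s)).
  by apply/trivIsetP => s s' _ _ ss'; apply: tA; rewrite (inj_eq enum_val_inj).
have := rsm_additive hZ j (fun s => bA (enum_val s)) t.
apply: filterS => w; rewrite (_ : \bigcup_s _ = \bigcup_(i in setT) A i).
  by move=> <-; rewrite -(big_enum_val (A := I) (fun i => Z j (A i) w)).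
apply/seteqP; split => x [i _ Ai]; first by exists (enum_val i).
by exists (enum_rank i) => //; rewrite enum_rankK.
Qed.

(** This is the additivity over an empty family. *)
Lemma Z0 j : {ae P, forall w, Z j set0 w = 0}.
Proof.
have := @Z_fin_add 'I_0 j (fun=> set0) (fun=> bborel0 _ _ _) (fun i => match i with Ordinal _ h => match notF h with end end).
apply: filterS => w; rewrite big_ord0 (_ : \bigcup_(_ in _) _ = set0)//.
by apply/seteqP; split => // x [].
Qed.

Definition Zprod n (js : n.-tuple 'I_d) (A : 'I_n -> set E) (w : O) : R[i] :=
  \prod_(l < n) Z (tnth js l) (A l) w.

Lemma callmom_Zprod n (js : n.-tuple 'I_d) A : (forall l, bborel (A l)) ->
  callmom (Zprod js A).
Proof. by move=> bA; apply: callmom_prod => l _; exact: callmom_Z. Qed.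

(** By [EC_ZZ] the second clause, where l = l' is allowed, makes E[Z(A_l) Z(A_l')] vanish for all
    pairs of sides, a side with itself included. *)
Definition good_rect n (A : 'I_n -> set E) := [/\ forall l, bborel (A l),
  forall l l', A l `&` set_opp (A l') = set0 &
  forall l l', l != l' -> A l `&` A l' = set0].

(** The 2 n factors of the product over A times the conjugated product over B: an index with [true]
    is a factor over A, one with [false] is a conjugated factor over B, rewritten without
    conjugation at the opposite set. *)
Let Zp n (js : n.-tuple 'I_d) (A B : 'I_n -> set E) (i : bool * 'I_n) :=
  Z (tnth js i.2) (if i.1 then A i.2 else set_opp (B i.2)).

Let Zp_CGs n (js : n.-tuple 'I_d) A B i : (forall l, bborel (A l)) ->
  (forall l, bborel (B l)) -> CGs Zspace (@Zp n js A B i).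
Proof.
move=> bA bB; apply: CGs_Z; case: i.1 => //; exact: bborel_opp.
Qed.

Let Zp_cov n (js : n.-tuple 'I_d) A B a i : (forall l, bborel (A l)) ->
  (forall l, bborel (B l)) ->
  EC (fun w => Z (tnth js a) (A a) w * @Zp n js A B i w) =
  G (tnth js a) (tnth js i.2) (A a `&` (if i.1 then set_opp (A i.2) else B i.2)).
Proof.
move=> bA bB; rewrite EC_ZZ//; last by case: i.1 => //; exact: bborel_opp.
by case: i.1; rewrite ?set_oppK.
Qed.

Let Zp_conj n (js : n.-tuple 'I_d) A B : (forall l, bborel (A l)) ->
  (forall l, bborel (B l)) ->
  EC (fun w => Zprod js A w * (Zprod js B w)^*) =
  EC (fun w => \prod_i @Zp n js A B i w).
Proof.
move=> bA bB; apply: ae_eq_EC.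
- apply: callmom_meas; apply: callmomM; first exact: callmom_Zprod.
  by apply: callmomJ; exact: callmom_Zprod.
- apply: callmom_meas; apply: callmom_prod => i _.
  exact: (CGs_callmom Zspace_meas Zspace_gauss (Zp_CGs js i bA bB)).
have h : {ae P, forall w, forall l, (Z (tnth js l) (B l) w)^* = Z (tnth js l) (set_opp (B l)) w}.
  by apply: ae_forall_fin => l; exact: Z_opp.
apply: filterS h => w h.
rewrite rmorph_prod (eq_bigr _ (fun l _ => h l)) -big_split/=.
rewrite -(pair_bigA _ (fun b l => Zp js A B (b, l) w))/= big_bool/= -big_split/=.
by [].
Qed.

(** In Wick's formula with Z(A_a) singled out every pairing is zero: with another side of A because
    A is good, with a conjugated factor because A_a misses all B_l. *)
Lemma Zprod_orth n (js : n.-tuple 'I_d) (A B : 'I_n -> set E) a :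
  good_rect A -> (forall l, bborel (B l)) -> (forall l, A a `&` B l = set0) ->
  EC (fun w => Zprod js A w * (Zprod js B w)^*) = 0.
Proof.
move=> [bA A1 A2] bB AB; rewrite Zp_conj//.
under eq_EC => w do rewrite (bigD1 (true, a))//=.
rewrite (wick Zspace_meas Zspace_gauss Zspace_centered Zspace0 Zspace_lin
  (fun i => i != (true, a)) (CGs_Z _ (bA a)) (fun i => Zp_CGs js i bA bB)).
apply: big1 => -[b l] ne; rewrite Zp_cov//; case: b ne => /= ne.
  by rewrite A1 G0 mul0r.
by rewrite AB G0 mul0r.
Qed.

(** The factor (true, a) has a nonzero pairing only with (false, a). Removing both leaves the same
    expression for a smaller index set, whence the induction on S. *)
Lemma Zprod_norm n (js : n.-tuple 'I_d) (A : 'I_n -> set E) : good_rect A ->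
  EC (fun w => Zprod js A w * (Zprod js A w)^*) = \prod_(l < n) G (tnth js l) (tnth js l) (A l).
Proof.
move=> [bA A1 A2]; rewrite Zp_conj//.
suff h : forall (S : {set 'I_n}),
    EC (fun w => \prod_(i : bool * 'I_n | i.2 \in S) Zp js A A i w) =
    \prod_(l in S) G (tnth js l) (tnth js l) (A l).
  have := h [set: 'I_n]%SET.
  rewrite (eq_bigl predT) => [<-|l]; last by rewrite inE.
  by apply: eq_EC => w; apply: eq_bigl => i; rewrite inE.
move=> S; have [m] := ubnP #|S|; elim: m S => // m IH S; rewrite ltnS => Sm.
have [->|[a aS]] := set_0Vmem S.
  rewrite [RHS]big_pred0 => [|l]; last by rewrite inE.
  rewrite -[RHS](EC_cst P 1); apply: eq_EC => w.
  by rewrite big_pred0 // => i; rewrite inE.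
under eq_EC => w do rewrite (bigD1 (true, a))//=.
rewrite (wick Zspace_meas Zspace_gauss Zspace_centered Zspace0 Zspace_lin
  (fun i => (i.2 \in S) && (i != (true, a))) (CGs_Z _ (bA a)) (fun i => Zp_CGs js i bA bA)).
rewrite (bigD1 (false, a))/=; last by rewrite aS.
rewrite [X in _ + X]big1 ?addr0; last first.
  move=> [b l] /andP[/andP[/= lS ne] ne']; rewrite Zp_cov//; case: b ne ne' => /= ne ne'.
    by rewrite A1 G0 mul0r.
  have al : a != l by apply: contra_neq ne' => ->.
  by rewrite A2// G0 mul0r.
rewrite Zp_cov//= setIid (bigD1 a aS)/=; congr (_ * _).
have := IH (S :\ a); rewrite (cardsD1 a S) aS add1n in Sm => /(_ Sm).
rewrite (eq_bigl (fun l => (l \in S) && (l != a))) => [<-|l]; last by rewrite !inE andbC.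
apply: eq_EC => w; apply: eq_bigl => -[b l] /=.
rewrite !inE !xpair_eqE; case: (l == a); rewrite ?andbT ?andbF/= ?andbT//.
by case: b; rewrite /= ?andbF.
Qed.

End random_measure.

Section probability_L2.
Context (dO : measure_display) (O : measurableType dO) (R : realType).
Variable P : probability O R.
Implicit Types f h : O -> R[i].

Lemma N2_EC f : callmom P f -> N2 P f = (Re (EC P (fun w => f w * (f w)^*)))%:E.
Proof.
move=> cf; have [a1 _] := callmomM cf (callmomJ cf).
rewrite /EC /= /Rintegral fineK; last first.
  by apply: integrable_fin_num => //; exact: allmom_integrable a1.
by apply: eq_integral => w _; rewrite mul_conjc.
Qed.

Lemma N2_callmom_fin f : callmom P f -> (N2 P f < +oo)%E.
Proof. by move=> cf; rewrite N2_EC// ltry. Qed.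

Lemma EC_young f h : callmom P f -> callmom P h ->
  Re (EC P (fun w => f w * (h w)^*)) <=
  (Re (EC P (fun w => f w * (f w)^*)) + Re (EC P (fun w => h w * (h w)^*))) / 2.
Proof.
move=> cf ch; have [a1 _] := callmomM cf (callmomJ ch).
have [a2 _] := callmomM cf (callmomJ cf); have [a3 _] := callmomM ch (callmomJ ch).
rewrite /EC /= -ExD// mulrC -ExZ; last exact: allmomD.
apply: le_Rintegral => //.
- exact: allmom_integrable a1.
- by apply: allmom_integrable; apply: allmomZ; exact: allmomD.
move=> w _; rewrite !cRI.
have := sqr_ge0 (Re (f w) - Re (h w)); have := sqr_ge0 (Im (f w) - Im (h w)); lra.
Qed.

Lemma EC_conj f : callmom P f -> EC P (fun w => (f w)^*) = (EC P f)^*.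
Proof.
move=> [_ cf]; apply: complex_ext; rewrite !cRI/=; first by apply: eq_Rintegral => w _; rewrite cReJ.
by under eq_Rintegral do rewrite cImJ -mulN1r; rewrite ExZ// mulN1r.
Qed.

End probability_L2.

Section regular.
Context (R : realType) (k : space_kind) (nu d : nat).
Local Notation E := (espace R k nu).
Variables (mu : {sigma_finite_measure set E -> \bar R})
  (G : 'I_d -> 'I_d -> set E -> R[i]) (g : 'I_d -> 'I_d -> E -> R[i]).
Hypothesis hG : matrix_spectral_measure G mu g.
Context (dO : measure_display) (O : measurableType dO) (P : probability O R).
Variable Z : 'I_d -> set E -> O -> R[i].
Hypothesis hZ : random_spectral_measure P G Z.
Variables (N : nat) (D : signed_index N -> set E).
Hypothesis rD : regular_system D.

Definition sflip (i : signed_index N) : signed_index N := (~~ i.1, i.2).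

Lemma regular_bborel i : bborel (D i). Proof. by case: rD. Qed.

Lemma regular_opp i : set_opp (D i) = D (sflip i).
Proof. by case: rD => _ h _; rewrite [in LHS]h set_oppK. Qed.

Lemma regular_disj i i' : i != i' -> D i `&` D i' = set0.
Proof. by case: rD => _ _ h /eqP; exact: h. Qed.

Lemma regular_uniq i i' x : D i x -> D i' x -> i = i'.
Proof.
move=> Dx Dx'; apply/eqP; apply: contraPT Dx => /regular_disj h.
by move=> Dx; have : (D i `&` D i') x by []; rewrite h.
Qed.

Variables (n : nat) (js : n.-tuple 'I_d).

Definition gks (ks : n.-tuple (signed_index N)) : bool :=
  [forall l, forall l', (l != l') ==> ((tnth ks l).2 != (tnth ks l').2)].

Definition rectk (ks : n.-tuple (signed_index N)) (l : 'I_n) : set E := D (tnth ks l).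

Lemma gks_good ks : gks ks -> good_rect (rectk ks).
Proof.
move=> gk; split => [l|l l'|l l' ll'].
- exact: regular_bborel.
- rewrite /rectk regular_opp regular_disj//; apply/eqP => e.
  have [ll'|ll'] := eqVneq l l'.
    by move: e; rewrite ll' /sflip; case: (tnth _ _) => b i /= -[]; case: b.
  have /forallP/(_ l)/forallP/(_ l')/implyP/(_ ll') := gk.
  by rewrite e /sflip eqxx.
- rewrite /rectk regular_disj//; apply/eqP => e.
  have /forallP/(_ l)/forallP/(_ l')/implyP/(_ ll') := gk.
  by rewrite e eqxx.
Qed.

Lemma boxE (ks : n.-tuple (signed_index N)) : box D ks = [set x | forall l, rectk ks l (tnth x l)].
Proof. by []. Qed.

Lemma measurable_box (ks : n.-tuple (signed_index N)) : measurable (box D ks).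
Proof.
rewrite (_ : box _ _ = \bigcap_(i in [set: 'I_n]) [set x : n.-tuple E | rectk ks i (tnth x i)]).
  apply: fin_bigcap_measurable => // i _.
  rewrite -[X in measurable X]setTI; apply: measurable_tnth => //.
  by case: (regular_bborel (tnth ks i)).
by apply/seteqP; split=> x h i; [move=> _; exact: h|exact: (h i Logic.I)].
Qed.

Lemma box_uniq (ks ls : n.-tuple (signed_index N)) x : box D ks x -> box D ls x -> ks = ls.
Proof.
move=> h1 h2; apply: eq_from_tnth => l; exact: regular_uniq (h1 l) (h2 l).
Qed.

Definition cind (T : Type) (A : set T) (x : T) : R[i] := (\1_A x)%:C.

Definition valks (v : n.-tuple (signed_index N) -> R[i]) (x : n.-tuple E) : R[i] :=
  \sum_ks v ks * cind (box D ks) x.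

Definition Jks (v : n.-tuple (signed_index N) -> R[i]) (w : O) : R[i] :=
  \sum_ks v ks * Zprod Z js (rectk ks) w.

Lemma valks_box v ks x : box D ks x -> valks v x = v ks.
Proof.
move=> bx; rewrite /valks (bigD1 ks)//= big1 ?addr0 => [|ls ne].
  by rewrite /cind indicE mem_set// mulr1.
rewrite /cind indicE memNset ?mulr0// => bx'.
by move/eqP : ne; apply; exact: box_uniq bx' bx.
Qed.

Lemma valks_out v x : (forall ks, ~ box D ks x) -> valks v x = 0.
Proof.
by move=> h; apply: big1 => ks _; rewrite /cind indicE memNset ?mulr0.
Qed.

Lemma cmeasurable_cind (dT : measure_display) (T : measurableType dT) (A : set T) :
  measurable A -> cmeasurable (cind A).
Proof. by move=> mA; apply: cmeasurable_real; exact: measurable_indic. Qed.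

Lemma callmom_Jks v : callmom P (Jks v).
Proof.
apply: callmom_sum => ks _; apply: callmomZ; apply: (callmom_Zprod hZ) => l.
exact: regular_bborel.
Qed.

Lemma Mj_box_fin (ks : n.-tuple (signed_index N)) : (Mj hG js (box D ks) =
  (\prod_(l < n) fine (nuj hG (tnth js l) (rectk ks l)))%:E)%E.
Proof.
rewrite boxE Mj_box; last by move=> l; case: (regular_bborel (tnth ks l)).
elim/big_rec2: _ => // l x y _ ->.
rewrite EFinM fineK// ge0_fin_numE//.
by apply: nuj_fin; exact: regular_bborel.
Qed.

Lemma N2_valks v : N2 (Mj hG js) (valks v) =
  (\sum_ks normc (v ks) ^+ 2 * \prod_(l < n) fine (nuj hG (tnth js l) (rectk ks l)))%:E.
Proof.
rewrite -sumEFin.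
transitivity (\sum_ks \int[Mj hG js]_x ((normc (v ks) ^+ 2)%:E * (\1_(box D ks) x)%:E))%E.
  rewrite -ge0_integral_sum//; last 2 first.
  - move=> ks; apply: emeasurable_funM => //; apply/measurable_EFinP.
    by apply: measurable_indic; exact: measurable_box.
  - by move=> ks x _; rewrite mule_ge0// lee_fin sqr_ge0.
  apply: eq_integral => x _.
  have [[ks bx]|nb] := pselect (exists ks, box D ks x).
    rewrite (valks_box v bx) (bigD1 ks)//= big1 ?adde0 => [|ls ne].
      by rewrite indicE mem_set// mule1.
    rewrite indicE memNset ?mule0// => bx'.
    by move/eqP : ne; apply; exact: box_uniq bx' bx.
  have nb' ks : ~ box D ks x by move=> bx; apply: nb; exists ks.
  rewrite (valks_out v nb') Normc.normc0 expr0n/= big1// => ks _.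
  by rewrite indicE memNset ?mule0.
apply: eq_bigr => ks _; rewrite [RHS]EFinM -Mj_box_fin ge0_integralZl//.
- by rewrite integral_indic ?setIT//; exact: measurable_box.
- by apply/measurable_EFinP; apply: measurable_indic; exact: measurable_box.
- by rewrite lee_fin sqr_ge0.
Qed.

Lemma EC_Zprod_norm ks : gks ks ->
  Re (EC P (fun w => Zprod Z js (rectk ks) w * (Zprod Z js (rectk ks) w)^*)) =
  \prod_(l < n) fine (nuj hG (tnth js l) (rectk ks l)).
Proof.
move=> /gks_good gk; rewrite (Zprod_norm hG hZ js gk).
rewrite (eq_bigr (fun l => (fine (nuj hG (tnth js l) (rectk ks l)))%:C)).
  by rewrite -rmorph_prod.
by move=> l _; rewrite (G_diag hG)//; exact: regular_bborel.
Qed.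

(* Products over ks and ls are orthogonal unless rel ks ls. *)
Let rel (ks ls : n.-tuple (signed_index N)) : bool :=
  [forall a, exists b, tnth ks a == tnth ls b] &&
  [forall a, exists b, tnth ls a == tnth ks b].

Let rel_sym ks ls : rel ks ls = rel ls ks. Proof. by rewrite /rel andbC. Qed.

(** A tuple that uses only entries of ks is ks composed with a self-map of ['I_n]. *)
Let card_rel ks : (#|[pred ls | rel ks ls]| <= n ^ n)%N.
Proof.
pose F (t : {ffun 'I_n -> 'I_n}) : n.-tuple (signed_index N) := [tuple tnth ks (t l) | l < n].
have -> : (n ^ n = #|{ffun 'I_n -> 'I_n}|)%N by rewrite card_ffun card_ord.
apply: (leq_trans _ (leq_image_card F predT)).
apply: subset_leq_card; apply/fintype.subsetP => ls; rewrite inE => /andP[_ /forallP h].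
have hb a : {b | tnth ls a == tnth ks b} by apply: sigW; exact/existsP.
apply/fintype.imageP; exists [ffun a => sval (hb a)] => //.
apply: eq_from_tnth => a; rewrite tnth_mktuple ffunE.
by case: (hb a) => b /= /eqP.
Qed.

(** The double sum of covariances is nearly diagonal: each ks meets at most n^n tuples ls, and each
    covariance is at most half the sum of the two variances. The factor n^n is a crude version of
    n!. *)
Lemma J_bound v : (forall ks, v ks != 0 -> gks ks) ->
  (N2 P (Jks v) <= (n ^ n)%:R%:E * N2 (Mj hG js) (valks v))%E.
Proof.
move=> vg.
pose Y ks := fun w => v ks * Zprod Z js (rectk ks) w.
have cY ks : callmom P (Y ks).
  by apply: callmomZ; apply: (callmom_Zprod hZ) => l; exact: regular_bborel.
pose e ks := Re (EC P (fun w => Y ks w * (Y ks w)^*)).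
have eE ks : e ks = normc (v ks) ^+ 2 * \prod_(l < n) fine (nuj hG (tnth js l) (rectk ks l)).
  have [v0|/vg gk] := eqVneq (v ks) 0.
    rewrite v0 Normc.normc0 expr0n mul0r /e /Y v0.
    rewrite (eq_EC _ (g := fun=> 0)) ?EC_cst// => w.
    by rewrite !mul0r.
  rewrite /e /Y (eq_EC _ (g := fun w => (normc (v ks) ^+ 2)%:C *
    (Zprod Z js (rectk ks) w * (Zprod Z js (rectk ks) w)^*))); last first.
    by move=> w; rewrite -mul_conjc rmorphM; ring.
  rewrite ECZ; last first.
    apply: callmomM; [|apply: callmomJ]; apply: (callmom_Zprod hZ) => l; exact: regular_bborel.
  by rewrite cRe_scale EC_Zprod_norm.
have e0 ks : 0 <= e ks.
  by rewrite eE mulr_ge0 ?sqr_ge0// prodr_ge0// => l _; rewrite fine_ge0.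
rewrite N2_EC; last exact: callmom_Jks.
rewrite N2_valks -EFinM lee_fin -(eq_bigr _ (fun ks _ => eE ks)).
have -> : Re (EC P (fun w => Jks v w * (Jks v w)^*)) =
    \sum_ks \sum_ls Re (EC P (fun w => Y ks w * (Y ls w)^*)).
  rewrite (eq_EC _ (g := fun w => \sum_ks \sum_ls Y ks w * (Y ls w)^*)).
    rewrite EC_sum ?cRe_sum => [|ks _].
      apply: eq_bigr => ks _; rewrite EC_sum ?cRe_sum// => ls _.
      by apply: callmomM => //; exact: callmomJ.
    by apply: callmom_sum => ls _; apply: callmomM => //; exact: callmomJ.
  move=> w; rewrite /Jks mulr_suml; apply: eq_bigr => ks _.
  by rewrite rmorph_sum mulr_sumr.
have orth ks ls : ~~ rel ks ls -> Re (EC P (fun w => Y ks w * (Y ls w)^*)) = 0.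
  have key ks' ls' : gks ks' -> ~~ [forall a, exists b, tnth ks' a == tnth ls' b] ->
      EC P (fun w => Zprod Z js (rectk ks') w * (Zprod Z js (rectk ls') w)^*) = 0.
    move=> gk; rewrite negb_forall => /existsP[a]; rewrite negb_exists => /forallP h.
    apply: (Zprod_orth hG hZ js (gks_good gk) (a := a)).
      by move=> l; exact: regular_bborel.
    by move=> l; rewrite /rectk regular_disj.
  have cZ ks' : callmom P (Zprod Z js (rectk ks')).
    by apply: (callmom_Zprod hZ) => l; exact: regular_bborel.
  have EY : EC P (fun w => Y ks w * (Y ls w)^*) = v ks * (v ls)^* *
     EC P (fun w => Zprod Z js (rectk ks) w * (Zprod Z js (rectk ls) w)^*).
    rewrite -ECZ; last by apply: callmomM => //; exact: callmomJ.
    by apply: eq_EC => w; rewrite /Y rmorphM; ring.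
  rewrite EY => nr.
  have [->|/vg gk] := eqVneq (v ks) 0; first by rewrite !mul0r.
  have [->|/vg gl] := eqVneq (v ls) 0; first by rewrite rmorph0 mulr0 mul0r.
  move: nr; rewrite negb_and => /orP[h|h]; first by rewrite key// mulr0.
  have := key _ _ gl h; rewrite -[X in X -> _]/(_ = 0).
  rewrite (_ : EC P (fun w => Zprod Z js (rectk ks) w * _) =
     (EC P (fun w => Zprod Z js (rectk ls) w * (Zprod Z js (rectk ks) w)^*))^*).
    by move=> ->; rewrite rmorph0 mulr0.
  rewrite -EC_conj; last by apply: callmomM => //; exact: callmomJ.
  by apply: eq_EC => w; rewrite [RHS]rmorphM mulrC; congr (_ * _); rewrite [RHS]conjcK.
apply: (@le_trans _ _ (\sum_ks \sum_(ls | rel ks ls) (e ks + e ls) / 2)).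
  apply: ler_sum => ks _; rewrite [leRHS]big_mkcond/=; apply: ler_sum => ls _.
  case: ifPn => [_|h]; first exact: EC_young.
  by rewrite le_eqVlt; apply/orP; left; apply/eqP; exact: orth h.
have half : \sum_ks \sum_(ls | rel ks ls) e ks <= (n ^ n)%:R * \sum_ks e ks.
  rewrite mulr_sumr; apply: ler_sum => ks _; rewrite sumr_const -[leLHS]mulr_natl.
  by rewrite ler_wpM2r// ler_nat card_rel.
have -> : \sum_ks \sum_(ls | rel ks ls) (e ks + e ls) / 2 =
   (\sum_ks \sum_(ls | rel ks ls) e ks + \sum_ks \sum_(ls | rel ks ls) e ls) / 2.
  rewrite -big_split/= mulr_suml; apply: eq_bigr => ks _.
  by rewrite -big_split/= mulr_suml.
have -> : \sum_ks \sum_(ls | rel ks ls) e ls = \sum_ks \sum_(ls | rel ks ls) e ks.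
  rewrite (exchange_big_dep predT)//=; apply: eq_bigr => ks _.
  by apply: eq_bigl => ls; rewrite rel_sym.
lra.
Qed.

End regular.

(** * The half space and common refinements into regular systems *)

Section half_space.
Context (R : realType) (k : space_kind) (nu : nat).
Local Notation E := (espace R k nu).

(* antisymmetric coordinate, vanishing exactly at the fixed points of axis_opp *)
Definition acoord (x : E) (i : 'I_nu) : R :=
  val (tnth x i) - val (axis_opp (tnth x i)).

Lemma acoord_opp x i : acoord (pt_opp x) i = - acoord x i.
Proof. by rewrite /acoord tnth_pt_opp axis_oppK opprB. Qed.

Lemma acoord_eq0 x : (forall i, acoord x i = 0) -> pt_opp x = x.
Proof.
move=> h; apply: eq_from_tnth => i; rewrite tnth_pt_opp; apply: val_inj.
by have /eqP := h i; rewrite subr_eq0 => /eqP.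
Qed.

Lemma measurable_acoord i : measurable_fun setT (acoord^~ i).
Proof.
apply: measurable_funB.
  by apply: measurableT_comp; [exact: measurable_axis_val|exact: measurable_tnth].
apply: measurableT_comp; first exact: measurable_axis_val.
by apply: measurableT_comp; [exact: measurable_axis_opp|exact: measurable_tnth].
Qed.

(* E is the disjoint union of half_space, its opposite and the fixed points of the
   opposite. *)
Definition half_space : set E := [set x | exists i : 'I_nu,
  0 < acoord x i /\ forall i' : 'I_nu, (i' < i)%N -> acoord x i' = 0].

Lemma half_space_opp x : half_space x -> ~ half_space (pt_opp x).
Proof.
move=> [i [xi xi0]] [j [xj xj0]]; rewrite acoord_opp oppr_gt0 in xj.
have [ij|ji|ij] := ltngtP i j.
- by have := xj0 _ ij; rewrite acoord_opp => /eqP; rewrite oppr_eq0 gt_eqF.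
- by move: xj; rewrite xi0// ltxx.
- have e : i = j by exact: val_inj.
  by move: xi xj; rewrite e => /lt_trans h /h; rewrite ltxx.
Qed.

Lemma half_space_cover x : pt_opp x <> x -> half_space x \/ half_space (pt_opp x).
Proof.
move=> xx; have [i0 hi0] : exists i, acoord x i != 0.
  apply: contrapT => h; apply: xx; apply: acoord_eq0 => i; apply/eqP.
  by apply: contrapT => /negP hi; apply: h; exists i.
pose i := [arg min_(i < i0 | acoord x i != 0) (i : nat)].
have [hi imin] : acoord x i != 0 /\ forall j, acoord x j != 0 -> (i <= j)%N.
  by rewrite /i; case: arg_minnP.
have z (j : 'I_nu) : (j < i)%N -> acoord x j = 0.
  by move=> ji; apply/eqP; apply: contraTT ji => /imin; rewrite -leqNgt.
have [xi|xi|xi] := ltgtP (acoord x i) 0.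
- right; exists i; rewrite acoord_opp oppr_gt0; split => // j /z.
  by rewrite acoord_opp => ->; rewrite oppr0.
- by left; exists i.
- by move: hi; rewrite xi eqxx.
Qed.

Lemma measurable_half_space : measurable half_space.
Proof.
rewrite (_ : half_space = \bigcup_(i in [set: 'I_nu])
  ([set x | 0 < acoord x i] `&`
   \bigcap_(i' in [set i' : 'I_nu | (i' < i)%N]) [set x | acoord x i' = 0])).
  apply: fin_bigcup_measurable => // i _; apply: measurableI.
    rewrite (_ : [set x | _] = setT `&` (acoord^~ i) @^-1` [set` `]0, +oo[ ]).
      by apply: measurable_acoord => //; exact: measurable_itv.
    by rewrite setTI; apply/seteqP; split => x /=; rewrite in_itv/= andbT.
  apply: fin_bigcap_measurable => // i' _.
  rewrite (_ : [set x | _] = setT `&` (acoord^~ i') @^-1` [set 0]).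
    by apply: measurable_acoord => //; exact: measurable_set1.
  by rewrite setTI.
apply/seteqP; split => x.
  by move=> [i [h1 h2]]; exists i => //; split.
by move=> [i _ [h1 h2]]; exists i; split => // i' h; exact: h2.
Qed.

End half_space.

Section refinement.
Context (R : realType) (k : space_kind) (nu : nat).
Local Notation E := (espace R k nu).
Local Notation hs := (@half_space R k nu).

Definition adapted N (D : signed_index N -> set E) (A : set E) :=
  forall x, A x -> exists i, D i x /\ D i `<=` A.

(** The cells with positive sign are the traces on the half space of the atoms generated by the sets
    and their opposites; the others are their opposites. As a set that misses its opposite has no
    point with -x = x, each of its points x has x or -x in the half space, hence lies in a cell. *)
Lemma refinement (K : finType) (C : K -> set E) :
  (forall c, bborel (C c)) -> (forall c, C c `&` set_opp (C c) = set0) ->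
  exists N (D : signed_index N -> set E), regular_system D /\
    forall c, adapted D (C c).
Proof.
move=> bC CC.
pose C2 (c : bool * K) := if c.1 then C c.2 else set_opp (C c.2).
have bC2 c : bborel (C2 c) by rewrite /C2; case: c.1 => //; exact: bborel_opp.
(* A nonempty s puts the atom inside some [C2 c], which makes it bounded; the complement of all
   these sets need not be. *)
pose atom (s : {set bool * K}) : set E :=
  hs `&` [set x | s != finset.set0 /\ forall c, C2 c x <-> c \in s].
have mH := @measurable_half_space R k nu.
have batom s : bborel (atom s).
  have [->|[c cs]] := set_0Vmem s.
    rewrite (_ : atom _ = set0); first exact: bborel0.
    by apply/seteqP; split => // x [_ []]; rewrite eqxx.
  have -> : atom s = C2 c `&` (hs `&`
      \bigcap_(c in [set: bool * K]) (if c \in s then C2 c else ~` C2 c)).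
    apply/seteqP; split => x.
      move=> [hx [s0 h]]; split; first by apply/h.
      split => // c' _; case: ifPn => [/h//|].
      by move=> /negP ns /h.
    move=> [_ [hx h]]; split => //; split; first by apply/set0Pn; exists c.
    move=> c'; have := h c' Logic.I; case: ifPn => // _ ?; split => //.
  apply: bborelI => //; apply: measurableI => //.
  apply: fin_bigcap_measurable => // c' _.
  by have [m _] := bC2 c'; case: ifP => // _; exact: measurableC.
pose D (i : bool * 'I_#|{set bool * K}|) :=
  if i.1 then atom (enum_val i.2) else set_opp (atom (enum_val i.2)).
exists #|{set bool * K}|, D; split.
  split.
  - by move=> i; rewrite /D; case: i.1 => //; exact: bborel_opp.
  - by move=> -[[] i]; rewrite /D /= ?set_oppK.
  - move=> [b i] [b' i'] ne; rewrite /D /=; apply/seteqP; split => // x [h h'].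
    have ss (y : E) : atom (enum_val i) y -> atom (enum_val i') y -> i = i'.
      move=> [_ [_ h1]] [_ [_ h2]]; apply: enum_val_inj; apply/setP => c.
      by apply/idP/idP => /[dup] ? /[dup] => [/h1/h2|/h2/h1].
    move: h h'; case: b ne => ne; case: b' ne => ne h h'.
    + by apply: ne; rewrite (ss _ h h').
    + by case: h => h _; case: h' => /half_space_opp; rewrite pt_oppK.
    + by case: h => h _; case: h' => /half_space_opp h' _; apply: h'.
    + by apply: ne; rewrite (ss _ h h').
pose sx (x : E) : {set bool * K} := [set c | `[< C2 c x >]]%SET.
have sxP x c : c \in sx x <-> C2 c x by rewrite inE; split => /asboolP.
have C2_opp c x : C2 c (pt_opp x) <-> C2 (~~ c.1, c.2) x.
  by case: c => -[] c; rewrite /C2 /= /set_opp /= ?pt_oppK.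
move=> c x Cx.
have xx : pt_opp x <> x.
  move=> e; have h : (C c `&` set_opp (C c)) x by split => //; rewrite /set_opp /= e.
  by rewrite CC in h.
have key y b : hs y -> C2 (b, c) y -> atom (sx y) y /\ atom (sx y) `<=` C2 (b, c).
  move=> hy Cy; split.
    split => //; split; first by apply/set0Pn; exists (b, c); apply/sxP.
    by move=> c'; apply: iff_sym; exact: sxP.
  by move=> z [_ [_ h]]; apply/h/sxP.
have [hx|hx] := half_space_cover xx.
  have [h1 h2] := key x true hx Cx.
  by exists (true, enum_rank (sx x)); rewrite /D /= enum_rankK.
have [|h1 h2] := key (pt_opp x) false hx; first by rewrite /C2 /= /set_opp /= pt_oppK.
exists (false, enum_rank (sx (pt_opp x))); rewrite /D /= enum_rankK; split => //.
by move=> z hz; have := h2 _ hz; rewrite /C2 /= /set_opp /= pt_oppK.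
Qed.

End refinement.

Lemma prod_sum_tuple (A : comNzRingType) (n : nat) (S : finType) (F : 'I_n -> S -> A) :
  \prod_(l < n) \sum_s F l s = \sum_(t : n.-tuple S) \prod_(l < n) F l (tnth t l).
Proof.
rewrite bigA_distr_bigA (reindex (fun t : n.-tuple S => [ffun l => tnth t l])) /=.
  by apply: eq_bigr => t _; apply: eq_bigr => l _; rewrite ffunE.
exists (fun f : {ffun 'I_n -> S} => [tuple f l | l < n]) => t _.
  by apply: eq_from_tnth => l; rewrite tnth_mktuple ffunE.
by apply/ffunP => l; rewrite ffunE tnth_mktuple.
Qed.

(** * Formal sums of rectangles *)

Section formal_sums.
Context (R : realType) (k : space_kind) (nu d : nat).
Local Notation E := (espace R k nu).
Variables (mu : {sigma_finite_measure set E -> \bar R})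
  (G : 'I_d -> 'I_d -> set E -> R[i]) (g : 'I_d -> 'I_d -> E -> R[i]).
Hypothesis hG : matrix_spectral_measure G mu g.
Context (dO : measure_display) (O : measurableType dO) (P : probability O R).
Variable Z : 'I_d -> set E -> O -> R[i].
Hypothesis hZ : random_spectral_measure P G Z.

(** Kept as an expression rather than a function, so that [fJ] can be read off its terms. That [fJ]
    depends on [fval] alone, up to a null set, comes afterwards from [fJ_bound] applied to a
    difference [fsub]. *)
Record fsum (n : nat) := FSum {
  fidx : finType ; fcf : fidx -> R[i] ; frc : fidx -> 'I_n -> set E }.

Definition fgood n (e : fsum n) := forall a, good_rect (@frc n e a).

Definition fval n (e : fsum n) (x : n.-tuple E) : R[i] :=
  \sum_a fcf a * \prod_(l < n) cind R (@frc n e a l) (tnth x l).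

Definition fJ n (js : n.-tuple 'I_d) (e : fsum n) (w : O) : R[i] :=
  \sum_a fcf a * Zprod Z js (@frc n e a) w.

Definition fadd n (e e' : fsum n) : fsum n :=
  @FSum n (fidx e + fidx e')%type
    (fun a => match a with inl a => fcf a | inr a => fcf a end)
    (fun a => match a with inl a => frc a | inr a => frc a end).

Definition fscale n (c : R[i]) (e : fsum n) : fsum n :=
  @FSum n (fidx e) (fun a => c * fcf a) (@frc n e).

Definition fsub n (e e' : fsum n) := fadd e (fscale (-1) e').

Lemma fgood_add n (e e' : fsum n) : fgood e -> fgood e' -> fgood (fadd e e').
Proof. by move=> ge ge' [a|a]; [exact: ge|exact: ge']. Qed.

Lemma fgood_scale n c (e : fsum n) : fgood e -> fgood (fscale c e).
Proof. by move=> ge a; exact: ge. Qed.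

Lemma fgood_sub n (e e' : fsum n) : fgood e -> fgood e' -> fgood (fsub e e').
Proof. by move=> ge ge'; apply: fgood_add => //; exact: fgood_scale. Qed.

Lemma fval_add n (e e' : fsum n) x : fval (fadd e e') x = fval e x + fval e' x.
Proof. by rewrite /fval big_sumType. Qed.

Lemma fval_scale n c (e : fsum n) x : fval (fscale c e) x = c * fval e x.
Proof. by rewrite /fval mulr_sumr; apply: eq_bigr => a _; rewrite mulrA. Qed.

Lemma fval_sub n (e e' : fsum n) x : fval (fsub e e') x = fval e x - fval e' x.
Proof. by rewrite fval_add fval_scale mulN1r. Qed.

Lemma fJ_add n js (e e' : fsum n) w : fJ js (fadd e e') w = fJ js e w + fJ js e' w.
Proof. by rewrite /fJ big_sumType. Qed.

Lemma fJ_scale n js c (e : fsum n) w : fJ js (fscale c e) w = c * fJ js e w.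
Proof. by rewrite /fJ mulr_sumr; apply: eq_bigr => a _; rewrite mulrA. Qed.

Lemma fJ_sub n js (e e' : fsum n) w : fJ js (fsub e e') w = fJ js e w - fJ js e' w.
Proof. by rewrite fJ_add fJ_scale mulN1r. Qed.

Lemma good_bborel n (A : 'I_n -> set E) l : good_rect A -> bborel (A l).
Proof. by case. Qed.

Lemma good_measurable n (A : 'I_n -> set E) l : good_rect A -> measurable (A l).
Proof. by move=> /(good_bborel l)[]. Qed.

Lemma cmeasurable_tnth_cind n (A : set E) (l : 'I_n) : measurable A ->
  cmeasurable (fun x : n.-tuple E => cind R A (tnth x l)).
Proof.
move=> mA; apply: (cmeasurable_comp (cmeasurable_cind R mA)).
exact: measurable_tnth.
Qed.

Lemma cmeasurable_fval n (e : fsum n) : fgood e -> cmeasurable (fval e).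
Proof.
move=> ge; apply: cmeasurable_sum => a _; apply: cmeasurableZ.
apply: cmeasurable_prod => l _; apply: cmeasurable_tnth_cind.
exact: good_measurable (ge a).
Qed.

Lemma callmom_fJ n js (e : fsum n) : fgood e -> callmom P (fJ js e).
Proof.
move=> ge; apply: callmom_sum => a _; apply: callmomZ; apply: (callmom_Zprod hZ).
by move=> l; exact: good_bborel (ge a).
Qed.

Section adapted_system.
Variables (N : nat) (D : signed_index N -> set E).
Hypothesis rD : regular_system D.

(** An empty cell would be included in every side and could produce nonzero coefficients on the
    diagonals, contrary to [fcoef_gks]. *)
Definition incl (A : set E) (i : signed_index N) : bool := `[< D i !=set0 /\ D i `<=` A >].

Lemma cind_incl (A : set E) x : adapted D A ->
  cind R A x = \sum_i (incl A i)%:R * cind R (D i) x.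
Proof.
move=> aA; rewrite /cind; have [Ax|nAx] := pselect (A x).
  have [i [Dix DiA]] := aA _ Ax.
  rewrite (bigD1 i)//= big1 => [|i' ne].
    rewrite !indicE !mem_set// addr0 /incl asboolT ?mulr1//.
    by split => //; exists x.
  rewrite [\1_(D i') x]indicE memNset ?mulr0// => Di'x.
  by move/eqP : ne; apply; exact (regular_uniq rD Di'x Dix).
rewrite indicE memNset// big1// => i _.
have [Dix|nDix] := pselect (D i x).
  rewrite /incl asboolF ?mul0r// => -[_ DiA].
  by apply: nAx; exact: DiA.
by rewrite indicE memNset// mulr0.
Qed.

Lemma Z_incl j (A : set E) : bborel A -> adapted D A ->
  {ae P, forall w, Z j A w = \sum_i (incl A i)%:R * Z j (D i) w}.
Proof.
move=> bA aA; pose F i := if incl A i then D i else set0.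
have bD i : bborel (D i) by exact: regular_bborel rD i.
have bF i : bborel (F i) by rewrite /F; case: ifP => // _; exact: bborel0.
have tF i i' : i != i' -> F i `&` F i' = set0.
  move=> ii'; rewrite /F; case: ifP; case: ifP => _ _; rewrite ?set0I ?setI0//.
  exact: regular_disj rD _ _ ii'.
have := Z_fin_add hZ j bF tF.
apply: filterS2 (Z0 hZ j) => w Z0w; rewrite (_ : \bigcup_(i in setT) F i = A).
  move=> ->; apply: eq_bigr => i _; rewrite /F; case: ifP => _.
    by rewrite mul1r.
  by rewrite Z0w mul0r.
apply/seteqP; split => x.
  move=> [i _]; rewrite /F; case: ifPn => // /asboolP[_ h]; exact: h.
move=> Ax; have [i [Dix DiA]] := aA _ Ax; exists i => //.
by rewrite /F /incl asboolT//; split => //; exists x.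
Qed.

Definition fcoef n (e : fsum n) (ks : n.-tuple (signed_index N)) : R[i] :=
  \sum_a fcf a * \prod_(l < n) (incl (@frc n e a l) (tnth ks l))%:R.

(** If two entries of ks are equal up to sign, a point of the cell common to them would lie in two
    sides of a good rectangle, or in a side and the opposite of another. *)
Lemma fcoef_gks n (e : fsum n) ks : fgood e -> fcoef e ks != 0 -> gks ks.
Proof.
move=> ge; apply: contraNT => ng; apply/eqP; apply: big1 => a _.
move: ng; rewrite negb_forall => /existsP[l]; rewrite negb_forall => /existsP[l'].
rewrite negb_imply => /andP[ll'] /negPn/eqP e2.
have [bA A1 A2] := ge a.
have [/asboolP[[x Dx] DA]|nl] := boolP (incl (frc a l) (tnth ks l)); last first.
  by rewrite (bigD1 l)//= (negbTE nl) mul0r mulr0.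
have [/asboolP[_ DA']|nl'] := boolP (incl (frc a l') (tnth ks l')); last first.
  by rewrite (bigD1 l')//= (negbTE nl') mul0r mulr0.
exfalso; have [e1|ne1] := eqVneq (tnth ks l).1 (tnth ks l').1.
  have ee : tnth ks l = tnth ks l' 
    by move: e1 e2; case: (tnth ks l) => b i; case: (tnth ks l') => b' i' /= -> ->.
  have : (frc a l `&` frc a l') x by split; [exact: DA|apply: DA'; rewrite -ee].
  by rewrite A2.
have ee : tnth ks l' = sflip (tnth ks l).
  move: ne1 e2; rewrite /sflip; case: (tnth ks l) => b i; case: (tnth ks l') => b' i' /=.
  by move=> h ->; congr pair; case: b b' h => -[].
have : (frc a l `&` set_opp (frc a l')) x.
  split; first exact: DA.
  apply: DA'; rewrite ee -(regular_opp rD) /set_opp /= pt_oppK//.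
by rewrite A1.
Qed.

Lemma fval_valks n (e : fsum n) x : (forall a l, adapted D (@frc n e a l)) ->
  fval e x = valks D (fcoef e) x.
Proof.
move=> ae; rewrite /fval /valks.
transitivity (\sum_a \sum_ks fcf a * \prod_(l < n) (incl (@frc n e a l) (tnth ks l))%:R *
    cind R (box D ks) x).
  apply: eq_bigr => a _.
  rewrite (eq_bigr _ (fun l _ => cind_incl (tnth x l) (ae a l))) prod_sum_tuple mulr_sumr.
  apply: eq_bigr => ks _; rewrite big_split/= mulrA; congr (_ * _).
  rewrite /cind -rmorph_prod; congr (_%:C).
  have [bx|nbx] := pselect (box D ks x).
    by rewrite indicE mem_set// big1// => l _; rewrite indicE mem_set//; exact: bx.
  rewrite [RHS]indicE memNset//=.
  have [l nl] : exists l, ~ D (tnth ks l) (tnth x l) by apply/existsNP.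
  by rewrite (bigD1 l)//= indicE memNset// mul0r.
rewrite exchange_big/=; apply: eq_bigr => ks _.
by rewrite /fcoef mulr_suml.
Qed.

Lemma fJ_Jks n js (e : fsum n) : fgood e -> (forall a l, adapted D (@frc n e a l)) ->
  {ae P, forall w, fJ js e w = Jks Z D js (fcoef e) w}.
Proof.
move=> ge ae.
have h : {ae P, forall w, forall al : fidx e * 'I_n, Z (tnth js al.2) (frc al.1 al.2) w =
    \sum_i (incl (frc al.1 al.2) i)%:R * Z (tnth js al.2) (D i) w}.
  by apply: ae_forall_fin => -[a l] /=; apply: Z_incl => //; exact: good_bborel (ge a).
apply: filterS h => w hw; rewrite /fJ /Jks.
transitivity (\sum_a \sum_ks fcf a * \prod_(l < n) (incl (@frc n e a l) (tnth ks l))%:R *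
    Zprod Z js (rectk D ks) w).
  apply: eq_bigr => a _; rewrite /Zprod.
  rewrite (eq_bigr _ (fun l _ => hw (a, l))) /= prod_sum_tuple mulr_sumr.
  by apply: eq_bigr => ks _; rewrite big_split/= mulrA.
rewrite exchange_big/=; apply: eq_bigr => ks _.
by rewrite /fcoef mulr_suml.
Qed.

End adapted_system.

Lemma good_rect_sym n (A : 'I_n -> set E) l : good_rect A -> A l `&` set_opp (A l) = set0.
Proof. by case. Qed.

Lemma fsum_refinement n (e : fsum n) : fgood e ->
  exists N (D : signed_index N -> set E), regular_system D /\
    forall a l, adapted D (@frc n e a l).
Proof.
move=> ge.
have [N [D [rD aD]]] := @refinement R k nu (fidx e * 'I_n)%type
  (fun al => frc al.1 al.2) (fun al => good_bborel al.2 (ge al.1))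
  (fun al => good_rect_sym al.2 (ge al.1)).
by exists N, D; split => // a l; exact: (aD (a, l)).
Qed.

Lemma fJ_bound n js (e : fsum n) : fgood e ->
  (N2 P (fJ js e) <= (n ^ n)%:R%:E * N2 (Mj hG js) (fval e))%E.
Proof.
move=> ge; have [N [D [rD aD]]] := fsum_refinement ge.
rewrite (@ae_eq_N2 _ _ _ P _ (Jks Z D js (fcoef D e))); last 3 first.
- by apply: callmom_meas; exact: callmom_fJ.
- by apply: callmom_meas; exact: (callmom_Jks hZ rD).
- exact: fJ_Jks.
have -> : fval e = valks D (fcoef D e) by apply/funext => x; exact: fval_valks.
by apply: (J_bound hG hZ rD) => ks; exact: fcoef_gks.
Qed.

Lemma N2_fval_fin n js (e : fsum n) : fgood e -> (N2 (Mj hG js) (fval e) < +oo)%E.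
Proof.
move=> ge; have [N [D [rD aD]]] := fsum_refinement ge.
have -> : fval e = valks D (fcoef D e) by apply/funext => x; exact: fval_valks.
by rewrite N2_valks// ltry.
Qed.

End formal_sums.

(** * Extension of the integral by continuity *)

Section ereal_null_sequences.
Context (R : realType).
Implicit Types u v : nat -> \bar R.

Lemma cvg0_le u v : (forall m, 0 <= u m)%E -> (forall m, u m <= v m)%E ->
  v @ \oo --> 0%E -> u @ \oo --> 0%E.
Proof.
move=> u0 uv v0; apply: (squeeze_cvge _ (cvg_cst 0%E) v0).
by apply: nearW => m; rewrite u0 uv.
Qed.

Lemma cvg0D u v : u @ \oo --> 0%E -> v @ \oo --> 0%E ->
  (fun m => u m + v m)%E @ \oo --> 0%E.
Proof. by move=> u0 v0; rewrite -[X in _ --> X](adde0 0%E); apply: cvgeD. Qed.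

Lemma cvg0Z (c : R) u : u @ \oo --> 0%E -> (fun m => c%:E * u m)%E @ \oo --> 0%E.
Proof. by move=> u0; rewrite -[X in _ --> X](mule0 c%:E); apply: cvgeZl. Qed.

Lemma cvg0_small u (e : R) : u @ \oo --> 0%E -> 0 < e -> \forall m \near \oo, (u m <= e%:E)%E.
Proof.
move=> /fine_cvgP[fin /cvgr0_norm_lt/(_ _) h] e0; have := h _ e0.
apply: filterS2 fin => m fu um; rewrite -(fineK fu) lee_fin.
by rewrite ltW// (le_lt_trans (ler_norm _)).
Qed.

Lemma cvg0_bound u (a c : \bar R) : u @ \oo --> 0%E -> (forall m, a <= u m + c)%E ->
  (a <= c)%E.
Proof.
move=> u0 h; apply/lee_addgt0Pr => e e0.
have [m _ um] := cvg0_small u0 e0; have := um m (leqnn m) => {}um.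
by apply: le_trans (h m) _; rewrite addeC leeD2l.
Qed.

Lemma cvg0_geometric (r : R) : 0 <= r < 1 -> (fun m => (r ^+ m)%:E) @ \oo --> 0%E.
Proof.
move=> /andP[r0 r1]; apply: cvg_EFin; first exact: nearW.
by apply: cvg_expr; rewrite ger0_norm.
Qed.

End ereal_null_sequences.

Section L2_complete.
Context (dO : measure_display) (O : measurableType dO) (R : realType).
Variable P : probability O R.

Lemma cmeasurable_limn_sup (f : nat -> O -> R) : (forall m, measurable_fun setT (f m)) ->
  measurable_fun setT (fun w => fine (limn_esup (fun m => (f m w)%:E))).
Proof.
move=> mf; apply: (measurableT_comp (fine_measurable measurableT)).
apply: measurable_fun_limn_esup => m; exact/measurable_EFinP.
Qed.

(** The ratio 1/16 outweighs the doubling in each use of [N2_tri]: 2 (1 + 4/16) <= 4. *)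
Lemma L2_fast_tail (Y : nat -> O -> R[i]) : (forall m, cmeasurable (Y m)) ->
  (forall m, N2 P (fun w => Y m.+1 w - Y m w)%R <= ((16^-1 : R) ^+ m)%:E)%E ->
  forall i m, (N2 P (fun w => Y m w - Y (m + i)%N w)%R <= (4 * 16^-1 ^+ m)%:E)%E.
Proof.
move=> mY fast; elim=> [|i IH] m.
  rewrite addn0; under eq_fun do rewrite subrr; rewrite N20 lee_fin.
  by rewrite mulr_ge0// exprn_ge0.
rewrite addnS -addSn; apply: le_trans (N2_tri _ (mY m) (mY m.+1) (mY _)) _.
apply: (@le_trans _ _ (2%:E * ((16^-1 ^+ m)%:E + (4 * 16^-1 ^+ m.+1)%:E))%E).
  by rewrite lee_pmul2l// leeD// N2_sym.
rewrite -EFinD -EFinM lee_fin exprS.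
have : 0 <= 16^-1 ^+ m :> R by rewrite exprn_ge0.
lra.
Qed.

(** By Cauchy-Schwarz against the constant 1 the increments have L1 norms at most 4^-m, so the
    expectation of the sum of their moduli is finite. *)
Lemma L2_fast_ae (Y : nat -> O -> R[i]) : (forall m, cmeasurable (Y m)) ->
  (forall m, N2 P (fun w => Y m.+1 w - Y m w)%R <= ((16^-1 : R) ^+ m)%:E)%E ->
  {ae P, forall w, cvgn (series (fun m => normc (Y m.+1 w - Y m w)))}.
Proof.
move=> mY fast; pose D m w := normc (Y m.+1 w - Y m w).
have mD m : measurable_fun setT (D m).
  by apply: measurable_normc; exact: cmeasurableB.
have mDE m : measurable_fun setT (fun w => (D m w)%:E) by exact/measurable_EFinP.
have D0 m w : 0 <= D m w by exact: normc_ge0.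
have DE0 m w : (0 <= (D m w)%:E)%E by rewrite lee_fin.
have I1 : (\int[P]_w (1 ^+ 2 : R)%:E)%E = 1%E.
  have := Ex_cst P 1; rewrite /Rintegral => h.
  under eq_integral do rewrite expr1n.
  rewrite -(@fineK _ (\int[P]_w _)%E) ?h//.
  apply: integrable_fin_num => //; exact: allmom_integrable (allmom_cst P 1).
have ED m : (\int[P]_w (D m w)%:E <= (2^-1 ^+ m)%:E)%E.
  have fin : (\int[P]_w (D m w ^+ 2)%:E < +oo)%E by apply: le_lt_trans (fast m) _; rewrite ltry.
  have [|Dfin CS] := cauchy_schwarz (m := P) (mD m) (measurable_cst (1 : R)) (D0 m)
    (fun _ => ler01) fin; first by rewrite I1 ltry.
  move: Dfin CS; rewrite I1 /= mulr1.
  under eq_integral do rewrite mulr1.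
  move=> Dfin CS.
  have Dn : (\int[P]_w (D m w)%:E)%E \is a fin_num.
    by rewrite ge0_fin_numE//; apply: integral_ge0.
  have : (fine (\int[P]_w (D m w)%:E)%E) ^+ 2 <= (4^-1 ^+ m) ^+ 2 :> R.
    apply: le_trans CS _; rewrite -lee_fin fineK; last first.
      by rewrite ge0_fin_numE//; apply: integral_ge0 => w _; rewrite lee_fin sqr_ge0.
    apply: le_trans (fast m) _; rewrite lee_fin -exprM mulnC exprM.
    by rewrite (_ : 4^-1 ^+ 2 = 16^-1 :> R)//; field.
  rewrite ler_sqr ?nnegrE ?exprn_ge0// ?fine_ge0//; last exact: integral_ge0.
  move=> le; rewrite -(fineK Dn) lee_fin (le_trans le)// lerXn2r ?nnegrE//.
  lra.
pose F w := (\sum_(m <oo) (D m w)%:E)%E.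
have mF : measurable_fun setT F.
  by apply: ge0_emeasurable_sum => // m w _ _; exact: DE0.
have F0 w : (0 <= F w)%E by exact: nneseries_ge0.
have Ffin : (\int[P]_w F w < +oo)%E.
  rewrite integral_nneseries//; apply: (@le_lt_trans _ _ 2%:E); last by rewrite ltry.
  apply: le_trans (@epsilon_trick0 R 2 xpredT _) => //.
  apply: lee_nneseries => [m _ _|m _]; first exact: integral_ge0.
  apply: le_trans (ED m) _; rewrite lee_fin natrX exprS invfM mulrA divff ?mul1r ?exprVn//.
have iF : P.-integrable setT F.
  apply/integrableP; split => //.
  by under eq_integral do rewrite gee0_abs//.
have := integrable_ae measurableT iF; apply: filterS => w /(_ Logic.I) Fw.
apply: nondecreasing_is_cvgn.
  by apply/nondecreasing_seqP => m; rewrite /series/= big_nat_recr//= lerDl; exact: D0.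
exists (fine (F w)) => _ [m _ <-]; rewrite -lee_fin fineK// /series/= -sumEFin.
by apply: (@nneseries_lim_ge _ (fun i => (D i w)%:E) xpredT) => i _ _; exact: DE0.
Qed.

(* the limit of a fast L2-Cauchy sequence exists almost surely, and Fatou's
   lemma upgrades the convergence *)
Theorem L2_complete_fast (Y : nat -> O -> R[i]) : (forall m, cmeasurable (Y m)) ->
  (forall m, N2 P (fun w => Y m.+1 w - Y m w)%R <= ((16^-1 : R) ^+ m)%:E)%E ->
  exists X, cmeasurable X /\ (fun m => N2 P (fun w => Y m w - X w)) @ \oo --> 0%E.
Proof.
move=> mY fast.
(* Upper limits exist and are measurable everywhere. They are the limits almost surely; the default
   values of [fine] can only matter on the exceptional null set. *)
pose X w : R[i] := fine (limn_esup (fun m => (Re (Y m w))%:E)) +i*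
  fine (limn_esup (fun m => (Im (Y m w))%:E)).
have mX : cmeasurable X.
  by split; apply: cmeasurable_limn_sup => m; have [] := mY m.
exists X; split => //.
have cX : {ae P, forall w, (fun m => Re (Y m w)) @ \oo --> Re (X w) /\
    (fun m => Im (Y m w)) @ \oo --> Im (X w)}.
  have := L2_fast_ae mY fast; apply: filterS => w cw.
  have key (a : nat -> R) : (forall m, `|a m.+1 - a m| <= normc (Y m.+1 w - Y m w)) ->
      a @ \oo --> fine (limn_esup (fun m => (a m)%:E)).
    move=> ha; have ca : cvgn a.
      have : cvgn (series (fun m => a m.+1 - a m)).
        apply: normed_cvg; apply: series_le_cvg cw => m; [exact: normr_ge0|exact: normc_ge0|exact: ha].
      move=> cs; have -> : a = (fun m => a 0%N + series (fun m => a m.+1 - a m) m).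
        apply/funext => m; rewrite /series/= telescope_sumr//.
        by rewrite addrC subrK.
      by apply: is_cvgD => //; exact: is_cvg_cst.
    have : (fun m => (a m)%:E) @ \oo --> (limn a)%:E by apply: cvg_EFin => //; exact: nearW.
    by move=> /cvg_limn_einf_sup[_ ->].
  split; apply: key => m; rewrite /=.
    by rewrite (_ : _ - _ = Re (Y m.+1 w - Y m w)) ?normc_Re// !cRI.
  by rewrite (_ : _ - _ = Im (Y m.+1 w - Y m w)) ?normc_Im// !cRI.
have tail m : (N2 P (fun w => Y m w - X w)%R <= (4 * 16^-1 ^+ m)%:E)%E.
  pose f i w := ((normc (Y m w - Y (m + i)%N w)) ^+ 2)%:E.
  have mf i : measurable_fun setT (f i) by apply: measurable_N2; exact: cmeasurableB.
  have f0 i w : setT w -> (0 <= f i w)%E by rewrite lee_fin sqr_ge0.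
  apply: (@le_trans _ _ (\int[P]_w limn_einf (f^~ w))%E).
    rewrite le_eqVlt; apply/orP; left; apply/eqP; apply: ae_eq_integral => //.
    - by apply: measurable_N2; exact: cmeasurableB.
    - rewrite (_ : (fun w => _) = (fun w => - limn_esup (fun i => - f i w))%E).
        apply: measurableT_comp => //; apply: measurable_fun_limn_esup => i.
        exact: measurableT_comp.
      apply/funext => w; rewrite -limn_einfN; congr limn_einf.
      by apply/funext => i; rewrite /comp oppeK.
    apply: filterS cX => w [c1 c2] _; apply/esym; apply: (fun h => (cvg_limn_einf_sup h).1).
    apply: cvg_EFin; first exact: nearW.
    rewrite sqr_normcE !cRI; under eq_fun do rewrite /f /= sqr_normcE !cRI.
    have sh (a : nat -> R) (c l : R) : a @ \oo --> l ->
        (fun i => (c - a (m + i)%N) ^+ 2) @ \oo --> (c - l) ^+ 2.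
      have -> : (fun i => (c - a (m + i)%N) ^+ 2) = (fun i => (c - a (i + m)%N) ^+ 2).
        by apply/funext => i; rewrite addnC.
      move=> al; have al' : (fun i => a (i + m)%N) @ \oo --> l.
        by apply: cvg_comp al; exact: cvg_addnr.
      have B : (fun i => c - a (i + m)%N) @ \oo --> c - l by apply: cvgB => //; exact: cvg_cst.
      exact: (cvgM B B).
    exact: (cvgD (sh _ (Re (Y m w)) _ c1) (sh _ (Im (Y m w)) _ c2)).
  apply: le_trans (fatou P measurableT mf f0) _.
  rewrite limn_einf_lim; apply: lime_le; first exact: is_cvg_einfs.
  apply: nearW => i; apply: le_trans (L2_fast_tail mY fast i m).
  by apply: ereal_inf_lbound; exists i => /=.
apply: (cvg0_le (v := fun m => (4%:E * (16^-1 ^+ m)%:E)%E)).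
- by move=> m; exact: N2_ge0.
- by move=> m; rewrite -EFinM; exact: tail.
- by apply: cvg0Z; apply: cvg0_geometric; apply/andP; split; lra.
Qed.

End L2_complete.

Section L2_more.
Context (dT : measure_display) (T : measurableType dT) (R : realType).
Variable m : {measure set T -> \bar R}.

Lemma N2_tri3 (f g g' h : T -> R[i]) : cmeasurable f -> cmeasurable g ->
  cmeasurable g' -> cmeasurable h ->
  (N2 m (fun x => f x - h x)%R <= 4%:E * (N2 m (fun x => f x - g x)%R +
    (N2 m (fun x => g x - g' x)%R + N2 m (fun x => g' x - h x)%R)))%E.
Proof.
move=> mf mg mg' mh; apply: le_trans (N2_tri m mf mg mh) _.
have -> : 4%:E = (2%:E * 2%:E)%E :> \bar R by rewrite -EFinM; congr EFin; ring.
have h0 := N2_ge0 m (fun x => f x - g x).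
have h1 := N2_ge0 m (fun x => g x - g' x); have h2 := N2_ge0 m (fun x => g' x - h x).
have := N2_tri m mg mg' mh.
move: (N2 m _) (N2 m _) (N2 m _) (N2 m _) h0 h1 h2 => a b c e a0 b0 c0 le.
rewrite -muleA lee_pmul2l// ge0_muleDr ?adde_ge0//.
by apply: leeD => //; rewrite -[leLHS]mul1e lee_wpmul2r// lee_fin ler1n.
Qed.

End L2_more.

Section wiener_integral.
Context (R : realType) (k : space_kind) (nu d : nat).
Local Notation E := (espace R k nu).
Variables (mu : {sigma_finite_measure set E -> \bar R})
  (G : 'I_d -> 'I_d -> set E -> R[i]) (g : 'I_d -> 'I_d -> E -> R[i]).
Hypothesis hG : matrix_spectral_measure G mu g.
Context (dO : measure_display) (O : measurableType dO) (P : probability O R).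
Variable Z : 'I_d -> set E -> O -> R[i].
Hypothesis hZ : random_spectral_measure P G Z.

Definition fcv n (js : n.-tuple 'I_d) (f : n.-tuple E -> R[i])
    (e : nat -> fsum R k nu n) :=
  (forall m, fgood (e m)) /\
  (fun m => N2 (Mj hG js) (fun x => fval (e m) x - f x)) @ \oo --> 0%E.

(* Unlike is_wiener_ito, Wint does not ask that f (- x) be the conjugate of f x. *)
Definition Wint n (js : n.-tuple 'I_d) (f : n.-tuple E -> R[i]) (X : O -> R[i]) :=
  cmeasurable X /\ exists e, fcv js f e /\
  (fun m => N2 P (fun w => fJ Z js (e m) w - X w)) @ \oo --> 0%E.

Definition approx n (js : n.-tuple 'I_d) (f : n.-tuple E -> R[i]) :=
  forall eps : R, 0 < eps -> exists e : fsum R k nu n, fgood e /\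
    (N2 (Mj hG js) (fun x => fval e x - f x)%R <= eps%:E)%E.

Lemma cmeasurable_fJ n js (e : fsum R k nu n) : fgood e -> cmeasurable (fJ Z js e).
Proof. by move=> ge; apply: callmom_meas; exact: (callmom_fJ hZ). Qed.

Lemma fJ_dist n js (e e' : fsum R k nu n) : fgood e -> fgood e' ->
  (N2 P (fun w => fJ Z js e w - fJ Z js e' w)%R <=
   (n ^ n)%:R%:E * N2 (Mj hG js) (fun x => fval e x - fval e' x)%R)%E.
Proof.
move=> ge ge'; have := fJ_bound hG hZ js (fgood_sub ge ge').
have -> : fJ Z js (fsub e e') = (fun w => fJ Z js e w - fJ Z js e' w).
  by apply/funext => w; rewrite fJ_sub.
by have -> : fval (fsub e e') = (fun w => fval e w - fval e' w)
  by apply/funext => w; rewrite fval_sub.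
Qed.

Section integrals.
Variables (n : nat) (js : n.-tuple 'I_d).
Implicit Types (f : n.-tuple E -> R[i]) (X : O -> R[i]) (e : fsum R k nu n).
Local Notation M := (Mj hG js).
Local Notation C := ((n ^ n)%:R : R).

Let C_gt0 : 0 < C. Proof. by rewrite ltr0n expn_gt0; case: n. Qed.

Let C_ge0 : (0 <= C%:E)%E. Proof. by rewrite lee_fin ltW. Qed.

Lemma approx_small f : cmeasurable f -> (forall eps : R, 0 < eps -> exists f',
    [/\ cmeasurable f', approx js f' & (N2 M (fun x => f' x - f x)%R <= eps%:E)%E]) ->
  approx js f.
Proof.
move=> mf h eps eps0; have [f' [mf' af' ff']] := h (eps / 4) (divr_gt0 eps0 (ltr0n _ 4)).
have [e [ge ee]] := af' _ (divr_gt0 eps0 (ltr0n _ 4)); exists e; split => //.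
apply: le_trans (N2_tri _ (cmeasurable_fval ge) mf' mf) _.
rewrite [leRHS](_ : _ = 2%:E * ((eps / 4)%:E + (eps / 4)%:E))%E; last first.
  by rewrite -EFinD -EFinM; congr EFin; field.
by rewrite lee_pmul2l// leeD.
Qed.

Lemma approx_cvg f (f_ : nat -> n.-tuple E -> R[i]) : cmeasurable f ->
  (forall m, cmeasurable (f_ m)) -> (forall m, approx js (f_ m)) ->
  (fun m => N2 M (fun x => f_ m x - f x)) @ \oo --> 0%E -> approx js f.
Proof.
move=> mf mf_ af_ h; apply: approx_small => // eps eps0.
have [m _ hm] := cvg0_small h eps0; exists (f_ m); split => //; exact: hm (leqnn m).
Qed.

Lemma approxD f f' : cmeasurable f -> cmeasurable f' -> approx js f -> approx js f' ->
  approx js (fun x => f x + f' x).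
Proof.
move=> mf mf' af af' eps eps0.
have [e [ge ee]] := af _ (divr_gt0 eps0 (ltr0n _ 4)).
have [e' [ge' ee']] := af' _ (divr_gt0 eps0 (ltr0n _ 4)).
exists (fadd e e'); split; first exact: fgood_add.
rewrite [X in N2 _ X](_ : _ = (fun x => (fval e x - f x) + (fval e' x - f' x))); last first.
  by apply/funext => x; rewrite fval_add opprD addrACA.
apply: le_trans (N2D _ (cmeasurableB (cmeasurable_fval ge) mf)
  (cmeasurableB (cmeasurable_fval ge') mf')) _.
rewrite [leRHS](_ : _ = 2%:E * ((eps / 4)%:E + (eps / 4)%:E))%E; last first.
  by rewrite -EFinD -EFinM; congr EFin; field.
by rewrite lee_pmul2l// leeD.
Qed.

Lemma approxZ c f : cmeasurable f -> approx js f -> approx js (fun x => c * f x).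
Proof.
move=> mf af eps eps0; pose q : R := normc c ^+ 2 + 1.
have q0 : 0 < q by rewrite ltr_wpDl ?sqr_ge0.
have [e [ge ee]] := af _ (divr_gt0 eps0 q0).
exists (fscale c e); split; first exact: fgood_scale.
rewrite [X in N2 _ X](_ : _ = (fun x => c * (fval e x - f x))); last first.
  by apply/funext => x; rewrite fval_scale mulrBr.
rewrite N2Z; last by apply: cmeasurableB => //; exact: cmeasurable_fval.
apply: (@le_trans _ _ ((normc c ^+ 2)%:E * (eps / q)%:E)%E).
  by rewrite lee_wpmul2l// lee_fin sqr_ge0.
rewrite -EFinM lee_fin mulrA ler_pdivrMr// mulrC ler_wpM2l ?(ltW eps0)//.
by rewrite /q lerDl.
Qed.

Lemma approx_sum (I : Type) (r : seq I) (Q : pred I) (f : I -> n.-tuple E -> R[i]) :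
  (forall i, cmeasurable (f i)) -> (forall i, Q i -> approx js (f i)) ->
  approx js (fun x => \sum_(i <- r | Q i) f i x).
Proof.
move=> mf af; elim: r => [|i r IH].
  under eq_fun do rewrite big_nil.
  move=> eps eps0; exists (FSum (fun i : 'I_0 => 0) (fun _ _ => set0)); split; first by case.
  rewrite [X in N2 _ X](_ : _ = (fun=> 0)) ?N20 ?lee_fin ?ltW//.
  by apply/funext => x; rewrite /fval big_ord0 subrr.
have [Qi|nQi] := boolP (Q i); last by under eq_fun do rewrite big_cons (negbTE nQi).
under eq_fun do rewrite big_cons Qi.
by apply: approxD => //; [exact: cmeasurable_sum|exact: af].
Qed.

Lemma Wint_fsum e : fgood e -> Wint js (fval e) (fJ Z js e).
Proof.
move=> ge; split; first exact: cmeasurable_fJ.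
exists (fun=> e); split; first split => //.
- under eq_fun do under eq_fun do rewrite subrr.
  by under eq_fun do rewrite N20; exact: cvg_cst.
- under eq_fun do under eq_fun do rewrite subrr.
  by under eq_fun do rewrite N20; exact: cvg_cst.
Qed.

(** By [fJ_dist] the integrals along two approximating sequences of the same kernel merge, so the
    sequence is free. This later allows symmetrized or refined approximations. *)
Lemma Wint_cvg f X : cmeasurable f -> Wint js f X -> forall e : nat -> fsum R k nu n, fcv js f e ->
  (fun m => N2 P (fun w => fJ Z js (e m) w - X w)) @ \oo --> 0%E.
Proof.
move=> mf [mX [e1 [[ge1 e1f] e1X]]] e2 [ge2 e2f].
apply: (cvg0_le (v := fun m => (2%:E * (C%:E * (2%:E *
  (N2 M (fun x => fval (e2 m) x - f x)%R + N2 M (fun x => fval (e1 m) x - f x)%R)) +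
  N2 P (fun w => fJ Z js (e1 m) w - X w)%R))%E)) => [m|m|]; first exact: N2_ge0.
  apply: le_trans (N2_tri _ (cmeasurable_fJ js (ge2 m)) (cmeasurable_fJ js (ge1 m)) mX) _.
  rewrite lee_pmul2l// leeD2r//.
  apply: le_trans (fJ_dist js (ge2 m) (ge1 m)) _; rewrite lee_wpmul2l//.
  rewrite [X in (_ + X)%E]N2_sym.
  exact: N2_tri (cmeasurable_fval (ge2 m)) mf (cmeasurable_fval (ge1 m)).
by apply: cvg0Z; apply: cvg0D => //; apply: cvg0Z; apply: cvg0Z; exact: cvg0D.
Qed.

(** A chain from X to X' through the two approximating integrals costs a factor 4, and so does the
    chain between the kernels; the approximation errors disappear in the limit. Uniqueness is the
    case f = f'. *)
Lemma Wint_dist f f' X X' : cmeasurable f -> cmeasurable f' ->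
  Wint js f X -> Wint js f' X' ->
  (N2 P (fun w => X w - X' w)%R <= (16 * C)%:E * N2 M (fun x => f x - f' x)%R)%E.
Proof.
move=> mf mf' [mX [e1 [[ge1 e1f] e1X]]] [mX' [e2 [[ge2 e2f] e2X]]].
pose a m := N2 P (fun w => fJ Z js (e1 m) w - X w).
pose b m := N2 P (fun w => fJ Z js (e2 m) w - X' w).
pose u m := N2 M (fun x => fval (e1 m) x - f x).
pose v m := N2 M (fun x => fval (e2 m) x - f' x).
apply: (@cvg0_bound _ (fun m => 4%:E * (a m + b m) + (16 * C)%:E * (u m + v m))%E).
  by apply: cvg0D; apply: cvg0Z; exact: cvg0D.
move=> m; apply: le_trans (N2_tri3 P mX (cmeasurable_fJ js (ge1 m))
  (cmeasurable_fJ js (ge2 m)) mX') _.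
rewrite N2_sym -/(a m) -/(b m).
have h : (N2 P (fun w => fJ Z js (e1 m) w - fJ Z js (e2 m) w)%R <=
    (4 * C)%:E * (u m + (N2 M (fun x => f x - f' x)%R + v m)))%E.
  apply: le_trans (fJ_dist js (ge1 m) (ge2 m)) _.
  rewrite (mulrC 4) EFinM -muleA lee_wpmul2l//.
  have -> : v m = N2 M (fun x => f' x - fval (e2 m) x) by rewrite /v N2_sym.
  exact: N2_tri3 (cmeasurable_fval (ge1 m)) mf mf' (cmeasurable_fval (ge2 m)).
have a0 : (0 <= a m)%E := N2_ge0 _ _; have b0 : (0 <= b m)%E := N2_ge0 _ _.
have u0 : (0 <= u m)%E := N2_ge0 _ _; have v0 : (0 <= v m)%E := N2_ge0 _ _.
have D0 : (0 <= N2 M (fun x => f x - f' x)%R)%E := N2_ge0 _ _.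
apply: (@le_trans _ _ (4%:E * (a m + ((4 * C)%:E * (u m + (N2 M (fun x => f x - f' x)%R + v m)) + b m)))%E).
  by rewrite lee_pmul2l// leeD2l// leeD2r.
move: (N2 M _) (a m) (b m) (u m) (v m) D0 a0 b0 u0 v0 => D {h}a {}b {}u {}v D0 a0 b0 u0 v0.
have C4 : (0 <= (4 * C)%:E)%E by rewrite lee_fin mulr_ge0// ltW.
rewrite [(_ * _ + b)%E]addeC addeA ge0_muleDr ?adde_ge0 ?mule_ge0 ?adde_ge0//.
have -> : (16 * C)%:E = (4%:E * (4 * C)%:E)%E :> \bar R.
  by rewrite -EFinM; congr EFin; ring.
rewrite muleA -addeA; apply: leeD => //.
have C16 : (0 <= 4%:E * (4 * C)%:E)%E by rewrite mule_ge0.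
by rewrite [(D + _)%E]addeC addeA ge0_muleDr ?adde_ge0.
Qed.

Lemma Wint_uniq f X X' : cmeasurable f -> Wint js f X -> Wint js f X' ->
  {ae P, forall w, X w = X' w}.
Proof.
move=> mf WX WX'; have := Wint_dist mf mf WX WX'.
under [X in (_ <= _ * N2 _ X)%E]eq_fun do rewrite subrr.
rewrite N20 mule0 => le0.
have : N2 P (fun w => X w - X' w) = 0%E by apply/eqP; rewrite eq_le le0 N2_ge0.
move=> /(N2_eq0 (cmeasurableB WX.1 WX'.1)).
by apply: filterS => w /eqP; rewrite subr_eq0 => /eqP.
Qed.

Lemma WintD f f' X X' : cmeasurable f -> cmeasurable f' -> Wint js f X -> Wint js f' X' ->
  Wint js (fun x => f x + f' x) (fun w => X w + X' w).
Proof.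
move=> mf mf' [mX [e1 [[ge1 e1f] e1X]]] [mX' [e2 [[ge2 e2f] e2X]]].
split; first exact: cmeasurableD.
exists (fun m => fadd (e1 m) (e2 m)); split; first split.
- by move=> m; exact: fgood_add.
- apply: (cvg0_le (v := fun m => (2%:E * (N2 M (fun x => fval (e1 m) x - f x)%R +
    N2 M (fun x => fval (e2 m) x - f' x)%R))%E)) => [m|m|]; first exact: N2_ge0.
    rewrite [X in N2 _ X](_ : _ = (fun x => (fval (e1 m) x - f x) + (fval (e2 m) x - f' x))).
      by apply: N2D; apply: cmeasurableB => //; exact: cmeasurable_fval.
    by apply/funext => x; rewrite fval_add opprD addrACA.
  by apply: cvg0Z; exact: cvg0D.
- apply: (cvg0_le (v := fun m => (2%:E * (N2 P (fun x => fJ Z js (e1 m) x - X x)%R +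
    N2 P (fun x => fJ Z js (e2 m) x - X' x)%R))%E)) => [m|m|]; first exact: N2_ge0.
    rewrite [X in N2 _ X](_ : _ = (fun x => (fJ Z js (e1 m) x - X x) + (fJ Z js (e2 m) x - X' x))).
      by apply: N2D; apply: cmeasurableB => //; exact: cmeasurable_fJ.
    by apply/funext => x; rewrite fJ_add opprD addrACA.
  by apply: cvg0Z; exact: cvg0D.
Qed.

Lemma WintZ c f X : cmeasurable f -> Wint js f X ->
  Wint js (fun x => c * f x) (fun w => c * X w).
Proof.
move=> mf [mX [e1 [[ge1 e1f] e1X]]]; split; first exact: cmeasurableZ.
exists (fun m => fscale c (e1 m)); split; first split.
- by move=> m; exact: fgood_scale.
- apply: (cvg0_le (v := fun m => ((normc c ^+ 2)%:E *
    N2 M (fun x => fval (e1 m) x - f x)%R)%E)) => [m|m|]; first exact: N2_ge0.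
    rewrite [X in N2 _ X](_ : _ = (fun x => c * (fval (e1 m) x - f x))).
      by rewrite N2Z//; apply: cmeasurableB => //; exact: cmeasurable_fval.
    by apply/funext => x; rewrite fval_scale mulrBr.
  exact: cvg0Z.
- apply: (cvg0_le (v := fun m => ((normc c ^+ 2)%:E *
    N2 P (fun x => fJ Z js (e1 m) x - X x)%R)%E)) => [m|m|]; first exact: N2_ge0.
    rewrite [X in N2 _ X](_ : _ = (fun x => c * (fJ Z js (e1 m) x - X x))).
      by rewrite N2Z//; apply: cmeasurableB => //; exact: cmeasurable_fJ.
    by apply/funext => x; rewrite fJ_scale mulrBr.
  exact: cvg0Z.
Qed.

Lemma Wint_sum (I : Type) (r : seq I) (f : I -> n.-tuple E -> R[i]) (X : I -> O -> R[i]) :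
  (forall i, cmeasurable (f i)) -> (forall i, Wint js (f i) (X i)) ->
  Wint js (fun x => \sum_(i <- r) f i x) (fun w => \sum_(i <- r) X i w).
Proof.
move=> mf WfX; elim: r => [|i r IH].
  have g0 : fgood (@FSum R k nu n 'I_0 (fun=> 0) (fun _ _ => set0)) by case.
  have := Wint_fsum g0.
  rewrite (_ : fval _ = (fun x => \sum_(i <- [::]) f i x)); last first.
    by apply/funext => x; rewrite /fval big_ord0 big_nil.
  rewrite (_ : fJ _ _ _ = (fun x => \sum_(i <- [::]) X i x))//.
  by apply/funext => x; rewrite /fJ big_ord0 big_nil.
under eq_fun do rewrite big_cons; under [X in Wint _ _ X]eq_fun do rewrite big_cons.
by apply: WintD => //; exact: cmeasurable_sum.
Qed.

Lemma Wint_exists f : cmeasurable f -> approx js f -> exists X, Wint js f X.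
Proof.
(* With this choice two successive integrals are at squared distance at most 17/32 * 16^-m, as
   [L2_complete_fast] requires. *)
move=> mf af; pose del (m : nat) : R := 16^-1 ^+ m / (4 * C).
have del0 m : 0 < del m by rewrite divr_gt0 ?exprn_gt0 ?invr_gt0 ?mulr_gt0.
pose e m := projT1 (cid (af (del m) (del0 m))).
have ge m : fgood (e m) by have [] := projT2 (cid (af (del m) (del0 m))).
have ee m : (N2 M (fun x => fval (e m) x - f x)%R <= (del m)%:E)%E
  by have [] := projT2 (cid (af (del m) (del0 m))).
have [|X [mX cX]] := @L2_complete_fast _ O R P (fun m => fJ Z js (e m))
    (fun m => cmeasurable_fJ js (ge m)).
  move=> m; apply: le_trans (fJ_dist js (ge m.+1) (ge m)) _.
  apply: (@le_trans _ _ (C%:E * (2%:E * ((del m.+1)%:E + (del m)%:E)))%E).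
    rewrite lee_wpmul2l//.
    apply: le_trans (N2_tri _ (cmeasurable_fval (ge _)) mf (cmeasurable_fval (ge _))) _.
    by rewrite lee_pmul2l// leeD// N2_sym.
  rewrite -EFinD -!EFinM lee_fin /del exprS.
  have -> : C * (2 * (16^-1 * 16^-1 ^+ m / (4 * C) + 16^-1 ^+ m / (4 * C))) =
      17 / 32 * 16^-1 ^+ m by field; rewrite gt_eqF.
  by rewrite ler_piMl ?exprn_ge0//; lra.
exists X; split => //; exists e; split => //; split => //.
apply: (cvg0_le (v := fun m => ((4 * C)^-1%:E * (16^-1 ^+ m)%:E)%E)) => [m|m|].
- exact: N2_ge0.
- by rewrite -EFinM mulrC; exact: ee.
by apply: cvg0Z; apply: cvg0_geometric; apply/andP; split; lra.
Qed.

End integrals.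

End wiener_integral.

Lemma cvg0_sum (R : realType) (I : Type) (r : seq I) (u : I -> nat -> \bar R) :
  (forall i, u i @ \oo --> 0%E) -> (fun m => \sum_(i <- r) u i m)%E @ \oo --> 0%E.
Proof.
move=> u0; elim: r => [|i r IH].
  by under eq_fun do rewrite big_nil; exact: cvg_cst.
by under eq_fun do rewrite big_cons; apply: cvg0D.
Qed.

(** * Density of the formal sums *)

Section cells.
Context (R : realType) (k : space_kind) (nu : nat).
Local Notation E := (espace R k nu).

(** A countable family of measurable sets that separates the points of E; integers that encode no
    pair give the empty set. The atoms of its first m members therefore shrink to points. *)
Definition rat_half_space (l : nat) : set E :=
  if @unpickle ('I_nu * rat)%type l is Some (i, q)
  then [set x | val (tnth x i) < ratr q] else set0.

Lemma measurable_rat_half_space l : measurable (rat_half_space l).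
Proof.
rewrite /rat_half_space; case: unpickle => [[i q]|//].
rewrite (_ : [set _ | _] = (fun x : E => val (tnth x i)) @^-1` `]-oo, ratr q[); last first.
  by apply/seteqP; split => x /=; rewrite in_itv.
rewrite -[X in measurable X]setTI.
have mt : measurable_fun setT (fun x : E => val (tnth x i)).
  exact: (measurableT_comp (@measurable_axis_val R k) (@measurable_tnth _ _ _ i)).
exact: mt.
Qed.

Lemma rat_half_space_sep (x y : E) :
  (forall l, rat_half_space l x <-> rat_half_space l y) -> x = y.
Proof.
move=> h; apply: eq_from_tnth => i; apply: val_inj.
have key (u v : E) : (forall l, rat_half_space l u <-> rat_half_space l v) ->
    val (tnth v i) <= val (tnth u i).
  move=> huv; rewrite leNgt; apply/negP => uv.
  have [q] := rat_in_itvoo uv; rewrite in_itv/= => /andP[uq qv].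
  have := huv (pickle (i, q)); rewrite /rat_half_space pickleK /= => -[/(_ uq)].
  by rewrite ltNge (ltW qv).
apply/eqP; rewrite eq_le !key// => l; split; apply h.
Qed.

Definition cell_code (m : nat) (x : E) : {ffun 'I_m -> bool} :=
  [ffun l : 'I_m => `[< rat_half_space l x >]].

Definition cell (m : nat) (s : {ffun 'I_m -> bool}) : set E := [set x | cell_code m x = s].

Lemma measurable_cell m (s : {ffun 'I_m -> bool}) : measurable (cell s).
Proof.
rewrite (_ : cell s = \bigcap_(l in [set: 'I_m])
    (if s l then rat_half_space l else ~` rat_half_space l)).
  apply: fin_bigcap_measurable => // l _.
  by case: ifP => _; [|apply: measurableC]; exact: measurable_rat_half_space.
apply/seteqP; split => [x /= <- l _|x h /=].
  by rewrite ffunE; case: ifPn => [/asboolP|/asboolP].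
apply/ffunP => l; rewrite ffunE; have := h l Logic.I.
by case: ifPn => sl hl; [apply/asboolP|apply/asboolP].
Qed.

Lemma cell_nonincreasing x : nonincreasing_seq (fun m => cell (cell_code m x)).
Proof.
apply/nonincreasing_seqP => m; apply/subsetPset => y /= h.
apply/ffunP => l; have /ffunP/(_ (widen_ord (leqnSn m) l)) := h.
by rewrite !ffunE.
Qed.

Lemma bigcap_cell x : \bigcap_m cell (cell_code m x) = [set x].
Proof.
apply/seteqP; split => [y h|y -> //].
apply: rat_half_space_sep => l; have /ffunP/(_ ord_max) := h l.+1 Logic.I.
by rewrite !ffunE => /= e; split => /asboolP; [rewrite e|rewrite -e] => /asboolP.
Qed.

Lemma measurable_point (x : E) : measurable [set x].
Proof.
rewrite -bigcap_cell; apply: bigcap_measurable => [|m _]; first by exists 0%N.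
exact: measurable_cell.
Qed.

(* with a m x the mass of the part of B in the m-th cell of x, the sum is the
   integral of a m over B and a m tends to the mass of {x} *)
Lemma sum_sqr_cells (la : {measure set E -> \bar R}) (B : set E) : measurable B ->
  (la B < +oo)%E -> (forall x, la [set x] = 0%E) ->
  (fun m => \sum_(s : {ffun 'I_m -> bool}) ((fine (la (B `&` cell s))) ^+ 2)%:E)%E
    @ \oo --> 0%E.
Proof.
move=> mB Bfin la0.
have mC m (s : {ffun 'I_m -> bool}) : measurable (B `&` cell s).
  by apply: measurableI => //; exact: measurable_cell.
have leC m (s : {ffun 'I_m -> bool}) : (la (B `&` cell s) <= la B)%E.
  by apply: le_measure; rewrite ?inE//; exact: subIsetl.
have finC m (s : {ffun 'I_m -> bool}) : la (B `&` cell s) \is a fin_num.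
  by rewrite ge0_fin_numE// (le_lt_trans (leC m s)).
pose f m (x : E) := la (B `&` cell (cell_code m x)).
have fE m x : f m x = (\sum_(s : {ffun 'I_m -> bool})
    (fine (la (B `&` cell s)))%:E * (\1_(cell s) x)%:E)%E.
  rewrite (bigD1 (cell_code m x))//= big1 => [|s ne].
    by rewrite indicE mem_set// mule1 adde0 fineK.
  by rewrite indicE memNset ?mule0//= => /eqP; rewrite eq_sym (negbTE ne).
have mf m : measurable_fun setT (f m).
  rewrite (_ : f m = fun x => (\sum_(s : {ffun 'I_m -> bool})
    (fine (la (B `&` cell s)))%:E * (\1_(cell s) x)%:E)%E); last exact/funext.
  apply: emeasurable_sum => s; apply: emeasurable_funM => //.
  by apply/measurable_EFinP; apply: measurable_indic; exact: measurable_cell.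
have If m : (\int[la]_(x in B) f m x = \sum_(s : {ffun 'I_m -> bool})
    ((fine (la (B `&` cell s))) ^+ 2)%:E)%E.
  under eq_integral do rewrite fE.
  rewrite (@ge0_integral_sum _ _ _ la B mB _ (fun (s : {ffun 'I_m -> bool}) x =>
    (fine (la (B `&` cell s)))%:E * (\1_(cell s) x)%:E)%E); first last.
  - by move=> s x _; rewrite mule_ge0// lee_fin ?fine_ge0.
  - move=> s; apply: measurable_funTS; apply: emeasurable_funM => //.
    by apply/measurable_EFinP; apply: measurable_indic; exact: measurable_cell.
  apply: eq_bigr => s _; rewrite ge0_integralZl//; last first.
    by first [by rewrite lee_fin fine_ge0 | by apply: measurable_funTS;
      apply/measurable_EFinP; apply: measurable_indic; exact: measurable_cell].
  rewrite integral_indic//; last exact: measurable_cell.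
  by rewrite (setIC _ B) -[X in (_ * X)%E](fineK (finC m s)) -EFinM expr2.
rewrite (_ : (fun m => _) = (fun m => \int[la]_(x in B) f m x)%E); last first.
  by apply/funext => m; rewrite If.
have [//| | | | |_ _] := @dominated_convergence _ _ R la B mB f (cst 0%E) (cst (la B)).
- by move=> m; exact: measurable_funTS.
- exact: measurable_cst.
- apply: aeW => x Bx.
  have := @nonincreasing_cvg_mu _ _ _ la (fun m => B `&` cell (cell_code m x)).
  rewrite bigcapIr; last by exists 0%N.
  rewrite bigcap_cell (_ : B `&` [set x] = [set x]); last first.
    by apply/seteqP; split => [y []//|y -> //].
  rewrite la0; apply.
  + by rewrite (le_lt_trans (leC _ _)).
  + by [].
  + exact: measurable_point.
  + apply/nonincreasing_seqP => m; apply/subsetPset; apply: setIS.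
    by have /nonincreasing_seqP/(_ m)/subsetPset := cell_nonincreasing x.
- apply/integrableP; split; first exact: measurable_cst.
  under eq_integral do rewrite gee0_abs//.
  by rewrite integral_cst// lte_mul_pinfty// ge0_fin_numE.
- apply: aeW => x m _; rewrite gee0_abs//; exact: leC.
by rewrite integral0.
Qed.

End cells.

Section fine_partition.
Context (R : realType) (k : space_kind) (nu d : nat).
Local Notation E := (espace R k nu).
Variables (mu : {sigma_finite_measure set E -> \bar R})
  (G : 'I_d -> 'I_d -> set E -> R[i]) (g : 'I_d -> 'I_d -> E -> R[i]).
Hypothesis hG : matrix_spectral_measure G mu g.
Hypothesis na : nonatomic mu.

(** The sums of squares are added over the finitely many j before the limit is taken, so one level
    of cells serves for all j. *)
Lemma fine_partition (B : set E) (eps : R) : bborel B -> 0 < eps ->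
  exists (S : finType) (C : S -> set E), [/\ forall s, bborel (C s),
    forall s s', s != s' -> C s `&` C s' = set0, \bigcup_(s in setT) C s = B &
    forall j, \sum_s (fine (nuj hG j (C s))) ^+ 2 <= eps].
Proof.
move=> bB eps0; have [mB _] := bB.
have := @cvg0_sum R _ (enum 'I_d) _ (fun j => sum_sqr_cells mB (nuj_fin hG j bB)
  (fun x => nuj_set1 hG j na (measurable_point x))).
move=> /cvg0_small/(_ eps0)[m _ /(_ m (leqnn m)) le].
exists {ffun 'I_m -> bool}, (fun s => B `&` cell s); split.
- by move=> s; apply: bborelI => //; exact: measurable_cell.
- move=> s s' ss'; apply/seteqP; split => // x [[_ /= xs] [_ /= xs']].
  by move: ss'; rewrite -xs -xs' eqxx.
- by apply/seteqP; split => [x [s _ []]//|x Bx]; exists (cell_code m x).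
move=> j; rewrite -lee_fin -sumEFin; apply: le_trans le.
rewrite (big_rem j) ?mem_enum//= leeDl//.
by apply: sume_ge0 => i _; apply: sume_ge0 => s _; rewrite lee_fin sqr_ge0.
Qed.

Lemma nuj_finite_set j (F : set E) : finite_set F -> nuj hG j F = 0%E.
Proof.
move=> finF; have mx x := @measurable_point R k nu x.
have mF : measurable F.
  rewrite (_ : F = \bigcup_(x in F) [set x]); first by apply: fin_bigcup_measurable.
  by apply/seteqP; split => [x Fx|x [y Fy ->]//]; exists x.
apply/eqP; rewrite eq_le measure_ge0 andbT.
have : (nuj hG j F <= \sum_(x \in F) nuj hG j [set x])%E.
  rewrite -measure_fin_bigcup//; last first.
    by move=> x y _ _ [z [/= -> ->]].
  rewrite (_ : \bigcup_(x in F) [set x] = F)//.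
  by apply/seteqP; split => [x [y Fy ->]//|x Fx]; exists x.
by rewrite fsbig1// => x _; exact: nuj_set1.
Qed.

(** The coordinates of such a point are 0 or, on the torus, -pi. There are at most 2^nu of these
    points, and points carry no mass. *)
Lemma fixed_points_null j : nuj hG j [set x : E | pt_opp x = x] = 0%E.
Proof.
apply: nuj_finite_set.
pose a (b : bool) : axis R k := if b then insubd (@point (axis R k)) (- pi) else insubd (@point (axis R k)) 0.
pose p (s : {ffun 'I_nu -> bool}) : E := [tuple a (s i) | i < nu].
apply: (@sub_finite_set _ _ (range p)); last exact: finite_image finite_finset.
move=> x /= xx; exists [ffun i => val (tnth x i) == - pi] => //.
apply: eq_from_tnth => i; rewrite tnth_mktuple ffunE.
have := congr1 (fun y => val (tnth y i)) xx; rewrite tnth_pt_opp axis_opp_val.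
move: (tnth x i) => y; have ry : axis_range k (val y) := valP y.
have pi0 : 0 < pi :> R := pi_gt0 R.
case: ifPn => [_ e|nry _]; apply: val_inj; rewrite /a.
  have -> : val y = 0 by lra.
  by rewrite eq_sym oppr_eq0 gt_eqF// val_insubd axis_range0.
move: ry nry; rewrite /axis_range.
case E : k y => // y /andP[y1 y2]; rewrite negb_and -!ltNge -leNgt => y3.
have yE : val y = - pi by apply/eqP; rewrite eq_le y1 andbT; case/orP : y3 => y3; lra.
by rewrite yE eqxx val_insubd /axis_range lexx/= ifT//; lra.
Qed.

End fine_partition.

Section complex_facts.
Context (R : realType).
Implicit Types x y : R[i].

Lemma normc_real (r : R) : normc r%:C = `|r|.
Proof. by rewrite /normc /= expr0n /= addr0 sqrtr_sqr. Qed.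

Lemma sqr_normcB x y : normc (x - y) ^+ 2 <= 2 * (normc x ^+ 2 + normc y ^+ 2).
Proof.
rewrite !sqr_normcE !cRI.
have := sqr_ge0 (Re x + Re y); have := sqr_ge0 (Im x + Im y); nra.
Qed.

End complex_facts.

Lemma prode_eq0 (R : realType) (I : finType) (F : I -> \bar R) i :
  F i = 0%E -> (\prod_i F i)%E = 0%E.
Proof. by move=> F0; rewrite (bigD1 i)//= F0 mul0e. Qed.

Section L2_dominated.
Context (dT : measure_display) (T : measurableType dT) (R : realType).
Variable m : {measure set T -> \bar R}.

Lemma N2_dominated (f_ : nat -> T -> R[i]) (f : T -> R[i]) :
  (forall i, cmeasurable (f_ i)) -> cmeasurable f -> (N2 m f < +oo)%E ->
  (forall i x, normc (f_ i x) <= normc (f x)) ->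
  (forall x, (fun i => normc (f_ i x - f x)) @ \oo --> (0 : R)) ->
  (fun i => N2 m (fun x => f_ i x - f x)) @ \oo --> 0%E.
Proof.
move=> mf_ mf ff le c.
pose h i x := (normc (f_ i x - f x) ^+ 2)%:E.
have mh i : measurable_fun setT (h i) by apply: measurable_N2; exact: cmeasurableB.
have [//| | | | |_ _] := @dominated_convergence _ _ R m setT measurableT h (cst 0%E)
  (fun x => 4%:E * (normc (f x) ^+ 2)%:E)%E.
- exact: measurable_cst.
- apply: aeW => x _; apply: cvg_EFin; first exact: nearW.
  rewrite -[X in _ --> X](mulr0 (0 : R)); exact: (cvgM (c x) (c x)).
- apply: integrableZl => //; apply/integrableP; split; first exact: measurable_N2.
  by under eq_integral do rewrite gee0_abs ?lee_fin ?sqr_ge0//.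
- apply: aeW => x i _; change (`|h i x| <= 4%:E * (normc (f x) ^+ 2)%:E)%E.
  rewrite gee0_abs; last by rewrite lee_fin sqr_ge0.
  rewrite /h -EFinM lee_fin.
  apply: le_trans (sqr_normcB _ _) _.
  have : normc (f_ i x) ^+ 2 <= normc (f x) ^+ 2 by rewrite lerXn2r ?nnegrE ?normc_ge0.
  lra.
by rewrite integral0.
Qed.

End L2_dominated.

Section density.
Context (R : realType) (k : space_kind) (nu d : nat).
Local Notation E := (espace R k nu).
Variables (mu : {sigma_finite_measure set E -> \bar R})
  (G : 'I_d -> 'I_d -> set E -> R[i]) (g : 'I_d -> 'I_d -> E -> R[i]).
Hypothesis hG : matrix_spectral_measure G mu g.
Hypothesis na : nonatomic mu.

Section tuples.
Variables (n : nat) (js : n.-tuple 'I_d).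
Local Notation M := (Mj hG js).

Definition sbox (A : 'I_n -> set E) : set (n.-tuple E) :=
  [set x | forall l, A l (tnth x l)].

Lemma measurable_sbox (A : 'I_n -> set E) : (forall l, measurable (A l)) ->
  measurable (sbox A).
Proof.
move=> mA; rewrite (_ : sbox A =
    \bigcap_(i in [set: 'I_n]) [set x : n.-tuple E | A i (tnth x i)]).
  apply: fin_bigcap_measurable => // i _.
  by rewrite -[X in measurable X]setTI; apply: measurable_tnth.
by apply/seteqP; split=> x h i; [move=> _; exact: h|exact: (h i Logic.I)].
Qed.

Lemma prod_cind (A : 'I_n -> set E) x :
  \prod_(l < n) cind R (A l) (tnth x l) = cind R (sbox A) x.
Proof.
have [h|h] := pselect (sbox A x).
  rewrite /cind indicE mem_set//; apply: big1 => l _.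
  by rewrite indicE mem_set//; exact: h.
have [l nl] : exists l, ~ A l (tnth x l) by apply/existsNP.
by rewrite (bigD1 l)//= /cind !indicE !memNset// mul0r.
Qed.

(** The errors to be estimated are differences of indicators, of modulus at most 1, so covering
    their supports by boxes is enough. *)
Lemma N2_le_boxes (I : finType) (W : I -> 'I_n -> set E) (f : n.-tuple E -> R[i]) :
  (forall i l, measurable (W i l)) -> cmeasurable f -> (forall x, normc (f x) <= 1) ->
  (forall x, f x <> 0 -> exists i, sbox (W i) x) ->
  (N2 M f <= \sum_i \prod_(l < n) nuj hG (tnth js l) (W i l))%E.
Proof.
move=> mW mf f1 cov.
have mI i : measurable_fun setT (fun x => (\1_(sbox (W i)) x)%:E : \bar R).
  by apply/measurable_EFinP; apply: measurable_indic; exact: measurable_sbox.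
rewrite [leRHS](_ : _ = \int[M]_x \sum_i (\1_(sbox (W i)) x)%:E)%E; last first.
  rewrite ge0_integral_sum//; apply: eq_bigr => i _.
  by rewrite integral_indic ?setIT -?Mj_box//; exact: measurable_sbox.
apply: ge0_le_integral => //.
- by move=> x _; rewrite lee_fin sqr_ge0.
- exact: measurable_N2.
- exact: emeasurable_sum.
move=> x _; have [->|/eqP f0] := eqVneq (f x) 0.
  by rewrite (_ : normc 0 = 0) ?normc_real ?normr0// expr0n/= sume_ge0.
have [i Wi] := cov _ f0; rewrite (bigD1 i)//= indicE mem_set//.
apply: (@le_trans _ _ 1%E); last by rewrite leeDl// sume_ge0.
by rewrite lee_fin exprn_ile1 ?normc_ge0.
Qed.

End tuples.

Section boxes.
Variables (n : nat) (js : n.-tuple 'I_d) (A : 'I_n -> set E) (T : R).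
Hypotheses (mA : forall l, measurable (A l)) (AT : forall l, A l `<=` cube T).
Variables (S : finType) (C : S -> set E).
Hypotheses (bC : forall s, bborel (C s))
  (CC : forall s s', s != s' -> C s `&` C s' = set0)
  (CU : \bigcup_(s in setT) C s = cube T `&` @half_space R k nu).

Let pc (c : bool * S) : set E := if c.1 then C c.2 else set_opp (C c.2).

Let bpc c : bborel (pc c).
Proof. by rewrite /pc; case: ifP => _; [|apply: bborel_opp]. Qed.

Let pc_opp c : set_opp (pc c) = pc (~~ c.1, c.2).
Proof. by rewrite /pc; case: c => [[] s] //=; rewrite set_oppK. Qed.

Let C_half s x : C s x -> half_space x.
Proof. by move=> Cx; have [] : (cube T `&` @half_space R k nu) x by rewrite -CU; exists s. Qed.

Let pc_uniq c c' x : pc c x -> pc c' x -> c = c'.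
Proof.
have Cu s s' y : C s y -> C s' y -> s = s'.
  move=> Cy Cy'; apply/eqP; apply/negP => /negP /CC h.
  by have : (C s `&` C s') y by []; rewrite h.
case: c c' => [[] s] [[] s']; rewrite /pc /= => h h'.
- by rewrite (Cu _ _ _ h h').
- by have := half_space_opp (C_half h) (C_half h').
- by have := half_space_opp (C_half h') (C_half h).
- by rewrite (Cu _ _ _ h h').
Qed.

Let ok (ks : n.-tuple (bool * S)) : bool :=
  [forall l, forall l', (l != l') ==> ((tnth ks l).2 != (tnth ks l').2)].

(* The indicator of the points of the box with sides A whose coordinates lie in
   distinct, non opposite cells: it differs from the indicator of the box only
   near the diagonals. *)
Definition box_fsum : fsum R k nu n := @FSum R k nu n (n.-tuple (bool * S))%type
  (fun ks => (ok ks)%:R) (fun ks l => if ok ks then A l `&` pc (tnth ks l) else set0).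

Lemma box_fsum_good : fgood box_fsum.
Proof.
move=> /= ks; case: (boolP (ok ks)) => [/forallP oks|_]; last first.
  split => [l|l l'|l l' _]; rewrite ?set0I//; exact: bborel0.
split => [l|l l'|l l' ll'].
- by rewrite setIC; apply: bborelI.
- apply/seteqP; split => // x [[_ h1] [_ h2]].
  have := pc_uniq h1 (_ : pc (~~ (tnth ks l').1, (tnth ks l').2) x).
  rewrite -pc_opp => /(_ h2) e.
  have [ll'|ll'] := eqVneq l l'.
    by move: e; rewrite ll'; case: (tnth ks l') => -[] s.
  by have /forallP/(_ l')/implyP/(_ ll') := oks l; rewrite e /= eqxx.
- apply/seteqP; split => // x [[_ h1] [_ h2]]; have e := pc_uniq h1 h2.
  by have /forallP/(_ l')/implyP/(_ ll') := oks l; rewrite e eqxx.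
Qed.

Let D s := C s `|` set_opp (C s).

(** The boxes that cover what [box_fsum] misses: [inl p] when the p-th coordinate is its own
    opposite, [inr (p, p', s)] when the p-th and the p'-th coordinates both lie in the s-th cell or
    its opposite. For p = p' the box is made empty, so that the index set is a full product. *)
Let idx := ('I_n + 'I_n * 'I_n * S)%type.
Let W (i : idx) (l : 'I_n) : set E := match i with
  | inl p => if l == p then [set x | pt_opp x = x] else cube T
  | inr (p, p', s) => if p == p' then set0 else if (l == p) || (l == p') then D s else cube T end.

Let mF : measurable [set x : E | pt_opp x = x].
Proof.
rewrite (_ : [set x : E | _] = ~` (@half_space R k nu `|` set_opp (@half_space R k nu))).
  apply: measurableC; apply: measurableU; first exact: measurable_half_space.
  apply: measurable_set_opp; exact: measurable_half_space.
apply/seteqP; split => [x /= xx [h|]|x /= h].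
- by apply: (half_space_opp h); rewrite xx.
- by rewrite /set_opp /= xx => h; apply: (half_space_opp h); rewrite xx.
- apply: contrapT => xx; apply: h.
  by case: (half_space_cover xx) => h; [left|right].
Qed.

Let cell ks := sbox (fun l => A l `&` pc (tnth ks l)).

Let fval_box x : fval box_fsum x = \sum_ks (ok ks)%:R * cind R (cell ks) x.
Proof.
apply: eq_bigr => /= ks _; case: (boolP (ok ks)) => oks; last by rewrite !mul0r.
by rewrite (prod_cind (fun l => A l `&` pc (tnth ks l))).
Qed.

Let fval_box1 ks x : ok ks -> cell ks x -> fval box_fsum x = 1.
Proof.
move=> oks h; rewrite fval_box (bigD1 ks)//= big1 => [|ls ne].
  by rewrite oks /cind indicE mem_set// mul1r addr0.
rewrite /cind indicE memNset ?mulr0// => h'; move/eqP : ne; apply.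
apply: eq_from_tnth => l.
by have [_ h1] := h l; have [_ h2] := h' l; exact: pc_uniq h2 h1.
Qed.

Let fval_box0 x : ~ (exists2 ks, ok ks & cell ks x) -> fval box_fsum x = 0.
Proof.
move=> h; rewrite fval_box big1// => ks _.
case: (boolP (ok ks)) => oks; last by rewrite mul0r.
by rewrite /cind indicE memNset ?mulr0// => h'; apply: h; exists ks.
Qed.

Lemma box_fsum_cover x : fval box_fsum x - \prod_(l < n) cind R (A l) (tnth x l) <> 0 ->
  exists i, sbox (W i) x.
Proof.
move=> ne; have [Ax|nAx] := pselect (sbox A x); last first.
  exfalso; apply: ne; rewrite prod_cind /cind indicE memNset// subr0.
  by apply: fval_box0 => -[ks _ h]; apply: nAx => l; case: (h l).
have cT l : cube T (tnth x l) by apply: AT; exact: Ax.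
have [[l xl]|nF] := pselect (exists l, pt_opp (tnth x l) = tnth x l).
  exists (inl l) => l' /=; case: eqP => [->//|_]; exact: cT.
have hpc l : exists c, pc c (tnth x l).
  have cU y : cube T y -> half_space y -> exists s, C s y.
    move=> cy hy; have : (\bigcup_(s in setT) C s) y by rewrite CU.
    by move=> [s _ Cy]; exists s.
  have nl : pt_opp (tnth x l) <> tnth x l by move=> e; apply: nF; exists l.
  have [h|h] := half_space_cover nl.
    by have [s Cs] := cU _ (cT l) h; exists (true, s).
  have [s Cs] := cU _ ((cube_opp T (tnth x l)).2 (cT l)) h.
  by exists (false, s).
pose c l := projT1 (cid (hpc l)); have hc l : pc (c l) (tnth x l) := projT2 (cid (hpc l)).
have [[[l l'] ll' e]|nd] := pselect (exists2 p : 'I_n * 'I_n, p.1 != p.2 & (c p.1).2 = (c p.2).2).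
  have hD q : D (c q).2 (tnth x q).
    by have := hc q; rewrite /pc /D; case: (c q) => -[] s /= h; [left|right].
  exists (inr (l, l', (c l).2)) => q /=; rewrite (negbTE ll'); case: ifP => [/orP[]/eqP->|_].
  - exact: hD.
  - by rewrite e; exact: hD.
  - exact: cT.
exfalso; apply: ne; rewrite prod_cind /cind indicE mem_set//.
pose ks : n.-tuple (bool * S) := [tuple c l | l < n].
rewrite (@fval_box1 ks) ?subrr//.
  apply/forallP => l; apply/forallP => l'; apply/implyP => ll'; apply/eqP => e.
  by apply: nd; exists (l, l'); rewrite //= !tnth_mktuple in e *.
by move=> l; split; [exact: Ax|rewrite tnth_mktuple].
Qed.

Lemma box_fsum_le1 x : normc (fval box_fsum x - \prod_(l < n) cind R (A l) (tnth x l)) <= 1.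
Proof.
have [b ->] : exists b : bool, \prod_(l < n) cind R (A l) (tnth x l) = b%:R.
  by exists (x \in sbox A); rewrite prod_cind /cind indicE; case: (_ \in _).
have [b' ->] : exists b : bool, fval box_fsum x = b%:R.
  have [[ks oks h]|h] := pselect (exists2 ks, ok ks & cell ks x).
    by exists true; rewrite (fval_box1 oks h).
  by exists false; rewrite fval_box0.
have -> : b'%:R - b%:R = (b'%:R - b%:R)%:C :> R[i].
  by case: b' b => -[]; apply: complex_ext => //=; rewrite ?subrr ?subr0 ?sub0r ?oppr0.
by rewrite normc_real; case: b' b => -[]; rewrite /= ?subrr ?subr0 ?sub0r ?normrN ?normr0 ?normr1.
Qed.

Variables (v del : R).
Hypotheses (v1 : 1 <= v) (vT : forall j, fine (nuj hG j (cube T)) <= v)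
  (Cdel : forall j, \sum_s (fine (nuj hG j (C s))) ^+ 2 <= del).

(** The boxes [inl p] are null. For p <> p' and masses a, b of the s-th cell, the box has mass at
    most (2 a) (2 b) v^n <= 2 (a^2 + b^2) v^n, where v >= 1 allows the exponent n. Summing over s
    gives 4 del v^n, and there are n^2 pairs. *)
Lemma box_fsum_N2 : (N2 (Mj hG js)
    (fun x => fval box_fsum x - \prod_(l < n) cind R (A l) (tnth x l))%R <=
  ((n * n)%:R * (4 * del * v ^+ n))%:E)%E.
Proof.
have mW i l : measurable (W i l).
  case: i => [p|[[p p'] s]] /=; first by case: ifP => // _; exact: measurable_cube.
  case: ifP => // _; case: ifP => _; last exact: measurable_cube.
  by have [mC _] := bC s; apply: measurableU => //; exact: measurable_set_opp.
apply: le_trans (N2_le_boxes (W := W) js mW _ box_fsum_le1 box_fsum_cover) _.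
  apply: cmeasurableB; first exact: cmeasurable_fval box_fsum_good.
  by apply: cmeasurable_prod => l _; exact: cmeasurable_tnth_cind.
apply: (@le_trans _ _ (\sum_(i : 'I_n * 'I_n * S)
    \prod_(l < n) nuj hG (tnth js l) (W (inr i) l))%E).
  rewrite big_sumType big1 => [|p _].
    exact: (eq_ind_r (fun x => (x <= _)%E) (lexx _) (add0e _)).
  have WE : W (inl p) p = [set x | pt_opp x = x] by rewrite /W /= eqxx.
  by apply: (@prode_eq0 _ _ _ p); rewrite WE; exact: fixed_points_null.
have nuD j s : nuj hG j (D s) = (fine (nuj hG j (D s)))%:E.
  rewrite fineK// ge0_fin_numE// nuj_fin//; apply: bborelU => //; exact: bborel_opp.
have nuT j : nuj hG j (cube T) = (fine (nuj hG j (cube T)))%:E.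
  by rewrite fineK// ge0_fin_numE// nuj_fin//; exact: bborel_cube.
have nuD2 j s : fine (nuj hG j (D s)) <= 2 * fine (nuj hG j (C s)).
  have fC := nuj_fin hG j (bC s); have [mC _] := bC s.
  rewrite -lee_fin -nuD EFinM fineK ?ge0_fin_numE// mule_natl mule2n.
  apply: le_trans (measureU2 _ _ _) _ => //; first exact: measurable_set_opp.
  apply: leeD => //; rewrite le_eqVlt; apply/orP; left; apply/eqP.
  exact: (nuj_opp hG j mC).
have v0 : 0 <= v by exact: le_trans ler01 v1.
have bound p p' s : p != p' -> (\prod_(l < n) nuj hG (tnth js l) (W (inr (p, p', s)) l) <=
    ((2 * ((fine (nuj hG (tnth js p) (C s))) ^+ 2 +
      (fine (nuj hG (tnth js p') (C s))) ^+ 2)) * v ^+ n)%:E)%E.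
  move=> pp'.
  pose a := fine (nuj hG (tnth js p) (C s)); pose b := fine (nuj hG (tnth js p') (C s)).
  have a0 : 0 <= a by exact: fine_ge0. 
  have b0 : 0 <= b by exact: fine_ge0.
  pose w l := fine (nuj hG (tnth js l) (W (inr (p, p', s)) l)).
  have w0 l : 0 <= w l by exact: fine_ge0.
  have -> : (\prod_(l < n) nuj hG (tnth js l) (W (inr (p, p', s)) l))%E = (\prod_(l < n) w l)%:E.
    rewrite (big_morph EFin EFinM erefl); apply: eq_bigr => l _; rewrite /w /=.
    by rewrite (negbTE pp'); case: ifP => _; rewrite -?nuD -?nuT.
  rewrite lee_fin; apply: (@le_trans _ _ (\prod_(l < n)
      ((if l == p then 2 * a else 1) * (if l == p' then 2 * b else 1) * v))).
    apply: ler_prod => l _; rewrite w0 /= /w /= (negbTE pp').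
    have [->|lp] := eqVneq l p; rewrite /=.
      rewrite (negbTE pp') mulr1 (le_trans (nuD2 _ _))// -/a.
      by rewrite ler_peMr// mulr_ge0.
    have [->|lp'] := eqVneq l p'; rewrite /= ?mul1r; last exact: vT.
    by rewrite (le_trans (nuD2 _ _))// -/b ler_peMr// mulr_ge0.
  rewrite !big_split/= -!big_mkcond/= !big_pred1_eq prodr_const card_ord.
  rewrite ler_wpM2r ?exprn_ge0//.
  have := sqr_ge0 (a - b); rewrite -/a -/b; nra.
apply: (@le_trans _ _ (\sum_(i : 'I_n * 'I_n) \sum_s
  ((2 * ((fine (nuj hG (tnth js i.1) (C s))) ^+ 2 +
      (fine (nuj hG (tnth js i.2) (C s))) ^+ 2)) * v ^+ n)%:E)%E).
  rewrite pair_bigA; apply: lee_sum => -[[p p'] s] _.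
  have [pp'|] := eqVneq p p'; last exact: bound.
  have WE : W (inr (p, p', s)) p = set0 by rewrite /W /= pp' eqxx.
  rewrite (@prode_eq0 _ _ _ p); last by rewrite WE; exact: measure0.
  by rewrite lee_fin !mulr_ge0 ?exprn_ge0// addr_ge0 ?sqr_ge0.
apply: (@le_trans _ _ (\sum_(i : 'I_n * 'I_n) (4 * del * v ^+ n)%:E)%E).
  apply: lee_sum => i _; rewrite sumEFin lee_fin -mulr_suml -mulr_sumr big_split/=.
  rewrite ler_wpM2r ?exprn_ge0//.
  have := Cdel (tnth js i.1); have := Cdel (tnth js i.2); lra.
rewrite sumEFin lee_fin sumr_const card_prod card_ord.
by move: (4 * del * v ^+ n) => q; rewrite [leRHS]mulr_natl.
Qed.

End boxes.

Section dense.
Variables (n : nat) (js : n.-tuple 'I_d).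
Local Notation M := (Mj hG js).

Lemma approx_box (A : 'I_n -> set E) : (forall l, bborel (A l)) ->
  approx hG js (fun x => \prod_(l < n) cind R (A l) (tnth x l)).
Proof.
move=> bA eps eps0.
pose T : R := \sum_(l < n) `|projT1 (cid (bA l).2)|.
have AT l : A l `<=` cube T.
  apply: subset_trans (projT2 (cid (bA l).2)) _; apply: cube_le.
  rewrite /T (bigD1 l)//= (le_trans (ler_norm _))// lerDl.
  by apply: sumr_ge0 => i _.
pose c j : R := fine (nuj hG j (cube T)).
have c0 j : 0 <= c j by exact: fine_ge0.
pose v := 1 + \sum_(j < d) c j.
have v1 : 1 <= v by rewrite lerDl; apply: sumr_ge0.
have vT j : fine (nuj hG j (cube T)) <= v.
  rewrite -/(c j) /v (bigD1 j)//= addrCA lerDl addr_ge0//.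
  by apply: sumr_ge0.
have v0 : 0 < v by lra.
(* The value that turns the bound of [box_fsum_N2] into eps; the successor keeps the denominator
   positive when n = 0. *)
pose del := eps / ((n * n).+1%:R * (4 * v ^+ n)).
have q0 : 0 < (n * n).+1%:R * (4 * v ^+ n) by rewrite !mulr_gt0 ?exprn_gt0.
have bH : bborel (cube T `&` @half_space R k nu).
  by apply: bborelI; [exact: bborel_cube|exact: measurable_half_space].
have [S [C [bC CC CU Cdel]]] := fine_partition hG na bH (divr_gt0 eps0 q0).
have mA l : measurable (A l) by case: (bA l).
exists (box_fsum A C); split; first by apply: box_fsum_good; eassumption.
apply: le_trans (box_fsum_N2 js mA AT bC CC CU v1 vT Cdel) _.
rewrite lee_fin -/del; apply: (@le_trans _ _ ((n * n).+1%:R * (4 * del * v ^+ n))).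
  have del0 : 0 < del by exact: divr_gt0.
  apply: ler_wpM2r; last by rewrite ler_nat.
  by have v0' := ltW v0; have del0' := ltW del0; apply: mulr_ge0; [exact: mulr_ge0|exact: exprn_ge0].
rewrite /del le_eqVlt; apply/orP; left; apply/eqP; field.
by rewrite !gt_eqF// ?exprn_gt0// ltr_wpDr// ler0n.
Qed.

Let boxes : set (set (n.-tuple E)) :=
  [set S | exists2 A : 'I_n -> set E, (forall l, measurable (A l)) & S = sbox A].

Lemma measurable_boxes : @measurable _ (n.-tuple E) = <<s boxes >>.
Proof.
apply/seteqP; split => S.
  move=> mS; have : g_sigma_preimage (fun i (x : n.-tuple E) => tnth x i) S by exact: mS.
  apply: smallest_sub; first exact: smallest_sigma_algebra.
  move=> {mS}S.
  rewrite -bigcup_seq => -[i _ [B mB <-]].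
  apply: sub_sigma_algebra; exists (fun l => if l == i then B else setT).
    by move=> l; case: ifP.
  apply/seteqP; split => [x [_ Bx] l|x h]; first by case: eqP => // ->.
  by split => //; have := h i; rewrite eqxx.
apply: smallest_sub; first exact: sigma_algebra_measurable.
by move=> _ [A mA ->]; exact: measurable_sbox.
Qed.

(** The box of side [cube T] is at distance at most 1 from a good sum, and good sums have finite
    norm. *)
Lemma Mj_cube_fin T (S : set (n.-tuple E)) : measurable S ->
  (N2 M (cind R (S `&` sbox (fun=> cube T))) < +oo)%E.
Proof.
move=> mS; have mU : measurable (sbox (fun _ : 'I_n => cube T : set E)).
  by apply: measurable_sbox => l; exact: measurable_cube.
have [e [ge ee]] := approx_box (fun _ : 'I_n => bborel_cube k nu T) ltr01.
apply: (@le_lt_trans _ _ (N2 M (cind R (sbox (fun _ : 'I_n => cube T : set E))))).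
  apply: le_N2; [apply: cmeasurable_cind; exact: measurableI|exact: cmeasurable_cind|].
  move=> x; rewrite /cind !normc_real !ger0_norm ?indicE// ler_nat.
  by rewrite in_setI; case: (_ \in S).
have -> : cind R (sbox (fun _ : 'I_n => cube T : set E)) =
    (fun x => \prod_(l < n) cind R (cube T : set E) (tnth x l)).
  by apply/funext => x; rewrite (prod_cind (fun=> cube T)).
rewrite [X in N2 _ X](_ : _ = (fun x => fval e x -
    (fval e x - \prod_(l < n) cind R (cube T : set E) (tnth x l)))); last first.
  by apply/funext => x; rewrite subKr.
have mp : cmeasurable (fun x : n.-tuple E => \prod_(l < n) cind R (cube T : set E) (tnth x l)).
  by apply: cmeasurable_prod => l _; apply: cmeasurable_tnth_cind; exact: measurable_cube.
apply: N2B_fin; [exact: cmeasurable_fval|apply: cmeasurableB => //; exact: cmeasurable_fval|..].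
  exact: N2_fval_fin.
by apply: le_lt_trans ee _; rewrite ltry.
Qed.

(** Dynkin induction on S, starting from boxes, which generate and are stable under intersection.
    The cut by a fixed bounded box makes all norms finite, so complements are differences and
    disjoint unions are dominated limits. *)
Lemma approx_set T (S : set (n.-tuple E)) : measurable S ->
  approx hG js (cind R (S `&` sbox (fun=> cube T))).
Proof.
set U := sbox (fun _ : 'I_n => cube T : set E).
have mU : measurable U by apply: measurable_sbox => l; exact: measurable_cube.
rewrite {1}measurable_boxes; move: S.
apply: (dynkin_induction (P := fun S => approx hG js (cind R (S `&` U)))).
- exact: measurable_boxes.
- move=> _ _ [A mA ->] [B mB ->]; exists (fun l => A l `&` B l).
    by move=> l; exact: measurableI.
  by apply/seteqP; split => [x [h h'] l|x h]; [split|split => l; case: (h l)].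
- rewrite setTI; have := approx_box (fun _ : 'I_n => bborel_cube k nu T).
  by under [X in approx _ _ X]eq_fun do rewrite (prod_cind (fun=> cube T)).
- move=> _ [A mA ->]; have := @approx_box (fun l => cube T `&` A l)
    (fun l => bborelI (bborel_cube k nu T) (mA l)).
  under [X in approx _ _ X]eq_fun do rewrite (prod_cind (fun l => cube T `&` A l)).
  rewrite (_ : sbox (fun l => cube T `&` A l) = sbox A `&` U)//.
  by apply/seteqP; split => [x h|x [h1 h2] l]; [split => l; case: (h l)|split].
- move=> S mS aS.
  have aU : approx hG js (cind R U).
    have := approx_box (fun _ : 'I_n => bborel_cube k nu T).
    by under [X in approx _ _ X]eq_fun do rewrite (prod_cind (fun=> cube T)).
  have mc V : measurable V -> cmeasurable (cind R (V `&` U)).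
    by move=> mV; apply: cmeasurable_cind; exact: measurableI.
  have := approxD (cmeasurable_cind R mU) (cmeasurableZ (-1) (mc _ mS)) aU
    (approxZ (-1) (mc _ mS) aS).
  congr approx; apply/funext => x; rewrite mulN1r /cind !indicE !in_setI in_setC.
  by case: (_ \in S); case: (_ \in U); rewrite ?subrr ?subr0.
move=> F mF tF aF.
have mS : measurable (\bigcup_i F i `&` U) by apply: measurableI => //; exact: bigcup_measurable.
have mc i : cmeasurable (cind R (F i `&` U)).
  by apply: cmeasurable_cind; exact: measurableI.
have val x : (\bigcup_i F i) x -> U x -> exists i0, forall i,
    cind R (F i `&` U) x = (i == i0)%:R.
  move=> [i0 _ Fx] Ux; exists i0 => i; rewrite /cind indicE.
  have [->|ne] := eqVneq i i0; first by rewrite mem_set.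
  rewrite memNset// => -[Fx' _]; move/eqP : ne; apply.
  by apply: tF => //; exists x.
have out x : ~ (\bigcup_i F i `&` U) x -> forall i, cind R (F i `&` U) x = 0.
  move=> h i; rewrite /cind indicE memNset// => -[Fx Ux]; apply: h; split => //.
  by exists i.
have sumE x i0 m : (forall i, cind R (F i `&` U) x = (i == i0)%:R) ->
    \sum_(i < m) cind R (F i `&` U) x = (i0 < m)%N%:R.
  move=> h; case: ltnP => im.
    rewrite (bigD1 (Ordinal im))//= h eqxx big1 ?addr0// => i ne.
    by rewrite h (_ : _ == _ = false)//; apply: contraNF ne => /eqP e; apply/eqP/val_inj.
  rewrite big1// => i _; rewrite h; case: eqP => // e.
  by have := ltn_ord i; rewrite e ltnNge im.
have bE (b : bool) : b%:R = (b%:R)%:C :> R[i] by case: b; apply: complex_ext.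
apply: (@approx_cvg _ _ _ _ _ _ _ hG _ _ _ (fun m x => \sum_(i < m) cind R (F i `&` U) x)).
- exact: cmeasurable_cind.
- by move=> m; apply: cmeasurable_sum.
- by move=> m; apply: approx_sum.
apply: N2_dominated.
- by move=> m; apply: cmeasurable_sum.
- exact: cmeasurable_cind.
- by apply: Mj_cube_fin; exact: bigcup_measurable.
- move=> m x; have [[Sx Ux]|nS] := pselect ((\bigcup_i F i `&` U) x).
    have [i0 h] := val _ Sx Ux; rewrite (sumE _ _ _ h) /cind indicE mem_set//.
    by rewrite bE !normc_real !ger0_norm// ler_nat leq_b1.
  rewrite big1 => [|i _]; last exact: out.
  by rewrite (_ : 0 = 0%:C)// normc_real normr0 normc_ge0.
move=> x; apply: cvg_near_cst.
have [[Sx Ux]|nS] := pselect ((\bigcup_i F i `&` U) x).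
  have [i0 h] := val _ Sx Ux; exists i0.+1 => // m im.
  rewrite (sumE _ _ _ h) im /cind indicE mem_set// subrr.
  by rewrite (_ : 0 = 0%:C)// normc_real normr0.
exists 0%N => // m _; rewrite big1 => [|i _]; last exact: out.
by rewrite /cind indicE memNset// subrr (_ : 0 = 0%:C)// normc_real normr0.
Qed.

(** Simple functions below h, cut to growing cubes, converge to h in L2 by domination, and each of
    them is a combination of sets treated by [approx_set]. *)
Lemma approx_nneg (h : n.-tuple E -> R) : measurable_fun setT h -> (forall x, 0 <= h x) ->
  (N2 M (fun x => (h x)%:C) < +oo)%E -> approx hG js (fun x => (h x)%:C).
Proof.
move=> mh h0 hfin.
have mhE : measurable_fun setT (fun x => (h x)%:E) by exact/measurable_EFinP.
pose a := nnsfun_approx measurableT mhE.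
have hE0 x : setT x -> (0 <= (h x)%:E)%E by rewrite lee_fin.
pose U (m : nat) := sbox (fun _ : 'I_n => cube m%:R : set E).
have mU m : measurable (U m) by apply: measurable_sbox => l; exact: measurable_cube.
pose f m x : R[i] := (a m x)%:C * cind R (U m) x.
have ma m : cmeasurable (fun x => (a m x)%:C) by apply: cmeasurable_real; exact: measurable_funP.
have mf m : cmeasurable (f m) by apply: cmeasurableM => //; exact: cmeasurable_cind.
have a0 m x : 0 <= a m x by exact: fun_ge0.
have ah m x : a m x <= h x.
  by rewrite -lee_fin /a (nnsfun_approxE measurableT mhE); exact: le_approx.
have fE m x : f m x = (a m x * \1_(U m) x)%:C by rewrite rmorphM.
have mhC := cmeasurable_real mh.
apply: (@approx_cvg _ _ _ _ _ _ _ hG _ _ _ f) => //.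
- move=> m; pose s := fset_set (a m @` setT).
  rewrite (_ : f m = (fun x => \sum_(i < #|`s|) (s`_i)%:C *
      cind R (a m @^-1` [set s`_i] `&` U m) x)); last first.
    apply/funext => x; rewrite fE (fimfunEord (a m) x) mulr_suml rmorph_sum.
    apply: eq_bigr => i _; rewrite -mulrA !rmorphM /=; congr (_ * _).
    by rewrite /cind indicI /= rmorphM.
  apply: approx_sum => i; first by apply: cmeasurableZ; apply: cmeasurable_cind;
    apply: measurableI.
  move=> _; apply: approxZ; last by apply: approx_set.
  by apply: cmeasurable_cind; apply: measurableI.
apply: N2_dominated => //.
- move=> m x; rewrite fE !normc_real !ger0_norm ?mulr_ge0//.
  by rewrite (le_trans _ (ah m x))// ler_piMr// indicE; case: (_ \in _).
move=> x.
have [m0 hm0] : exists m0 : nat, forall m, (m0 <= m)%N -> U m x.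
  have hl l : exists m : nat, cube m%:R (tnth x l).
    have : (\bigcup_(m : nat) cube m%:R) (tnth x l) by rewrite bigcup_cube.
    by move=> [m _ hm]; exists m.
  exists (\sum_(l < n) projT1 (cid (hl l)))%N => m lm l.
  apply: (cube_le _ (projT2 (cid (hl l)))); rewrite ler_nat.
  by apply: leq_trans lm; rewrite (bigD1 l)//= leq_addr.
have ca : (fun m => a m x) @ \oo --> h x.
  by have /fine_cvgP[_] := cvg_nnsfun_approx measurableT mhE hE0 (x := x) Logic.I.
have : (fun m => `|a m x - h x|) @ \oo --> (0 : R).
  rewrite -(@normr0 _ R) -(subrr (h x)); apply: cvg_norm; apply: cvgB => //.
  exact: cvg_cst.
apply: cvg_trans; apply: near_eq_cvg; exists m0 => // m mm.
rewrite fE indicE mem_set ?mulr1; last exact: hm0.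
by rewrite -rmorphB normc_real.
Qed.

(** The positive and negative parts of the real and imaginary parts are each dominated by |f|, hence
    of finite norm. *)
Theorem density (f : n.-tuple E -> R[i]) : cmeasurable f -> (N2 M f < +oo)%E ->
  approx hG js f.
Proof.
move=> mf ff; have [mr mi] := mf.
have part (h : n.-tuple E -> R) : measurable_fun setT h -> (forall x, `|h x| <= normc (f x)) ->
    approx hG js (fun x => (h x)%:C).
  move=> mh hf.
  have key (p : n.-tuple E -> R) : measurable_fun setT p -> (forall x, 0 <= p x) ->
      (forall x, p x <= `|h x|) -> approx hG js (fun x => (p x)%:C).
    move=> mp p0 ph; apply: approx_nneg => //; apply: le_lt_trans ff.
    apply: (le_N2 _ (cmeasurable_real mp) mf).
    by move=> x; rewrite normc_real ger0_norm// (le_trans (ph x)).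
  have mpos : measurable_fun setT (fun x => Num.max (h x) 0).
    by apply: measurable_maxr => //; exact: measurable_cst.
  have mneg : measurable_fun setT (fun x => Num.max (- h x) 0).
    by apply: measurable_maxr; [exact: measurableT_comp|exact: measurable_cst].
  have apos : approx hG js (fun x => (Num.max (h x) 0)%:C).
    apply: key => // x; first by rewrite le_max lexx orbT.
    by rewrite ge_max normr_ge0 ler_norm.
  have aneg : approx hG js (fun x => (Num.max (- h x) 0)%:C).
    apply: key => // x; first by rewrite le_max lexx orbT.
    by rewrite ge_max normr_ge0 -normrN ler_norm.
  rewrite (_ : (fun x => (h x)%:C) = (fun x => (Num.max (h x) 0)%:C + -1 * (Num.max (- h x) 0)%:C)).
    exact: approxD (cmeasurable_real mpos) (cmeasurableZ (-1) (cmeasurable_real mneg))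
      apos (approxZ (-1) (cmeasurable_real mneg) aneg).
  apply/funext => x; rewrite mulN1r -rmorphB /=; congr (_%:C).
  by case: (leP (h x) 0) => hx; case: (leP (- h x) 0) => hx'; lra.
have aR := part _ mr (fun x => normc_Re (f x)).
have aI := part _ mi (fun x => normc_Im (f x)).
have := approxD (cmeasurable_real mr) (cmeasurableZ (0 +i* 1) (cmeasurable_real mi))
  aR (approxZ (0 +i* 1) (cmeasurable_real mi) aI).
congr approx; apply/funext => x; apply: complex_ext; rewrite !cRI /=; ring.
Qed.

End dense.

End density.

(** * Identities obtained from convergence in L1 *)

Section L1.
Context (dO : measure_display) (O : measurableType dO) (R : realType).
Variable P : probability O R.

Lemma normc_mul_le (t : R) (x y : R[i]) : 0 < t ->
  normc (x * y) <= t * normc x ^+ 2 + t^-1 * normc y ^+ 2.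
Proof.
move=> t0; rewrite Normc.normcM; move: (normc x) (normc y) => a b.
have : 0 <= (t * a - b) ^+ 2 + (t * a) ^+ 2 + b ^+ 2 by rewrite !addr_ge0 ?sqr_ge0.
have -> : (t * a - b) ^+ 2 + (t * a) ^+ 2 + b ^+ 2 =
    2 * t * (t * a ^+ 2 + t^-1 * b ^+ 2 - a * b) by field; rewrite gt_eqF.
by rewrite pmulr_rge0 ?mulr_gt0// subr_ge0.
Qed.

(* Young's inequality with a small parameter replaces Cauchy-Schwarz *)
Lemma L1_null (I : finType) (f g : nat -> I -> O -> R[i]) (D : O -> R[i]) :
  cmeasurable D -> (forall m i, cmeasurable (f m i)) -> (forall m i, cmeasurable (g m i)) ->
  (forall i, exists c : R, \forall m \near \oo, (N2 P (f m i) <= c%:E)%E) ->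
  (forall i, (fun m => N2 P (g m i)) @ \oo --> 0%E) ->
  (forall m, {ae P, forall w, D w = \sum_i f m i w * g m i w}) ->
  {ae P, forall w, D w = 0}.
Proof.
move=> mD mf mg fc g0 DE; pose N1 := (\int[P]_w (normc (D w))%:E)%E.
pose c i := projT1 (cid (fc i)).
have mn (h : O -> R[i]) : cmeasurable h -> measurable_fun setT (fun w => (normc (h w))%:E).
  by move=> mh; apply/measurable_EFinP; exact: measurable_normc.
have le m (t : R) : 0 < t ->
    (N1 <= \sum_i (t%:E * N2 P (f m i) + t^-1%:E * N2 P (g m i)))%E.
  move=> t0; pose h i w : \bar R :=
    (t%:E * (normc (f m i w) ^+ 2)%:E + t^-1%:E * (normc (g m i w) ^+ 2)%:E)%E.
  have h0 i w : (0 <= h i w)%E.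
    by rewrite adde_ge0 ?mule_ge0 ?lee_fin ?sqr_ge0 ?invr_ge0 ?ltW.
  have mh i : measurable_fun setT (h i).
    by apply: emeasurable_funD; apply: emeasurable_funM => //; exact: measurable_N2.
  rewrite [leRHS](_ : _ = \int[P]_w \sum_i h i w)%E; last first.
    rewrite ge0_integral_sum//; apply: eq_bigr => i _.
    rewrite ge0_integralD//; last 4 first.
    - by move=> w _; rewrite mule_ge0 ?lee_fin ?sqr_ge0 ?ltW.
    - by apply: emeasurable_funM => //; exact: measurable_N2.
    - by move=> w _; rewrite mule_ge0 ?lee_fin ?sqr_ge0 ?invr_ge0 ?ltW.
    - by apply: emeasurable_funM => //; exact: measurable_N2.
    rewrite !ge0_integralZl//.
    - exact: measurable_N2.
    - by move=> w _; rewrite lee_fin sqr_ge0.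
    - by rewrite lee_fin invr_ge0 ltW.
    - exact: measurable_N2.
    - by move=> w _; rewrite lee_fin sqr_ge0.
    - by rewrite lee_fin ltW.
  apply: ae_ge0_le_integral => //.
  - by move=> w _; rewrite lee_fin normc_ge0.
  - exact: mn.
  - by move=> w _; exact: sume_ge0.
  - exact: emeasurable_sum.
  apply: filterS (DE m) => w -> _.
  have hE i : h i w = (t * normc (f m i w) ^+ 2 + t^-1 * normc (g m i w) ^+ 2)%:E by [].
  rewrite (eq_bigr (fun i => (t * normc (f m i w) ^+ 2 + t^-1 * normc (g m i w) ^+ 2)%:E) (fun i _ => hE i)).
  rewrite sumEFin lee_fin.
  apply: (@le_trans _ _ (\sum_i normc (f m i w * g m i w))).
    elim/big_ind2 : _ => //; first by rewrite (_ : 0 = 0%:C)// normc_real normr0.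
    move=> x1 x2 y1 y2 h1 h2; apply: le_trans (le_normcD _ _) _.
    exact: lerD.
  by apply: ler_sum => i _; exact: normc_mul_le.
(* Here m tends to infinity with t fixed, which removes the terms with t^-1; only afterwards is t
   made small. *)
have N1le t : 0 < t -> (N1 <= (t * \sum_i c i)%:E)%E.
  move=> t0.
  have near_c : \forall m \near \oo, forall i, (N2 P (f m i) <= (c i)%:E)%E.
    have h (s : seq I) : \forall m \near \oo, forall i, i \in s -> (N2 P (f m i) <= (c i)%:E)%E.
      elim: s => [|i s IH]; first exact: nearW.
      apply: filterS2 (projT2 (cid (fc i))) IH => m h1 h2 i'.
      by rewrite inE => /predU1P[->|]//; exact: h2.
    by apply: filterS (h (enum I)) => m hm i; apply: hm; rewrite mem_enum.
  have c2 : (fun m => \sum_(i <- index_enum I) t^-1%:E * N2 P (g m i))%E @ \oo --> 0%E.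
    by apply: cvg0_sum => i; exact: cvg0Z.
  apply/lee_addgt0Pr => e e0.
  have [m _ /(_ m (leqnn m)) [h1 h2]] := filterI near_c (cvg0_small c2 e0).
  apply: le_trans (le m t t0) _; rewrite big_split/=; apply: leeD => //.
  rewrite mulr_sumr -sumEFin; apply: lee_sum => i _; rewrite EFinM lee_wpmul2l//.
  by rewrite lee_fin ltW.
have N10 : N1 = 0%E.
  apply/eqP; rewrite eq_le integral_ge0 ?andbT; last by move=> w _; rewrite lee_fin normc_ge0.
  apply/lee_addgt0Pr => e e0; rewrite add0e; pose K := 1 + `|\sum_i c i|.
  have K0 : 0 < K by rewrite ltr_pwDl.
  apply: le_trans (N1le (e / K) (divr_gt0 e0 K0)) _; rewrite lee_fin.
  rewrite mulrAC ler_pdivrMr//; apply: ler_wpM2l; first exact: ltW.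
  by rewrite (le_trans (ler_norm _))// lerDr.
have : (\int[P]_w `|(normc (D w))%:E| = 0)%E.
  rewrite -N10; apply: eq_integral => w _; rewrite gee0_abs// lee_fin; exact: normc_ge0.
move=> /ae_eq_integral_abs-/(_ measurableT (mn _ mD)).
apply: filterS => w /(_ Logic.I) [n0]; exact: Normc.eq0_normc n0.
Qed.

End L1.

Lemma tnth_rcons_lift (T : Type) (n : nat) (x : n.-tuple T) y s :
  tnth [tuple of rcons x y] (lift ord_max s) = tnth x s.
Proof. by rewrite (tnth_nth y) lift_max /= nth_rcons size_tuple ltn_ord -tnth_nth. Qed.

Lemma tnth_rcons_max (T : Type) (n : nat) (x : n.-tuple T) y :
  tnth [tuple of rcons x y] ord_max = y.
Proof. by rewrite (tnth_nth y) /= nth_rcons size_tuple ltnn eqxx. Qed.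

(** * The product formula for rectangles *)

Section rectangles.
Context (R : realType) (k : space_kind) (nu d : nat).
Local Notation E := (espace R k nu).
Variables (mu : {sigma_finite_measure set E -> \bar R})
  (G : 'I_d -> 'I_d -> set E -> R[i]) (g : 'I_d -> 'I_d -> E -> R[i]).
Hypothesis hG : matrix_spectral_measure G mu g.
Hypothesis na : nonatomic mu.
Context (dO : measure_display) (O : measurableType dO) (P : probability O R).
Variable Z : 'I_d -> set E -> O -> R[i].
Hypothesis hZ : random_spectral_measure P G Z.
Local Notation EC := (EC P).

Lemma EC_Z4 j1 j2 j3 j4 (A1 A2 A3 A4 : set E) : bborel A1 -> bborel A2 -> bborel A3 ->
  bborel A4 ->
  EC (fun w => Z j1 A1 w * (Z j2 A2 w * (Z j3 A3 w * Z j4 A4 w))) =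
  G j1 j2 (A1 `&` set_opp A2) * G j3 j4 (A3 `&` set_opp A4) +
  G j1 j3 (A1 `&` set_opp A3) * G j2 j4 (A2 `&` set_opp A4) +
  G j1 j4 (A1 `&` set_opp A4) * G j2 j3 (A2 `&` set_opp A3).
Proof.
move=> b1 b2 b3 b4.
pose V (i : 'I_3) := nth (Z j2 A2) [:: Z j2 A2; Z j3 A3; Z j4 A4] i.
have cV i : CGs (Zspace Z) (V i).
  by case: i => -[|[|[|//]]] ?; rewrite /V /=; exact: CGs_Z.
transitivity (EC (fun w => Z j1 A1 w * \prod_i V i w)).
  by apply: eq_EC => w; rewrite !big_ord_recl big_ord0 mulr1.
rewrite (wick (Zspace_meas hZ) (Zspace_gauss hZ) (Zspace_centered hZ) (@Zspace0 _ _ _ _ _ _ Z)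
  (@Zspace_lin _ _ _ _ _ _ Z) xpredT (CGs_Z Z j1 b1) cV).
rewrite !big_ord_recl big_ord0 addr0 /V /=.
rewrite !(EC_ZZ hZ)// addrA; congr (_ * _ + _ * _ + _ * _).
- transitivity (EC (fun w => Z j3 A3 w * Z j4 A4 w)); last by rewrite (EC_ZZ hZ).
  by apply: eq_EC => w; rewrite big_mkcond !big_ord_recl big_ord0 /= mul1r mulr1.
- transitivity (EC (fun w => Z j2 A2 w * Z j4 A4 w)); last by rewrite (EC_ZZ hZ).
  by apply: eq_EC => w; rewrite big_mkcond !big_ord_recl big_ord0 /= mul1r mulr1.
- transitivity (EC (fun w => Z j2 A2 w * Z j3 A3 w)); last by rewrite (EC_ZZ hZ).
  by apply: eq_EC => w; rewrite big_mkcond !big_ord_recl big_ord0 /= !mulr1.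
Qed.

Section fine_products.
Variables (S : finType) (C : S -> set E) (b : bool) (j j' : 'I_d) (del : R).
Hypotheses (bC : forall s, bborel (C s))
  (CC : forall s s', s != s' -> C s `&` C s' = set0)
  (CN : forall s s', C s `&` set_opp (C s') = set0)
  (Cdel : forall j, \sum_s (fine (nuj hG j (C s))) ^+ 2 <= del).

Let C' s := if b then C s else set_opp (C s).
Let m s := G j j' (C' s `&` set_opp (C s)).
(* The terms of Z(B') Z(B) coming from the pairs of equal or opposite cells, minus
   their expectation. *)
Definition fine_error (w : O) : R[i] := \sum_s (Z j (C' s) w * Z j' (C s) w - m s).

Let bC' s : bborel (C' s).
Proof. by rewrite /C'; case: b => //; exact: bborel_opp. Qed.

Lemma callmom_fine_error : callmom P fine_error.
Proof.
apply: callmom_sum => s _; apply: callmomB; last exact: callmom_cst.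
by apply: callmomM; exact: (callmom_Z hZ).
Qed.

Lemma set_oppI (A B : set E) : set_opp (A `&` B) = set_opp A `&` set_opp B.
Proof. by []. Qed.

(** Of the three pairings of the four factors, the one inside each of the two products is cancelled
    by the means; the two cross pairings remain. *)
Let cov s t : EC (fun w => (Z j (C' s) w * Z j' (C s) w - m s) *
    (Z j (C' t) w * Z j' (C t) w - m t)^*) =
  G j j (C' s `&` C' t) * G j' j' (C s `&` C t) +
  G j j' (C' s `&` C t) * G j' j (C s `&` C' t).
Proof.
have cU t' : callmom P (fun w => Z j (C' t') w * Z j' (C t') w).
  by apply: callmomM; exact: (callmom_Z hZ).
have EU t' : EC (fun w => Z j (C' t') w * Z j' (C t') w) = m t' by exact: (EC_ZZ hZ).
have cUJ t' : callmom P (fun w => (Z j (C' t') w * Z j' (C t') w)^*) by exact: callmomJ.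
have EUJ t' : EC (fun w => (Z j (C' t') w * Z j' (C t') w)^*) = (m t')^*.
  by rewrite EC_conj// EU.
transitivity (EC (fun w => (Z j (C' s) w * Z j' (C s) w) * (Z j (C' t) w * Z j' (C t) w)^* +
   ((- (m t)^*) * (Z j (C' s) w * Z j' (C s) w) +
   ((- m s) * (Z j (C' t) w * Z j' (C t) w)^* + m s * (m t)^*)))).
  by apply: eq_EC => w; rewrite rmorphB; ring.
have c1 := callmomM (cU s) (cUJ t); have c2 := callmomZ (- (m t)^*) (cU s).
have c3 := callmomZ (- m s) (cUJ t); have c4 := callmom_cst P (m s * (m t)^*).
rewrite (ECD c1 (callmomD c2 (callmomD c3 c4))) (ECD c2 (callmomD c3 c4)) (ECD c3 c4).
rewrite (ECZ _ (cU s)) (ECZ _ (cUJ t)) EC_cst EU EUJ.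
transitivity (EC (fun w => Z j (C' s) w * (Z j' (C s) w *
    (Z j (set_opp (C' t)) w * Z j' (set_opp (C t)) w))) - m s * (m t)^*).
  rewrite [RHS]addrC; rewrite (_ : forall a : R[i], a + (- (m t)^* * m s + (- m s * (m t)^* + m s * (m t)^*)) = - (m s * (m t)^*) + a); last by move=> a; ring.
  congr (_ + _); apply: ae_eq_EC.
  - by apply: callmom_meas; exact: callmomM.
  - apply: callmom_meas; repeat apply: callmomM; apply: (callmom_Z hZ) => //; exact: bborel_opp.
  apply: filterS2 (Z_opp hZ j (bC' t)) (Z_opp hZ j' (bC t)) => w h1 h2.
  by rewrite rmorphM /= h1 h2 !mulrA.
rewrite EC_Z4//; [|exact: bborel_opp..].
have mt : (m t)^*%C = G j j' (set_opp (C' t) `&` set_opp (set_opp (C t))).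
  rewrite -set_oppI (msm_even hG)// /m; apply: bborelI => //.
  by have [] := bborel_opp (bC t).
have mt2 : (m t)^*%R = G j j' (set_opp (C' t) `&` set_opp (set_opp (C t))) := mt.
by rewrite ?mt ?mt2 !set_oppK -/(m s); ring.
Qed.

(** Distinct cells give uncorrelated terms. With v the sum of the masses of a cell for j and j', a
    diagonal term is at most 4 v^2 + v^2 <= 16 (a^2 + c^2), where a and c are these masses. Each of
    the two sums of squares is at most del, which gives 32 del. *)
Lemma fine_error_N2 : (N2 P fine_error <= (32 * del)%:E)%E.
Proof.
rewrite N2_EC; last exact: callmom_fine_error.
have cU s : callmom P (fun w => Z j (C' s) w * Z j' (C s) w - m s).
  by apply: callmomB; [apply: callmomM; exact: (callmom_Z hZ)|exact: callmom_cst].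
have -> : EC (fun w => fine_error w * (fine_error w)^*) = \sum_s
    (G j j (C' s) * G j' j' (C s) + G j j' (C' s `&` C s) * G j' j (C s `&` C' s)).
  transitivity (EC (fun w => \sum_s \sum_t (Z j (C' s) w * Z j' (C s) w - m s) *
    (Z j (C' t) w * Z j' (C t) w - m t)^*)).
    apply: eq_EC => w; rewrite /fine_error rmorph_sum mulr_suml.
    by apply: eq_bigr => s _; rewrite mulr_sumr.
  rewrite EC_sum; last first.
    by move=> s _; apply: callmom_sum => t _; apply: callmomM => //; exact: callmomJ.
  apply: eq_bigr => s _; rewrite EC_sum; last first.
    by move=> t _; apply: callmomM => //; exact: callmomJ.
  rewrite (bigD1 s)//= cov !setIid big1 ?addr0// => t ts; rewrite cov.
  rewrite [C s `&` C t]CC 1?eq_sym// (G0 hG) mulr0 add0r.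
  rewrite (_ : C' s `&` C t = set0) ?(G0 hG) ?mul0r//.
  by rewrite /C'; case: b; [rewrite CC// eq_sym|rewrite setIC CN].
rewrite cRe_sum lee_fin.
pose v s := fine (nuj hG j (C s)) + fine (nuj hG j' (C s)).
have n0 i s : 0 <= fine (nuj hG i (C s)) by exact: fine_ge0.
have v0 s : 0 <= v s by rewrite addr_ge0.
have C'E i s : fine (nuj hG i (C' s)) = fine (nuj hG i (C s)).
  by rewrite /C'; case: b => //; have [mC _] := bC s; rewrite (nuj_opp hG i mC).
have gD i s (X : set E) : (X = C s \/ X = C' s) -> i = j \/ i = j' ->
    normc (G i i X) <= 2 * v s.
  move=> XC ij; have bX : bborel X by case: XC => ->.
  apply: le_trans (normc_G_le hG i i bX) _.
  have -> : fine (nuj hG i X) = fine (nuj hG i (C s)) by case: XC => ->.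
  by rewrite /v; case: ij => ->; have := n0 j s; have := n0 j' s; lra.
have gX i i' s : (i = j /\ i' = j') \/ (i = j' /\ i' = j) -> normc (G i i' (C s `&` C' s)) <= v s.
  move=> ij; have [->|->] : C s `&` C' s = set0 \/ C s `&` C' s = C s.
    by rewrite /C'; case: b; [right; rewrite setIid|left; exact: CN].
    by rewrite (G0 hG) (_ : 0 = 0%:C)// normc_real normr0.
  apply: le_trans (normc_G_le hG i i' (bC s)) _; rewrite /v.
  by case: ij => -[-> ->]; rewrite // addrC.
apply: (@le_trans _ _ (\sum_s (16 * ((fine (nuj hG j (C s))) ^+ 2 + (fine (nuj hG j' (C s))) ^+ 2)))).
  apply: ler_sum => s _; apply: le_trans (ler_norm _) _; apply: le_trans (normc_Re _) _.
  apply: le_trans (le_normcD _ _) _; rewrite !Normc.normcM.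
  apply: (@le_trans _ _ ((2 * v s) * (2 * v s) + v s * v s)).
    apply: lerD; apply: ler_pM => //; try exact: normc_ge0.
    - by apply: gD; [right|left].
    - by apply: gD; [left|right].
    - by rewrite setIC; apply: gX; left.
    - by apply: gX; right.
  rewrite /v; move: (fine _) (fine _) => a c.
  have := sqr_ge0 (a - c); have := sqr_ge0 (a + c); nra.
rewrite -mulr_sumr big_split/=; have := Cdel j; have := Cdel j'; lra.
Qed.

End fine_products.

(** Additivity of G is read off from that of Z, through the covariance. *)
Lemma G_fin_add (S : finType) (C : S -> set E) (A B : set E) j j' : bborel A ->
  (forall s, bborel (C s)) -> (forall s s', s != s' -> C s `&` C s' = set0) ->
  \bigcup_(s in setT) C s = B ->
  \sum_s G j j' (A `&` set_opp (C s)) = G j j' (A `&` set_opp B).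
Proof.
move=> bA bC CC CB; have bB : bborel B.
  rewrite -CB; have mU : measurable (\bigcup_(s in [set: S]) C s).
    by apply: fin_bigcup_measurable => // s _; case: (bC s).
  split => //; exists (\sum_s `|projT1 (cid (bC s).2)|) => x [s _ Cx].
  apply: (cube_le _ (projT2 (cid (bC s).2) _ Cx)).
  rewrite (bigD1 s)//= (le_trans (ler_norm _))// lerDl.
  by apply: sumr_ge0 => i _.
have cZ := callmom_Z hZ.
transitivity (EC (fun w => \sum_s Z j A w * Z j' (C s) w)).
  rewrite EC_sum; last by move=> s _; apply: callmomM; exact: cZ.
  by apply: eq_bigr => s _; rewrite (EC_ZZ hZ).
rewrite -(EC_ZZ hZ)//; apply: ae_eq_EC.
- by apply: callmom_meas; apply: callmom_sum => s _; apply: callmomM; exact: cZ.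
- by apply: callmom_meas; apply: callmomM; exact: cZ.
by apply: filterS (Z_fin_add hZ j' bC CC) => w; rewrite CB => ->; rewrite mulr_sumr.
Qed.

Lemma Z_addU j (A B : set E) : bborel A -> bborel B -> A `&` B = set0 ->
  {ae P, forall w, Z j (A `|` B) w = Z j A w + Z j B w}.
Proof.
move=> bA bB AB; pose F (c : bool) := if c then A else B.
have bF c : bborel (F c) by rewrite /F; case: c.
have tF c c' : c != c' -> F c `&` F c' = set0.
  by rewrite /F; case: c c' => -[]// _; rewrite setIC.
have := Z_fin_add hZ j bF tF; apply: filterS => w.
rewrite big_bool/= (_ : \bigcup_(c in setT) F c = A `|` B)//.
apply/seteqP; split => [x [[] _ h]|x [h|h]]; [by left|by right|by exists true|by exists false].
Qed.

Definition rext n (A : 'I_n -> set E) (B : set E) (i : 'I_n.+1) : set E :=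
  if unlift ord_max i is Some l then A l else B.

Lemma rext_lift n (A : 'I_n -> set E) B l : rext A B (lift ord_max l) = A l.
Proof. by rewrite /rext liftK. Qed.

Lemma rext_max n (A : 'I_n -> set E) B : rext A B ord_max = B.
Proof. by rewrite /rext unlift_none. Qed.

Lemma Zprod_rext n (js : n.-tuple 'I_d) j' (A : 'I_n -> set E) B w :
  Zprod Z [tuple of rcons js j'] (rext A B) w = Z j' B w * Zprod Z js A w.
Proof.
rewrite /Zprod (bigD1_ord ord_max)//= rext_max tnth_rcons_max; congr (_ * _).
by apply: eq_bigr => l _; rewrite rext_lift tnth_rcons_lift.
Qed.

Lemma sbox_rext n (A : 'I_n -> set E) B x : sbox (rext A B) x <->
  B (tnth x ord_max) /\ forall l, A l (tnth x (lift ord_max l)).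
Proof.
split => [h|[hB hA] i]; first by split => [|l]; [have := h ord_max; rewrite rext_max|
  have := h (lift ord_max l); rewrite rext_lift].
by case: (unliftP ord_max i) => [l ->|->]; rewrite ?rext_lift ?rext_max.
Qed.

Lemma good_rext n (A : 'I_n -> set E) B : good_rect A -> bborel B ->
  B `&` set_opp B = set0 -> (forall l, A l `&` B = set0) ->
  (forall l, A l `&` set_opp B = set0) -> good_rect (rext A B).
Proof.
move=> [bA A1 A2] bB BN AB ABN.
have BAN l : B `&` set_opp (A l) = set0.
  rewrite -[LHS]set_oppK set_oppI set_oppK setIC ABN.
  by apply/seteqP; split => x.
split => [i|i i'|i i' ii'].
- by case: (unliftP ord_max i) => [l ->|->]; rewrite ?rext_lift ?rext_max.
- by case: (unliftP ord_max i) => [l ->|->]; case: (unliftP ord_max i') => [l' ->|->];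
    rewrite ?rext_lift ?rext_max.
- case: (unliftP ord_max i) ii' => [l ->|->]; case: (unliftP ord_max i') => [l' ->|->];
    rewrite ?rext_lift ?rext_max => ii' //.
  + by apply: A2; apply: contraNneq ii' => ->.
  + by rewrite setIC.
  + by rewrite eqxx in ii'.
Qed.

Section critical.
Variables (n : nat) (js : n.+1.-tuple 'I_d) (j' : 'I_d) (A : 'I_n.+1 -> set E) (B : set E).
Variables (p : 'I_n.+1) (b : bool).
Hypotheses (gA : good_rect A) (bB : bborel B) (BN : B `&` set_opp B = set0).
Hypothesis Ap : A p = if b then B else set_opp B.
Local Notation J := [tuple of rcons js j'].

Let bA l : bborel (A l). Proof. exact: good_bborel. Qed.

Let AB l : l != p -> A l `&` B = set0 /\ A l `&` set_opp B = set0.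
Proof.
move=> lp; have [_ A1 A2] := gA; have := A1 l p; have := A2 _ _ lp; rewrite Ap.
by case: b; rewrite ?set_oppK.
Qed.

Definition rest_prod (w : O) : R[i] := \prod_(s < n) Z (tnth js (lift p s)) (A (lift p s)) w.

(** For each cell C_s the part [C' s] of A_p that is equal or opposite to C_s is cut out of A_p,
    which leaves a good rectangle. What is cut out has a double role. In the kernel it is an error
    of mass sum nu(C_s) nu'(C_s), at most del, times the masses of the other sides. In the integral
    it leaves the products Z([C' s]) Z(C_s), whose sum is the error V plus its mean G(A_p cap -
    B). *)
Lemma critical_approx (del : R) : 0 < del -> exists (e : fsum R k nu n.+2) (V : O -> R[i]),
  [/\ fgood e, cmeasurable V,
     (N2 (Mj hG J) (fun x => fval e x - \prod_(i < n.+2) cind R (rext A B i) (tnth x i))%R <=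
       ((\prod_(s < n) fine (nuj hG (tnth js (lift p s)) (A (lift p s)))) * del)%:E)%E,
     (N2 P V <= (32 * del)%:E)%E &
     {ae P, forall w, Zprod Z js A w * Z j' B w - fJ Z J e w =
        rest_prod w * (V w + G (tnth js p) j' (A p `&` set_opp B))}].
Proof.
move=> del0; have [S [C [bC CC CB Cdel]]] := fine_partition hG na bB del0.
have CsB s : C s `<=` B by move=> x Cx; rewrite -CB; exists s.
have CN s s' : C s `&` set_opp (C s') = set0.
  apply/seteqP; split => // x [h1 h2]; have : (B `&` set_opp B) x.
    by split; [exact: CsB h1|apply: (CsB s' (pt_opp x))].
  by rewrite BN.
pose C' s := if b then C s else set_opp (C s).
have bC' s : bborel (C' s) by rewrite /C'; case: b => //; exact: bborel_opp.
have C'A s : C' s `<=` A p.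
  by rewrite Ap /C'; case: b => x Cx; [exact: CsB Cx|apply: (CsB s (pt_opp x))].
pose Ds s := C s `|` set_opp (C s).
have mDs s : measurable (Ds s).
  have [mC _] := bC s; have [mCo _] := bborel_opp (bC s); exact: measurableU.
have ApD s : A p `&` Ds s = C' s.
  apply/seteqP; split => [x []|x Cx]; last first.
    by split; [exact: C'A Cx|move: Cx; rewrite /C' /Ds; case: b => h; [left|right]].
  rewrite Ap /C' /Ds; case: b => Bx [Cx|Cx] //.
  - have : (B `&` set_opp B) x by split => //; apply: (CsB s (pt_opp x)).
    by rewrite BN.
  - have : (B `&` set_opp B) x by split => //; exact: CsB Cx.
    by rewrite BN.
(* Both the cell and its opposite are removed, because the last side C_s has to miss the p-th side
   and its opposite. *)
pose As s l := if l == p then A p `\` Ds s else A l.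
pose e : fsum R k nu n.+2 := @FSum R k nu n.+2 S (fun=> 1) (fun s => rext (As s) (C s)).
have bAs s l : bborel (As s l) by rewrite /As; case: eqP => // _; exact: bborelD.
have AsA s l : As s l `<=` A l by rewrite /As; case: eqP => [-> x []|_ x].
have gAs s : good_rect (As s).
  have [_ A1 A2] := gA; split => // l l'.
  - apply/seteqP; split => // x [h1 h2]; have : (A l `&` set_opp (A l')) x.
      by split; [exact: AsA h1|exact: (AsA s l' (pt_opp x))].
    by rewrite A1.
  - move=> ll'; apply/seteqP; split => // x [h1 h2]; have : (A l `&` A l') x.
      by split; [exact: AsA h1|exact: AsA h2].
    by rewrite A2.
have ge : fgood e.
  move=> s; apply: good_rext => // l.
  - apply/seteqP; split => // x []; rewrite /As; case: eqP => [_ [_ h] Cx|/eqP lp Ax Cx].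
      by apply: h; left.
    have : (A l `&` B) x by split => //; exact: CsB Cx.
    by rewrite (AB lp).1.
  - apply/seteqP; split => // x []; rewrite /As; case: eqP => [_ [_ h] Cx|/eqP lp Ax Cx].
      by apply: h; right.
    have : (A l `&` set_opp B) x by split => //; exact: (CsB s (pt_opp x)).
    by rewrite (AB lp).2.
pose V (w : O) : R[i] := \sum_s (Z (tnth js p) (C' s) w * Z j' (C s) w -
  G (tnth js p) j' (C' s `&` set_opp (C s))).
have cV : callmom P V by exact: callmom_fine_error.
exists e, V; split => //.
- exact: callmom_meas cV.
(* A point of the full rectangle whose last coordinate is in C_s is missed only if its p-th
   coordinate lies in A_p and in [Ds s], that is in [C' s]; these boxes cover the error. *)
- pose W s := rext (fun l => if l == p then C' s else A l) (C s).
  have mW s i : measurable (W s i).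
    rewrite /W; case: (unliftP ord_max i) => [l ->|->]; rewrite ?rext_lift ?rext_max.
      by case: ifP => _; [have [] := bC' s|have [] := bA l].
    by have [] := bC s.
  have bext i : bborel (rext A B i).
    by case: (unliftP ord_max i) => [l ->|->]; rewrite ?rext_lift ?rext_max.
  have fvalE x : fval e x = \sum_s cind R (sbox (rext (As s) (C s))) x.
    by apply: eq_bigr => s _; rewrite mul1r (prod_cind (rext (As s) (C s))).
  have Cu s s' y : C s y -> C s' y -> s = s'.
    move=> h h'; apply/eqP; apply/negP => /negP /CC CC0.
    by have : (C s `&` C s') y by []; rewrite CC0.
  have f01 x : fval e x = 0 /\ (forall s, ~ sbox (rext (As s) (C s)) x) \/
      fval e x = 1 /\ exists s, sbox (rext (As s) (C s)) x.
    have [[s hs]|h] := pselect (exists s, sbox (rext (As s) (C s)) x); last first.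
      left; split; last by move=> s hs; apply: h; exists s.
      by rewrite fvalE big1// => s _; rewrite /cind indicE memNset// => hs; apply: h; exists s.
    right; split; last by exists s.
    rewrite fvalE (bigD1 s)//= {1}/cind indicE mem_set// big1 ?addr0// => s' ne.
    rewrite /cind indicE memNset// => hs'; move/eqP : ne; apply.
    by move/sbox_rext : hs => [h _]; move/sbox_rext : hs' => [h' _]; exact: Cu h' h.
  have sub s x : sbox (rext (As s) (C s)) x -> sbox (rext A B) x.
    move=> /sbox_rext[h1 h2]; apply/sbox_rext; split; first exact: CsB h1.
    by move=> l; exact: AsA (h2 l).
  apply: le_trans (N2_le_boxes (W := W) hG J mW _ _ _) _.
  + apply: cmeasurableB; first exact: cmeasurable_fval.
    by apply: cmeasurable_prod => i _; apply: cmeasurable_tnth_cind; have [] := bext i.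
  + move=> x; rewrite prod_cind.
    have n01 (r : R) : normc r%:C = `|r| := normc_real r.
    have [[-> _]|[-> [s hs]]] := f01 x.
      rewrite sub0r (_ : - cind R _ x = (- \1_(sbox (rext A B)) x)%:C); last by rewrite rmorphN.
      by rewrite normc_real normrN ger0_norm// indicE; case: (_ \in _).
    by rewrite /cind indicE mem_set ?subrr ?Normc.normc0//; exact: sub hs.
  + move=> x ne; have [[f0 h]|[f1 [s hs]]] := f01 x; last first.
      by exfalso; apply: ne; rewrite f1 prod_cind /cind indicE mem_set ?subrr//; exact: sub hs.
    have hx : sbox (rext A B) x.
      apply: contrapT => hx; apply: ne; rewrite f0 prod_cind /cind indicE memNset// subr0//.
    move/sbox_rext : (hx) => [hB hA].
    have : (\bigcup_(s in setT) C s) (tnth x ord_max) by rewrite CB.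
    move=> [s _ Cs]; exists s; apply/sbox_rext; split => // l.
    case: eqP => [->|_]; last exact: hA.
    rewrite -ApD; split; first exact: hA.
    apply: contrapT => nD; apply: (h s); apply/sbox_rext; split => // l'.
    by rewrite /As; case: eqP => [->|_]; [split => //; exact: hA|exact: hA].
  pose K : R := \prod_(s < n) fine (nuj hG (tnth js (lift p s)) (A (lift p s))).
  pose c j s : R := fine (nuj hG j (C s)).
  have fn i (X : set E) : bborel X -> nuj hG i X = (fine (nuj hG i X))%:E.
    by move=> bX; rewrite fineK// ge0_fin_numE// nuj_fin.
  have nC' i s : nuj hG i (C' s) = (c i s)%:E.
    rewrite -fn// /C'; case: b => //; have [mC _] := bC s; exact: (nuj_opp hG i mC).
  have WE s : (\prod_(i < n.+2) nuj hG (tnth J i) (W s i))%E =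
      ((c j' s * c (tnth js p) s) * K)%:E.
    have bW i : bborel (W s i).
      rewrite /W; case: (unliftP ord_max i) => [l ->|->]; rewrite ?rext_lift ?rext_max//.
      by case: ifP.
    pose w i : R := fine (nuj hG (tnth J i) (W s i)).
    have w1 : w ord_max = c j' s by rewrite /w /W rext_max tnth_rcons_max.
    have w2 : w (lift ord_max p) = c (tnth js p) s.
      by rewrite /w /W rext_lift tnth_rcons_lift eqxx nC'.
    have w3 l : w (lift ord_max (lift p l)) = fine (nuj hG (tnth js (lift p l)) (A (lift p l))).
      by rewrite /w /W rext_lift tnth_rcons_lift eq_sym (negbTE (neq_lift p l)).
    rewrite (eq_bigr (fun i => (w i)%:E)) => [|i _]; last exact: fn.
    rewrite -(big_morph EFin EFinM erefl); congr EFin.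
    rewrite (bigD1_ord ord_max)//= w1 (bigD1_ord p)//= w2 mulrA; congr (_ * _).
    by apply: eq_bigr => l _; exact: w3.
  rewrite (eq_bigr _ (fun s _ => WE s)) sumEFin lee_fin -mulr_suml mulrC.
  apply: ler_wpM2l; first by apply: prodr_ge0 => s _; exact: fine_ge0.
  apply: (@le_trans _ _ (\sum_s (c j' s ^+ 2 / 2 + c (tnth js p) s ^+ 2 / 2))).
    apply: ler_sum => s _; have := sqr_ge0 (c j' s - c (tnth js p) s); lra.
  rewrite big_split/= -!mulr_suml.
  have h1 : \sum_s c j' s ^+ 2 <= del by exact: Cdel.
  have h2 : \sum_s c (tnth js p) s ^+ 2 <= del by exact: Cdel.
  lra.
- exact: fine_error_N2.
have aeB := Z_fin_add hZ j' bC CC.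
have aeA : {ae P, forall w, forall s,
    Z (tnth js p) (A p) w = Z (tnth js p) (A p `\` Ds s) w + Z (tnth js p) (C' s) w}.
  have AU s : (A p `\` Ds s) `|` C' s = A p.
    apply/seteqP; split => [x [[]//|]|x Ax]; first exact: C'A.
    have [Dx|nDx] := pselect (Ds s x); last by left.
    by right; rewrite -ApD.
  have AD s : (A p `\` Ds s) `&` C' s = set0.
    by rewrite -(ApD s); apply/seteqP; split => // x [[_ h] [_]].
  apply: (@ae_forall_fin _ _ _ P S (fun s w => Z (tnth js p) (A p) w =
    Z (tnth js p) (A p `\` Ds s) w + Z (tnth js p) (C' s) w)) => s.
  by have := Z_addU (tnth js p) (bborelD (bA p) (mDs s)) (bC' s) (AD s); rewrite AU.
apply: filterS2 aeB aeA => w hB hA.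
have mE s : G (tnth js p) j' (C' s `&` set_opp (C s)) = G (tnth js p) j' (A p `&` set_opp (C s)).
  congr G; apply/seteqP; split => x [h1 h2]; split => //; first exact: C'A h1.
  by rewrite -ApD; split => //; right.
have -> : V w = \sum_s Z (tnth js p) (C' s) w * Z j' (C s) w -
    G (tnth js p) j' (A p `&` set_opp B).
  rewrite /V sumrB; congr (_ - _).
  by rewrite -(G_fin_add (tnth js p) j' (bA p) bC CC CB); apply: eq_bigr => s _; exact: mE.
have ZE (X : 'I_n.+1 -> set E) : (forall s, X (lift p s) = A (lift p s)) ->
    Zprod Z js X w = Z (tnth js p) (X p) w * rest_prod w.
  move=> XA; rewrite /Zprod (bigD1_ord p)//=; congr (_ * _).
  by apply: eq_bigr => s _; rewrite XA.
rewrite subrK ZE// -CB hB.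
have -> : fJ Z J e w = \sum_s Z j' (C s) w *
    ((Z (tnth js p) (A p) w - Z (tnth js p) (C' s) w) * rest_prod w).
  apply: eq_bigr => s _; rewrite mul1r Zprod_rext ZE; last first.
    by move=> s'; rewrite /As eq_sym (negbTE (neq_lift p s')).
  by rewrite /As eqxx (hA s) addrK.
rewrite [X in X - _]mulr_sumr [RHS]mulr_sumr -sumrB; apply: eq_bigr => s _; ring.
Qed.

(** With del = 2^-m the difference of the two sides is, for every m, [rest_prod] times V_m plus 1
    times the error of the m-th integral. Each product has a factor fixed in L2 and one tending to
    0, so [L1_null] applies. *)
Lemma critical_formula X :
  Wint hG P Z J (fun x => \prod_(i < n.+2) cind R (rext A B i) (tnth x i)) X ->
  {ae P, forall w, Zprod Z js A w * Z j' B w = X w +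
     G (tnth js p) j' (A p `&` set_opp B) * rest_prod w}.
Proof.
move=> WX; have [mX _] := WX.
have bext i : bborel (rext A B i).
  by case: (unliftP ord_max i) => [l ->|->]; rewrite ?rext_lift ?rext_max.
pose f (x : n.+2.-tuple E) := \prod_(i < n.+2) cind R (rext A B i) (tnth x i).
have mf : cmeasurable f.
  by apply: cmeasurable_prod => i _; apply: cmeasurable_tnth_cind; have [] := bext i.
have del0 m : 0 < (2^-1 ^+ m : R) by rewrite exprn_gt0.
pose e m := projT1 (cid (critical_approx (del0 m))).
pose V m := projT1 (cid (projT2 (cid (critical_approx (del0 m))))).
have H m := projT2 (cid (projT2 (cid (critical_approx (del0 m))))).
pose K : R := \prod_(s < n) fine (nuj hG (tnth js (lift p s)) (A (lift p s))).
have geo : (fun m => (2^-1 ^+ m)%:E : \bar R) @ \oo --> 0%E.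
  by apply: cvg0_geometric; apply/andP; split; lra.
have ef : fcv hG J f e.
  split => [m|]; first by have [] := H m.
  apply: (cvg0_le (v := fun m => (K%:E * (2^-1 ^+ m)%:E)%E)) => [m|m|]; first exact: N2_ge0.
    by rewrite -EFinM; have [] := H m.
  exact: cvg0Z.
have eX := Wint_cvg hZ mf WX ef.
have mge m : cmeasurable (fJ Z J (e m)).
  by apply: (cmeasurable_fJ hZ); have [] := H m.
have cQ : callmom P rest_prod.
  by apply: callmom_prod => s _; exact: (callmom_Z hZ).
have cZZ : callmom P (fun w => Zprod Z js A w * Z j' B w).
  by apply: callmomM; [apply: (callmom_Zprod hZ)|apply: (callmom_Z hZ)].
pose D w := Zprod Z js A w * Z j' B w - (X w +
     G (tnth js p) j' (A p `&` set_opp B) * rest_prod w).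
suff : {ae P, forall w, D w = 0}.
  by apply: filterS => w /eqP; rewrite subr_eq0 => /eqP.
apply: (@L1_null _ _ _ _ bool (fun _ c => if c then rest_prod else fun=> 1)
  (fun m c => if c then V m else fun w => fJ Z J (e m) w - X w)).
- apply: cmeasurableB; first exact: callmom_meas cZZ.
  by apply: cmeasurableD => //; apply: cmeasurableZ; exact: callmom_meas cQ.
- by move=> m [] /=; [exact: callmom_meas cQ|exact: cmeasurable_cst].
- by move=> m [] /=; [have [] := H m|exact: cmeasurableB].
- move=> c; exists (fine (N2 P (if c then rest_prod else fun=> 1))); apply: nearW => m.
  rewrite fineK// ge0_fin_numE ?N2_ge0// N2_callmom_fin//.
  by case: c => //; exact: callmom_cst.
- case => /=; last exact: eX.
  apply: (cvg0_le (v := fun m => (32%:E * (2^-1 ^+ m)%:E)%E)) => [m|m|]; first exact: N2_ge0.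
    by rewrite -EFinM; have [] := H m.
  exact: cvg0Z.
move=> m; have [_ _ _ _] := H m; apply: filterS => w h; rewrite big_bool/= mul1r /D.
have -> : Zprod Z js A w * Z j' B w = fJ Z J (e m) w +
    rest_prod w * (V m w + G (tnth js p) j' (A p `&` set_opp B)) by rewrite -h addrC subrK.
ring.
Qed.

End critical.

(** At most one side can equal B or - B, since the sides are disjoint from each other and from the
    opposites; the remaining terms of the sum vanish with G of the empty set. If there is no such
    side, the extended rectangle is itself good and the whole sum is zero. *)
Lemma rectangle_formula n (js : n.+1.-tuple 'I_d) j' (A : 'I_n.+1 -> set E) B X :
  good_rect A -> bborel B -> B `&` set_opp B = set0 ->
  (forall l, [\/ A l `&` (B `|` set_opp B) = set0, A l = B | A l = set_opp B]) ->
  Wint hG P Z [tuple of rcons js j']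
    (fun x => \prod_(i < n.+2) cind R (rext A B i) (tnth x i)) X ->
  {ae P, forall w, Zprod Z js A w * Z j' B w = X w + \sum_(p < n.+1)
     G (tnth js p) j' (A p `&` set_opp B) *
     Zprod Z (tuple_del p js) (fun s => A (lift p s)) w}.
Proof.
move=> gA bB BN cmp WX; have bA l : bborel (A l) := good_bborel l gA.
have [[p Ap]|np] := pselect (exists p, A p = B \/ A p = set_opp B).
  have [b Apb] : exists b : bool, A p = if b then B else set_opp B.
    by case: Ap => ->; [exists true|exists false].
  apply: filterS (critical_formula gA bB BN Apb WX) => w ->; congr (_ + _).
  rewrite (bigD1 p)//= big1 ?addr0 => [|q qp].
    congr (_ * _); rewrite /rest_prod /Zprod; apply: eq_bigr => s _.
    by rewrite tnth_mktuple.
  have [_ A1 A2] := gA.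
  have -> : A q `&` set_opp B = set0.
    case: b Apb => Apb; last by rewrite -Apb A2.
    by rewrite -Apb A1.
  by rewrite (G0 hG) mul0r.
have AB l : A l `&` (B `|` set_opp B) = set0.
  by case: (cmp l) => // h; exfalso; apply: np; exists l; [left|right].
have ABl l : A l `&` B = set0.
  by apply/seteqP; split => // x [h1 h2]; rewrite -(AB l); split => //; left.
have ABr l : A l `&` set_opp B = set0.
  by apply/seteqP; split => // x [h1 h2]; rewrite -(AB l); split => //; right.
have gext := good_rext gA bB BN ABl ABr.
pose e : fsum R k nu n.+2 := @FSum R k nu n.+2 unit (fun=> 1) (fun=> rext A B).
have ge : fgood e by move=> [].
have sumu (F : unit -> R[i]) : \sum_i F i = F tt.
  by rewrite (bigD1 tt)//= big1 ?addr0// => -[].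
have eE : (fun x => \prod_(i < n.+2) cind R (rext A B i) (tnth x i)) = fval e.
  by apply/funext => x; rewrite /fval sumu mul1r.
have JE w : fJ Z [tuple of rcons js j'] e w = Zprod Z js A w * Z j' B w.
  by rewrite /fJ sumu mul1r Zprod_rext mulrC.
rewrite eE in WX.
have := Wint_uniq hZ (cmeasurable_fval ge) WX (Wint_fsum hG hZ [tuple of rcons js j'] ge).
apply: filterS => w ->; rewrite JE big1 ?addr0// => p _.
by rewrite ABr (G0 hG) mul0r.
Qed.

End rectangles.

(** * Contractions *)

Section cintegral_linear.
Context (dT : measure_display) (T : measurableType dT) (R : realType).
Variable m : {measure set T -> \bar R}.
Implicit Types f g : T -> R[i].

Lemma cintegrableD f g : cintegrable m setT f -> cintegrable m setT g ->
  cintegrable m setT (fun x => f x + g x).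
Proof.
move=> [f1 f2] [g1 g2]; split.
  under eq_fun do rewrite cReD EFinD; exact: integrableD.
under eq_fun do rewrite cImD EFinD; exact: integrableD.
Qed.

Lemma cintegrableZ c f : cintegrable m setT f -> cintegrable m setT (fun x => c * f x).
Proof.
move=> [f1 f2]; split.
  under eq_fun do rewrite cReM EFinB !EFinM.
  by apply: integrableB => //; apply: integrableZl.
under eq_fun do rewrite cImM EFinD !EFinM.
by apply: integrableD => //; apply: integrableZl.
Qed.

Lemma cintegralE f : cintegrable m setT f ->
  cintegral m setT f = (\int[m]_x Re (f x)) +i* (\int[m]_x Im (f x)).
Proof. by move=> fi; rewrite /cintegral asboolT. Qed.

Lemma cintegralD f g : cintegrable m setT f -> cintegrable m setT g ->
  cintegral m setT (fun x => f x + g x) = cintegral m setT f + cintegral m setT g.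
Proof.
move=> fi gi; rewrite !cintegralE//; last exact: cintegrableD.
have [f1 f2] := fi; have [g1 g2] := gi.
under eq_Rintegral do rewrite cReD.
under [X in _ +i* X]eq_Rintegral do rewrite cImD.
by rewrite !RintegralD.
Qed.

Lemma cintegralZ c f : cintegrable m setT f ->
  cintegral m setT (fun x => c * f x) = c * cintegral m setT f.
Proof.
move=> fi; rewrite !cintegralE//; last exact: cintegrableZ.
have [f1 f2] := fi.
under eq_Rintegral do rewrite cReM.
under [X in _ +i* X]eq_Rintegral do rewrite cImM.
have iZ (r : R) (h : T -> R) : m.-integrable setT (fun x => (h x)%:E) ->
    m.-integrable setT (fun x => (r * h x)%:E).
  by move=> hi; under eq_fun do rewrite EFinM; exact: integrableZl.
rewrite RintegralB ?RintegralD//; try exact: iZ.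
by rewrite !RintegralZl//; case: c.
Qed.

Lemma cintegrable_sum (I : Type) (r : seq I) (f : I -> T -> R[i]) :
  (forall i, cintegrable m setT (f i)) ->
  cintegrable m setT (fun x => \sum_(i <- r) f i x) /\
  cintegral m setT (fun x => \sum_(i <- r) f i x) = \sum_(i <- r) cintegral m setT (f i).
Proof.
move=> fi; elim: r => [|i r [IH1 IH2]].
  under eq_fun do rewrite big_nil; rewrite big_nil.
  have i0 : cintegrable m setT (fun _ : T => 0 : R[i]) by split; exact: integrable0.
  split => //; rewrite cintegralE//= !Rintegral_cst ?mul0r//.
under eq_fun do rewrite big_cons; rewrite big_cons.
by split; [exact: cintegrableD|rewrite cintegralD// IH2].
Qed.

Lemma cintegral_conj f : cintegral m setT (fun x => (f x)^*%C) = (cintegral m setT f)^*%C.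
Proof.
have conjI h : cintegrable m setT h -> cintegrable m setT (fun x => (h x)^*%C).
  move=> [h1 h2]; split; first by under eq_fun do rewrite cReJ.
  by under eq_fun do rewrite cImJ EFinN; exact: integrableN.
have [fi|nfi] := pselect (cintegrable m setT f); last first.
  rewrite /cintegral asboolF ?asboolF ?rmorph0// => fi; apply: nfi.
  by have := conjI _ fi; under eq_fun do rewrite conjcK.
rewrite !cintegralE//; last exact: conjI.
under eq_Rintegral do rewrite cReJ.
under [X in _ +i* X]eq_Rintegral do rewrite cImJ -mulN1r.
by rewrite RintegralZl ?mulN1r//; case: fi.
Qed.

Lemma normc_cintegral_le f : cintegrable m setT f ->
  normc (cintegral m setT f) ^+ 2 <= 2 * (fine (\int[m]_x (normc (f x))%:E)) ^+ 2.
Proof.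
move=> fi; have [i1 i2] := fi.
have mf : cmeasurable f.
  by split; apply/measurable_EFinP; [case/integrableP : i1|case/integrableP : i2].
have fin := (cintegrableP m measurableT mf).1 fi.
have n0 : (0 <= \int[m]_x (normc (f x))%:E)%E.
  by apply: integral_ge0 => x _; rewrite lee_fin normc_ge0.
have nfin : (\int[m]_x (normc (f x))%:E)%E \is a fin_num by rewrite ge0_fin_numE.
have part (h : T -> R) : m.-integrable setT (fun x => (h x)%:E) ->
    (forall x, `|h x| <= normc (f x)) ->
    (\int[m]_x h x) ^+ 2 <= (fine (\int[m]_x (normc (f x))%:E)) ^+ 2.
  move=> hi hf; have mh : measurable_fun setT h.
    by apply/measurable_EFinP; case/integrableP : hi.
  have le : `|\int[m]_x h x| <= fine (\int[m]_x (normc (f x))%:E).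
    rewrite -lee_fin fineK// EFin_normr_Rintegral//.
    apply: le_trans (le_abse_integral m measurableT _) _; first exact/measurable_EFinP.
    apply: ge0_le_integral => //.
    - by apply: measurableT_comp => //; exact/measurable_EFinP.
    - by apply/measurable_EFinP; exact: measurable_normc.
    - by move=> x _; rewrite lee_fin.
  rewrite -(real_normK (num_real (\int[m]_x h x))).
  by rewrite lerXn2r ?nnegrE ?fine_ge0.
rewrite sqr_normcE cintegralE//= mulr_natl mulr2n; apply: lerD; apply: part => // x.
  exact: normc_Re.
exact: normc_Im.
Qed.

End cintegral_linear.

Section contraction.
Context (R : realType) (k : space_kind) (nu d : nat).
Local Notation E := (espace R k nu).
Variables (mu : {sigma_finite_measure set E -> \bar R})
  (G : 'I_d -> 'I_d -> set E -> R[i]) (g : 'I_d -> 'I_d -> E -> R[i]).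
Hypothesis hG : matrix_spectral_measure G mu g.

Lemma N2_snu j (f : E -> R[i]) : cmeasurable f ->
  N2 (snu hG j) f = (\int[mu]_y ((normc (f y) * Num.sqrt (rho g j y)) ^+ 2)%:E)%E.
Proof.
move=> mf; rewrite /N2 (_ : (\int[snu hG j]_x _)%E =
  (\int[nuj hG j]_x (normc (f x) ^+ 2)%:E)%E)//.
rewrite /nuj integral_dens//; last first.
- by move=> x; rewrite lee_fin sqr_ge0.
- exact: measurable_N2.
by apply: eq_integral => y _; rewrite exprMn sqr_sqrtr ?rho_ge0// EFinM.
Qed.

(** The bound |g_jj'|^2 <= rho_j rho_j' distributes the density over the two factors, and
    Cauchy-Schwarz for mu does the rest. The factor 2 comes from estimating real and imaginary parts
    separately. *)
Lemma Gintegrable j j' (f h : E -> R[i]) : cmeasurable f -> cmeasurable h ->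
  (N2 (snu hG j) f < +oo)%E -> (N2 (snu hG j') h < +oo)%E ->
  cintegrable mu setT (fun y => (f y * h y) * g j j' y) /\
  (((normc (cintegral mu setT (fun y => (f y * h y) * g j j' y))) ^+ 2)%:E <=
    2%:E * (N2 (snu hG j) f * N2 (snu hG j') h))%E.
Proof.
move=> mf mh ff hf; have mg := msm_density_measurable hG j j'.
have mfg : cmeasurable (fun y => (f y * h y) * g j j' y).
  by apply: cmeasurableM => //; exact: cmeasurableM.
pose a y := normc (f y) * Num.sqrt (rho g j y).
pose b y := normc (h y) * Num.sqrt (rho g j' y).
have ms j0 : measurable_fun setT (fun y => Num.sqrt (rho g j0 y)).
  by apply: measurableT_comp (measurable_rho hG j0); exact: (continuous_measurable_fun (@sqrt_continuous R)).
have ma : measurable_fun setT a by apply: measurable_funM => //; exact: measurable_normc mf.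
have mb : measurable_fun setT b by apply: measurable_funM => //; exact: measurable_normc mh.
have a0 y : 0 <= a y by rewrite mulr_ge0 ?normc_ge0 ?sqrtr_ge0.
have b0 y : 0 <= b y by rewrite mulr_ge0 ?normc_ge0 ?sqrtr_ge0.
have fa : (\int[mu]_y (a y ^+ 2)%:E < +oo)%E by move: ff; rewrite (N2_snu j mf).
have fb : (\int[mu]_y (b y ^+ 2)%:E < +oo)%E by move: hf; rewrite (N2_snu j' mh).
have [abfin CS] := cauchy_schwarz ma mb a0 b0 fa fb.
have le : (\int[mu]_y (normc ((f y * h y) * g j j' y))%:E <= \int[mu]_y (a y * b y)%:E)%E.
  apply: ae_ge0_le_integral => //.
  - by move=> y _; rewrite lee_fin normc_ge0.
  - by apply/measurable_EFinP; exact: measurable_normc.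
  - by move=> y _; rewrite lee_fin mulr_ge0.
  - by apply/measurable_EFinP; exact: measurable_funM.
  apply: filterS (g_ae hG) => y /(_ j j')[_ _ gy] _; rewrite lee_fin !Normc.normcM.
  rewrite /a /b mulrACA ler_wpM2l ?mulr_ge0 ?normc_ge0// -sqrtrM ?rho_ge0//.
  rewrite -(ger0_norm (normc_ge0 (g j j' y))) -sqrtr_sqr ler_wsqrtr//.
have ifin : (\int[mu]_y (normc ((f y * h y) * g j j' y))%:E < +oo)%E.
  exact: le_lt_trans le abfin.
have ci := (cintegrableP mu measurableT mfg).2 ifin.
split => //.
have i0 : (0 <= \int[mu]_y (normc ((f y * h y) * g j j' y))%:E)%E.
  by apply: integral_ge0 => y _; rewrite lee_fin normc_ge0.
have ab0 : (0 <= \int[mu]_y (a y * b y)%:E)%E.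
  by apply: integral_ge0 => y _; rewrite lee_fin mulr_ge0.
rewrite -[N2 _ f]fineK ?ge0_fin_numE ?N2_ge0// -[N2 _ h]fineK ?ge0_fin_numE ?N2_ge0//.
rewrite -!EFinM lee_fin; apply: le_trans (normc_cintegral_le ci) _.
apply: ler_wpM2l => //; rewrite (N2_snu _ mf) (N2_snu _ mh); apply: le_trans CS.
rewrite lerXn2r ?nnegrE ?fine_ge0//; apply: fine_le => //; by rewrite ge0_fin_numE.
Qed.

Section ctr.
Variables (n : nat) (js : n.+1.-tuple 'I_d) (j' : 'I_d) (p : 'I_n.+1).
Local Notation j := (tnth js p).
Local Notation M := (Mj hG js).
Local Notation M' := (Mj hG (tuple_del p js)).

(* Contraction of the p-th variable of f; h stands for the conjugate of h2. *)
Definition ctr (f : n.+1.-tuple E -> R[i]) (h : E -> R[i]) (x : n.-tuple E) : R[i] :=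
  cintegral mu setT (fun y => (f (ins p x y) * h y) * g j j' y).

Lemma measurable_ins_section (x : n.-tuple E) : measurable_fun setT (fun y : E => ins p x y).
Proof.
apply: (measurableT_comp (@measurable_ins _ E n p)
  (_ : measurable_fun setT (fun y : E => (x, y)))).
exact: measurable_fun_pair.
Qed.

Lemma cmeasurable_section (f : n.+1.-tuple E -> R[i]) x : cmeasurable f -> cmeasurable (fun y : E => f (ins p x y)).
Proof. by move=> mf; apply: (cmeasurable_comp mf); exact: measurable_ins_section. Qed.

(** The set of x at which the integral converges absolutely is measurable by Tonelli's theorem; off
    this set the default value 0 of [cintegral] is produced by its indicator. *)
Lemma cmeasurable_ctr f h : cmeasurable f -> cmeasurable h -> cmeasurable (ctr f h).
Proof.
move=> mf mh.
pose F (z : n.-tuple E * E) : R[i] := (f (ins p z.1 z.2) * h z.2) * g j j' z.2.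
have mF : cmeasurable F.
  apply: cmeasurableM; first apply: cmeasurableM.
  - by apply: (cmeasurable_comp mf); exact: measurable_ins.
  - by apply: (cmeasurable_comp mh); exact: measurable_snd.
  - apply: (cmeasurable_comp (msm_density_measurable hG j j')); exact: measurable_snd.
pose I x := (\int[mu]_y (normc (F (x, y)))%:E)%E.
have mI : measurable_fun setT I.
  apply: (@measurable_fun_fubini_tonelli_F _ _ _ _ R mu (fun z => (normc (F z))%:E)).
    by apply/measurable_EFinP; exact: measurable_normc.
  by move=> z; rewrite lee_fin normc_ge0.
have mA : measurable [set x | (I x < +oo)%E].
  rewrite -[X in measurable X]setTI; exact: emeasurable_fun_infty_o.
have mP (q : n.-tuple E * E -> R) : measurable_fun setT q ->
    measurable_fun setT (fun x => \int[mu]_y q (x, y)).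
  move=> mq; apply: (measurableT_comp (fine_measurable measurableT)).
  have mq0 (r : n.-tuple E * E -> R) : measurable_fun setT r -> (forall z, 0 <= r z) ->
      measurable_fun setT (fun x => \int[mu]_y (r (x, y))%:E)%E.
    move=> mr r0; apply: (@measurable_fun_fubini_tonelli_F _ _ _ _ R mu (fun z => (r z)%:E)).
      exact/measurable_EFinP.
    by move=> z; rewrite lee_fin.
  rewrite (_ : (fun x => _) = (fun x => \int[mu]_y (Num.max (q (x, y)) 0)%:E -
      \int[mu]_y (Num.max (- q (x, y)) 0)%:E)%E).
    apply: emeasurable_funB.
    - apply: (mq0 (fun z => Num.max (q z) 0)) => [|z]; last by rewrite le_max lexx orbT.
      by apply: measurable_maxr => //; exact: measurable_cst.
    - apply: (mq0 (fun z => Num.max (- q z) 0)) => [|z]; last by rewrite le_max lexx orbT.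
      by apply: measurable_maxr; [exact: measurableT_comp|exact: measurable_cst].
  apply/funext => x; rewrite integralE; congr (_ - _)%E; apply: eq_integral => y _.
    by rewrite funeposE EFin_max.
  by rewrite funenegE -EFinN EFin_max.
have [mF1 mF2] := mF.
rewrite (_ : ctr f h = (fun x => cind R [set x | (I x < +oo)%E] x *
    ((\int[mu]_y Re (F (x, y))) +i* (\int[mu]_y Im (F (x, y)))))).
  apply: cmeasurableM; first exact: cmeasurable_cind.
  by split; [exact: (mP _ mF1)|exact: (mP _ mF2)].
apply/funext => x; rewrite /ctr /cintegral.
have mFx : cmeasurable (fun y => F (x, y)).
  by apply: (cmeasurable_comp mF); exact: measurable_fun_pair.
have [fi|nfi] := pselect (I x < +oo)%E.
  rewrite asboolT; last exact: (cintegrableP mu measurableT mFx).2 fi.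
  by rewrite /cind indicE mem_set// mul1r.
rewrite asboolF; last by move=> ci; apply: nfi; exact: (cintegrableP mu measurableT mFx).1 ci.
by rewrite /cind indicE memNset// mul0r.
Qed.

Lemma N2_section f : cmeasurable f ->
  (\int[M']_x N2 (snu hG j) (fun y => f (ins p x y)) = N2 M f)%E.
Proof.
move=> mf; rewrite /N2 [RHS](integral_tmeas_ins (snu hG) p)//; first exact: measurable_N2.
by move=> x; rewrite lee_fin sqr_ge0.
Qed.

Lemma measurable_N2_section f : cmeasurable f ->
  measurable_fun setT (fun x => N2 (snu hG j) (fun y => f (ins p x y))).
Proof.
move=> mf; apply: (@measurable_fun_fubini_tonelli_F _ _ _ _ R (snu hG j)
  (fun z : n.-tuple E * E => (normc (f (ins p z.1 z.2)) ^+ 2)%:E)).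
  apply: (measurable_N2 (f := fun z : n.-tuple E * E => f (ins p z.1 z.2))).
  by apply: (cmeasurable_comp mf); exact: measurable_ins.
by move=> z; rewrite lee_fin sqr_ge0.
Qed.

Lemma ae_section_fin f : cmeasurable f -> (N2 M f < +oo)%E ->
  {ae M', forall x, (N2 (snu hG j) (fun y => f (ins p x y)) < +oo)%E}.
Proof.
move=> mf ff; have mN := measurable_N2_section mf.
have : M'.-integrable setT (fun x => N2 (snu hG j) (fun y => f (ins p x y))).
  apply/integrableP; split => //.
  under eq_integral do rewrite gee0_abs ?N2_ge0//.
  by rewrite N2_section.
move=> /(integrable_ae measurableT); apply: filterS => x /(_ Logic.I).
by rewrite ge0_fin_numE ?N2_ge0.
Qed.

(** Almost every section of f is square integrable, so [Gintegrable] can be integrated over the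
    remaining variables. This gives both the membership of the contraction in K and its continuity
    in f and h. *)
Lemma N2_ctr f h : cmeasurable f -> cmeasurable h -> (N2 M f < +oo)%E ->
  (N2 (snu hG j') h < +oo)%E ->
  (N2 M' (ctr f h) <= 2%:E * (N2 M f * N2 (snu hG j') h))%E.
Proof.
move=> mf mh ff hf; have c0 : (0 <= 2%:E * N2 (snu hG j') h)%E by rewrite mule_ge0 ?N2_ge0.
have cE : (2%:E * N2 (snu hG j') h)%E = (fine (2%:E * N2 (snu hG j') h))%:E.
  by rewrite fineK// ge0_fin_numE// lte_mul_pinfty.
have -> : (2%:E * (N2 M f * N2 (snu hG j') h))%E = (2%:E * N2 (snu hG j') h * N2 M f)%E.
  by rewrite [(N2 M f * _)%E]muleC muleA.
rewrite -N2_section// cE -ge0_integralZl//; last 3 first.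
- exact: measurable_N2_section.
- by move=> x _; exact: N2_ge0.
- by rewrite -cE.
apply: ae_ge0_le_integral => //.
- by move=> x _; rewrite lee_fin sqr_ge0.
- by apply: measurable_N2; exact: cmeasurable_ctr.
- by move=> x _; rewrite mule_ge0 ?N2_ge0// -cE.
- by apply: emeasurable_funM => //; exact: measurable_N2_section.
apply: filterS (ae_section_fin mf ff) => x fx _.
have [_ le] := Gintegrable (cmeasurable_section x mf) mh fx hf.
by apply: le_trans le _; rewrite -cE -muleA [(N2 _ h * _)%E]muleC.
Qed.

(** Only almost everywhere: where a section of f or f' is not square integrable, default values may
    break linearity. *)
Lemma ctrB f f' h h' : cmeasurable f -> cmeasurable f' -> cmeasurable h -> cmeasurable h' ->
  (N2 M f < +oo)%E -> (N2 M f' < +oo)%E ->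
  (N2 (snu hG j') h < +oo)%E -> (N2 (snu hG j') h' < +oo)%E ->
  {ae M', forall x, ctr f h x - ctr f' h' x =
    ctr (fun x => f x - f' x) h x + ctr f' (fun y => h y - h' y) x}.
Proof.
move=> mf mf' mh mh' ff ff' hf hf'.
apply: filterS2 (ae_section_fin mf ff) (ae_section_fin mf' ff') => x fx fx'.
have i f0 h0 : cmeasurable f0 -> cmeasurable h0 ->
    (N2 (snu hG j) (fun y => f0 (ins p x y)) < +oo)%E -> (N2 (snu hG j') h0 < +oo)%E ->
    cintegrable mu setT (fun y => (f0 (ins p x y) * h0 y) * g j j' y).
  move=> mf0 mh0 f0x h0x; have [//] := Gintegrable (j := j) (cmeasurable_section x mf0) mh0 f0x h0x.
have i1 := i _ _ mf mh fx hf; have i2 := i _ _ mf' mh' fx' hf'.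
have i3 := i _ _ mf' mh fx' hf.
have B (a b : E -> R[i]) : cintegrable mu setT a -> cintegrable mu setT b ->
    cintegral mu setT (fun x => a x - b x) = cintegral mu setT a - cintegral mu setT b.
  move=> ia ib; under [in LHS]eq_fun do rewrite -mulN1r.
  by rewrite cintegralD ?cintegralZ ?mulN1r//; exact: cintegrableZ.
have -> : ctr (fun x => f x - f' x) h x = ctr f h x - ctr f' h x.
  by rewrite /ctr -B//; congr cintegral; apply/funext => y; rewrite !mulrBl.
have -> : ctr f' (fun y => h y - h' y) x = ctr f' h x - ctr f' h' x.
  by rewrite /ctr -B//; congr cintegral; apply/funext => y; rewrite mulrBr mulrBl.
by rewrite addrA subrK.
Qed.

(** The second factor is the indicator of B at - y, which stands for the conjugate of h2(y) and puts
    - B into the coefficient. The integrability clause is what allows sums of rectangles to be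
    contracted term by term. *)
Lemma ctr_rect (A : 'I_n.+1 -> set E) (B : set E) (x : n.-tuple E) :
  (forall l, bborel (A l)) -> bborel B ->
  cintegrable mu setT (fun y => (\prod_l cind R (A l) (tnth (ins p x y) l) *
    cind R B (pt_opp y)) * g j j' y) /\
  ctr (fun z => \prod_l cind R (A l) (tnth z l)) (fun y => cind R B (pt_opp y)) x =
  G j j' (A p `&` set_opp B) * \prod_s cind R (A (lift p s)) (tnth x s).
Proof.
move=> bA bB; set S := A p `&` set_opp B; have bBo := bborel_opp bB.
have bS : bborel S by apply: bborelI => //; case: bBo.
have [mS _] := bS; have [[i1 i2] GS] := msm_density hG j j' bS.
set c := \prod_s cind R (A (lift p s)) (tnth x s).
have cE : (fun y => (\prod_l cind R (A l) (tnth (ins p x y) l) *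
    cind R B (pt_opp y)) * g j j' y) = (fun y => c * (cind R S y * g j j' y)).
  apply/funext => y; rewrite (bigD1_ord p)//= tnth_ins mulrA; congr (_ * _).
  have -> : \prod_(i < n) cind R (A (lift p i)) (tnth (ins p x y) (lift p i)) = c.
    by apply: eq_bigr => s _; rewrite tnth_ins_lift.
  rewrite mulrAC mulrC; congr (_ * _); rewrite /cind indicI /= rmorphM; congr (_ * _).
rewrite cE.
have E (q : E -> R) : (fun y => ((q y)%:E : \bar R) * (\1_S y)%:E)%E = (fun y => (q y)%:E) \_ S.
  apply/funext => y; rewrite patchE indicE; case: (_ \in S); by rewrite ?mule1 ?mule0.
have iS : cintegrable mu setT (fun y => cind R S y * g j j' y).
  split.
    rewrite (_ : (fun y => _) = (fun y => (Re (g j j' y))%:E) \_ S); last first.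
      by rewrite -E; apply/funext => y; rewrite -EFinM; congr EFin; rewrite !cRI /=; ring.
    by rewrite -integrable_mkcond.
  rewrite (_ : (fun y => _) = (fun y => (Im (g j j' y))%:E) \_ S); last first.
    by rewrite -E; apply/funext => y; rewrite -EFinM; congr EFin; rewrite !cRI /=; ring.
  by rewrite -integrable_mkcond.
split; first exact: cintegrableZ.
rewrite /ctr cE.
rewrite cintegralZ// mulrC; congr (_ * _).
rewrite GS /cintegral !asboolT//; congr (_ +i* _); rewrite /Rintegral; congr fine.
  rewrite [RHS]integral_mkcond -E; apply: eq_integral => y _; rewrite -EFinM; congr EFin.
  by rewrite !cRI /=; ring.
rewrite [RHS]integral_mkcond -E; apply: eq_integral => y _; rewrite -EFinM; congr EFin.
by rewrite !cRI /=; ring.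
Qed.

(** The contraction of two formal sums, term by term. There is no conjugation on the coefficients of
    e2, in accordance with the use of h2(- y). *)
Definition cfsum (e : fsum R k nu n.+1) (e2 : fsum R k nu 1) : fsum R k nu n :=
  @FSum R k nu n (fidx e * fidx e2)%type
    (fun ab => fcf ab.1 * fcf ab.2 * G j j' (frc ab.1 p `&` set_opp (frc ab.2 ord0)))
    (fun ab s => frc ab.1 (lift p s)).

Lemma cfsum_good e e2 : fgood e -> fgood (cfsum e e2).
Proof.
move=> ge [a b]; have [bA A1 A2] := ge a; split => [l|l l'|l l' ll'] /=.
- exact: bA.
- exact: A1.
- by apply: A2; apply: contraNneq ll' => /lift_inj ->.
Qed.

Lemma fval_cfsum e e2 x : fgood e -> fgood e2 ->
  fval (cfsum e e2) x = ctr (fval e) (fun y => fval e2 [tuple pt_opp y]) x.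
Proof.
move=> ge ge2; pose q (ab : fidx e * fidx e2) y : R[i] :=
  (\prod_l cind R (frc ab.1 l) (tnth (ins p x y) l) *
    cind R (frc ab.2 ord0) (pt_opp y)) * g j j' y.
have H (ab : fidx e * fidx e2) := ctr_rect (A := frc ab.1) (B := frc ab.2 ord0) x
  (fun l => good_bborel l (ge ab.1)) (good_bborel ord0 (ge2 ab.2)).
have [_] := cintegrable_sum (m := mu) (index_enum (fidx e * fidx e2)%type)
  (fun ab => cintegrableZ (fcf ab.1 * fcf ab.2) (H ab).1).
rewrite /ctr => S; rewrite (_ : (fun y => _) = (fun y => \sum_ab fcf ab.1 * fcf ab.2 * q ab y)).
  rewrite S; apply: eq_bigr => ab _; rewrite cintegralZ; last exact: (H ab).1.
  by have := (H ab).2; rewrite /ctr => ->; rewrite mulrA.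
apply/funext => y; rewrite /fval mulr_suml mulr_suml -(pair_bigA _ (fun a b => fcf a * fcf b * q (a, b) y)).
apply: eq_bigr => a _; rewrite mulr_sumr mulr_suml; apply: eq_bigr => b _.
by rewrite /q big_ord1 /= (tnth_nth y) /=; ring.
Qed.

(** Substitute - y for y: the evenness of G, in the form of [cintegral_reflect], conjugates the
    density while the hypotheses conjugate f and h. *)
Lemma ctr_opp f h x : cmeasurable f -> cmeasurable h ->
  (forall z, f (map_tuple (@pt_opp R k nu) z) = (f z)^*%C) ->
  (forall y, h (pt_opp y) = (h y)^*%C) ->
  ctr f h (map_tuple (@pt_opp R k nu) x) = (ctr f h x)^*%C.
Proof.
move=> mf mh fo ho; rewrite -cintegral_conj /ctr.
pose phi y : R[i] := (f (ins p x y))^*%C * (h y)^*%C.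
have mphi : cmeasurable phi.
  by apply: cmeasurableM; apply: cmeasurableJ => //; exact: cmeasurable_section.
have := cintegral_reflect mphi (reflects_Re hG j j') (reflects_Im hG j j').
rewrite (_ : (fun y => phi (pt_opp y) * _) = (fun y => f (ins p (map_tuple (@pt_opp R k nu) x) y) * h y * g j j' y)).
  move=> ->; congr cintegral; apply/funext => y; rewrite /phi !rmorphM /=; ring.
apply/funext => y; rewrite /phi -fo -ho pt_oppK; congr (f _ * _ * _).
apply: eq_from_tnth => i; rewrite tnth_map; case: (unliftP p i) => [s ->|->].
  by rewrite !tnth_ins_lift tnth_map.
by rewrite !tnth_ins pt_oppK.
Qed.

(** The permutation [pi_gamma p] applied to x followed by y moves y to the p-th place and keeps the
    order of the rest, which is [ins p x y]. *)
Lemma ctr_h_gamma (h1 : n.+1.-tuple E -> R[i]) (h2 : 1.-tuple E -> R[i]) x :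
  h_gamma mu g js j' h1 h2 p x = ctr h1 (fun y => (h2 [tuple y])^*%C) x.
Proof.
rewrite /h_gamma /Gintegral /ctr; congr cintegral; apply/funext => y; congr (h1 _ * _ * _).
apply: eq_from_tnth => i; rewrite tnth_mktuple /pi_gamma.
have tn (s : 'I_n) (q : 'I_n.+1) : q = s :> nat -> tnth [tuple of rcons x y] q = tnth x s.
  move=> qs; rewrite (_ : q = lift ord_max s) ?tnth_rcons_lift//.
  by apply: val_inj; rewrite /= qs; exact/esym/lift_max.
case: (unliftP p i) => [s ->|->]; last by rewrite ltnn eqxx tnth_rcons_max tnth_ins.
have lp : (lift p s == p) = false by rewrite eq_sym (negbTE (neq_lift p s)).
rewrite tnth_ins_lift lp.
case: ifPn => /= [|]; rewrite /bump.
  case: (leqP p s) => ps sp; last by apply: tn; rewrite /= /bump leqNgt ps.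
  by move: sp; rewrite add1n ltnNge (leq_trans ps).
case: (leqP p s) => ps sp; last by move: sp; rewrite add0n ps.
by apply: tn; rewrite add1n /= inordK// ltnS ltnW// ltn_ord.
Qed.

End ctr.

(** The reflection does not change the norm, as G_jj is even; this allows h2(- y) in all
    estimates. *)
Lemma N2_Mj1 (j' : 'I_d) (f : 1.-tuple E -> R[i]) : cmeasurable f ->
  N2 (Mj hG [tuple j']) f = N2 (snu hG j') (fun y => f [tuple pt_opp y]).
Proof.
move=> mf; rewrite -N2_opp// -(N2_section [tuple j'] ord0); last first.
  by apply: (cmeasurable_comp mf); exact: measurable_map_opp.
rewrite /Mj integral_tmeas0 => [|x]; last exact: N2_ge0.
congr N2; apply/funext => y; congr f; apply: eq_from_tnth => i.
by rewrite (ord1 i) tnth_map tnth_ins !(tnth_nth y).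
Qed.

End contraction.

(** * Comparison with the Wiener-Ito integral *)

Section wiener_ito_Wint.
Context (R : realType) (k : space_kind) (nu d : nat).
Local Notation E := (espace R k nu).
Variables (mu : {sigma_finite_measure set E -> \bar R})
  (G : 'I_d -> 'I_d -> set E -> R[i]) (g : 'I_d -> 'I_d -> E -> R[i]).
Hypothesis hG : matrix_spectral_measure G mu g.
Hypothesis na : nonatomic mu.
Context (dO : measure_display) (O : measurableType dO) (P : probability O R).
Variable Z : 'I_d -> set E -> O -> R[i].
Hypothesis hZ : random_spectral_measure P G Z.
Local Notation opp := (@pt_opp R k nu).

Section regular_system.
Variables (N : nat) (D : signed_index N -> set E).
Hypothesis rD : regular_system D.
Variables (n : nat) (js : n.-tuple 'I_d).

Definition gpt (ks : n.-tuple (signed_index N)) : n.-tuple E :=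
  [tuple get (D (tnth ks l)) | l < n].

Lemma gpt_box ks : box D ks !=set0 -> box D ks (gpt ks).
Proof.
move=> [x Dx] l; rewrite tnth_mktuple; apply: getPex; exists (tnth x l); exact: Dx.
Qed.

(** [simple_integral] evaluates f at an arbitrary default point when a cell of the box is empty.
    Such terms disappear, since Z of the empty set is 0 almost surely. *)
Lemma Zprod_empty : {ae P, forall w, forall ks : n.-tuple (signed_index N),
  ~ (box D ks !=set0) -> Zprod Z js (rectk D ks) w = 0}.
Proof.
have h : {ae P, forall w, forall j, Z j set0 w = 0}.
  by apply: (@ae_forall_fin _ _ _ P _ (fun j w => Z j set0 w = 0)) => j; exact: (Z0 hZ).
apply: filterS h => w h ks nb.
have [l Dl] : exists l, D (tnth ks l) = set0.
  apply: contrapT => hl; apply: nb.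
  have hx l : exists x, D (tnth ks l) x.
    apply: contrapT => hx; apply: hl; exists l; apply/seteqP; split => // x Dx.
    by apply: hx; exists x.
  exists [tuple projT1 (cid (hx l)) | l < n] => l; rewrite tnth_mktuple.
  exact: projT2 (cid (hx l)).
by rewrite /Zprod (bigD1 l)//= /rectk Dl h mul0r.
Qed.

(** Tuples that repeat an index up to sign get coefficient 0 and empty sides, so that every term of
    the sum is a good rectangle. *)
Definition reg_fsum (v : n.-tuple (signed_index N) -> R[i]) : fsum R k nu n :=
  @FSum R k nu n (n.-tuple (signed_index N))%type (fun ks => if gks ks then v ks else 0)
    (fun ks => if gks ks then rectk D ks else fun=> set0).

Lemma reg_fsum_good v : fgood (reg_fsum v).
Proof.
move=> /= ks; case: ifP => gk; first exact: gks_good.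
by split => [l|l l'|l l' _]; rewrite ?set0I//; exact: bborel0.
Qed.

Lemma fval_reg_fsum v x : (forall ks, v ks != 0 -> gks ks) ->
  fval (reg_fsum v) x = valks D v x.
Proof.
move=> hv; apply: eq_bigr => /= ks _; case: ifP => gk.
  by rewrite (prod_cind (rectk D ks)).
by rewrite mul0r; have [->|/hv] := eqVneq (v ks) 0; rewrite ?mul0r// gk.
Qed.

Lemma fJ_reg_fsum v w : (forall ks, v ks != 0 -> gks ks) ->
  fJ Z js (reg_fsum v) w = Jks Z D js v w.
Proof.
move=> hv; apply: eq_bigr => /= ks _; case: ifP => gk //.
by rewrite mul0r; have [->|/hv] := eqVneq (v ks) 0; rewrite ?mul0r// gk.
Qed.

(** The coefficients are the values of f at the chosen points, set to 0 for tuples with a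
    repetition, where f vanishes on every nonempty box in any case. *)
Lemma simple_fsum f : simple_for D f -> exists e : fsum R k nu n,
  [/\ fgood e, fval e = f &
    {ae P, forall w, simple_integral Z js D f w = fJ Z js e w}].
Proof.
move=> [_ fc f0 fd]; pose v ks := if gks ks then f (gpt ks) else 0.
have hv ks : v ks != 0 -> gks ks by rewrite /v; case: ifP; rewrite ?eqxx.
have fng ks x : ~~ gks ks -> box D ks x -> f x = 0.
  rewrite negb_forall => /existsP[l]; rewrite negb_forall => /existsP[l'].
  rewrite negb_imply negbK => /andP[ll' /eqP e] Dx; apply: (fd ks l l') => //.
  exact/eqP.
exists (reg_fsum v); split; first exact: reg_fsum_good.
  apply/funext => x; rewrite fval_reg_fsum//.
  have [[ks Dx]|h] := pselect (exists ks, box D ks x); last first.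
    rewrite (valks_out v); last by move=> ks Dx; apply: h; exists ks.
    by rewrite f0// => ks Dx; apply: h; exists ks.
  rewrite (valks_box rD v Dx) /v; case: ifPn => gk; last by rewrite (fng _ _ gk Dx).
  by apply: (fc ks) => //; apply: gpt_box; exists x.
apply: filterS Zprod_empty => w Zw; rewrite fJ_reg_fsum//; apply: eq_bigr => ks _.
have [ne|nb] := pselect (box D ks !=set0); last by have := Zw _ nb; rewrite /Zprod /rectk => ->; rewrite !mulr0.
congr (_ * _); rewrite /v; case: ifPn => // gk; apply: fng gk _; exact: gpt_box.
Qed.

End regular_system.

Lemma is_wiener_ito_Wint n (js : n.-tuple 'I_d) f X : cmeasurable f ->
  is_wiener_ito mu g P Z js f X -> Wint hG P Z js f X.
Proof.
move=> mf [mX [N [D [s [sK sf sX]]]]]; split => //.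
have rD m : regular_system (D m) by have [_ []] := sK m.
have he m := simple_fsum (rD m) js (sK m).2.
pose e m := projT1 (cid (he m)).
have [ge [ev eJ]] : (forall m, fgood (e m)) /\ (forall m, fval (e m) = s m) /\
    (forall m, {ae P, forall w, simple_integral Z js (D m) (s m) w = fJ Z js (e m) w}).
  by split => [m|]; [|split => m]; have [] := projT2 (cid (he m)).
have ms m : cmeasurable (s m) by have [[]] := sK m.
exists e; split; first split => //.
  rewrite (_ : (fun m => _) = (fun m => Knorm2 mu g js (fun x => s m x - f x)))//.
  by apply/funext => m; rewrite ev (Knorm2E hG)//; exact: cmeasurableB.
rewrite (_ : (fun m => _) =
    (fun m => N2 P (fun w => simple_integral Z js (D m) (s m) w - X w))) //.
have mZ m l (ks : n.-tuple (signed_index (N m))) : cmeasurable (Z (tnth js l) (D m (tnth ks l))).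
  by apply: (rsm_measurable hZ); exact: (regular_bborel (rD m)).
apply/funext => m; apply: ae_eq_N2.
- by apply: cmeasurableB => //; exact: (cmeasurable_fJ hZ).
- apply: cmeasurableB => //; apply: cmeasurable_sum => ks _; apply: cmeasurableZ.
  by apply: cmeasurable_prod => l _.
by apply: filterS (eJ m) => w ->.
Qed.

Lemma good_rect_opp n (A : 'I_n -> set E) : good_rect A -> good_rect (fun l => set_opp (A l)).
Proof.
move=> [bA A1 A2]; split => [l|l l'|l l' ll'].
- exact: bborel_opp.
- by rewrite -set_oppI A1; apply/seteqP; split => x.
- by rewrite -set_oppI A2//; apply/seteqP; split => x.
Qed.

(** Its kernel is (f(x) + conj f(-x)) / 2, written again with rectangles: conjugate the coefficients
    and reflect the sides. The simple functions in [is_wiener_ito] belong to K and have this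
    symmetry. *)
Definition fsym n (e : fsum R k nu n) : fsum R k nu n :=
  @FSum R k nu n (fidx e + fidx e)%type
    (fun a => match a with inl a => 2^-1 * fcf a | inr a => 2^-1 * (fcf a)^*%C end)
    (fun a => match a with inl a => frc a | inr a => fun l => set_opp (frc a l) end).

Lemma fsym_good n (e : fsum R k nu n) : fgood e -> fgood (fsym e).
Proof. by move=> ge [a|a] /=; [exact: ge|exact: good_rect_opp]. Qed.

Lemma fval_fsym n (e : fsum R k nu n) x :
  fval (fsym e) x = 2^-1 * (fval e x + (fval e (map_tuple opp x))^*%C).
Proof.
rewrite /fval big_sumType/= mulrDr; congr (_ + _).
  by rewrite mulr_sumr; apply: eq_bigr => a _; rewrite mulrA.
rewrite rmorph_sum mulr_sumr; apply: eq_bigr => a _; rewrite rmorphM /= -mulrA; congr (_ * (_ * _)).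
rewrite rmorph_prod; apply: eq_bigr => l _; rewrite tnth_map /cind.
by apply: complex_ext => //=; rewrite ?oppr0.
Qed.

Lemma fval_fsym_opp n (e : fsum R k nu n) x :
  fval (fsym e) (map_tuple opp x) = (fval (fsym e) x)^*%C.
Proof.
rewrite !fval_fsym.
have -> : (2^-1 : R[i]) = (2^-1 : R)%:C by rewrite fmorphV rmorph_nat.
rewrite rmorphM /= rmorphD /=; congr (_ * _).
  by apply: complex_ext => //=; rewrite oppr0.
rewrite conjcK addrC (_ : map_tuple opp (map_tuple opp x) = x)//.
by apply: eq_from_tnth => i; rewrite !tnth_map pt_oppK.
Qed.

(** Symmetrization fixes a kernel of K and, the norm being invariant under reflection and
    conjugation, multiplies the squared error by at most 4. *)
Lemma fcv_fsym n (js : n.-tuple 'I_d) f e : in_K mu g js f -> fcv hG js f e ->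
  fcv hG js f (fun m => fsym (e m)).
Proof.
move=> [mf fo _] [ge ef]; split => [m|]; first exact: fsym_good.
apply: (cvg0_le (v := fun m => (4%:E * N2 (Mj hG js) (fun x => fval (e m) x - f x)%R)%E)).
- by move=> m; exact: N2_ge0.
- move=> m; set u := fun x => fval (e m) x - f x.
  have mu' : cmeasurable u by apply: cmeasurableB => //; exact: cmeasurable_fval.
  have mu2 : cmeasurable (fun x => (u (map_tuple opp x))^*%C).
    by apply: cmeasurableJ; apply: (cmeasurable_comp mu'); exact: measurable_map_opp.
  have -> : (fun x => fval (fsym (e m)) x - f x) =
      (fun x => 2^-1 * (u x + (u (map_tuple opp x))^*%C)).
    apply/funext => x; rewrite fval_fsym /u fo rmorphB /= conjcK.
    have : (2 : R[i]) != 0 by rewrite pnatr_eq0.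
    by move: (fval _ _) (_^*)%C (f x) => a b c n2; field.
  apply: (@le_trans _ _ (N2 (Mj hG js) (fun x => u x + (u (map_tuple opp x))^*%C))).
    apply: le_N2; first by apply: cmeasurableZ; exact: cmeasurableD.
      exact: cmeasurableD.
    move=> x; rewrite Normc.normcM ler_piMl ?normc_ge0//.
    have -> : (2^-1 : R[i]) = (2^-1 : R)%:C by rewrite fmorphV rmorph_nat.
    by rewrite normc_real ger0_norm ?invr_ge0// invf_le1 ?ler1n.
  apply: le_trans (N2D _ mu' mu2) _.
  rewrite (N2J (Mj hG js) (fun x => u (map_tuple opp x))) N2_opp//.
  rewrite -[X in (_ * (X + X))%E]mul1e -ge0_muleDl// muleA -EFinD -EFinM.
  by rewrite (_ : 2 * (1 + 1) = 4 :> R)//; ring.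
exact: cvg0Z.
Qed.

(** A symmetrized good sum is a simple function of K for a regular system refining its sides. Its
    two integrals agree almost surely, box by box, because boxes with an empty cell contribute
    nothing. *)
Lemma Wint_is_wiener_ito n (js : n.-tuple 'I_d) f X : in_K mu g js f ->
  Wint hG P Z js f X -> is_wiener_ito mu g P Z js f X.
Proof.
move=> Kf WX; have [mf fo ff] := Kf; have [mX [e0 [ef0 _]]] := WX; split => //.
have ef := fcv_fsym Kf ef0; pose e m := fsym (e0 m); have [ge ce] := ef.
have eX := Wint_cvg hZ mf WX ef.
have hD m := fsum_refinement (ge m).
pose N m := projT1 (cid (hD m)); pose D m := projT1 (cid (projT2 (cid (hD m)))).
have [rD aD] : (forall m, regular_system (D m)) /\
    (forall m a l, adapted (D m) (@frc _ _ _ n (e m) a l)).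
  by split => m; have [] := projT2 (cid (projT2 (cid (hD m)))).
have eV m : fval (e m) = valks (D m) (fcoef (D m) (e m)).
  by apply/funext => x; exact: (fval_valks (rD m) x (aD m)).
have gV m ks : fcoef (D m) (e m) ks != 0 -> gks ks by exact: (fcoef_gks (rD m) (ge m)).
exists N, D, (fun m => fval (e m)); split.
- move=> m; split.
    split; first by exact: (cmeasurable_fval (ge m)).
      by move=> x; exact: fval_fsym_opp.
    by rewrite (Knorm2E hG); [exact: (N2_fval_fin _ js (ge m))|exact: (cmeasurable_fval (ge m))].
  split; first exact: (rD m).
  + by move=> ks x y Dx Dy; rewrite eV (valks_box (rD m) _ Dx) (valks_box (rD m) _ Dy).
  + by move=> x h; rewrite eV (valks_out _ h).
  + move=> ks l l' ll' e' x Dx; rewrite eV (valks_box (rD m) _ Dx).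
    apply/eqP; apply: contraT => /gV /forallP/(_ l)/forallP/(_ l')/implyP.
    by move=> /(_ (introN eqP ll')); rewrite e' eqxx.
- rewrite (_ : (fun m => _) = (fun m => N2 (Mj hG js) (fun x => fval (e m) x - f x)))//.
  by apply/funext => m; rewrite (Knorm2E hG)//; apply: cmeasurableB => //; exact: (cmeasurable_fval (ge m)).
rewrite /cvg_L2 (_ : (fun m => _) = (fun m => N2 P (fun w => fJ Z js (e m) w - X w)))//.
have mZ m l (ks : n.-tuple (signed_index (N m))) : cmeasurable (Z (tnth js l) (D m (tnth ks l))).
  by apply: (rsm_measurable hZ); exact: (regular_bborel (rD m)).
apply/funext => m; transitivity (N2 P (fun w => simple_integral Z js (D m) (fval (e m)) w - X w)) => //.
apply: ae_eq_N2.
- apply: cmeasurableB => //; apply: cmeasurable_sum => ks _; apply: cmeasurableZ.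
  by apply: cmeasurable_prod => l _.
- by apply: cmeasurableB => //; exact: (cmeasurable_fJ hZ js (ge m)).
apply: filterS2 (fJ_Jks hZ (rD m) js (ge m) (aD m)) (Zprod_empty (D m) js) => w -> Zw.
congr (_ - _); apply: eq_bigr => ks _.
have [ne|nb] := pselect (box (D m) ks !=set0); last first.
  by have := Zw _ nb; rewrite /Zprod /rectk => ->; rewrite !mulr0.
by rewrite eV (valks_box (rD m) _ (gpt_box ne)).
Qed.

(** For n = 0 the integral is the constant itself, the integral of a one-term sum with an empty
    product. For n >= 1 density and completeness provide a value, so [xget] does not return its
    default. *)
Lemma wiener_ito_Wint n (js : n.-tuple 'I_d) f : in_K mu g js f ->
  Wint hG P Z js f (wiener_ito mu g P Z js f).
Proof.
move=> Kf; have [mf fo ff] := Kf; case: n js f Kf mf fo ff => [|n] js f Kf mf fo ff /=.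
  pose e : fsum R k nu 0 := @FSum R k nu 0 unit (fun=> f [tuple]) (fun _ _ => set0).
  have ge : fgood e by move=> a; split => -[].
  have := Wint_fsum hG hZ js ge.
  have sumu (F : unit -> R[i]) : \sum_i F i = F tt.
    by rewrite (bigD1 tt)//= big1 ?addr0// => -[].
  rewrite (_ : fval e = f); last first.
    by apply/funext => x; rewrite /fval sumu big_ord0 mulr1 (tuple0 x).
  rewrite (_ : fJ Z js e = (fun=> f [tuple]))//.
  by apply/funext => w; rewrite /fJ sumu /Zprod big_ord0 mulr1.
apply: is_wiener_ito_Wint => //; apply: xgetPex.
have fN : (N2 (Mj hG js) f < +oo)%E by rewrite -(Knorm2E hG).
have [X WX] := Wint_exists hZ mf (density na mf fN).
by exists X; exact: Wint_is_wiener_ito.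
Qed.

End wiener_ito_Wint.

(** * The product formula *)

Section products_of_formal_sums.
Context (R : realType) (k : space_kind) (nu d : nat).
Local Notation E := (espace R k nu).

Definition compat n (e : fsum R k nu n) (e2 : fsum R k nu 1) := forall a b l,
  let B := frc (f := e2) b ord0 in
  [\/ frc (f := e) a l `&` (B `|` set_opp B) = set0, frc (f := e) a l = B
    | frc (f := e) a l = set_opp B].

(** All sides of both sums are cut by one regular system. Two of its cells are equal, opposite, or
    disjoint from each other and from each other's opposites, and rewriting the sums over the cells
    does not change their kernels. *)
Lemma compat_refinement n (e : fsum R k nu n) (e2 : fsum R k nu 1) :
  fgood e -> fgood e2 -> exists e' e2',
  [/\ fgood e', fgood e2', fval e' = fval e, fval e2' = fval e2 & compat e' e2'].
Proof.
move=> ge ge2.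
have [|c|N [D [rD aD]]] := @refinement R k nu ((fidx e * 'I_n) + (fidx e2 * 'I_1))%type
  (fun c => match c with inl al => frc al.1 al.2 | inr bl => frc bl.1 bl.2 end).
- by case=> -[a l]; [exact: good_bborel (ge a)|exact: good_bborel (ge2 a)].
- by case: c => -[a l]; [exact: good_rect_sym (ge a)|exact: good_rect_sym (ge2 a)].
have a1 (a : fidx e) l : adapted D (frc a l) by exact: (aD (inl (a, l))).
have a2 (a : fidx e2) l : adapted D (frc a l) by exact: (aD (inr (a, l))).
have V n' (f : fsum R k nu n') : fgood f -> (forall (a : fidx f) l, adapted D (frc a l)) ->
    fval (reg_fsum D (fcoef D f)) = fval f.
  move=> gf af; apply/funext => x; rewrite fval_reg_fsum ?(fval_valks rD x af)// => ks.
  exact: (fcoef_gks rD gf).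
exists (reg_fsum D (fcoef D e)), (reg_fsum D (fcoef D e2)); split.
- exact: (reg_fsum_good rD).
- exact: (reg_fsum_good rD).
- exact: V.
- exact: V.
move=> ks ks2 l /=; case: ifP => _; last by constructor 1; rewrite set0I.
case: ifP => _; last first.
  by constructor 1; rewrite set0U; apply/seteqP; split => // x [].
rewrite /rectk; set i := tnth ks l; set i' := tnth ks2 ord0.
have [->|ne] := eqVneq i i'; first by constructor 2.
rewrite (regular_opp rD); have [->|ne2] := eqVneq i (sflip i'); first by constructor 3.
by constructor 1; rewrite setIUr !(regular_disj rD)// setU0.
Qed.

Lemma widen_ord_lift_max n (i : 'I_n) : widen_ord (leqnSn n) i = lift ord_max i.
Proof. by apply: val_inj; rewrite /= /bump leqNgt ltn_ord. Qed.

Lemma h_gamma0_ins n (f : n.-tuple E -> R[i]) (h : 1.-tuple E -> R[i]) x y :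
  h_gamma0 f h (ins ord_max x y) = f x * h [tuple y].
Proof.
rewrite /h_gamma0 tnth_ins; congr (f _ * _); apply: eq_from_tnth => i.
by rewrite tnth_mktuple widen_ord_lift_max tnth_ins_lift.
Qed.

Lemma h_gamma0B n (f f' : n.-tuple E -> R[i]) (h h' : 1.-tuple E -> R[i]) x :
  h_gamma0 f h x - h_gamma0 f' h' x =
  h_gamma0 (fun x => f x - f' x) h x + h_gamma0 f' (fun x => h x - h' x) x.
Proof. by rewrite /h_gamma0; ring. Qed.

Lemma cmeasurable_h_gamma0 n (f : n.-tuple E -> R[i]) (h : 1.-tuple E -> R[i]) :
  cmeasurable f -> cmeasurable h -> cmeasurable (h_gamma0 f h).
Proof.
move=> mf mh; apply: cmeasurableM.
- apply: (cmeasurable_comp mf); apply/measurable_fun_tnthP => i.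
  rewrite (_ : _ \o _ = fun x : n.+1.-tuple E => tnth x (widen_ord (leqnSn n) i)).
    exact: measurable_tnth.
  by apply/funext => x /=; rewrite tnth_mktuple.
- apply: (cmeasurable_comp mh); apply/measurable_fun_tnthP => i.
  rewrite (_ : _ \o _ = fun x : n.+1.-tuple E => tnth x ord_max); first exact: measurable_tnth.
  by apply/funext => x /=; rewrite (ord1 i).
Qed.

Lemma h_gamma0_opp n (f : n.-tuple E -> R[i]) (h : 1.-tuple E -> R[i]) x :
  (forall x, f (map_tuple (@pt_opp R k nu) x) = (f x)^*%C) ->
  (forall x, h (map_tuple (@pt_opp R k nu) x) = (h x)^*%C) ->
  h_gamma0 f h (map_tuple (@pt_opp R k nu) x) = (h_gamma0 f h x)^*%C.
Proof.
move=> fo ho; rewrite /h_gamma0 rmorphM /= -fo -ho; congr (f _ * h _);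
  by apply: eq_from_tnth => i; rewrite ?(ord1 i) !(tnth_map, tnth_mktuple).
Qed.

Variables (mu : {sigma_finite_measure set E -> \bar R})
  (G : 'I_d -> 'I_d -> set E -> R[i]) (g : 'I_d -> 'I_d -> E -> R[i]).
Hypothesis hG : matrix_spectral_measure G mu g.

Lemma N2_Mj1_id j' (f : 1.-tuple E -> R[i]) : cmeasurable f ->
  N2 (Mj hG [tuple j']) f = N2 (snu hG j') (fun y => f [tuple y]).
Proof.
move=> mf; have mo := cmeasurable_comp mf (@measurable_map_opp R k nu 1).
rewrite -(N2_opp hG _ mf) (N2_Mj1 hG j' mo); congr N2; apply/funext => y; congr f.
by apply: eq_from_tnth => i; rewrite (ord1 i) tnth_map /= pt_oppK.
Qed.

Variables (n : nat) (js : n.-tuple 'I_d) (j' : 'I_d).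
Local Notation J := [tuple of rcons js j'].

Lemma tuple_del_rcons : tuple_del ord_max J = js.
Proof. by apply: eq_from_tnth => s; rewrite tnth_mktuple tnth_rcons_lift. Qed.

Lemma N2_h_gamma0 (f : n.-tuple E -> R[i]) (h : 1.-tuple E -> R[i]) :
  cmeasurable f -> cmeasurable h ->
  N2 (Mj hG J) (h_gamma0 f h) = (N2 (Mj hG js) f * N2 (Mj hG [tuple j']) h)%E.
Proof.
move=> mf mh; have m0 := cmeasurable_h_gamma0 mf mh.
rewrite -(N2_section hG J ord_max m0) tuple_del_rcons tnth_rcons_max.
have mh1 : cmeasurable (fun y : E => h [tuple y]).
  apply: (cmeasurable_comp mh); apply/measurable_fun_tnthP => i.
  by rewrite (_ : _ \o _ = id)//; apply/funext => x /=; rewrite (ord1 i).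
under eq_integral do under eq_fun do rewrite h_gamma0_ins.
under eq_integral do rewrite N2Z//.
rewrite ge0_integralZr ?N2_Mj1_id//.
- exact: measurable_N2.
- by move=> x _; rewrite lee_fin sqr_ge0.
- exact: N2_ge0.
Qed.

Lemma N2_h_gamma0B (f f' : n.-tuple E -> R[i]) (h h' : 1.-tuple E -> R[i]) :
  cmeasurable f -> cmeasurable f' -> cmeasurable h -> cmeasurable h' ->
  (N2 (Mj hG J) (fun x => h_gamma0 f h x - h_gamma0 f' h' x)%R <=
   2%:E * (N2 (Mj hG js) (fun x => (f x - f' x)%R) * N2 (Mj hG [tuple j']) h +
     N2 (Mj hG js) f' * N2 (Mj hG [tuple j']) (fun x => (h x - h' x)%R)))%E.
Proof.
move=> mf mf' mh mh'.
rewrite (_ : (fun x => _) = (fun x => h_gamma0 (fun x => f x - f' x) h x +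
  h_gamma0 f' (fun x => h x - h' x) x)); last by apply/funext => x; exact: h_gamma0B.
have m1 := cmeasurableB mf mf'; have m2 := cmeasurableB mh mh'.
rewrite -!N2_h_gamma0//; apply: N2D; exact: cmeasurable_h_gamma0.
Qed.

End products_of_formal_sums.

Section formal_product_formula.
Context (R : realType) (k : space_kind) (nu d : nat).
Local Notation E := (espace R k nu).
Variables (mu : {sigma_finite_measure set E -> \bar R})
  (G : 'I_d -> 'I_d -> set E -> R[i]) (g : 'I_d -> 'I_d -> E -> R[i]).
Hypothesis hG : matrix_spectral_measure G mu g.
Hypothesis na : nonatomic mu.
Context (dO : measure_display) (O : measurableType dO) (P : probability O R).
Variable Z : 'I_d -> set E -> O -> R[i].
Hypothesis hZ : random_spectral_measure P G Z.
Variables (n : nat) (js : n.+1.-tuple 'I_d) (j' : 'I_d).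
Local Notation J := [tuple of rcons js j'].

(** X combines integrals of the extended rectangles A x B. These need not be good, so their
    integrals are obtained from [approx_box] and not from a formal sum. *)
Lemma fsum_formula (e : fsum R k nu n.+1) (e2 : fsum R k nu 1) :
  fgood e -> fgood e2 -> compat e e2 -> exists X,
  Wint hG P Z J (h_gamma0 (fval e) (fval e2)) X /\
  {ae P, forall w, fJ Z js e w * fJ Z [tuple j'] e2 w =
    X w + \sum_p fJ Z (tuple_del p js) (cfsum G js j' p e e2) w}.
Proof.
move=> ge ge2 ce.
pose S (ab : fidx e * fidx e2) := rext (frc ab.1) (frc ab.2 ord0).
pose f0 ab (x : n.+2.-tuple E) := \prod_i cind R (S ab i) (tnth x i).
have bS ab i : bborel (S ab i).
  rewrite /S /rext; case: unlift => [l|]; first exact: good_bborel (ge ab.1).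
  exact: good_bborel (ge2 ab.2).
have mf0 ab : cmeasurable (f0 ab).
  apply: cmeasurable_prod => i _; apply: (cmeasurable_comp (f := cind R (S ab i))).
    by apply: cmeasurable_cind; case: (bS ab i).
  exact: measurable_tnth.
have hX ab := Wint_exists hZ (mf0 ab) (approx_box hG na J (bS ab)).
pose X ab := projT1 (cid (hX ab)).
have WX ab : Wint hG P Z J (f0 ab) (X ab) by exact: projT2 (cid (hX ab)).
have H : {ae P, forall w, forall ab : fidx e * fidx e2,
    Zprod Z js (frc ab.1) w * Z j' (frc ab.2 ord0) w = X ab w +
    \sum_(p < n.+1) G (tnth js p) j' (frc ab.1 p `&` set_opp (frc ab.2 ord0)) *
      Zprod Z (tuple_del p js) (fun s => frc ab.1 (lift p s)) w}.
  apply: ae_forall_fin => -[a b] /=.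
  apply: (rectangle_formula na hZ (ge a) _ _ (ce a b) (WX (a, b))).
  - exact: good_bborel (ge2 b).
  - exact: good_rect_sym (ge2 b).
exists (fun w => \sum_ab fcf ab.1 * fcf ab.2 * X ab w); split.
  have := Wint_sum hZ (index_enum (fidx e * fidx e2)%type)
    (fun ab => cmeasurableZ (fcf ab.1 * fcf ab.2) (mf0 ab))
    (fun ab => WintZ hZ (fcf ab.1 * fcf ab.2) (mf0 ab) (WX ab)).
  congr (Wint _ _ _ _ _ _); apply/funext => x.
  rewrite /h_gamma0 /fval big_distrlr /= pair_big /=; apply: eq_bigr => -[a b] _ /=.
  rewrite /f0 /S (bigD1_ord ord_max)//= rext_max big_ord1.
  rewrite (_ : tnth [tuple tnth x ord_max] ord0 = tnth x ord_max)//.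
  under [in RHS]eq_bigr do rewrite tnth_mktuple.
  rewrite [RHS]mulrACA; congr (_ * _); rewrite [RHS]mulrC; congr (_ * _).
  apply: eq_bigr => l _; by rewrite rext_lift widen_ord_lift_max.
apply: filterS H => w Hw; rewrite /fJ big_distrlr /= pair_big /=.
rewrite exchange_big /= -big_split /=; apply: eq_bigr => -[a b] _ /=.
have := Hw (a, b) => /= {}Hw.
rewrite {2}/Zprod big_ord1 (_ : tnth [tuple j'] ord0 = j')// mulrACA Hw mulrDr; congr (_ + _).
by rewrite mulr_sumr; apply: eq_bigr => p _; rewrite !mulrA.
Qed.

End formal_product_formula.

Lemma fine_lty (R : realType) (x : \bar R) : (0 <= x)%E -> (x < +oo)%E -> x = (fine x)%:E.
Proof. by move=> x0 xy; rewrite fineK// ge0_fin_numE. Qed.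

(** Continuity of a bilinear operation along sequences, in squared norms: a and b are the errors of
    the two arguments, c is the squared norm of the moving second argument, F and C are those of the
    limits. Eventually b <= 1, which bounds c by 2 (1 + C). *)
Lemma bilinear_cvg0 (R : realType) (u a b c : nat -> \bar R) (K : R) (C F : \bar R) :
  (0 <= K) -> (forall m, 0 <= u m)%E -> (forall m, 0 <= a m)%E ->
  (0 <= C < +oo)%E -> (0 <= F < +oo)%E ->
  (forall m, u m <= K%:E * (a m * c m + F * b m))%E ->
  (forall m, c m <= 2%:E * (b m + C))%E ->
  a @ \oo --> 0%E -> b @ \oo --> 0%E -> u @ \oo --> 0%E.
Proof.
move=> K0 u0 a0 /andP[C0 Cy] /andP[F0 Fy] hu hc ac bc.
have [CE FE] := (fine_lty C0 Cy, fine_lty F0 Fy).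
apply: (@squeeze_cvge _ _ _ R (fun _ => 0%E) u
  (fun m => (K%:E * ((2 * (1 + fine C))%:E * a m + (fine F)%:E * b m))%E)).
- near=> m; rewrite u0 /=; apply: le_trans (hu m) _.
  apply: lee_wpmul2l; first by rewrite lee_fin.
  rewrite -FE; apply: leeD => //; rewrite muleC; apply: lee_wpmul2r => //.
  apply: le_trans (hc m) _; rewrite EFinM [(1 + fine C)%:E]EFinD -CE; apply: lee_wpmul2l => //.
  by apply: leeD => //; near: m; exact: cvg0_small bc ltr01.
- exact: cvg_cst.
- by apply: cvg0Z; apply: cvg0D; exact: cvg0Z.
Unshelve. all: by end_near. Qed.

Section product_formula.
Context (R : realType) (k : space_kind) (nu d : nat).
Local Notation E := (espace R k nu).
Variables (mu : {sigma_finite_measure set E -> \bar R})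
  (G : 'I_d -> 'I_d -> set E -> R[i]) (g : 'I_d -> 'I_d -> E -> R[i]).
Hypothesis hG : matrix_spectral_measure G mu g.
Local Notation opp := (@pt_opp R k nu).

Lemma in_K_h_gamma0 n (js : n.-tuple 'I_d) j' h1 h2 :
  in_K mu g js h1 -> in_K mu g [tuple j'] h2 ->
  in_K mu g [tuple of rcons js j'] (h_gamma0 h1 h2).
Proof.
move=> [m1 o1 f1] [m2 o2 f2]; have m0 := cmeasurable_h_gamma0 m1 m2.
split => // [x|]; first exact: h_gamma0_opp.
rewrite !(Knorm2E hG)// in f1 f2 *; rewrite N2_h_gamma0//.
by rewrite (fine_lty (N2_ge0 _ _) f1) (fine_lty (N2_ge0 _ _) f2) -EFinM ltry.
Qed.

Variables (n : nat) (js : n.+1.-tuple 'I_d) (j' : 'I_d).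
Variables (h1 : n.+1.-tuple E -> R[i]) (h2 : 1.-tuple E -> R[i]).
Hypotheses (K1 : in_K mu g js h1) (K2 : in_K mu g [tuple j'] h2).

Lemma in_K1_opp y : h2 [tuple opp y] = (h2 [tuple y])^*%C.
Proof.
have [_ o2 _] := K2; rewrite -o2; congr h2.
by apply: eq_from_tnth => i; rewrite (ord1 i) tnth_map.
Qed.

Lemma measurable_tuple1 : measurable_fun setT (fun y : E => [tuple y]).
Proof.
apply/measurable_fun_tnthP => i.
by rewrite (_ : _ \o _ = id)//; apply/funext => x /=; rewrite (ord1 i).
Qed.

Lemma cmeasurable_tuple1_opp f : cmeasurable f -> cmeasurable (fun y : E => f [tuple opp y] : R[i]).
Proof.
move=> mf; apply: (cmeasurable_comp mf (h := fun y : E => [tuple opp y])).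
exact: (measurableT_comp measurable_tuple1 (@measurable_pt_opp R k nu)).
Qed.

Lemma h_gammaE p : h_gamma mu g js j' h1 h2 p =
  ctr mu g js j' p h1 (fun y => h2 [tuple opp y]).
Proof.
by apply/funext => x; rewrite ctr_h_gamma; congr ctr; apply/funext => y; rewrite in_K1_opp.
Qed.

Lemma N2_h2 : (N2 (snu hG j') (fun y : E => h2 [tuple opp y]) < +oo)%E.
Proof. by have [m2 _ f2] := K2; rewrite -(N2_Mj1 hG j' m2) -(Knorm2E hG). Qed.

Lemma N2_h1 : (N2 (Mj hG js) h1 < +oo)%E.
Proof. by have [m1 _ f1] := K1; rewrite -(Knorm2E hG). Qed.

Lemma cmeasurable_h_gamma p : cmeasurable (h_gamma mu g js j' h1 h2 p).
Proof.
have [[m1 _ _] [m2 _ _]] := (K1, K2); rewrite h_gammaE; apply: (cmeasurable_ctr hG) => //.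
exact: cmeasurable_tuple1_opp.
Qed.

Lemma in_K_h_gamma p : in_K mu g (tuple_del p js) (h_gamma mu g js j' h1 h2 p).
Proof.
have [[m1 o1 f1] [m2 o2 f2]] := (K1, K2); have mp := cmeasurable_h_gamma p.
have mo := cmeasurable_tuple1_opp m2.
split => // [x|].
  by rewrite h_gammaE (ctr_opp hG)// => y; rewrite in_K1_opp.
rewrite (Knorm2E hG)// h_gammaE; apply: le_lt_trans (N2_ctr p m1 mo N2_h1 N2_h2) _.
by rewrite (fine_lty (N2_ge0 _ _) N2_h1) (fine_lty (N2_ge0 _ _) N2_h2) -!EFinM ltry.
Qed.

Section convergence.
Variables (e : nat -> fsum R k nu n.+1) (e2 : nat -> fsum R k nu 1).
Hypotheses (ce : fcv hG js h1 e) (ce2 : fcv hG [tuple j'] h2 e2).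

Lemma N2_fval_le n' (ks : n'.-tuple 'I_d) f (a : nat -> fsum R k nu n') m : cmeasurable f ->
  fcv hG ks f a ->
  (N2 (Mj hG ks) (fval (a m)) <=
    2%:E * (N2 (Mj hG ks) (fun x => (fval (a m) x - f x)%R) + N2 (Mj hG ks) f))%E.
Proof.
move=> mf [ga _]; have ma := cmeasurable_fval (ga m).
apply: le_trans (N2D _ (cmeasurableB ma mf) mf).
by rewrite (_ : (fun x => _) = fval (a m))//; apply/funext => x; rewrite subrK.
Qed.

Lemma cvg_h_gamma0 : (fun m => N2 (Mj hG [tuple of rcons js j'])
  (fun x => h_gamma0 (fval (e m)) (fval (e2 m)) x - h_gamma0 h1 h2 x)) @ \oo --> 0%E.
Proof.
have [[m1 _ _] [m2 _ f2]] := (K1, K2); rewrite (Knorm2E hG)// in f2.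
have [[ge ec] [ge2 e2c]] := (ce, ce2).
have [me me2] := (fun m => cmeasurable_fval (ge m), fun m => cmeasurable_fval (ge2 m)).
apply: (bilinear_cvg0 (K := 2) (C := N2 (Mj hG [tuple j']) h2) (F := N2 (Mj hG js) h1)
  (a := fun m => N2 (Mj hG js) (fun x => (fval (e m) x - h1 x)%R))
  (b := fun m => N2 (Mj hG [tuple j']) (fun x => (fval (e2 m) x - h2 x)%R))
  (c := fun m => N2 (Mj hG [tuple j']) (fval (e2 m)))) => //.
- by move=> m; exact: N2_ge0.
- by move=> m; exact: N2_ge0.
- by rewrite N2_ge0.
- by rewrite N2_ge0 N2_h1.
- by move=> m; exact: N2_h_gamma0B.
- by move=> m; exact: N2_fval_le.
Qed.

(** The difference of the contractions is split by [ctrB], almost everywhere, into one term with the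
    error of e and one with the error of e2, and [N2_ctr] bounds each of them. *)
Lemma fcv_cfsum p : fcv hG (tuple_del p js) (h_gamma mu g js j' h1 h2 p)
  (fun m => cfsum G js j' p (e m) (e2 m)).
Proof.
have [[m1 _ _] [m2 _ f2]] := (K1, K2); rewrite (Knorm2E hG)// in f2.
have [[ge ec] [ge2 e2c]] := (ce, ce2).
have [me me2] := (fun m => cmeasurable_fval (ge m), fun m => cmeasurable_fval (ge2 m)).
split => [m|]; first exact: cfsum_good.
apply: (bilinear_cvg0 (K := 4) (C := N2 (Mj hG [tuple j']) h2) (F := N2 (Mj hG js) h1)
  (a := fun m => N2 (Mj hG js) (fun x => (fval (e m) x - h1 x)%R))
  (b := fun m => N2 (Mj hG [tuple j']) (fun x => (fval (e2 m) x - h2 x)%R))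
  (c := fun m => N2 (Mj hG [tuple j']) (fval (e2 m)))) => //.
- by move=> m; exact: N2_ge0.
- by move=> m; exact: N2_ge0.
- by rewrite N2_ge0.
- by rewrite N2_ge0 N2_h1.
- move=> m; pose H y := fval (e2 m) [tuple opp y]; pose k2 y := h2 [tuple opp y].
  have mH : cmeasurable H := cmeasurable_tuple1_opp (me2 m).
  have mk : cmeasurable k2 := cmeasurable_tuple1_opp m2.
  have fe : (N2 (Mj hG js) (fval (e m)) < +oo)%E := N2_fval_fin hG js (ge m).
  have fH : (N2 (snu hG j') H < +oo)%E.
    by rewrite -(N2_Mj1 hG j' (me2 m)); exact: N2_fval_fin.
  have m1' := cmeasurableB (me m) m1; have m2' := cmeasurableB mH mk.
  have f1' := N2B_fin (me m) m1 fe N2_h1; have f2' := N2B_fin mH mk fH N2_h2.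
  pose c1 := ctr mu g js j' p (fun x => fval (e m) x - h1 x) H.
  pose c2 := ctr mu g js j' p h1 (fun y => H y - k2 y).
  have mc1 : cmeasurable c1 by exact: (cmeasurable_ctr hG).
  have mc2 : cmeasurable c2 by exact: (cmeasurable_ctr hG).
  rewrite (ae_eq_N2 (g := fun x => c1 x + c2 x)); last 3 first.
  + apply: cmeasurableB; last exact: cmeasurable_h_gamma.
    by apply: cmeasurable_fval; exact: cfsum_good.
  + exact: cmeasurableD.
  + apply: filterS (ctrB p (me m) m1 mH mk fe N2_h1 fH N2_h2) => x.
    by rewrite (fval_cfsum hG)// h_gammaE.
  apply: le_trans (N2D _ mc1 mc2) _.
  rewrite (_ : 4 = 2 * 2 :> R); last by rewrite -natrM.
  rewrite EFinM -muleA; apply: lee_wpmul2l => //.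
  rewrite (N2_Mj1 hG j' (me2 m)) (N2_Mj1 hG j' (cmeasurableB (me2 m) m2)).
  rewrite ge0_muleDr ?mule_ge0 ?N2_ge0//; apply: leeD.
  + exact: (N2_ctr p m1' mH f1' fH).
  + exact: (N2_ctr p m1 m2' N2_h1 f2').
- by move=> m; exact: N2_fval_le.
Qed.

End convergence.

Hypothesis na : nonatomic mu.
Context (dO : measure_display) (O : measurableType dO) (P : probability O R).
Variable Z : 'I_d -> set E -> O -> R[i].
Hypothesis hZ : random_spectral_measure P G Z.

Lemma N2_Wint_fin n' (ks : n'.-tuple 'I_d) f X : cmeasurable f ->
  Wint hG P Z ks f X -> (N2 P X < +oo)%E.
Proof.
move=> mf WX; have [mX [a [ca aX]]] := WX; have [ga _] := ca.
have [m _ /(_ m (leqnn m)) aX1] := cvg0_small aX ltr01.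
have ma := cmeasurable_fJ hZ ks (ga m).
have fa : (N2 P (fJ Z ks (a m)) < +oo)%E.
  apply: le_lt_trans (fJ_bound hG hZ ks (ga m)) _.
  by rewrite (fine_lty (N2_ge0 _ _) (N2_fval_fin hG ks (ga m))) -EFinM ltry.
rewrite (_ : X = fun w => fJ Z ks (a m) w - (fJ Z ks (a m) w - X w)); last first.
  by apply/funext => w; rewrite subKr.
apply: N2B_fin => //; first exact: cmeasurableB.
exact: le_lt_trans aX1 (ltry _).
Qed.

Lemma fJ_near_bound n' (ks : n'.-tuple 'I_d) f X a : cmeasurable f ->
  Wint hG P Z ks f X -> fcv hG ks f a ->
  exists c : R, \forall m \near \oo, (N2 P (fJ Z ks (a m)) <= c%:E)%E.
Proof.
move=> mf WX ca; have [ga _] := ca; have [mX _] := WX.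
have XE := fine_lty (N2_ge0 _ _) (N2_Wint_fin mf WX).
exists (2 * (1 + fine (N2 P X))).
apply: filterS (cvg0_small (Wint_cvg hZ mf WX ca) ltr01) => m hm.
have ma := cmeasurable_fJ hZ ks (ga m).
apply: (@le_trans _ _ (2%:E * (N2 P (fun w => fJ Z ks (a m) w - X w)%R + N2 P X))%E).
  apply: le_trans (N2D _ (cmeasurableB ma mX) mX).
  by rewrite (_ : (fun x => _) = fJ Z ks (a m))//; apply/funext => x; rewrite subrK.
by rewrite EFinM [(1 + fine (N2 P X))%:E]EFinD -XE; apply: lee_wpmul2l => //; apply: leeD.
Qed.

(** The refinement is made separately for each m; as it keeps the kernels, the convergence is not
    affected. *)
Lemma compat_sequences : exists e e2,
  [/\ fcv hG js h1 e, fcv hG [tuple j'] h2 e2 & forall m, compat (e m) (e2 m)].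
Proof.
have [_ [a [[ga ca] _]]] := wiener_ito_Wint hG na hZ K1.
have [_ [b [[gb cb] _]]] := wiener_ito_Wint hG na hZ K2.
have h m : exists ee, [/\ fgood ee.1, fgood ee.2, fval ee.1 = fval (a m),
    fval ee.2 = fval (b m) & compat ee.1 ee.2].
  by have [e [e2 he]] := compat_refinement (ga m) (gb m); exists (e, e2).
pose ee m := projT1 (cid (h m)); exists (fun m => (ee m).1), (fun m => (ee m).2).
split; last by move=> m; have [] := projT2 (cid (h m)).
- split=> [m|]; first by have [] := projT2 (cid (h m)).
  rewrite (_ : (fun m => _) = fun m => N2 (Mj hG js) (fun x => fval (a m) x - h1 x))//.
  by apply/funext => m; have [_ _ E1 _ _] := projT2 (cid (h m)); rewrite -E1.
- split=> [m|]; first by have [] := projT2 (cid (h m)).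
  rewrite (_ : (fun m => _) = fun m => N2 (Mj hG [tuple j']) (fun x => fval (b m) x - h2 x))//.
  by apply/funext => m; have [_ _ _ E2 _] := projT2 (cid (h m)); rewrite -E2.
Qed.

Lemma wiener_ito_product : {ae P, forall w,
  wiener_ito mu g P Z js h1 w * wiener_ito mu g P Z [tuple j'] h2 w =
  wiener_ito mu g P Z [tuple of rcons js j'] (h_gamma0 h1 h2) w +
  \sum_(p < n.+1)
    wiener_ito mu g P Z (tuple_del p js) (h_gamma mu g js j' h1 h2 p) w}.
Proof.
have [[m1 _ _] [m2 _ _]] := (K1, K2).
have W1 := wiener_ito_Wint hG na hZ K1; have W2 := wiener_ito_Wint hG na hZ K2.
have W0 := wiener_ito_Wint hG na hZ (in_K_h_gamma0 K1 K2).
have Wp p := wiener_ito_Wint hG na hZ (in_K_h_gamma p).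
set I1 := wiener_ito _ _ _ _ js h1 in W1 *.
set I2 := wiener_ito _ _ _ _ _ h2 in W2 *.
set I0 := wiener_ito _ _ _ _ _ (h_gamma0 h1 h2) in W0 *.
pose Ip p := wiener_ito mu g P Z (tuple_del p js) (h_gamma mu g js j' h1 h2 p).
have [[[M1 _] [M2 _]] [M0 _]] := ((W1, W2), W0).
have Mp p : cmeasurable (Ip p) by have [] := Wp p.
have [e [e2 [ce ce2 cc]]] := compat_sequences.
have [[ge _] [ge2 _]] := (ce, ce2).
have hX m := fsum_formula hG na hZ js j' (ge m) (ge2 m) (cc m).
pose X m := projT1 (cid (hX m)).
have [WX EX] : (forall m, Wint hG P Z [tuple of rcons js j']
      (h_gamma0 (fval (e m)) (fval (e2 m))) (X m)) /\
    (forall m, {ae P, forall w, fJ Z js (e m) w * fJ Z [tuple j'] (e2 m) w =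
      X m w + \sum_p fJ Z (tuple_del p js) (cfsum G js j' p (e m) (e2 m)) w}).
  by split => m; have [] := projT2 (cid (hX m)).
pose D w := I1 w * I2 w - (I0 w + \sum_p Ip p w).
have MJ m : cmeasurable (fJ Z js (e m)) by exact: (cmeasurable_fJ hZ).
have MJ2 m : cmeasurable (fJ Z [tuple j'] (e2 m)) by exact: (cmeasurable_fJ hZ).
have MX m : cmeasurable (X m) by have [] := WX m.
have MC m p : cmeasurable (fJ Z (tuple_del p js) (cfsum G js j' p (e m) (e2 m))).
  by apply: (cmeasurable_fJ hZ); exact: cfsum_good.
suff : {ae P, forall w, D w = 0}.
  by apply: filterS => w /eqP; rewrite subr_eq0 => /eqP.
(* With J and J' the integrals of [e m] and [e2 m], and J J' expanded by [fsum_formula], the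
   difference D is (I1 - J) I2 + J (I2 - J') + (X - I0) + the sum over p of the errors of the
   contracted integrals. In each product f is bounded in L2 and q tends to 0. *)
pose f m (i : bool + (unit + 'I_n.+1)) : O -> R[i] := match i with
  | inl true => I2 | inl false => fJ Z js (e m) | inr _ => fun=> 1 end.
pose q m (i : bool + (unit + 'I_n.+1)) : O -> R[i] := match i with
  | inl true => fun w => I1 w - fJ Z js (e m) w
  | inl false => fun w => I2 w - fJ Z [tuple j'] (e2 m) w
  | inr (inl _) => fun w => X m w - I0 w
  | inr (inr p) => fun w => fJ Z (tuple_del p js) (cfsum G js j' p (e m) (e2 m)) w - Ip p w
  end.
apply: (L1_null (f := f) (g := q)).
- apply: cmeasurableB; first exact: cmeasurableM.
  by apply: cmeasurableD => //; exact: cmeasurable_sum.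
- by move=> m [[]|i] //=; exact: cmeasurable_cst.
- by move=> m [[]|[i|p]] /=; exact: cmeasurableB.
- case=> [[]|i] /=.
  + exists (fine (N2 P I2)); apply: nearW => m.
    by rewrite -(fine_lty (N2_ge0 _ _) (N2_Wint_fin m2 W2)).
  + exact: fJ_near_bound m1 W1 ce.
  + exists 1; apply: nearW => m; rewrite /N2.
    under eq_integral do rewrite Normc.normc1 expr1n.
    by rewrite integral_cst//= mul1e probability_le1.
- case=> [[]|[i|p]] /=.
  + rewrite (_ : (fun m => _) = fun m => N2 P (fun w => fJ Z js (e m) w - I1 w)%R).
      exact: (Wint_cvg hZ m1 W1 ce).
    by apply/funext => m; exact: N2_sym.
  + rewrite (_ : (fun m => _) = fun m => N2 P (fun w => fJ Z [tuple j'] (e2 m) w - I2 w)%R).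
      exact: (Wint_cvg hZ m2 W2 ce2).
    by apply/funext => m; exact: N2_sym.
  + have m0 := cmeasurable_h_gamma0 m1 m2.
    apply: cvg0_le (cvg0Z (16 * ((n.+2 ^ n.+2)%:R : R)) (cvg_h_gamma0 ce ce2)) => m; first exact: N2_ge0.
    apply: (Wint_dist hZ _ m0 (WX m) W0).
    by apply: cmeasurable_h_gamma0; exact: cmeasurable_fval.
  + exact: (Wint_cvg hZ (cmeasurable_h_gamma p) (Wp p) (fcv_cfsum ce ce2 p)).
move=> m; apply: filterS (EX m) => w Ew.
rewrite !big_sumType /= big_bool /= (bigD1 tt)//= [X in _ + (_ + X + _)]big1 => [|[]//].
under eq_bigr do rewrite mul1r.
rewrite sumrB mul1r addr0 /D; move: Ew; set S := \sum_i fJ _ _ _ _; set S' := \sum_i Ip _ _.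
move=> Ew; transitivity (I1 w * I2 w - fJ Z js (e m) w * fJ Z [tuple j'] (e2 m) w +
  (X m w + S) - (I0 w + S')); last by ring.
by rewrite Ew subrK.
Qed.

End product_formula.

(* The number of arguments of h1, which is positive, is n.+1. *)
Theorem mainTheorem8 (R : realType) (k : space_kind) (nu d : nat)
    (mu : {sigma_finite_measure set (espace R k nu) -> \bar R})
    (G : 'I_d -> 'I_d -> set (espace R k nu) -> R[i])
    (g : 'I_d -> 'I_d -> espace R k nu -> R[i])
    (dO : measure_display) (O : measurableType dO) (P : probability O R)
    (Z : 'I_d -> set (espace R k nu) -> O -> R[i])
    (n : nat) (js : n.+1.-tuple 'I_d) (j' : 'I_d)
    (h1 : n.+1.-tuple (espace R k nu) -> R[i])
    (h2 : 1.-tuple (espace R k nu) -> R[i]) :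
  matrix_spectral_measure G mu g ->
  nonatomic mu ->
  random_spectral_measure P G Z ->
  in_K mu g js h1 ->
  in_K mu g [tuple j'] h2 ->
  [/\ in_K mu g [tuple of rcons js j'] (h_gamma0 h1 h2),
      forall p : 'I_n.+1,
        in_K mu g (tuple_del p js) (h_gamma mu g js j' h1 h2 p) &
      {ae P, forall w,
        wiener_ito mu g P Z js h1 w * wiener_ito mu g P Z [tuple j'] h2 w =
        wiener_ito mu g P Z [tuple of rcons js j'] (h_gamma0 h1 h2) w +
        \sum_(p < n.+1)
          wiener_ito mu g P Z (tuple_del p js)
            (h_gamma mu g js j' h1 h2 p) w}].
Proof.
move=> hG na hZ K1 K2; split.
- exact: (in_K_h_gamma0 hG K1 K2).
- move=> p; exact: (in_K_h_gamma hG K1 K2 p).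
- exact: (wiener_ito_product hG K1 K2 na hZ).
Qed.
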